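(* Let $(\mathcal X,d,\mu)$ be a space of homogeneous type with upper dimension $\omega$ (with $\mu(\mathcal X)$ finite or infinite), let $\{Q_k\}_{k=0}^\infty$ be an exp-IATI on $\mathcal X$ with smoothness index $\eta\in(0,1)$, let $\beta,\gamma\in(0,\eta)$, $s\in(0,\beta\wedge\gamma)$, and $Q\in[\omega,\infty)$. (i) If $p\in[1,\infty]$ and $q\in(0,\infty]$, then $B^s_{p,q}(\mathcal X)\subset L(s,p,q;\mathcal X)$. (ii) If $\mathcal X$ has a local lower bound $Q$, $p\in(Q/(Q+s),1)$ satisfies $-\eta<s-Q/p$, and $q\in(0,\infty]$, then $B^s_{p,q}(\mathcal X)\subset L(s,p,q;\mathcal X)$. (iii) If $p\in(1,\infty)$ and $q\in(1,\infty]$, then $F^s_{p,q}(\mathcal X)\subset L_t(s,p,q;\mathcal X)$. (iv) If $\mathcal X$ has a local lower bound $Q$, $p\in(Q/(Q+s),1]$ satisfies $-\eta<s-Q/p$, and $q\in(Q/[Q+(\beta\wedge\gamma)],\infty]$, then $F^s_{p,q}(\mathcal X)\subset L_t(s,p,q,u;\mathcal X)$ with $u\in(0,\min\{p,q\})$.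
   Context: **Space.** A quasi-metric $d$ on a non-empty set $\mathcal X$ is a function $d:\mathcal X\times\mathcal X\to[0,\infty)$ with $d(x,y)=0\iff x=y$, $d(x,y)=d(y,x)$ and $d(x,z)\le A_0[d(x,y)+d(y,z)]$ for all $x,y,z$, for some constant $A_0\in[1,\infty)$. $B(x,r):=\{y: d(x,y)<r\}$. $(\mathcal X,d,\mu)$ is a space of homogeneous type if $\mu$ is a measure for which balls are measurable with measure in $(0,\infty)$ and there is $C_{(\mu)}\in[1,\infty)$ with $\mu(B(x,2r))\le C_{(\mu)}\mu(B(x,r))$ for all $x,r$; $\omega:=\log_2C_{(\mu)}$ is the upper dimension. $\mathcal X$ (or $\mu$) has a local lower bound $Q\in(0,\infty)$ if there is $C>0$ with $\mu(B(x,r))\ge Cr^Q$ for all $x\in\mathcal X$, $r\in(0,1]$. Notation: $V_r(x):=\mu(B(x,r))$, $V(x,y):=\mu(B(x,d(x,y)))$ (so $V(x,x)=0$), $a\wedge b:=\min\{a,b\}$, $\mathbb N=\{1,2,\dots\}$, $m_E(f):=\frac1{\mu(E)}\int_Ef\,d\mu$. **Dyadic system.** Fix $0<c_0\le C_0<\infty$ and $\delta$ with $0<\delta\le(2A_0)^{-10}$, $12A_0^3C_0\delta\le c_0$, and points $\{z^k_\alpha:k\in\mathbb Z,\alpha\in\mathcal A_k\}\subset\mathcal X$ such that, for each $k$, $d(z^k_\alpha,z^k_\beta)\ge c_0\delta^k$ if $\alpha\ne\beta$, and $\min_{\alpha\in\mathcal A_k}d(x,z_\alpha^k)<C_0\delta^k$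 for all $x$. Fix an associated system of dyadic cubes $\{Q^k_\alpha\}$: for each $k$ the sets $Q_\alpha^k$ ($\alpha\in\mathcal A_k$) are disjoint with union $\mathcal X$; if $k\le l$ then either $Q^l_\beta\subset Q^k_\alpha$ or $Q^l_\beta\cap Q^k_\alpha=\emptyset$; and $B(z^k_\alpha,(3A_0^2)^{-1}c_0\delta^k)\subset Q^k_\alpha\subset B(z^k_\alpha,2A_0C_0\delta^k)$. Put $\mathcal G_k:=\mathcal A_{k+1}\setminus\mathcal A_k$, $\mathcal Y^k:=\{z_\alpha^{k+1}\}_{\alpha\in\mathcal G_k}$, $d(x,\mathcal Y^k):=\inf_{y\in\mathcal Y^k}d(x,y)$. Fix $j_0\in\mathbb N$ sufficiently large that $\delta^{j_0}\le(2A_0)^{-3}C_0$; for $k\in\mathbb Z$, $\alpha\in\mathcal A_k$, the cubes $Q_\tau^{k+j_0}$ ($\tau\in\mathcal A_{k+j_0}$) contained in $Q_\alpha^k$ are enumerated as $Q_\alpha^{k,m}$, $m=1,\dots,N(k,\alpha)$. **exp-IATI.** For $k\ge0$ let $$e_k(x,y):=\frac{1}{\sqrt{V_{\delta^k}(x)V_{\delta^k}(y)}}\exp\Big\{-\nu\Big[\frac{d(x,y)}{\delta^k}\Big]^a\Big\},\quad h_k(x,y):=\exp\Big\{-\nu\Big[\frac{\max\{d(x,\mathcal Y^k),d(y,\mathcal Y^k)\}}{\delta^k}\Big]^a\Big\}.$$ A sequence $\{Q_k\}_{k=0}^\infty$ of bounded linear integral operators on $L^2(\mathcal X)$ (kernels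 also denoted $Q_k(x,y)$) is an exp-IATI (inhomogeneous approximation of the identity with exponential decay) with smoothness index $\eta\in(0,1)$ if $\sum_{k=0}^\infty Q_k=I$ in $L^2(\mathcal X)$ and there are $C,\nu\in(0,\infty)$, $a\in(0,1]$ such that, with $E_k:=e_kh_k$ for $k\ge1$ and $E_0:=e_0$, for all $k\ge0$: $|Q_k(x,y)|\le CE_k(x,y)$ for all $x,y$; if $d(x,x')\le\delta^k$, then $|Q_k(x,y)-Q_k(x',y)|+|Q_k(y,x)-Q_k(y,x')|\le C[d(x,x')/\delta^k]^\eta E_k(x,y)$; if $d(x,x')\le\delta^k$ and $d(y,y')\le\delta^k$, then $|[Q_k(x,y)-Q_k(x',y)]-[Q_k(x,y')-Q_k(x',y')]|\le C[d(x,x')/\delta^k]^\eta[d(y,y')/\delta^k]^\eta E_k(x,y)$; and for all $x$, $\int Q_k(x,y)\,d\mu(y)=\int Q_k(y,x)\,d\mu(y)$ equals $0$ if $k\ge1$ and $1$ if $k=0$. **Test functions and distributions.** For $x_1\in\mathcal X$, $r\in(0,\infty)$, $\beta\in(0,1]$, $\gamma\in(0,\infty)$, $\mathcal G(x_1,r,\beta,\gamma)$ is the set of measurable $f$ for which there is $C$ with (a) $|f(x)|\le C\frac1{V_r(x_1)+V(x_1,x)}[\frac r{r+d(x_1,x)}]^\gamma$ for all $x$; (b) $|f(x)-f(y)|\le C[\frac{d(x,y)}{r+d(x_1,x)}]^\beta\frac1{V_r(x_1)+V(x_1,x)}[\frac r{r+d(x_1,x)}]^\gamma$ whenever $d(x,y)\le(2A_0)^{-1}[r+d(x_1,x)]$;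 its norm is the infimum of such $C$. Fix $x_0\in\mathcal X$, $r_0\in(0,\infty)$ and set $\mathcal G(\beta,\gamma):=\mathcal G(x_0,r_0,\beta,\gamma)$ (independent of the choice up to equivalent norms). For $\beta,\gamma\in(0,\eta]$, $\mathcal G_0^\eta(\beta,\gamma)$ is the completion of $\mathcal G(\eta,\eta)$ in $\mathcal G(\beta,\gamma)$, and $(\mathcal G_0^\eta(\beta,\gamma))'$ is its dual with the weak-$*$ topology. For $f$ in this dual, $Q_kf(x)=Q_k(f)(x):=\langle f,Q_k(x,\cdot)\rangle$. **The number $N$.** $N\in\mathbb N$ is a fixed number for which the following discrete Calderón reproducing formula (known to hold) is valid: for any choice of points $y_\alpha^{k,m}\in Q_\alpha^{k,m}$ there are bounded integral operators $\widetilde Q_k$ ($k\ge0$) on $L^2(\mathcal X)$ such that, for all $f\in(\mathcal G_0^\eta(\beta,\gamma))'$, in $(\mathcal G_0^\eta(\beta,\gamma))'$, $$f=\sum_{\alpha\in\mathcal A_0}\sum_{m=1}^{N(0,\alpha)}\int_{Q_\alpha^{0,m}}\widetilde Q_0(\cdot,y)\,d\mu(y)\,m_{Q_\alpha^{0,m}}(Q_0f)+\sum_{k=1}^N\sum_{\alpha\in\mathcal A_k}\sum_{m=1}^{N(k,\alpha)}\mu(Q_\alpha^{k,m})\widetilde Q_k(\cdot,y_\alpha^{k,m})\,m_{Q_\alpha^{k,m}}(Q_kf)+\sum_{k=N+1}^\infty\sum_{\alpha\in\mathcal A_k}\sum_{m=1}^{N(k,\alpha)}\mu(Q_\alpha^{k,m})\widetilde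 Q_k(\cdot,y_\alpha^{k,m})Q_kf(y_\alpha^{k,m}),$$ where, with $R_\gamma(x,y;k):=\frac1{V_{\delta^k}(x)+V(x,y)}[\frac{\delta^k}{\delta^k+d(x,y)}]^\gamma$ and $C$ independent of $k$ and of the points, $|\widetilde Q_k(x,y)|\le CR_\gamma(x,y;k)$, $|\widetilde Q_k(x,y)-\widetilde Q_k(x',y)|\le C[\frac{d(x,x')}{\delta^k+d(x,y)}]^\beta R_\gamma(x,y;k)$ if $d(x,x')\le(2A_0)^{-1}[\delta^k+d(x,y)]$, and $\int\widetilde Q_k(x,y)\,d\mu(y)=\int\widetilde Q_k(y,x)\,d\mu(y)$ equals $1$ for $k\le N$ and $0$ for $k>N$. **Besov and Triebel–Lizorkin spaces** (independent of the choice of $\beta,\gamma$ and the exp-IATI). With $\eta,\beta,\gamma,s$ as in the claim, for $p\in(\omega/[\omega+(\beta\wedge\gamma)],\infty]$, $q\in(0,\infty]$, $B^s_{p,q}(\mathcal X)$ is the set of $f\in(\mathcal G_0^\eta(\beta,\gamma))'$ with finite $$\|f\|_{B^s_{p,q}(\mathcal X)}:=\Big\{\sum_{k=0}^N\sum_{\alpha\in\mathcal A_k}\sum_{m=1}^{N(k,\alpha)}\mu(Q_\alpha^{k,m})[m_{Q_\alpha^{k,m}}(|Q_kf|)]^p\Big\}^{1/p}+\Big[\sum_{k=N+1}^\infty\delta^{-ksq}\|Q_kf\|_{L^p(\mathcal X)}^q\Big]^{1/q};$$ for $p\in(\omega/[\omega+(\beta\wedge\gamma)],\infty)$, $q\in(\omega/[\omega+(\beta\wedge\gamma)],\infty]$,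 $F^s_{p,q}(\mathcal X)$ is defined in the same way with the last term replaced by $\big\|\big[\sum_{k=N+1}^\infty\delta^{-ksq}|Q_kf|^q\big]^{1/q}\big\|_{L^p(\mathcal X)}$. Usual modifications: when $p=\infty$ the first term is the supremum of $m_{Q_\alpha^{k,m}}(|Q_kf|)$ over $k\le N,\alpha,m$; when $q=\infty$ sums over $k$ are replaced by suprema of $\delta^{-ks}(\cdots)$. **Lipschitz-type spaces.** Fix a constant $\widetilde C\in(0,\infty)$ and write $B_k(x):=B(x,\widetilde C\delta^k)$. For $s,u\in(0,\infty)$, $p,q\in(0,\infty]$: - $L(s,p,q;\mathcal X)$: all $f\in L^p(\mathcal X)$ with finite $\|f\|:=\|f\|_{L^p(\mathcal X)}+\big\{\sum_{k\in\mathbb Z}\delta^{-ksq}\big[\int_{\mathcal X}\frac1{\mu(B_k(x))}\int_{B_k(x)}|f(x)-f(y)|^p\,d\mu(y)\,d\mu(x)\big]^{q/p}\big\}^{1/q}$; - $L_t(s,p,q,u;\mathcal X)$: all $f\in L^p(\mathcal X)$ with finite $\|f\|:=\|f\|_{L^p(\mathcal X)}+\big\|\big\{\sum_{k=0}^\infty\delta^{-ksq}\big[\frac1{\mu(B_k(\cdot))}\int_{B_k(\cdot)}|f(\cdot)-f(y)|^u\,d\mu(y)\big]^{q/u}\big\}^{1/q}\big\|_{L^p(\mathcal X)}$; and $L_t(s,p,q;\mathcal X):=L_t(s,p,q,1;\mathcal X)$. Usual modifications (for $L$, essential suprema in $x$ and in $y\in B_k(x)$ when $p=\infty$; supremum over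 $k$ when $q=\infty$). **Identification.** A function $f$ is identified with the distribution $g\mapsto\int_{\mathcal X}fg\,d\mu$, $g\in\mathcal G_0^\eta(\beta,\gamma)$. An inclusion of a space of distributions into a Lipschitz-type space means that each such distribution is given in this sense by a function in the Lipschitz-type space. *)

(* Defs.v *)
From HB Require Import structures.
From mathcomp Require Import all_boot all_order all_algebra.
From mathcomp Require Import all_classical all_reals all_analysis.
From mathcomp Require Import ess_sup_inf.

Set Implicit Arguments.
Unset Strict Implicit.
Unset Printing Implicit Defensive.

Import Order.TTheory GRing.Theory Num.Theory.
Import numFieldNormedType.Exports.

Local Open Scope classical_set_scope.
Local Open Scope ring_scope.

(* Functions are real-valued; [R] is an arbitrary model of the reals. *)

Record homog_space (R : realType) (disp : measure_display)
    (X : measurableType disp) := HomogSpace {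
  qdist : X -> X -> R ;
  A0 : R ;
  hmu : {measure set X -> \bar R} ;
  Cmu : R ;
  qball : X -> R -> set X := fun x r => [set y | qdist x y < r] ;
  qdist_ge0 : forall x y, 0 <= qdist x y ;
  qdist_eq0 : forall x y, qdist x y = 0 <-> x = y ;
  qdist_sym : forall x y, qdist x y = qdist y x ;
  A0_ge1 : 1 <= A0 ;
  qdist_triangle : forall x y z, qdist x z <= A0 * (qdist x y + qdist y z) ;
  qball_measurable : forall x r, 0 < r -> measurable (qball x r) ;
  qball_mu_bounds : forall x r, 0 < r -> (0 < hmu (qball x r) < +oo)%E ;
  Cmu_ge1 : 1 <= Cmu ;
  hmu_doubling : forall x r, 0 < r ->
        (hmu (qball x (2 * r)) <= Cmu%:E * hmu (qball x r))%E
}.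

Section space.
Context (R : realType) (disp : measure_display) (X : measurableType disp).
Variable H : homog_space R X.
Local Notation d := (qdist H).
Local Notation mu := (hmu H).

Definition omega : R := ln (Cmu H) / ln 2.

Definition local_lower_bound (Q : R) : Prop :=
  0 < Q /\ exists2 C : R, 0 < C &
    forall x r, 0 < r <= 1 -> ((C * r `^ Q)%:E <= mu (qball H x r))%E.

Definition Vr (r : R) (x : X) : R := fine (mu (qball H x r)).
Definition V (x y : X) : R := fine (mu (qball H x (d x y))).

Definition avg (E : set X) (f : X -> R) : R :=
  (fine (mu E))^-1 * \int[mu]_(x in E) f x.

Definition avge (E : set X) (f : X -> R) : \bar R :=
  ((fine (mu E))^-1%:E * \int[mu]_(x in E) (f x)%:E)%E.

Definition in_Lp (p : \bar R) (f : X -> R) : Prop :=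
  measurable_fun setT f /\ ('N[mu]_p[EFin \o f] < +oo)%E.

Definition op_of_kernel (K : X -> X -> R) (f : X -> R) (x : X) : R :=
  \int[mu]_y (K x y * f y).

Definition L2_bounded_kernel (K : X -> X -> R) : Prop :=
  measurable_fun setT (fun z : X * X => K z.1 z.2) /\
  exists M : R, forall f, in_Lp 2%:E f ->
    [/\ {ae mu, forall x, mu.-integrable setT (fun y => (K x y * f y)%:E)},
        in_Lp 2%:E (op_of_kernel K f) &
        ('N[mu]_2%:E[EFin \o op_of_kernel K f]
           <= M%:E * 'N[mu]_2%:E[EFin \o f])%E].

Definition test_weight (x1 : X) (r gamma : R) (x : X) : R :=
  (Vr r x1 + V x1 x)^-1 * (r / (r + d x1 x)) `^ gamma.

Definition test_bound (x1 : X) (r beta gamma : R) (f : X -> R) (C : R) : Prop :=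
  [/\ 0 <= C,
      forall x, `|f x| <= C * test_weight x1 r gamma x &
      forall x y, d x y <= (2 * A0 H)^-1 * (r + d x1 x) ->
        `|f x - f y| <= C * (d x y / (r + d x1 x)) `^ beta
                          * test_weight x1 r gamma x].

Definition test_space (x1 : X) (r beta gamma : R) : set (X -> R) :=
  [set f | measurable_fun setT f /\ exists C, test_bound x1 r beta gamma f C].

Definition test_norm (x1 : X) (r beta gamma : R) (f : X -> R) : R :=
  inf [set C | test_bound x1 r beta gamma f C].

(* [test_space] being complete, the completion of G(eta,eta) in G(beta,gamma)
   is its closure there. *)
Definition test_space0 (x0 : X) (r0 eta beta gamma : R) : set (X -> R) :=
  [set g | test_space x0 r0 beta gamma g /\
     forall e : R, 0 < e -> exists2 h, test_space x0 r0 eta eta h &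
       test_norm x0 r0 beta gamma (g \- h) < e].

(* The values of a functional outside [test_space0] are irrelevant: every
   notion below depends only on its restriction to [test_space0]. *)
Definition distribution (x0 : X) (r0 eta beta gamma : R) :
    set ((X -> R) -> R) :=
  [set f |
     (forall (a : R) g h, test_space0 x0 r0 eta beta gamma g ->
        test_space0 x0 r0 eta beta gamma h ->
        f (fun x => a * g x + h x) = a * f g + f h) /\
     exists M : R, forall g, test_space0 x0 r0 eta beta gamma g ->
        `|f g| <= M * test_norm x0 r0 beta gamma g].

Definition pairing (F g : X -> R) : R := \int[mu]_x (F x * g x).

Definition represents (x0 : X) (r0 eta beta gamma : R)
    (F : X -> R) (f : (X -> R) -> R) : Prop :=
  forall g, test_space0 x0 r0 eta beta gamma g ->
    mu.-integrable setT (fun x => (F x * g x)%:E) /\ f g = pairing F g.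

Definition distr_incl (x0 : X) (r0 eta beta gamma : R)
    (DS : set ((X -> R) -> R)) (FS : set (X -> R)) : Prop :=
  forall f, DS f -> exists2 F, FS F & represents x0 r0 eta beta gamma F f.

(* The l^q norm over [K], for 0 < q <= +oo, of a nonnegative family. *)
Definition lq (T : choiceType) (q : \bar R) (K : set T) (a : T -> \bar R) :
    \bar R :=
  match q with
  | q%:E => ((\esum_(k in K) a k `^ q) `^ q^-1)%E
  | _ => ereal_sup [set a k | k in K]
  end.

(* The unordered sum of a summable real family. *)
Definition usum (T : choiceType) (K : set T) (a : T -> R) : R :=
  fine (\esum_(i in K) (Num.max (a i) 0)%:E)
  - fine (\esum_(i in K) (Num.max (- a i) 0)%:E).

End space.

(* The cubes Q^{k,m}_alpha, m = 1, ..., N(k,alpha), are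
    [cube (k + j0) (sub_idx k a m)] for [m < nsub k a]. *)

Record dyadic_system (R : realType) (disp : measure_display)
    (X : measurableType disp) (H : homog_space R X) := DyadicSystem {
  idx : choiceType ;
  c0 : R ;
  C0 : R ;
  delta : R ;
  idx_at : int -> set idx ;
  center : int -> idx -> X ;
  cube : int -> idx -> set X ;
  j0 : nat ;
  nsub : int -> idx -> nat ;
  sub_idx : int -> idx -> nat -> idx ;
  c0_C0 : 0 < c0 <= C0 ;
  delta_bounds : 0 < delta <= (2 * A0 H) ^- 10 ;
  delta_small : 12 * A0 H ^+ 3 * C0 * delta <= c0 ;
  center_separated : forall k a b, idx_at k a -> idx_at k b -> a <> b ->
        c0 * delta ^ k <= qdist H (center k a) (center k b) ;
  center_dense : forall k x, exists2 a, idx_at k a &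
        qdist H x (center k a) < C0 * delta ^ k ;
  cube_measurable : forall k a, idx_at k a -> measurable (cube k a) ;
  cube_disjoint : forall k, trivIset (idx_at k) (cube k) ;
  cube_cover : forall k, \bigcup_(a in idx_at k) cube k a = setT ;
  cube_nested : forall (k l : int) a b, k <= l -> idx_at k a -> idx_at l b ->
        cube l b `<=` cube k a \/ cube l b `&` cube k a = set0 ;
  cube_balls : forall k a, idx_at k a ->
        qball H (center k a) ((3 * A0 H ^+ 2)^-1 * c0 * delta ^ k)
          `<=` cube k a /\
        cube k a `<=` qball H (center k a) (2 * A0 H * C0 * delta ^ k) ;
  j0_gt0 : (0 < j0)%N ;
  j0_large : delta ^+ j0 <= (2 * A0 H) ^- 3 * C0 ;
  sub_idx_bij : forall k a, idx_at k a ->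
        set_bij [set m : nat | (m < nsub k a)%N]
          [set t | idx_at (k + j0%:Z) t /\ cube (k + j0%:Z) t `<=` cube k a]
          (sub_idx k a)
}.

Arguments cube {R disp X H} _ _ _.
Arguments center {R disp X H} _ _ _.
Arguments nsub {R disp X H} _ _ _.
Arguments sub_idx {R disp X H} _ _ _ _.
Arguments idx_at {R disp X H} _ _.

Section dyadic.
Context (R : realType) (disp : measure_display) (X : measurableType disp).
Variables (H : homog_space R X) (D : dyadic_system H).
Local Notation d := (qdist H).
Local Notation mu := (hmu H).
Local Notation del := (delta D).

Definition subcube (k : int) (a : idx D) (m : nat) : set X :=
  cube D (k + (j0 D)%:Z) (sub_idx D k a m).

Definition Ycal (k : int) : set X :=
  [set center D (k + 1) a | a in idx_at D (k + 1) `\` idx_at D k].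

(* Equal to +oo when [Ycal k] is empty. *)
Definition dist_Ycal (x : X) (k : int) : \bar R :=
  ereal_inf [set (d x y)%:E | y in Ycal k].

Definition ek (nu a : R) (k : nat) (x y : X) : R :=
  (Num.sqrt (Vr H (del ^+ k) x * Vr H (del ^+ k) y))^-1
  * expR (- (nu * (d x y / del ^+ k) `^ a)).

(* The exponential of -oo is 0, which is the value of [hk] if [Ycal k] is
   empty. *)
Definition hk (nu a : R) (k : nat) (x y : X) : R :=
  fine (expeR (- (nu%:E * (maxe (dist_Ycal x k) (dist_Ycal y k)
                           * ((del ^+ k)^-1)%:E) `^ a)))%E.

Definition Ek (nu a : R) (k : nat) (x y : X) : R :=
  if k == 0 then ek nu a k x y else ek nu a k x y * hk nu a k x y.

Definition exp_iati (eta : R) (Qk : nat -> X -> X -> R) : Prop :=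
  (forall k, L2_bounded_kernel H (Qk k)) /\
  (forall f, in_Lp H 2%:E f ->
     ('N[mu]_2%:E[(fun x =>
         (\sum_(0 <= k < n) op_of_kernel H (Qk k) f x - f x)%:E)])%E
       @[n --> \oo] --> 0%E) /\
  exists C nu a : R, [/\ 0 < C, 0 < nu, 0 < a <= 1 &
  forall k : nat, let E := Ek nu a k in let K := Qk k in let dk := del ^+ k in
  [/\ forall x y, `|K x y| <= C * E x y,
      forall x x' y, d x x' <= dk ->
        `|K x y - K x' y| + `|K y x - K y x'|
          <= C * (d x x' / dk) `^ eta * E x y,
      forall x x' y y', d x x' <= dk -> d y y' <= dk ->
        `|(K x y - K x' y) - (K x y' - K x' y')|
          <= C * (d x x' / dk) `^ eta * (d y y' / dk) `^ eta * E x y &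
      forall x, \int[mu]_y K x y = (if k == 0 then 1 else 0) /\
                \int[mu]_y K y x = (if k == 0 then 1 else 0)]].

Definition Rgamma (gamma : R) (k : nat) (x y : X) : R :=
  (Vr H (del ^+ k) x + V H x y)^-1
  * (del ^+ k / (del ^+ k + d x y)) `^ gamma.

Definition dist_op (Qk : nat -> X -> X -> R) (k : nat) (f : (X -> R) -> R)
    (x : X) : R := f (Qk k x).

(* The numbers [<., g>] of the alpha-th summands of the formula, for k = 0, for
   1 <= k <= N and for k > N respectively. *)
Definition calderon_term0 (Qk Qt : nat -> X -> X -> R)
    (f : (X -> R) -> R) (g : X -> R) (a : idx D) : R :=
  \sum_(0 <= m < nsub D 0 a)
    pairing H (fun x => \int[mu]_(y in subcube 0 a m) Qt 0 x y) g
    * avg H (subcube 0 a m) (dist_op Qk 0 f).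

Definition calderon_term_low (Qk Qt : nat -> X -> X -> R)
    (y : nat -> idx D -> nat -> X)
    (f : (X -> R) -> R) (g : X -> R) (k : nat) (a : idx D) : R :=
  \sum_(0 <= m < nsub D k a)
    fine (mu (subcube k a m)) * pairing H (fun x => Qt k x (y k a m)) g
    * avg H (subcube k a m) (dist_op Qk k f).

Definition calderon_term_high (Qk Qt : nat -> X -> X -> R)
    (y : nat -> idx D -> nat -> X)
    (f : (X -> R) -> R) (g : X -> R) (k : nat) (a : idx D) : R :=
  \sum_(0 <= m < nsub D k a)
    fine (mu (subcube k a m)) * pairing H (fun x => Qt k x (y k a m)) g
    * dist_op Qk k f (y k a m).

(* For each k the series over alpha in A_k converges unconditionally, and the
   outer series is the limit of its partial sums, tested on every g. *)
Definition calderon_formula (x0 : X) (r0 eta beta gamma : R) (N : nat)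
    (Qk Qt : nat -> X -> X -> R) (y : nat -> idx D -> nat -> X) : Prop :=
  forall f, distribution H x0 r0 eta beta gamma f ->
  forall g, test_space0 H x0 r0 eta beta gamma g ->
  let t0 := calderon_term0 Qk Qt f g in
  let tl := calderon_term_low Qk Qt y f g in
  let th := calderon_term_high Qk Qt y f g in
  [/\ summable (idx_at D 0) (EFin \o t0),
      forall k : nat, (1 <= k <= N)%N -> summable (idx_at D k) (EFin \o tl k),
      forall k : nat, (N < k)%N -> summable (idx_at D k) (EFin \o th k) &
      usum (idx_at D 0) t0
      + \sum_(1 <= k < N.+1) usum (idx_at D k) (tl k)
      + \sum_(N.+1 <= k < n) usum (idx_at D k) (th k) @[n --> \oo] --> f g].

Definition calderon_number (x0 : X) (r0 eta beta gamma : R)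
    (Qk : nat -> X -> X -> R) (N : nat) : Prop :=
  (0 < N)%N /\
  exists2 C : R, 0 < C &
  forall y : nat -> idx D -> nat -> X,
  (forall (k : nat) a m, idx_at D k a -> (m < nsub D k a)%N ->
     subcube k a m (y k a m)) ->
  exists Qt : nat -> X -> X -> R,
  [/\ forall k, L2_bounded_kernel H (Qt k),
      forall k x z, `|Qt k x z| <= C * Rgamma gamma k x z,
      forall k x x' z, d x x' <= (2 * A0 H)^-1 * (del ^+ k + d x z) ->
        `|Qt k x z - Qt k x' z|
          <= C * (d x x' / (del ^+ k + d x z)) `^ beta * Rgamma gamma k x z,
      forall k x, \int[mu]_z Qt k x z = (if (k <= N)%N then 1 else 0) /\
                  \int[mu]_z Qt k z x = (if (k <= N)%N then 1 else 0) &
      calderon_formula x0 r0 eta beta gamma N Qk Qt y].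

Definition BF_low (Qk : nat -> X -> X -> R) (N : nat) (p : \bar R)
    (f : (X -> R) -> R) : \bar R :=
  let v (k : nat) (a : idx D) (m : nat) :=
    avge H (subcube k a m) (fun x => `|dist_op Qk k f x|) in
  (match p with
  | p%:E => (\sum_(0 <= k < N.+1) \esum_(a in idx_at D k)
               \sum_(0 <= m < nsub D k a) mu (subcube k a m) * v k a m `^ p)
            `^ p^-1
  | _ => ereal_sup [set e | exists (k : nat) (a : idx D) (m : nat),
           [/\ (k <= N)%N, idx_at D k a, (m < nsub D k a)%N & e = v k a m]]
  end)%E.

Definition wt (s : R) (k : int) : R := del `^ (- (k%:~R * s)).

Definition besov_norm Qk (N : nat) (s : R) (p q : \bar R) f : \bar R :=
  (BF_low Qk N p f
   + lq q [set k : nat | (N < k)%N]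
       (fun k : nat => (wt s k)%:E * 'N[mu]_p[EFin \o dist_op Qk k f]))%E.

Definition triebel_norm Qk (N : nat) (s : R) (p q : \bar R) f : \bar R :=
  (BF_low Qk N p f
   + 'N[mu]_p[(fun x => lq q [set k : nat | (N < k)%N]
                         (fun k : nat => (wt s k * `|dist_op Qk k f x|)%:E))])%E.

Definition besov (x0 : X) (r0 eta beta gamma : R) Qk (N : nat)
    (s : R) (p q : \bar R) : set ((X -> R) -> R) :=
  [set f | distribution H x0 r0 eta beta gamma f /\
           (besov_norm Qk N s p q f < +oo)%E].

Definition triebel (x0 : X) (r0 eta beta gamma : R) Qk (N : nat)
    (s : R) (p q : \bar R) : set ((X -> R) -> R) :=
  [set f | distribution H x0 r0 eta beta gamma f /\
           (triebel_norm Qk N s p q f < +oo)%E].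

Definition Bk (Ct : R) (k : int) (x : X) : set X := qball H x (Ct * del ^ k).

Definition osc (Ct : R) (u : R) (k : int) (f : X -> R) (x : X) : \bar R :=
  avge H (Bk Ct k x) (fun y => `|f x - f y| `^ u).

(* The ball has positive measure, so the inner supremum of this nonnegative
   function extended by 0 is the essential supremum over the ball. *)
Definition lip_osc (Ct : R) (p : \bar R) (k : int) (f : X -> R) : \bar R :=
  (match p with
  | p%:E => (\int[mu]_x osc Ct p k f x) `^ p^-1
  | _ => ess_sup mu (fun x =>
           ess_sup mu ((fun y => `|f x - f y|%:E) \_ (Bk Ct k x)))
  end)%E.

Definition lip_norm (Ct s : R) (p q : \bar R) (f : X -> R) : \bar R :=
  ('N[mu]_p[EFin \o f]
   + lq q [set: int] (fun k => (wt s k)%:E * lip_osc Ct p k f))%E.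

Definition lip (Ct s : R) (p q : \bar R) : set (X -> R) :=
  [set f | in_Lp H p f /\ (lip_norm Ct s p q f < +oo)%E].

Definition lipt_norm (Ct s : R) (p q : \bar R) (u : R) (f : X -> R) : \bar R :=
  ('N[mu]_p[EFin \o f]
   + 'N[mu]_p[(fun x => lq q [set: nat]
        (fun k : nat => (wt s k)%:E * (osc Ct u k f x) `^ u^-1))])%E.

Definition lipt (Ct s : R) (p q : \bar R) (u : R) : set (X -> R) :=
  [set f | in_Lp H p f /\ (lipt_norm Ct s p q u f < +oo)%E].

End dyadic.

(* Main.v *)
(** A distribution [f] of the space is, by the reproducing formula, the
unconditional sum of atoms attached to the small cubes of level [j]. The
coefficient of an atom is an average or a value of [Q_j f] on its cube, and the
sample points can be chosen so that this value is at most [|Q_j f|] anywhere on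
the cube, up to a summable error. The atoms of level [j] are dominated by
[smo], a geometric superposition of averages, at scales coarser than [del^j], of
the piecewise constant function [h_j] of the coefficients, and they vary by a
factor [del^((k-j) beta)] less at distance [del^k]. Hence
[del^(-ks) |F x - F y|] is a sum over [j] of
[del^(-js) (smo h_j x + smo h_j y)] with weights decaying geometrically in
[|k - j|], because [0 < s < beta].

For [L] the sum is integrated at each scale; an exponent [p < 1] is absorbed by
a reversed Jensen inequality for functions constant on small cubes, whose loss
is smaller than the decay of the kernels. For [L_t] the [u]-th powers reduce the
claim to a Fefferman-Stein inequality for the averaging operators in
[L^(p/u)(l^(q/u))], both exponents being larger than 1. As the averages of each
level are taken at one scale only, it follows from the dual Doob inequality and
duality, without maximal functions. *)

From HB Require Import structures.
From mathcomp Require Import all_boot all_order all_algebra.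
From mathcomp Require Import finmap.
From mathcomp Require Import all_classical all_reals all_analysis.
From mathcomp Require Import measurable_realfun ess_sup_inf ring lra zify.
Require Import Defs.
Set Implicit Arguments.
Unset Strict Implicit.
Unset Printing Implicit Defensive.
Import Order.TTheory GRing.Theory Num.Theory.
Import numFieldNormedType.Exports.
Local Open Scope classical_set_scope.
Local Open Scope ring_scope.
Local Open Scope ereal_scope.

(** * Unordered sums, powers and mixed norms *)

(** Three obstacles shape the proof. Oscillations over balls centred at [x], and [Q_k f] itself, are
    not known to be measurable in [x]. Their integrals are only compared by monotonicity, and
    everything that needs additivity is done on functions of the cube index and on countable sums of
    such functions. The same estimates must serve exponents on both sides of 1. Weighted sums are
    therefore bounded through the largest term, which spends a whole geometric weight; weights are
    first split into two or three equal factors, one for each later summation. This is the origin of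
    the square roots and thirds. A distribution can be identified with the sum of its atoms only if
    that sum is integrable against bounded test functions. For [p < 1] this costs [Q (1/p - 1)] of
    the smoothness, and [p > Q / (Q + s)] says exactly that a positive amount is left. Both the dual
    Doob inequality and the duality argument absorb a term of the right-hand side. They are
    therefore run on finite sums, whose integrals are finite by bounds with constants depending on
    the number of terms. *)

Section esum_ext.
Context {R : realType}.
Implicit Types (T : choiceType).

Lemma esum_le_ub T (K : set T) (a : T -> \bar R) M :
  (forall F, fsets K F -> \sum_(i \in F) a i <= M) -> \esum_(i in K) a i <= M.
Proof. by move=> h; apply: ge_ereal_sup => _ [F KF <-]; exact: h. Qed.

Lemma fsum_le_esum T (K : set T) (a : T -> \bar R) F :
  fsets K F -> \sum_(i \in F) a i <= \esum_(i in K) a i.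
Proof. by move=> KF; apply: ereal_sup_ubound; exists F. Qed.

Lemma esum_ge_term T (K : set T) (a : T -> \bar R) i :
  K i -> a i <= \esum_(i in K) a i.
Proof.
move=> Ki; have <- : \sum_(j \in [set i]) a j = a i by rewrite fsbig_set1.
by apply: fsum_le_esum; split; [exact: finite_set1|move=> j ->].
Qed.

Lemma subset_esum T (J K : set T) (a : T -> \bar R) :
  J `<=` K -> \esum_(i in J) a i <= \esum_(i in K) a i.
Proof.
move=> JK; apply: esum_le_ub => F [fF FJ]; apply: fsum_le_esum; split => //.
exact: subset_trans JK.
Qed.

Lemma esumZl T (K : set T) (c : \bar R) (a : T -> \bar R) :
  0 <= c -> (forall i, 0 <= a i) ->
  \esum_(i in K) (c * a i) = c * \esum_(i in K) a i.
Proof.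
move=> c0 a0; have es0 (g : T -> \bar R) : (forall i, 0 <= g i) -> 0 <= \esum_(i in K) g i.
  by move=> g0; exact: esum_ge0.
have le1 (e : \bar R) (g : T -> \bar R) : 0 <= e -> (forall i, 0 <= g i) ->
    \esum_(i in K) (e * g i) <= e * \esum_(i in K) g i.
  move=> e0 g0; apply: esum_le_ub => F [fF FK].
  rewrite -ge0_mule_fsumr//; apply: lee_wpmul2l => //.
  exact: fsum_le_esum.
apply/eqP; rewrite eq_le le1//=.
move: c c0 => [c| |]//; rewrite ?lee_fin => c0.
- have [->|cn0] := eqVneq c 0%R; first by rewrite mul0e es0// => i; rewrite mul0e.
  have {cn0}c0 : (0 < c)%R by rewrite lt_neqAle eq_sym cn0.
  rewrite -lee_pdivlMl//; apply: le_trans (le1 _ _ _ _).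
  + by apply: le_esum => i _; rewrite muleA -EFinM mulVf ?gt_eqF// mul1e.
  + by rewrite lee_fin invr_ge0 ltW.
  + by move=> i; rewrite mule_ge0// lee_fin ltW.
(* The factor is [+oo]: one non-zero term makes both sides infinite, and otherwise both vanish since
   [+oo * 0] is 0. *)
- have [h|h] := pselect (exists2 i, K i & a i != 0).
    case: h => i Ki ai; apply: (le_trans (leey _)).
    apply: (@le_trans _ _ (+oo * a i)); first by rewrite gt0_mulye// lt_neqAle eq_sym ai a0.
    exact: (@esum_ge_term _ _ (fun i => +oo * a i)).
  rewrite esum1 ?mule0 ?es0//; first by move=> i; rewrite mule_ge0.
  by move=> i Ki; apply/eqP/contraT => ai; exfalso; apply: h; exists i.
Qed.

Lemma exchange_esum T1 T2 (I : set T1) (J : set T2) (a : T1 -> T2 -> \bar R) :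
  (forall i j, 0 <= a i j) ->
  \esum_(i in I) \esum_(j in J) a i j = \esum_(j in J) \esum_(i in I) a i j.
Proof.
move=> a0; rewrite !esum_esum//.
rewrite (@reindex_esum _ _ _ (J `*`` (fun=> I)) _ (fun x => (x.2, x.1)))//.
split; first by move=> [x y] [].
  by move=> [x y] [z t] _ _ /= [-> ->].
by move=> [x y] [/= Ix Jy]; exists (y, x).
Qed.

End esum_ext.

Section powers.
Context {R : realType}.
Implicit Types (T : choiceType).

Lemma le_poweR (r : R) (x y : \bar R) : (0 <= r)%R -> 0 <= x -> x <= y ->
  x `^ r <= y `^ r.
Proof.
move=> r0 x0 xy; apply: gt0_ler_poweR => //; rewrite in_itv/= leey andbT//.
exact: le_trans xy.
Qed.

Lemma poweRK (r : R) (x : \bar R) : (r != 0)%R -> 0 <= x -> (x `^ r) `^ r^-1 = x.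
Proof. by move=> r0 x0; rewrite -poweRrM mulfV// poweRe1. Qed.

Lemma poweRVK (r : R) (x : \bar R) : (r != 0)%R -> 0 <= x -> (x `^ r^-1) `^ r = x.
Proof. by move=> r0 x0; rewrite -poweRrM mulVf// poweRe1. Qed.

Lemma poweR_leP (r : R) (x y : \bar R) : (0 < r)%R -> 0 <= x -> 0 <= y ->
  (x `^ r <= y) = (x <= y `^ r^-1).
Proof.
move=> r0 x0 y0; apply/idP/idP => h.
  by rewrite -(@poweRK r x) ?gt_eqF//; apply: le_poweR; rewrite ?invr_ge0 ?(ltW r0) ?poweR_ge0.
by rewrite -(@poweRVK r y) ?gt_eqF//; apply: le_poweR => //; exact: ltW.
Qed.

(** With [t = x / (a + b)] in [0, 1] one has [t <= t ^ r]; multiplied by [(a + b) ^ r] and added for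
    [x = a] and [x = b] this is the claim. *)
Lemma poweRD_le (r : R) (a b : \bar R) : (0 < r <= 1)%R -> 0 <= a -> 0 <= b ->
  (a + b) `^ r <= a `^ r + b `^ r.
Proof.
move=> /andP[r0 r1]; move: a b => [a| |]// [b| |]//; rewrite ?lee_fin => a0 b0; last first.
- by rewrite !poweRyr ?gt_eqF// addye.
- by rewrite addye// !poweRyr ?gt_eqF// addye// -ltNye (lt_le_trans (ltNyr 0))// poweR_ge0.
- by rewrite addey// !poweRyr ?gt_eqF// addey// -ltNye (lt_le_trans (ltNyr 0))// poweR_ge0.
have [->|a1] := eqVneq (a + b)%R 0%R.
  by rewrite powR0 ?gt_eqF// addr_ge0// powR_ge0.
have s0 : (0 < a + b)%R by rewrite lt_neqAle eq_sym a1 addr_ge0.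
have key (x : R) : (0 <= x)%R -> (x <= a + b)%R -> (x / (a + b) * (a + b) `^ r <= x `^ r)%R.
  move=> x0 xs; rewrite -{2}(divfK a1 x) powRM ?divr_ge0// ?(ltW s0)//.
  apply: ler_wpM2r; first exact: powR_ge0.
  set t := (x / _)%R; have t1 : (t <= 1)%R by rewrite ler_pdivrMr// mul1r.
  have t0 : (0 <= t)%R by rewrite divr_ge0// ltW.
  have [->|tn0] := eqVneq t 0%R; first by rewrite powR_ge0.
  rewrite -{1}(powRr1 t0); apply: ger_powR => //.
  by rewrite t1 lt_neqAle eq_sym tn0 t0.
rewrite -{1}(mul1r (powR _ _)) -{1}(divff a1) mulrDl mulrDl.
by apply: lerD; apply: key => //; lra.
Qed.

Lemma poweR_sum_le (I : eqType) (s : seq I) (a : I -> \bar R) (r : R) :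
  (0 < r <= 1)%R -> (forall i, 0 <= a i) ->
  (\sum_(i <- s) a i) `^ r <= \sum_(i <- s) a i `^ r.
Proof.
move=> r01 a0; elim: s => [|i s IH].
  by rewrite !big_nil poweR0r//; case/andP: r01 => r0 _; rewrite gt_eqF.
rewrite !big_cons (le_trans (poweRD_le r01 _ _))//; first exact: sume_ge0.
exact: leeD.
Qed.

Lemma poweR_esum_le T (K : set T) (a : T -> \bar R) (r : R) :
  (0 < r <= 1)%R -> (forall i, 0 <= a i) ->
  (\esum_(i in K) a i) `^ r <= \esum_(i in K) a i `^ r.
Proof.
move=> r01 a0; have /andP[r0 r1] := r01.
have e0 : 0 <= \esum_(i in K) a i by exact: esum_ge0.
have e1 : 0 <= \esum_(i in K) a i `^ r by apply: esum_ge0 => i _; exact: poweR_ge0.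
rewrite poweR_leP//; apply: esum_le_ub => F [fF FK].
rewrite fsbig_finite//= -poweR_leP//; last exact: sume_ge0.
apply: le_trans (poweR_sum_le _ r01 a0) _.
by rewrite -fsbig_finite//; exact: fsum_le_esum.
Qed.

Lemma poweRD_max (p : R) (a b : \bar R) : (0 < p)%R -> 0 <= a -> 0 <= b ->
  (a + b) `^ p <= (2 `^ p)%:E * (a `^ p + b `^ p).
Proof.
move=> p0 a0 b0; wlog ab : a b a0 b0 / a <= b.
  move=> h; have [/h->//|/ltW/h] := leP a b.
  by rewrite addeC [X in _ * X]addeC; exact.
have -> : (2 `^ p)%:E = (2%:E : \bar R) `^ p by rewrite poweR_EFin.
apply: (@le_trans _ _ ((2%:E * b) `^ p)).
  apply: le_poweR; [exact: ltW|exact: adde_ge0|].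
  by rewrite mule_natl mule2n leeD.
rewrite poweRM// lee_wpmul2l ?poweR_ge0// leeDr// poweR_ge0//.
Qed.

(** Each [c i] is at most the [1/p]-th power of the sum of all [c i ^ p]. This crude bound takes the
    place of Hoelder's inequality and of subadditivity at once, for every [p > 0]; its price is that
    the weights are used up. *)
Lemma poweR_wesum T (K : set T) (w : T -> R) (W : R) (c : T -> \bar R) (p : R) :
  (0 < p)%R -> (forall i, 0 <= w i)%R -> (forall i, 0 <= c i) ->
  \esum_(i in K) (w i)%:E <= W%:E ->
  (\esum_(i in K) ((w i)%:E * c i)) `^ p <= (W `^ p)%:E * \esum_(i in K) (c i) `^ p.
Proof.
move=> p0 w0 c0 wW.
have W0 : 0 <= W%:E by apply: le_trans wW; apply: esum_ge0 => i _; rewrite lee_fin.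
have c1 i : 0 <= c i `^ p by exact: poweR_ge0.
set M := \esum_(i in K) (c i) `^ p.
have M0 : 0 <= M by exact: esum_ge0.
have cM i : K i -> c i <= M `^ p^-1.
  by move=> Ki; rewrite -poweR_leP//; exact: (@esum_ge_term _ _ _ (fun i => c i `^ p)).
rewrite -poweR_EFin -(@poweRVK p M) ?gt_eqF//.
rewrite -poweRM// ?poweR_ge0//; apply: le_poweR; first exact: ltW.
  by apply: esum_ge0 => i _; rewrite mule_ge0// lee_fin.
rewrite muleC; apply: le_trans (lee_wpmul2l _ wW); last exact: poweR_ge0.
rewrite -esumZl ?poweR_ge0//.
by apply: le_esum => i Ki; rewrite muleC lee_wpmul2r ?lee_fin// cM.
Qed.

Lemma poweRZl (c r : R) (x : \bar R) : (0 <= c)%R -> 0 <= x ->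
  (c%:E * x) `^ r = (c `^ r)%:E * x `^ r.
Proof. by move=> c0 x0; rewrite poweRM ?lee_fin// poweR_EFin. Qed.

Lemma powR_le1 (x r : R) : (0 <= x <= 1)%R -> (0 <= r)%R -> (x `^ r <= 1)%R.
Proof.
move=> /andP[x0 x1] r0; apply: (@le_trans _ _ (1 `^ r)%R); last by rewrite powR1.
by rewrite ge0_ler_powR ?nnegrE.
Qed.

End powers.

Section integral_ext.
Context {R : realType} d (T : measurableType d).
Variable mu : {measure set T -> \bar R}.

(* The integral of a nonnegative function is a supremum over simple functions,
   so that monotonicity needs no measurability. *)
Lemma ge0_le_integral_nomeas (D : set T) (f g : T -> \bar R) :
  (forall x, D x -> 0 <= f x) -> (forall x, D x -> f x <= g x) ->
  \int[mu]_(x in D) f x <= \int[mu]_(x in D) g x.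
Proof.
move=> f0 fg; have g0 x : D x -> 0 <= g x by move=> Dx; rewrite (le_trans (f0 x Dx))// fg.
rewrite !ge0_integralE//; apply: le_ereal_sup => _ [h hf <-].
exists h => // x; apply: le_trans (hf x) _; rewrite /patch.
by case: ifPn => // /[!inE] Dx; exact: fg.
Qed.

End integral_ext.


Lemma countable_enum (U : choiceType) (K : set U) : countable K -> K !=set0 ->
  exists B : set nat, exists e : nat -> U, set_bij B K e.
Proof.
move=> /countable_injP[f fi] [u0 Ku0].
pose e n := xget u0 [set u | K u /\ f u = n].
have eP n : (f @` K) n -> K (e n) /\ f (e n) = n.
  by move=> [u Ku <-]; rewrite /e; case: xgetP => [v _ []//|/(_ u)[]].
exists (f @` K), e; split.
- by move=> n /eP[].
- by move=> m n /[!inE] /eP[_ mE] /eP[_ nE] mn; rewrite -mE -nE mn.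
- move=> u Ku; exists (f u); first by exists u.
  have /eP[K1 f1] : (f @` K) (f u) by exists u.
  by apply: fi => //; rewrite inE.
Qed.

(** Turns an unordered sum into a series, to which measurability and monotone convergence for series
    apply. The values [None] fill the gaps of the enumeration, so that finite and empty index sets
    are treated alike. *)
Lemma esum_enum (R : realType) (U : choiceType) (K : set U) : countable K ->
  exists e : nat -> option U,
    (forall n u, e n = Some u -> K u) /\
    forall a : U -> \bar R, (forall u, 0 <= a u) ->
    \esum_(u in K) a u = \sum_(0 <= n <oo) if e n is Some u then a u else 0.
Proof.
move=> cK; have [->|/set0P K0] := eqVneq K set0.
  exists (fun=> None); split=> // a _.
  by rewrite esum_set0 eseries0.
have [B [e eb]] := countable_enum cK K0.
exists (fun n => if n \in B then Some (e n) else None); split.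
  by move=> n u; case: ifPn => // /[!inE] Bn [<-]; case: eb => h _ _; exact: h.
move=> a a0; rewrite (reindex_esum _ _ _ a eb) nneseries_esumT; last by move=> n; case: ifP.
rewrite esum_mkcond; apply: eq_esum => n _; by case: ifP.
Qed.

Lemma countable_bigcup_measurable d (T : measurableType d) (U : choiceType)
  (K : set U) (F : U -> set T) : countable K ->
  (forall u, K u -> measurable (F u)) -> measurable (\bigcup_(u in K) F u).
Proof.
move=> cK mF; have [->|/set0P K0] := eqVneq K set0; first by rewrite bigcup_set0.
have [B [e [fe _ se]]] := countable_enum cK K0.
rewrite (_ : \bigcup_(u in K) F u = \bigcup_(n in B) F (e n)).
  by apply: bigcup_measurable => n Bn; apply: mF; exact: fe.
apply/seteqP; split => [x [u Ku Fx]|x [n Bn Fx]].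
  by have [n Bn nu] := se _ Ku; exists n => //; rewrite nu.
by exists (e n) => //; exact: fe.
Qed.

Section countable_esum.
Context {R : realType} d (T : measurableType d) (U : choiceType).
Variables (mu : {measure set T -> \bar R}) (K : set U) (D : set T).
Hypotheses (cK : countable K) (mD : measurable D).
Variable f : U -> T -> \bar R.
Hypothesis f0 : forall u x, 0 <= f u x.
Hypothesis mf : forall u, K u -> measurable_fun D (f u).




Lemma measurable_esum : measurable_fun D (fun x => \esum_(u in K) f u x).
Proof.
have [e [eK H]] := esum_enum R cK.
pose g n x := if e n is Some u then f u x else 0.
rewrite (_ : (fun x => _) = (fun x => \sum_(0 <= n <oo | n \in predT) g n x)).
  apply: ge0_emeasurable_sum => [n x _ _|n _]; rewrite /g.
    by case: (e n).
  by case en : (e n) => [u|]; [apply: mf; exact: eK en|exact: measurable_cst].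
by apply/funext => x; rewrite H//; apply: eq_eseriesr.
Qed.

Lemma integral_esum : \int[mu]_(x in D) (\esum_(u in K) f u x) =
  \esum_(u in K) \int[mu]_(x in D) f u x.
Proof.
have [e [eK H]] := esum_enum R cK.
pose g n x := if e n is Some u then f u x else 0.
rewrite H; last by move=> u; apply: integral_ge0 => x _.
transitivity (\int[mu]_(x in D) \sum_(0 <= n <oo) g n x).
  by apply: eq_integral => x _; rewrite H.
rewrite integral_nneseries//.
- apply: eq_eseriesr => n _; rewrite /g; case: (e n) => //.
  by rewrite integral0.
- by move=> n; rewrite /g; case en : (e n) => [u|]; [apply: mf; exact: eK en|exact: measurable_cst].
- by move=> n x _; rewrite /g; case: (e n).
Qed.

End countable_esum.

Section lq_ext.
Context {R : realType}.
Implicit Types (T : choiceType) (q : \bar R).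

Lemma lq_ge_term T (K : set T) q (a : T -> \bar R) i : 0 < q ->
  (forall i, 0 <= a i) -> K i -> a i <= lq q K a.
Proof.
move=> q0 a0 Ki; case: q q0 => [q||]// q0; last first.
  by apply: ereal_sup_ubound; exists i.
rewrite /lq -poweR_leP//; first exact: (@esum_ge_term _ _ _ (fun i => a i `^ q)).
by apply: esum_ge0 => j _; exact: poweR_ge0.
Qed.

Lemma lq_ge0 T (K : set T) q (a : T -> \bar R) : 0 < q -> K !=set0 ->
  (forall i, 0 <= a i) -> 0 <= lq q K a.
Proof. by move=> q0 [i Ki] a0; apply: le_trans (a0 i) _; exact: lq_ge_term. Qed.

Lemma le_lq T (K : set T) q (a b : T -> \bar R) : 0 < q ->
  (forall i, K i -> 0 <= a i) -> (forall i, K i -> a i <= b i) ->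
  lq q K a <= lq q K b.
Proof.
move=> q0 a0 ab; case: q q0 => [q||]// q0; last first.
  apply: ge_ereal_sup => _ [i Ki <-]; apply: le_trans (ab _ Ki) _.
  by apply: ereal_sup_ubound; exists i.
rewrite lte_fin in q0; rewrite /lq; apply: le_poweR; first by rewrite invr_ge0 ltW.
  by apply: esum_ge0 => j _; exact: poweR_ge0.
by apply: le_esum => i Ki; apply: le_poweR; [exact: ltW|exact: a0|exact: ab].
Qed.

Lemma lqZl T (K : set T) q (c : R) (a : T -> \bar R) : 0 < q -> (0 <= c)%R ->
  (forall i, 0 <= a i) -> lq q K (fun i => c%:E * a i) <= c%:E * lq q K a.
Proof.
move=> q0 c0 a0; case: q q0 => [q||]// q0; last first.
  apply: ge_ereal_sup => _ [i Ki <-]; apply: lee_wpmul2l; first by rewrite lee_fin.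
  by apply: ereal_sup_ubound; exists i.
rewrite lte_fin in q0; rewrite /lq.
under eq_esum do rewrite poweRM ?lee_fin//.
rewrite esumZl ?poweR_ge0//; last by move=> i; exact: poweR_ge0.
rewrite poweRM ?poweR_ge0 ?poweRK ?gt_eqF// ?lee_fin//.
by apply: esum_ge0 => i _; exact: poweR_ge0.
Qed.

Lemma lq_poweR T (K : set T) q (t : R) (a : T -> \bar R) : 0 < q -> (0 < t)%R ->
  K !=set0 -> (forall i, 0 <= a i) ->
  lq q K (fun i => a i `^ t) <= (lq (q * t%:E) K a) `^ t.
Proof.
move=> q0 t0 K0 a0; case: q q0 => [q||]// q0; last first.
  rewrite gt0_mulye ?lte_fin//; apply: ge_ereal_sup => _ [i Ki <-].
  by apply: le_poweR => //; [exact: ltW|apply: ereal_sup_ubound; exists i].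
rewrite lte_fin in q0; rewrite -EFinM /lq invfM -poweRrM mulrAC -mulrA divff ?gt_eqF// mulr1.
under eq_esum do rewrite -poweRrM (mulrC t).
by [].
Qed.

(* Replaces the triangle inequality of l^q, and also serves for q < 1. *)
Lemma lq_wesum T1 T2 (L : set T1) (J : set T2) q (w : T1 -> R) (W : R)
    (c : T1 -> T2 -> \bar R) : 0 < q -> L !=set0 -> J !=set0 ->
  (forall l, 0 <= w l)%R -> (forall l j, 0 <= c l j) ->
  \esum_(l in L) (w l)%:E <= W%:E ->
  lq q J (fun j => \esum_(l in L) ((w l)%:E * c l j)) <=
  W%:E * lq q L (fun l => lq q J (c l)).
Proof.
move=> q0 L0 J0 w0 c0 wW.
have W0 : (0 <= W)%R.
  by rewrite -lee_fin; apply: le_trans wW; apply: esum_ge0 => i _; rewrite lee_fin.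
have lc0 l : 0 <= lq q J (c l) by exact: lq_ge0.
case: q q0 lc0 => [q||]// q0 lc0; last first.
  apply: ge_ereal_sup => _ [j Jj <-].
  have N0 : 0 <= lq +oo L (fun l => lq +oo J (c l)) by exact: lq_ge0.
  apply: (@le_trans _ _ (\esum_(l in L) (lq +oo L (fun l => lq +oo J (c l)) * (w l)%:E))).
    apply: le_esum => l Ll; rewrite muleC; apply: lee_wpmul2r; first by rewrite lee_fin.
    apply: (@le_trans _ _ (lq +oo J (c l))); first by apply: lq_ge_term.
    by apply: (@lq_ge_term _ _ _ (fun l => lq +oo J (c l))).
  rewrite esumZl// [leRHS]muleC; apply: lee_wpmul2l => //.
rewrite lte_fin in q0; rewrite /lq (@poweR_leP _ q^-1) ?invr_gt0// ?invrK; last 2 first.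
- by apply: esum_ge0 => j _; exact: poweR_ge0.
- by rewrite mule_ge0 ?lee_fin ?poweR_ge0.
rewrite poweRM ?poweR_ge0 ?lee_fin// poweRVK ?gt_eqF//; last first.
  by apply: esum_ge0 => j _; exact: poweR_ge0.
apply: (@le_trans _ _ (\esum_(j in J) ((W `^ q)%:E * \esum_(l in L) (c l j) `^ q))).
  by apply: le_esum => j _; exact: poweR_wesum.
rewrite esumZl ?lee_fin ?powR_ge0//; last first.
  by move=> j; apply: esum_ge0 => l _; exact: poweR_ge0.
rewrite poweR_EFin; apply: lee_wpmul2l; first by rewrite lee_fin powR_ge0.
rewrite exchange_esum; last by move=> l j; exact: poweR_ge0.
apply: le_esum => l _; rewrite poweRVK ?gt_eqF//.
by apply: esum_ge0 => j _; exact: poweR_ge0.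
Qed.

End lq_ext.

Section geometric.
Context {R : realType}.
Variable theta : R.
Hypothesis theta01 : (0 < theta < 1)%R.

Lemma esum_geo : \esum_(l in [set: nat]) (theta ^+ l)%:E <= ((1 - theta)^-1)%:E.
Proof.
have /andP[t0 t1] := theta01.
have t1' : (0 < 1 - theta)%R by rewrite subr_gt0.
rewrite -nneseries_esumT; last by move=> n; rewrite lee_fin exprn_ge0// ltW.
apply: lime_le; first by apply: is_cvg_nneseries => n _ _; rewrite lee_fin exprn_ge0// ltW.
near=> n; rewrite sumEFin lee_fin big_mkord.
rewrite -[leRHS]mul1r ler_pdivlMr// mulrC -opprB mulNr -subrX1 opprB.
by rewrite gerBl exprn_ge0// ltW.
Unshelve. all: by end_near. Qed.

Lemma esum_geo_int (j : int) :
  \esum_(k in [set: int]) (theta ^+ `|k - j|%N)%:E <= (2 / (1 - theta))%:E.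
Proof.
have /andP[t0 t1] := theta01.
have p0 (n : nat) : 0 <= (theta ^+ n)%:E by rewrite lee_fin exprn_ge0// ltW.
rewrite (esumID [set k : int | (j <= k)%R])//.
rewrite [(2 / _)%R]mulr_natl mulr2n EFinD; apply: leeD; apply: le_trans esum_geo.
- rewrite setTI (@reindex_esum _ _ _ [set: nat] _ (fun n : nat => j + n%:Z)%R).
    by apply: le_esum => n _; rewrite [(j + _)%R]addrC addrK.
  split=> [n _ /=|m n _ _ /addrI[]//|k /= jk]; first by rewrite lerDl.
  by exists `|k - j|%N => //; rewrite gez0_abs ?subr_ge0//; lia.
- rewrite setTI (@reindex_esum _ _ _ [set: nat] _ (fun n : nat => j - (n.+1)%:Z)%R).
    apply: le_esum => n _; rewrite [(j - _)%R]addrC addrK abszN lee_fin absz_nat exprS.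
    by rewrite ler_piMl ?exprn_ge0// ltW.
  split=> [n _ /=|m n _ _ /addrI/oppr_inj[]//|k /= /negP].
    by apply/negP; rewrite -ltNge gtrBl.
  rewrite -ltNge => kj; exists (`|j - k|%N).-1 => //.
  rewrite prednK ?absz_gt0 ?subr_eq0 ?gt_eqF// gez0_abs ?subr_ge0 ?ltW//; lia.
Qed.

End geometric.

Lemma esum_inj_le (R : realType) (T T' : choiceType) (e : T -> T') (a : T' -> \bar R) :
  injective e -> \esum_(i in [set: T]) a (e i) <= \esum_(i in [set: T']) a i.
Proof.
move=> ei; rewrite -(@esum_image _ _ _ _ e a); first exact: subset_esum.
by move=> x y _ _ /ei.
Qed.

Lemma lq_inj_le (R : realType) (T T' : choiceType) (e : T -> T') q
  (a : T' -> \bar R) : 0 < q -> injective e ->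
  lq q [set: T] (fun i => a (e i)) <= lq q [set: T'] a.
Proof.
move=> q0 ei; case: q q0 => [q||]// q0; last first.
  by apply: le_ereal_sup => _ [i _ <-]; exists (e i).
rewrite lte_fin in q0; rewrite /lq; apply: le_poweR; first by rewrite invr_ge0 ltW.
  by apply: esum_ge0 => j _; exact: poweR_ge0.
exact: (esum_inj_le (fun i => a i `^ q)).
Qed.

Lemma powR_exprn (R : realType) (x : R) n (r : R) : (0 <= x)%R ->
  ((x ^+ n) `^ r = (x `^ r) ^+ n)%R.
Proof.
move=> x0; elim: n => [|n IH]; first by rewrite !expr0 powR1.
by rewrite !exprS powRM ?exprn_ge0// IH.
Qed.

(** A discrete convolution inequality for all [q > 0]. The kernel is written as a product because
    one factor is spent on the sum over [j] by [poweR_wesum], the other on the sum over [k] after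
    the exchange. *)
Lemma lq_geo (R : realType) (theta : R) q : (0 < theta < 1)%R -> 0 < q ->
  exists2 C : R, (0 <= C)%R & forall b : nat -> \bar R, (forall j, 0 <= b j) ->
    lq q [set: int] (fun k : int =>
      \esum_(j in [set: nat]) ((theta ^+ `|k - j%:Z|%N * theta ^+ `|k - j%:Z|%N)%:E * b j))
    <= C%:E * lq q [set: nat] b.
Proof.
move=> t01 q0; have /andP[t0 t1] := t01.
have p0 (n : nat) : (0 <= theta ^+ n)%R by rewrite exprn_ge0// ltW.
have W0 (u : R) : (0 < u < 1)%R -> (0 <= 2 / (1 - u))%R.
  by move=> /andP[u0 u1]; rewrite divr_ge0// subr_ge0 ltW.
have wW (k : int) : \esum_(j in [set: nat]) (theta ^+ `|k - j%:Z|%N)%:E <= (2 / (1 - theta))%:E.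
  apply: le_trans (esum_geo_int t01 k).
  apply: le_trans (@esum_inj_le _ _ _ (fun j : nat => j%:Z) (fun j => (theta ^+ `|j - k|%N)%:E) _).
    by apply: le_esum => j _; rewrite distnC.
  by move=> x y [].
case: q q0 => [q||]// q0; last first.
  exists (2 / (1 - theta))%R; first exact: W0.
  move=> b b0; have l0 : 0 <= lq +oo [set: nat] b by apply: lq_ge0 => //; exists 0%N.
  apply: ge_ereal_sup => _ [k _ <-].
  apply: (@le_trans _ _ (\esum_(j in [set: nat]) (lq +oo [set: nat] b * (theta ^+ `|k - j%:Z|%N)%:E))).
    apply: le_esum => j _; rewrite muleC; apply: lee_pmul => //.
    - by rewrite lee_fin mulr_ge0.
    - exact: lq_ge_term.
    - by rewrite lee_fin ler_piMl// exprn_ile1// ltW.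
  rewrite esumZl//; last by move=> j; rewrite lee_fin.
  by rewrite [X in _ <= X]muleC; apply: lee_wpmul2l.
rewrite lte_fin in q0.
have u01 : (0 < theta `^ q < 1)%R.
  rewrite powR_gt0//=; have := @gt0_ltr_powR _ _ q0 theta 1%R.
  by rewrite powR1; apply; rewrite ?nnegrE// ltW.
pose C := ((2 / (1 - theta)) `^ q * (2 / (1 - theta `^ q)))%R.
have C0 : (0 <= C)%R by rewrite mulr_ge0 ?powR_ge0 ?W0.
exists (C `^ q^-1)%R; first exact: powR_ge0.
move=> b b0; rewrite /lq -poweR_EFin -poweRM ?lee_fin//; last first.
  by apply: esum_ge0 => j _; exact: poweR_ge0.
apply: le_poweR; first by rewrite invr_ge0 ltW.
  by apply: esum_ge0 => j _; exact: poweR_ge0.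
apply: (@le_trans _ _ (\esum_(k in [set: int]) (((2 / (1 - theta)) `^ q)%:E *
    \esum_(j in [set: nat]) ((((theta `^ q) ^+ `|k - j%:Z|%N)%:E * b j `^ q))))).
  apply: le_esum => k _.
  under eq_esum do rewrite EFinM -muleA.
  apply: le_trans (poweR_wesum q0 _ _ (wW k)) _ => //.
    by move=> j; rewrite mule_ge0 ?lee_fin.
  apply: lee_wpmul2l; first by rewrite lee_fin powR_ge0.
  apply: le_esum => j _; rewrite poweRM ?lee_fin// poweR_EFin.
  by rewrite powR_exprn// ltW.
rewrite esumZl ?lee_fin ?powR_ge0//; last first.
  move=> k; apply: esum_ge0 => j _; rewrite mule_ge0 ?poweR_ge0// lee_fin.
  by rewrite exprn_ge0// powR_ge0.
rewrite /C EFinM -muleA; apply: lee_wpmul2l; first by rewrite lee_fin powR_ge0.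
rewrite exchange_esum; last first.
  by move=> k j; rewrite mule_ge0 ?poweR_ge0// lee_fin exprn_ge0// powR_ge0.
rewrite -esumZl ?lee_fin ?W0//; last by move=> j; exact: poweR_ge0.
apply: le_esum => j _; under eq_esum do rewrite muleC.
rewrite esumZl ?poweR_ge0//; last by move=> k; rewrite lee_fin exprn_ge0// powR_ge0.
by rewrite [leRHS]muleC; apply: lee_wpmul2l; [exact: poweR_ge0|exact: esum_geo_int].
Qed.

(** * Jensen's inequality and inequalities for powers of sums *)

Section jensen.
Context {R : realType} d (T : measurableType d).
Variable mu : {measure set T -> \bar R}.

(** Young's inequality for the product of [x] and 1, with exponent [P]. *)
Lemma powR_bernoulli (P x : R) : (1 <= P)%R -> (0 <= x)%R ->
  (P * x <= x `^ P + (P - 1))%R.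
Proof.
move=> P1 x0; have [->|Pn1] := eqVneq P 1%R.
  by rewrite powRr1// subrr addr0 mul1r.
have {}P1 : (1 < P)%R by rewrite lt_neqAle eq_sym Pn1.
have P0 : (0 < P)%R by apply: lt_trans P1.
have q0 : (0 < P / (P - 1))%R by rewrite divr_gt0// subr_gt0.
have := conjugate_powR x0 ler01 P0 q0.
have -> : (P^-1 + (P / (P - 1))^-1 = 1)%R by field; rewrite subr_eq0 !gt_eqF.
move=> /(_ erefl); rewrite mulr1 powR1 => {}h.
rewrite -(ler_pM2l P0) in h; apply: (le_trans h); rewrite le_eqVlt; apply/orP; left.
by apply/eqP; field; rewrite subr_eq0 !gt_eqF.
Qed.

(** The convex function [x ^ P] lies above its tangent at [t]; the inequality is solved for [x]. *)
Lemma le_young (P t : R) (x : \bar R) : (1 <= P)%R -> (0 < t)%R -> 0 <= x ->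
  x <= (t `^ (1 - P) / P)%:E * x `^ P + (t * (1 - P^-1))%:E.
Proof.
move=> P1 t0; have P0 : (0 < P)%R by apply: lt_le_trans P1.
move: x => [x| |]// x0; last first.
  by rewrite poweRyr ?gt_eqF// gt0_muley ?addye// lte_fin divr_gt0// powR_gt0.
rewrite lee_fin in x0; rewrite poweR_EFin -EFinM -EFinD lee_fin.
have := powR_bernoulli P1 (divr_ge0 x0 (ltW t0)).
rewrite powRM ?invr_ge0 ?(ltW t0)// => /(ler_wpM2l (ltW (divr_gt0 t0 P0))).
have -> : (t / P * (P * (x / t)) = x)%R by field; rewrite !gt_eqF.
move=> /le_trans; apply; rewrite powRB ?(gt_eqF t0) ?implybT// powRr1 ?(ltW t0)//.
rewrite le_eqVlt; apply/orP; left; apply/eqP.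
have -> : (t^-1 `^ P = (t `^ P)^-1)%R.
  by apply: (mulfI (lt0r_neq0 (powR_gt0 P t0))); rewrite -powRM ?invr_ge0 ?(ltW t0)// !divff ?powR1 ?lt0r_neq0 ?powR_gt0.
by field; rewrite !gt_eqF ?powR_gt0.
Qed.

(** If [t ^ P] is at least the mean [M] of [h ^ P], the tangent inequality at [t] integrates to a
    mean of [h] of at most [t]; then [t] decreases to [M ^ (1/P)]. *)
Lemma jensen_poweR (B : set T) (V P : R) (h : T -> \bar R) : measurable B ->
  mu B = V%:E -> (0 < V)%R -> (1 <= P)%R -> measurable_fun B h ->
  (forall x, 0 <= h x) ->
  (V^-1%:E * \int[mu]_(x in B) h x) `^ P <= V^-1%:E * \int[mu]_(x in B) (h x `^ P).
Proof.
move=> mB BV V0 P1 mh h0; have P0 : (0 < P)%R by apply: lt_le_trans P1.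
have V0' : (0 <= V^-1)%R by rewrite invr_ge0 ltW.
set M := V^-1%:E * \int[mu]_(x in B) (h x `^ P).
have hP0 x : 0 <= h x `^ P by exact: poweR_ge0.
have M0 : 0 <= M by rewrite mule_ge0 ?lee_fin// integral_ge0.
rewrite poweR_leP//; last by rewrite mule_ge0 ?lee_fin// integral_ge0.
have [Moo|Mfin] := eqVneq M +oo.
  by rewrite Moo poweRyr ?leey// gt_eqF// invr_gt0.
have Mf : M \is a fin_num by rewrite ge0_fin_numE// ltey.
have mhP : measurable_fun B (fun x => h x `^ P).
  by apply: (measurableT_comp (measurable_poweR P)).
have key (t : R) : (0 < t)%R -> M <= (t `^ P)%:E -> V^-1%:E * \int[mu]_(x in B) h x <= t%:E.
  move=> t0 Mt.
  have c0 : (0 <= t `^ (1 - P) / P)%R by rewrite divr_ge0 ?powR_ge0 ?ltW.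
  have c1 : (0 <= t * (1 - P^-1))%R by rewrite mulr_ge0 ?(ltW t0)// subr_ge0 invf_le1.
  apply: (@le_trans _ _ (V^-1%:E * \int[mu]_(x in B)
      ((t `^ (1 - P) / P)%:E * h x `^ P + (t * (1 - P^-1))%:E))).
    apply: lee_wpmul2l; first by rewrite lee_fin.
    by apply: ge0_le_integral_nomeas => // x _; exact: le_young.
  rewrite ge0_integralD//; last 2 first.
  - by move=> x _; rewrite mule_ge0// lee_fin.
  - by apply: measurable_funeM.
  rewrite ge0_integralZl// integral_cst// BV ge0_muleDr; last 2 first.
  - by rewrite mule_ge0 ?lee_fin// integral_ge0.
  - by rewrite -EFinM lee_fin mulr_ge0// ltW.
  rewrite muleCA -/M; apply: (@le_trans _ _ ((t `^ (1 - P) / P)%:E * (t `^ P)%:E + (t * (1 - P^-1))%:E)).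
    apply: leeD; first by apply: lee_wpmul2l; rewrite ?lee_fin.
    by rewrite -!EFinM lee_fin mulrCA mulVf ?mulr1 ?gt_eqF.
  rewrite -EFinM -EFinD lee_fin mulrAC -powRD; last by rewrite (gt_eqF t0) implybT.
  by rewrite subrK powRr1 ?(ltW t0)// le_eqVlt; apply/orP; left; apply/eqP; ring.
(* The tangent point has to be positive while [M] may vanish, hence the added [e]. *)
apply/lee_addgt0Pr => e e0; set m := M `^ P^-1.
have mf : m \is a fin_num by exact: fin_num_poweR.
have m0 : 0 <= m by exact: poweR_ge0.
rewrite -(fineK mf) -EFinD; apply: key.
  by rewrite ltr_wpDl// fine_ge0.
rewrite -(@poweRVK _ P M) ?gt_eqF// -/m -(fineK mf) poweR_EFin lee_fin.
have fm0 : (0 <= fine m)%R by rewrite fine_ge0.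
by apply: ge0_ler_powR; rewrite ?nnegrE ?(ltW P0)// ?lerDl ?addr_ge0 ?(ltW e0).
Qed.

End jensen.

Section power_sums.
Context {R : realType}.

(** By convexity the increment is at most [b] times the derivative at the right end; it is
    Bernoulli's inequality at [y / (y + b)]. *)
Lemma poweR_increment (P : R) (y b : \bar R) : (1 <= P)%R -> 0 <= y -> 0 <= b ->
  (y + b) `^ P <= y `^ P + P%:E * (b * (y + b) `^ (P - 1)).
Proof.
move=> P1; have P0 : (0 < P)%R by apply: lt_le_trans P1.
have pp0 (x : \bar R) : 0 <= P%:E * x <-> 0 <= x by rewrite pmule_rge0// lte_fin.
move: y b => [y| |]// [b| |]// y0 b0.
- rewrite !lee_fin in y0 b0; have [xz|xn0] := eqVneq (y + b)%R 0%R.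
    have -> : y%:E + b%:E = 0 by rewrite -EFinD xz.
    rewrite poweR0r ?gt_eqF// adde_ge0 ?poweR_ge0//.
    by apply/pp0; rewrite mule_ge0 ?poweR_ge0.
  have x0 : (0 < y + b)%R by rewrite lt_neqAle eq_sym xn0 addr_ge0.
  rewrite -EFinD !poweR_EFin -!EFinM -EFinD lee_fin.
  set x := (y + b)%R in xn0 x0 *.
  have := powR_bernoulli P1 (divr_ge0 y0 (ltW x0)).
  have xP0 : (0 < x `^ P)%R by exact: powR_gt0.
  move=> /(ler_wpM2l (ltW xP0)).
  rewrite powRM ?invr_ge0 ?(ltW x0)// -powR_inv1 ?(ltW x0)// -!powRrM mulN1r.
  have -> : (x `^ P * (y `^ P * x `^ (- P) + (P - 1)) = y `^ P + x `^ P * (P - 1))%R.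
    by rewrite mulrDr mulrCA -powRD ?(gt_eqF x0) ?implybT// subrr powRr0 mulr1.
  have -> : (x `^ P * (P * (y * x `^ (-1))) = P * y * x `^ (P - 1))%R.
    by rewrite powRD ?(gt_eqF x0) ?implybT//; ring.
  have -> : b = (x - y)%R by rewrite /x addrC addKr.
  have -> : (x `^ P = x * x `^ (P - 1))%R.
    by rewrite -{2}(powRr1 (ltW x0)) -powRD ?(gt_eqF x0) ?implybT// addrCA subrr addr0.
  move: (x `^ (P - 1))%R (y `^ P)%R => u v; lra.
- have inf : P%:E * (+oo * +oo `^ (P - 1)) = +oo :> \bar R.
    rewrite gt0_mulye ?gt0_muley ?lte_fin//.
    have [->|P1'] := eqVneq (P - 1)%R 0%R; first by rewrite poweRe0.
    by rewrite poweRyr.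
  by rewrite addey// inf addey ?leey.
- rewrite addye// poweRyr ?gt_eqF// addye ?leey//.
  by rewrite -ltNye (lt_le_trans (ltNyr 0))//; apply/pp0; rewrite mule_ge0 ?poweR_ge0.
- rewrite addye// poweRyr ?gt_eqF// addye ?leey//.
  by rewrite -ltNye (lt_le_trans (ltNyr 0))//; apply/pp0; rewrite mule_ge0 ?poweR_ge0.
Qed.

(** In this form [b i] is multiplied only by the partial sum up to [i]. In the dual Doob inequality
    that partial sum consists of averages at scales no finer than the one of [b i]. *)
Lemma poweR_telescope (P : R) (b : nat -> \bar R) n : (1 <= P)%R ->
  (forall i, 0 <= b i) ->
  (\sum_(i < n) b i) `^ P <=
  P%:E * \sum_(i < n) b i * (\sum_(j < i.+1) b j) `^ (P - 1).
Proof.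
move=> P1 b0; have P0 : (0 < P)%R by apply: lt_le_trans P1.
elim: n => [|n IH]; first by rewrite !big_ord0 mule0 poweR0r// gt_eqF.
rewrite [X in _ <= _ * X]big_ord_recr ge0_muleDr; last 2 first.
- by apply: sume_ge0 => i _; rewrite mule_ge0 ?poweR_ge0.
- by rewrite mule_ge0 ?poweR_ge0.
rewrite big_ord_recr /=; apply: le_trans (poweR_increment P1 _ _) _ => //.
  exact: sume_ge0.
by rewrite leeD.
Qed.

(** If [u <= e * v] the second term suffices; otherwise [v] is below [u / e] and the first one does.
    The free parameter [e] allows the second term to be absorbed. *)
Lemma mule_poweR_eps (P e : R) (u v : \bar R) : (1 <= P)%R -> (0 < e)%R ->
  0 <= u -> 0 <= v ->
  u * v `^ (P - 1) <= (e `^ (1 - P))%:E * u `^ P + e%:E * v `^ P.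
Proof.
move=> P1 e0; have P0 : (0 < P)%R by apply: lt_le_trans P1.
have c0 : (0 < e `^ (1 - P))%R by rewrite powR_gt0.
have nNy (x : \bar R) : 0 <= x -> x != -oo by move=> x0; rewrite -ltNye (lt_le_trans (ltNyr 0)).
move: u v => [u| |]// [v| |]// u0 v0; rewrite ?(poweRyr (_ : P != 0%R)) ?gt_eqF//.
- rewrite !lee_fin in u0 v0; rewrite !poweR_EFin -!EFinM -EFinD lee_fin.
  have vP : (v `^ P = v * v `^ (P - 1))%R.
    have [->|v1] := eqVneq v 0%R; first by rewrite mul0r powR0// gt_eqF.
    by rewrite -{2}(powRr1 v0) -powRD ?v1 ?implybT// addrCA subrr addr0.
  have uP : (u `^ P = u * u `^ (P - 1))%R.
    have [->|v1] := eqVneq u 0%R; first by rewrite mul0r powR0// gt_eqF.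
    by rewrite -{2}(powRr1 u0) -powRD ?v1 ?implybT// addrCA subrr addr0.
  have [uv|vu] := leP u (e * v)%R.
    rewrite -[leLHS]add0r lerD// ?mulr_ge0 ?powR_ge0 ?(ltW c0)//.
    by rewrite vP mulrA ler_wpM2r ?powR_ge0.
  rewrite -[leLHS]addr0 lerD ?mulr_ge0 ?powR_ge0 ?(ltW e0)//.
  rewrite uP mulrCA ler_wpM2l//.
  have -> : (e `^ (1 - P) = (e^-1) `^ (P - 1))%R.
    by rewrite -(powR_inv1 (ltW e0)) -powRrM mulN1r opprB.
  rewrite -powRM ?invr_ge0 ?(ltW e0)//; apply: ge0_ler_powR; rewrite ?subr_ge0// ?nnegrE//.
    by rewrite mulr_ge0 ?invr_ge0 ?(ltW e0).
  by rewrite ler_pdivlMl// ltW.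
- by rewrite gt0_muley ?lte_fin// addey ?leey// nNy// mule_ge0 ?poweR_ge0// lee_fin ltW.
- by rewrite [X in _ <= X + _]gt0_muley ?lte_fin// addye ?leey// nNy// mule_ge0 ?poweR_ge0// lee_fin ltW.
- by rewrite [X in _ <= X + _]gt0_muley ?lte_fin// addye ?leey// nNy// mule_ge0 ?poweR_ge0// lee_fin ltW.
Qed.

(** The constant grows with [n]; the bound only serves to know that an integral is finite before it
    is absorbed. *)
Lemma poweR_sum_max (P : R) (b : nat -> \bar R) n : (0 < P)%R -> (forall i, 0 <= b i) ->
  (\sum_(i < n) b i) `^ P <= ((2 `^ P) ^+ n)%:E * \sum_(i < n) b i `^ P.
Proof.
move=> P0 b0; have c1 : (1 <= 2 `^ P :> R)%R.
  by rewrite -[leLHS](powRr0 2) ler_powR ?ler1n// ltW.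
have c0 : (0 <= 2 `^ P :> R)%R by rewrite powR_ge0.
elim: n => [|n IH]; first by rewrite !big_ord0 mule0 poweR0r// gt_eqF.
have s0 : 0 <= \sum_(i < n) b i `^ P by apply: sume_ge0 => i _; exact: poweR_ge0.
rewrite !big_ord_recr /=; apply: le_trans (poweRD_max P0 _ _) _ => //; first exact: sume_ge0.
rewrite exprS EFinM -muleA; apply: lee_wpmul2l; first by rewrite lee_fin.
rewrite ge0_muleDr ?poweR_ge0//; apply: leeD => //.
by rewrite lee_pemull ?poweR_ge0// lee_fin exprn_ege1.
Qed.

End power_sums.

Section finite_hoelder.
Context {R : realType}.

Lemma mulr_le_conj (q x y : R) : (1 < q)%R -> (0 <= x)%R -> (0 <= y)%R ->
  (x * y <= x `^ q + y `^ (q / (q - 1)))%R.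
Proof.
move=> q1 x0 y0; have q0 : (0 < q)%R by apply: lt_trans q1.
have q10 : (0 < q - 1)%R by rewrite subr_gt0.
have := conjugate_powR x0 y0 q0 (divr_gt0 q0 q10).
have -> : (q^-1 + (q / (q - 1))^-1 = 1)%R by field; rewrite !gt_eqF.
move=> /(_ erefl) h; apply: (le_trans h); apply: lerD.
  by rewrite ler_pdivrMr// ler_peMr ?powR_ge0// ltW.
rewrite ler_pdivrMr ?divr_gt0// ler_peMr ?powR_ge0// ler_pdivlMr// mul1r.
by rewrite gerBl.
Qed.

(** Both sums are normalized to 1 and Young's inequality is applied without its factors [1/q] and
    [1/q'], whence the 2. Sums equal to 0 or [+oo] cannot be normalized and are settled first. *)
Lemma sum_hoelder (q : R) n (a b : nat -> \bar R) : (1 < q)%R ->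
  (forall i, 0 <= a i) -> (forall i, 0 <= b i) ->
  \sum_(i < n) a i * b i <= 2%:E * ((\sum_(i < n) a i `^ q) `^ q^-1 *
     (\sum_(i < n) b i `^ (q / (q - 1))) `^ ((q - 1) / q)).
Proof.
move=> q1 a0 b0; have q0 : (0 < q)%R by apply: lt_trans q1.
have q10 : (0 < q - 1)%R by rewrite subr_gt0.
set q' := (q / (q - 1))%R; have q'0 : (0 < q')%R by rewrite divr_gt0.
have q'V : ((q - 1) / q = q'^-1)%R by rewrite /q' invf_div.
rewrite q'V.
have [hA|hA] := eqVneq (\sum_(i < n) a i `^ q) 0.
  rewrite big1 ?mule_ge0 ?poweR_ge0// => i _.
  have : a i `^ q == 0.
    rewrite eq_le poweR_ge0 andbT -hA (bigD1 i)//= leeDl// sume_ge0// => j _.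
    exact: poweR_ge0.
  by rewrite poweR_eq0// => /andP[/eqP ->]; rewrite mul0e.
have [hB|hB] := eqVneq (\sum_(i < n) b i `^ q') 0.
  rewrite big1 ?mule_ge0 ?poweR_ge0// => i _.
  have : b i `^ q' == 0.
    rewrite eq_le poweR_ge0 andbT -hB (bigD1 i)//= leeDl// sume_ge0// => j _.
    exact: poweR_ge0.
  by rewrite poweR_eq0// => /andP[/eqP ->]; rewrite mule0.
set A := \sum_(i < n) a i `^ q in hA *; set B := \sum_(i < n) b i `^ q' in hB *.
have A0 : 0 < A by rewrite lt_neqAle eq_sym hA sume_ge0// => i _; exact: poweR_ge0.
have B0 : 0 < B by rewrite lt_neqAle eq_sym hB sume_ge0// => i _; exact: poweR_ge0.
have [Aoo|Afin] := eqVneq A +oo.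
  rewrite Aoo poweRyr ?gt_eqF ?invr_gt0// gt0_mulye ?poweR_gt0//.
  by rewrite gt0_muley ?leey// lte_fin.
have [Boo|Bfin] := eqVneq B +oo.
  rewrite Boo poweRyr ?gt_eqF ?invr_gt0// gt0_muley ?poweR_gt0//.
  by rewrite gt0_muley ?leey// lte_fin.
have aA (i : 'I_n) : a i `^ q <= A by rewrite /A (bigD1 i)//= leeDl// sume_ge0// => j _; exact: poweR_ge0.
have bB (i : 'I_n) : b i `^ q' <= B by rewrite /B (bigD1 i)//= leeDl// sume_ge0// => j _; exact: poweR_ge0.
have Af : A \is a fin_num by rewrite ge0_fin_numE ?ltW// ltey.
have Bf : B \is a fin_num by rewrite ge0_fin_numE ?ltW// ltey.
set al := fine (A `^ q^-1); set be := fine (B `^ q'^-1).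
have alE : A `^ q^-1 = al%:E by rewrite fineK// fin_num_poweR.
have beE : B `^ q'^-1 = be%:E by rewrite fineK// fin_num_poweR.
have al0 : (0 < al)%R by rewrite -lte_fin -alE poweR_gt0.
have be0 : (0 < be)%R by rewrite -lte_fin -beE poweR_gt0.
have Aal : A = (al `^ q)%:E by rewrite -poweR_EFin -alE poweRVK ?gt_eqF// ltW.
have Bbe : B = (be `^ q')%:E by rewrite -poweR_EFin -beE poweRVK ?gt_eqF// ltW.
apply: (@le_trans _ _ (\sum_(i < n) (al * be)%:E *
    (((al^-1) `^ q)%:E * a i `^ q + ((be^-1) `^ q')%:E * b i `^ q'))).
  apply: lee_sum => i _.
  have ai : a i \is a fin_num.
    have h : a i <= A `^ q^-1 by rewrite -poweR_leP// ltW.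
    by rewrite ge0_fin_numE// (le_lt_trans h)// alE ltry.
  have bi : b i \is a fin_num.
    have h : b i <= B `^ q'^-1 by rewrite -poweR_leP// ltW.
    by rewrite ge0_fin_numE// (le_lt_trans h)// beE ltry.
  rewrite -(fineK ai) -(fineK bi) !poweR_EFin -!EFinM lee_fin.
  have fa : (0 <= fine (a i))%R by rewrite fine_ge0.
  have fb : (0 <= fine (b i))%R by rewrite fine_ge0.
  rewrite -!powRM ?invr_ge0 ?(ltW al0) ?(ltW be0)//.
  apply: le_trans (ler_wpM2l _ (mulr_le_conj q1 _ _)); rewrite ?mulr_ge0 ?invr_ge0 ?(ltW al0) ?(ltW be0)//.
  rewrite le_eqVlt; apply/orP; left; apply/eqP; field; rewrite !gt_eqF//.
rewrite -ge0_sume_distrr; last first.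
  by move=> i _; rewrite adde_ge0 ?mule_ge0 ?poweR_ge0 ?lee_fin ?powR_ge0.
rewrite big_split/= -!ge0_sume_distrr; try by move=> i _; exact: poweR_ge0.
rewrite -/A -/B alE beE Aal Bbe -!EFinM lee_fin -!powRM ?invr_ge0 ?(ltW al0) ?(ltW be0)// !mulVf ?gt_eqF// !powR1.
by rewrite mulrC.
Qed.

Lemma maxe_sum_le n (a : nat -> \bar R) M : (forall i, (i < n)%N -> a i <= M) ->
  0 <= M -> \big[maxe/0]_(i < n) a i <= M.
Proof. by move=> aM M0; apply/bigmax_leP; split=> // i _; exact: aM. Qed.

End finite_hoelder.

Section sup_integral.
Context {R : realType} d (T : measurableType d).
Variable mu : {measure set T -> \bar R}.

(** Monotone convergence with the supremum given through its upper bounds: the hypothesis on [B]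
    says that [f] is at most the supremum of the [g n]. This form fits powers of infinite sums and
    of suprema. *)
Lemma integral_sup_le (g : nat -> T -> \bar R) (f : T -> \bar R) M :
  (forall n, measurable_fun setT (g n)) -> (forall n x, 0 <= g n x) ->
  (forall x m n, (m <= n)%N -> g m x <= g n x) ->
  (forall x, 0 <= f x) -> (forall x B, (forall n, g n x <= B) -> f x <= B) ->
  (forall n, \int[mu]_x g n x <= M) -> \int[mu]_x f x <= M.
Proof.
move=> mg g0 ndg f0 fg gM.
have nd x : {homo g^~ x : n m / (n <= m)%N >-> n <= m} by move=> m n; exact: ndg.
apply: (@le_trans _ _ (\int[mu]_x limn (g^~ x))).
  apply: ge0_le_integral_nomeas => x _ //; apply: fg => n.
  have -> : limn (g^~ x) = ereal_sup (range (g^~ x)).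
    by apply/cvg_lim => //; exact: ereal_nondecreasing_cvgn.
  by apply: ereal_sup_ubound; exists n.
rewrite monotone_convergence//.
apply: lime_le; last by apply: nearW => n; exact: gM.
apply: ereal_nondecreasing_is_cvgn => m n mn.
by apply: ge0_le_integral_nomeas => x _ //; exact: ndg.
Qed.

End sup_integral.

Section esum_nat.
Context {R : realType}.

Lemma sum_ord_le_esum (a : nat -> \bar R) n : (forall i, 0 <= a i) ->
  \sum_(i < n) a i <= \esum_(i in [set: nat]) a i.
Proof.
move=> a0; rewrite -nneseries_esumT// -(big_mkord xpredT a).
exact: nneseries_lim_ge.
Qed.

Lemma esum_nat_le (a : nat -> \bar R) B : (forall i, 0 <= a i) ->
  (forall n, \sum_(i < n) a i <= B) -> \esum_(i in [set: nat]) a i <= B.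
Proof.
move=> a0 aB; rewrite -nneseries_esumT//; apply: lime_le.
  exact: is_cvg_nneseries.
by apply: nearW => n; rewrite big_mkord.
Qed.

Lemma poweR_esum_nat_le (a : nat -> \bar R) (r : R) B : (0 < r)%R ->
  (forall i, 0 <= a i) -> 0 <= B ->
  (forall n, (\sum_(i < n) a i) `^ r <= B) -> (\esum_(i in [set: nat]) a i) `^ r <= B.
Proof.
move=> r0 a0 B0 aB; rewrite poweR_leP//; last exact: esum_ge0.
apply: esum_nat_le => // n; rewrite -poweR_leP//; exact: sume_ge0.
Qed.

End esum_nat.

Section lq_more.
Context {R : realType}.

Lemma esum_geoZ (th : R) (c : \bar R) : (0 < th < 1)%R -> 0 <= c ->
  \esum_(l in [set: nat]) ((th ^+ l)%:E * c) <= ((1 - th)^-1)%:E * c.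
Proof.
move=> t01 c0; have /andP[t0 _] := t01.
under eq_esum do rewrite muleC.
rewrite esumZl//; last by move=> l; rewrite lee_fin exprn_ge0// ltW.
by rewrite muleC; apply: lee_wpmul2r => //; exact: esum_geo.
Qed.

Lemma powR_lt1 (th p : R) : (0 < th < 1)%R -> (0 < p)%R -> (0 < th `^ p < 1)%R.
Proof.
move=> /andP[t0 t1] p0; rewrite powR_gt0//=; have := @gt0_ltr_powR _ _ p0 th 1%R.
by rewrite powR1; apply; rewrite ?nnegrE// ltW.
Qed.

Lemma poweR_geo_esum (th p : R) (c : nat -> \bar R) : (0 < th < 1)%R -> (0 < p)%R ->
  (forall l, 0 <= c l) ->
  (\esum_(l in [set: nat]) ((th ^+ l * th ^+ l)%:E * c l)) `^ p <=
  ((1 - th)^-1 `^ p)%:E * \esum_(l in [set: nat]) (((th `^ p) ^+ l)%:E * c l `^ p).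
Proof.
move=> t01 p0 c0; have /andP[t0 t1] := t01.
have e0 (n : nat) : (0 <= th ^+ n)%R by rewrite exprn_ge0// ltW.
under eq_esum do rewrite EFinM -muleA.
apply: le_trans (poweR_wesum p0 _ _ (esum_geo t01)) _ => // [l|].
  by rewrite mule_ge0// lee_fin.
apply: lee_wpmul2l; first by rewrite lee_fin powR_ge0.
by apply: le_esum => l _; rewrite poweRM ?lee_fin// poweR_EFin powR_exprn// ltW.
Qed.

Lemma le_lqD q : 0 < q -> exists2 C : R, (0 <= C)%R &
  forall a b : nat -> \bar R, (forall i, 0 <= a i) -> (forall i, 0 <= b i) ->
  lq q [set: nat] (fun i => a i + b i) <= C%:E * (lq q [set: nat] a + lq q [set: nat] b).
Proof.
case: q => [q||]// q0; last first.
  exists 1%R => // u v u0 v0; rewrite mul1e; apply: ge_ereal_sup => _ [i _ <-].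
  by apply: leeD; apply: ereal_sup_ubound; exists i.
rewrite lte_fin in q0.
have qV : (0 < q^-1)%R by rewrite invr_gt0.
exists (2 * 2 `^ q^-1)%R; first by rewrite mulr_ge0// powR_ge0.
move=> u v u0 v0; rewrite /lq.
have pu i : 0 <= u i `^ q by exact: poweR_ge0.
have pv i : 0 <= v i `^ q by exact: poweR_ge0.
apply: (@le_trans _ _ (((2 `^ q)%:E * (\esum_(i in [set: nat]) u i `^ q + \esum_(i in [set: nat]) v i `^ q)) `^ q^-1)).
  apply: le_poweR; [exact: ltW|by apply: esum_ge0 => i _; exact: poweR_ge0|].
  rewrite -esumD// -esumZl ?lee_fin ?powR_ge0//; last by move=> i; rewrite adde_ge0.
  by apply: le_esum => i _; exact: poweRD_max.
rewrite poweRM ?lee_fin ?powR_ge0 ?adde_ge0 ?esum_ge0//.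
rewrite poweR_EFin -powRrM mulfV ?gt_eqF// powRr1//.
rewrite EFinM -muleA; apply: lee_wpmul2l => //.
by apply: poweRD_max; rewrite ?esum_ge0.
Qed.

(** Each [e l] is at most the [1/P]-th power of the sum on the right, so the geometric weight alone
    carries the [q]-norm. The exponents [q] and [P] may thus be compared in either direction. *)
Lemma lq_geo_weight (th P : R) q : (0 < th < 1)%R -> 0 < q -> (0 < P)%R ->
  exists2 C : R, (0 <= C)%R & forall e : nat -> \bar R, (forall l, 0 <= e l) ->
  (lq q [set: nat] (fun l => (th ^+ l)%:E * e l)) `^ P <=
  C%:E * \esum_(l in [set: nat]) e l `^ P.
Proof.
move=> t01 q0 P0; have /andP[t0 t1] := t01.
have t_ge0 (l : nat) : (0 <= th ^+ l)%R by rewrite exprn_ge0// ltW.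
have [C C0 HC] : exists2 C : R, (0 <= C)%R & lq q [set: nat] (fun l => (th ^+ l)%:E) <= C%:E.
  case: q q0 => [q||]// q0; last first.
    exists 1%R => //; apply: ge_ereal_sup => _ [l _ <-].
    by rewrite lee_fin exprn_ile1// ltW.
  rewrite lte_fin in q0; have /andP[u0 u1] := powR_lt1 t01 q0.
  exists (((1 - th `^ q)^-1) `^ q^-1)%R; first exact: powR_ge0.
  rewrite /lq -poweR_EFin; apply: le_poweR; first by rewrite invr_ge0 ltW.
    by apply: esum_ge0 => l _; exact: poweR_ge0.
  under eq_esum do rewrite poweR_EFin powR_exprn ?(ltW t0)//.
  by apply: esum_geo; rewrite u0.
exists ((C + 1) `^ P)%R; first exact: powR_ge0.
move=> e e0; set M := \esum_(l in [set: nat]) e l `^ P.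
have C1 : (0 < C + 1)%R by rewrite ltr_wpDl.
have M0 : 0 <= M by apply: esum_ge0 => l _; exact: poweR_ge0.
have eM l : e l <= M `^ P^-1.
  by rewrite -poweR_leP//; exact: (@esum_ge_term _ _ _ (fun l => e l `^ P)).
rewrite -(@poweRVK _ P M) ?gt_eqF// -poweR_EFin -poweRM ?lee_fin ?poweR_ge0 ?(ltW C1)//.
have w0 l : 0 <= (th ^+ l)%:E * e l by rewrite mule_ge0// lee_fin.
apply: le_poweR; [exact: ltW|exact: lq_ge0|].
have [Moo|Mfin] := eqVneq M +oo.
  by rewrite Moo poweRyr ?gt_eqF ?invr_gt0// gt0_muley ?leey.
have Mf : M `^ P^-1 \is a fin_num by rewrite fin_num_poweR// ge0_fin_numE// ltey.
move: eM; rewrite -(fineK Mf); set m := fine _ => eM.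
have m0 : (0 <= m)%R by rewrite fine_ge0// poweR_ge0.
apply: (@le_trans _ _ (m%:E * lq q [set: nat] (fun l => (th ^+ l)%:E))).
  apply: le_trans (lqZl _ q0 m0 _); last by move=> l; rewrite lee_fin.
  apply: le_lq => // l _; rewrite muleC; apply: lee_wpmul2r => //.
  by rewrite lee_fin.
rewrite muleC; apply: lee_wpmul2r; first by rewrite lee_fin.
by apply: (le_trans HC); rewrite lee_fin lerDl.
Qed.

End lq_more.

Lemma norm_maxE {R : realType} (x : R) : (`|x| = Num.max x 0 + Num.max (- x) 0)%R.
Proof.
rewrite !maxEle oppr_le0.
case: (ger0P x) => x0; last by rewrite ltW// add0r.
by case: (leP x 0%R) => // x1; rewrite ?addr0//; lra.
Qed.

(** * Unordered sums of real families *)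

Section unordered_sums.
Context {R : realType} (T : choiceType) (K : set T).
Implicit Types t u v : T -> R.

Let fin_part u : (forall i, 0 <= u i)%R -> \esum_(i in K) (u i)%:E < +oo ->
  (fine (\esum_(i in K) (u i)%:E))%:E = \esum_(i in K) (u i)%:E.
Proof. by move=> u0 h; rewrite fineK// ge0_fin_numE// esum_ge0// => i _; rewrite lee_fin. Qed.

Let pos0 t i : (0 <= Num.max (t i) 0)%R. Proof. by rewrite le_max lexx orbT. Qed.

Lemma esum_dom_lty t u : (forall i, 0 <= t i <= `|u i|)%R ->
  \esum_(i in K) `|u i|%:E < +oo -> \esum_(i in K) (t i)%:E < +oo.
Proof. by move=> tu; apply: le_lt_trans; apply: le_esum => i _; rewrite lee_fin; case/andP: (tu i). Qed.

Let pos_lty t : \esum_(i in K) `|t i|%:E < +oo -> \esum_(i in K) (Num.max (t i) 0)%:E < +oo.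
Proof.
by apply: esum_dom_lty => i; rewrite le_max lexx orbT/= ge_max ler_norm normr_ge0.
Qed.
Let neg_lty t : \esum_(i in K) `|t i|%:E < +oo -> \esum_(i in K) (Num.max (- t i) 0)%:E < +oo.
Proof.
apply: esum_dom_lty => i; rewrite le_max lexx orbT/= ge_max normr_ge0 andbT.
by rewrite -normrN ler_norm.
Qed.

(** Any difference of nonnegative summable families computes the sum: the positive part of [t] plus
    [v] equals its negative part plus [u], and all four sums are finite. *)
Lemma usum_split t u v : (forall i, K i -> t i = u i - v i)%R -> (forall i, 0 <= u i)%R ->
  (forall i, 0 <= v i)%R -> \esum_(i in K) (u i)%:E < +oo -> \esum_(i in K) (v i)%:E < +oo ->
  usum K t = (fine (\esum_(i in K) (u i)%:E) - fine (\esum_(i in K) (v i)%:E))%R.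
Proof.
move=> tuv u0 v0 uoo voo.
have e i : K i -> (Num.max (t i) 0 + v i = Num.max (- t i) 0 + u i)%R.
  by move=> Ki; rewrite tuv// opprB; case: (leP (u i - v i)%R 0%R); case: (leP (v i - u i)%R 0%R); lra.
have aoo : \esum_(i in K) `|t i|%:E < +oo.
  apply: (@le_lt_trans _ _ (\esum_(i in K) ((u i)%:E + (v i)%:E))).
    apply: le_esum => i Ki; rewrite -EFinD lee_fin tuv// (le_trans (ler_normB _ _))//.
    by rewrite !ger0_norm.
  by rewrite esumD ?lte_add_pinfty// => i _; rewrite lee_fin.
have : \esum_(i in K) (Num.max (t i) 0 + v i)%:E = \esum_(i in K) (Num.max (- t i) 0 + u i)%:E.
  by apply: eq_esum => i Ki; rewrite e.
under eq_esum do rewrite EFinD; under [RHS]eq_esum do rewrite EFinD.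
rewrite !esumD; try by move=> i _; rewrite lee_fin ?(pos0 t) ?(pos0 (fun i => - t i)%R).
rewrite /usum.
have := fin_part u0 uoo; have := fin_part v0 voo.
have := fin_part (pos0 t) (pos_lty aoo).
have := fin_part (pos0 (fun i => - t i)%R) (neg_lty aoo).
by do 4 (move=> <-); rewrite -!EFinD => -[]; move=> h; lra.
Qed.

Lemma usum_abs_le t : `|usum K t|%:E <= \esum_(i in K) `|t i|%:E.
Proof.
have [->|aoo] := eqVneq (\esum_(i in K) `|t i|%:E) +oo; first by rewrite leey.
rewrite -ltey in aoo.
have p0 := fin_part (pos0 t) (pos_lty aoo).
have n0 := fin_part (pos0 (fun i => - t i)%R) (neg_lty aoo).
have h : \esum_(i in K) `|t i|%:E = \esum_(i in K) (Num.max (t i) 0)%:E +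
    \esum_(i in K) (Num.max (- t i) 0)%:E.
  rewrite -esumD; try by move=> i _; rewrite lee_fin ?(pos0 t) ?(pos0 (fun i => - t i)%R).
  apply: eq_esum => i _; rewrite -EFinD; congr EFin.
  exact: norm_maxE.
rewrite h -p0 -n0 -EFinD lee_fin /usum.
by rewrite (le_trans (ler_normB _ _))// !ger0_norm// fine_ge0// esum_ge0// => i _;
  rewrite lee_fin ?(pos0 t) ?(pos0 (fun i => - t i)%R).
Qed.

Lemma usum_dist_le t t' : \esum_(i in K) `|t i|%:E < +oo ->
  \esum_(i in K) `|t' i|%:E < +oo ->
  `|usum K t - usum K t'|%:E <= \esum_(i in K) `|t i - t' i|%:E.
Proof.
move=> aoo boo; apply: le_trans (usum_abs_le (fun i => t i - t' i)%R).
have lt2 := @lte_add_pinfty R.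
have p1 := fin_part (pos0 t) (pos_lty aoo).
have p2 := fin_part (pos0 (fun i => - t i)%R) (neg_lty aoo).
have p3 := fin_part (pos0 t') (pos_lty boo).
have p4 := fin_part (pos0 (fun i => - t' i)%R) (neg_lty boo).
have eD u v : (forall i, 0 <= u i)%R -> (forall i, 0 <= v i)%R ->
    \esum_(i in K) (u i + v i)%:E = \esum_(i in K) (u i)%:E + \esum_(i in K) (v i)%:E.
  move=> u0 v0; under eq_esum do rewrite EFinD.
  by apply: esumD => i _; rewrite lee_fin.
rewrite (@usum_split (fun i => t i - t' i)%R (fun i => Num.max (t i) 0 + Num.max (- t' i) 0)%R
    (fun i => Num.max (- t i) 0 + Num.max (t' i) 0)%R).
- rewrite !eD; try by move=> i; rewrite ?(pos0 t) ?(pos0 (fun i => - t i)%R) ?(pos0 t') ?(pos0 (fun i => - t' i)%R).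
  rewrite -p1 -p2 -p3 -p4 /= lee_fin /usum.
  set x := fine _; set y := fine _; set z := fine _; set w := fine _.
  by rewrite (_ : x + w - (y + z) = x - y - (z - w))%R//; ring.
- by move=> i _; case: (leP (t i) 0%R); case: (leP (- t i)%R 0%R); case: (leP (t' i) 0%R); case: (leP (- t' i)%R 0%R); lra.
- by move=> i; rewrite addr_ge0 ?(pos0 t) ?(pos0 (fun i => - t' i)%R).
- by move=> i; rewrite addr_ge0 ?(pos0 (fun i => - t i)%R) ?(pos0 t').
- rewrite eD; try by move=> i; rewrite ?(pos0 t) ?(pos0 (fun i => - t' i)%R).
  by apply: lt2; [exact: pos_lty|exact: neg_lty].
- rewrite eD; try by move=> i; rewrite ?(pos0 t') ?(pos0 (fun i => - t i)%R).
  by apply: lt2; [exact: neg_lty|exact: pos_lty].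
Qed.

Lemma usumZ c t : usum K (fun i => c * t i)%R = (c * usum K t)%R.
Proof.
have pZ e t' : (0 < e)%R -> fine (\esum_(i in K) (Num.max (e * t' i) 0)%:E) =
    (e * fine (\esum_(i in K) (Num.max (t' i) 0)%:E))%R.
  move=> e0; have -> : \esum_(i in K) (Num.max (e * t' i) 0)%:E =
      e%:E * \esum_(i in K) (Num.max (t' i) 0)%:E.
    rewrite -esumZl ?lee_fin ?(ltW e0)//; last by move=> i; rewrite lee_fin (pos0 t').
    by apply: eq_esum => i _; rewrite -EFinM maxr_pMr ?ltW// mulr0.
  (* [fine] sends infinite values to 0, so homogeneity also holds for divergent families. *)
  by case: (\esum_(i in K) _) => [r||] //=; rewrite ?gt0_muley ?gt0_muleNy ?lte_fin//= mulr0.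
have pos e t' : (0 < e)%R -> usum K (fun i => e * t' i)%R = (e * usum K t')%R.
  move=> e0; rewrite /usum mulrBr pZ//; congr (_ - _)%R.
  by rewrite -(pZ e (fun i => - t' i)%R)//; under eq_esum do rewrite -mulrN.
have [c0|c0|<-] := ltgtP 0%R c; first exact: pos.
  have -> : (fun i => c * t i)%R = (fun i => (- c) * (- t i))%R by apply/funext => i; rewrite mulrNN.
  rewrite pos ?oppr_gt0// mulNr -mulrN; congr (_ * _)%R.
  by rewrite /usum opprB; under [in X in (X - _)%R]eq_esum do rewrite opprK.
rewrite mul0r /usum !esum1 ?subr0// => i _; first by rewrite mul0r oppr0 maxxx.
by rewrite mul0r maxxx.
Qed.

End unordered_sums.

Local Close Scope ereal_scope.

(** * Geometry of the dyadic system *)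

Section volume.
Context (R : realType) (disp : measure_display) (X : measurableType disp).
Variable H : homog_space R X.
Local Notation d := (qdist H).
Local Notation mu := (hmu H).
Local Notation A0 := (A0 H).
Local Notation om := (omega H).

Lemma A0_gt0 : 0 < A0. Proof. exact: lt_le_trans (A0_ge1 H). Qed.

Lemma mu_qball (x : X) (r : R) : 0 < r -> mu (qball H x r) = (Vr H r x)%:E.
Proof.
move=> r0; rewrite /Vr fineK// ge0_fin_numE//.
by have /andP[] := qball_mu_bounds H x r0.
Qed.

Lemma Vr_gt0 (x : X) (r : R) : 0 < r -> 0 < Vr H r x.
Proof.
by move=> r0; have /andP[] := qball_mu_bounds H x r0; rewrite mu_qball.
Qed.

Lemma Vr_ge0 (x : X) (r : R) : 0 <= Vr H r x.
Proof. by rewrite fine_ge0. Qed.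

Lemma qball_lty x r : 0 < r -> (mu (qball H x r) < +oo)%E.
Proof. by move=> r0; have /andP[] := qball_mu_bounds H x r0. Qed.

Lemma le_Vr (x y : X) (r s : R) : 0 < s -> qball H x r `<=` qball H y s ->
  Vr H r x <= Vr H s y.
Proof.
move=> s0 rs; have [r0|r0] := ltP 0 r.
  rewrite -lee_fin -!mu_qball//; apply: le_measure => //; rewrite inE; exact: qball_measurable.
rewrite (_ : Vr H r x = 0) ?Vr_ge0// /Vr.
rewrite (_ : qball H x r = set0) ?measure0// -subset0 => z /=.
by apply/negP; rewrite -leNgt (le_trans r0)// qdist_ge0.
Qed.

Lemma omega_ge0 : 0 <= om.
Proof. by rewrite divr_ge0// ln_ge0// ?Cmu_ge1// ler1n. Qed.

Lemma Cmu_gt0 : 0 < Cmu H. Proof. exact: lt_le_trans (Cmu_ge1 H). Qed.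

Lemma two_omega : 2 `^ om = Cmu H.
Proof.
rewrite /powR (gt_eqF (ltr0n _ 2)) /omega divfK ?lnK// ?posrE ?Cmu_gt0//.
by rewrite gt_eqF// ln_gt0// ltr1n.
Qed.

Lemma Vr_doubling_iter n (x : X) (r : R) : 0 < r ->
  Vr H (2 ^+ n * r) x <= Cmu H ^+ n * Vr H r x.
Proof.
move=> r0; elim: n => [|n IH]; first by rewrite !expr0 !mul1r.
have p0 : 0 < 2 ^+ n * r by rewrite mulr_gt0// exprn_gt0.
rewrite !exprS -!mulrA; apply: le_trans (ler_wpM2l (ltW Cmu_gt0) IH).
by rewrite -lee_fin EFinM -!mu_qball ?mulr_gt0//; exact: hmu_doubling.
Qed.

Lemma Vr_growth (x : X) (r lam : R) : 0 < r -> 1 <= lam ->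
  Vr H (lam * r) x <= Cmu H * lam `^ om * Vr H r x.
Proof.
move=> r0 lam1; have lam0 : 0 < lam by exact: lt_le_trans lam1.
have C1 := Cmu_ge1 H.
have ex : exists n, lam <= 2 ^+ n.
  have [n hn] : exists n : nat, lam <= n%:R.
    by exists (Num.truncn lam).+1; exact/ltW/truncnS_gt.
  exists n; apply: le_trans hn _; rewrite -natrX ler_nat; exact/ltnW/ltn_expl.
(* For the least [n], if positive, [2 ^ (n - 1) <= lam]; the [n] doublings then cost
   [Cmu * (2 ^ (n - 1)) ^ om], at most [Cmu * lam ^ om]. *)
case: (ex_minnP ex) => n hn nmin.
apply: (@le_trans _ _ (Vr H (2 ^+ n * r) x)).
  apply: le_Vr; first by rewrite mulr_gt0// exprn_gt0.
  by move=> z /= /lt_le_trans; apply; rewrite ler_wpM2r// ltW.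
apply: le_trans (Vr_doubling_iter n x r0) _.
apply: ler_wpM2r; first exact: Vr_ge0.
case: n hn nmin => [|n] hn nmin.
  rewrite expr0; apply: le_trans C1 _; rewrite ler_peMr ?(ltW Cmu_gt0)//.
  by rewrite -[leLHS](powRr0 lam) ler_powR// omega_ge0.
rewrite exprS; apply: ler_wpM2l; first exact: ltW Cmu_gt0.
have nlam : 2 ^+ n <= lam.
  by rewrite leNgt; apply/negP => /ltW/nmin; rewrite ltnn.
rewrite -two_omega -powR_exprn//; apply: ge0_ler_powR; rewrite ?nnegrE ?omega_ge0//.
  exact: ltW.
Qed.

Lemma Vr_cmp (x y : X) (r r' t : R) : 0 < r -> 0 < r' -> d x y <= t ->
  1 <= A0 * (t + r) / r' ->
  Vr H r x <= Cmu H * (A0 * (t + r) / r') `^ om * Vr H r' y.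
Proof.
move=> r0 r'0 dt one.
apply: le_trans (Vr_growth y r'0 one); rewrite divfK ?gt_eqF//.
have t0 : 0 <= t by apply: le_trans dt; exact: qdist_ge0.
apply: le_Vr; first by rewrite mulr_gt0 ?A0_gt0// ltr_wpDl.
move=> z /= xz; apply: le_lt_trans (qdist_triangle H y x z) _.
by rewrite ltr_pM2l ?A0_gt0// ler_ltD// (qdist_sym H).
Qed.

End volume.

Section scales.
Context (R : realType) (disp : measure_display) (X : measurableType disp).
Variables (H : homog_space R X) (D : dyadic_system H).
Local Notation d := (qdist H).
Local Notation mu := (hmu H).
Local Notation A0 := (A0 H).
Local Notation om := (omega H).
Local Notation del := (delta D).
Variable K : R.

Lemma del_gt0 : 0 < del. Proof. by have /andP[] := delta_bounds D. Qed.
Lemma del_neq0 : del != 0. Proof. by rewrite gt_eqF// del_gt0. Qed.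
Lemma delz_gt0 (k : int) : 0 < del ^ k.
Proof. by rewrite exprz_gt0// del_gt0. Qed.
Lemma del_ge0 : 0 <= del. Proof. exact/ltW/del_gt0. Qed.

(** Here the tenth power in the bound on [delta] is used: one level of scale absorbs the constants
    of several triangle inequalities. *)
Lemma A0_del (c : R) n : 0 <= c <= 2 ^+ 10 -> (n <= 10)%N -> c * A0 ^+ n * del <= 1.
Proof.
move=> /andP[c0 c1] n10; have /andP[_] := delta_bounds D => d1.
have A1 := A0_ge1 H; have A00 := A0_gt0 H.
have P0 : 0 < (2 * A0) ^+ 10 by rewrite exprn_gt0// mulr_gt0.
apply: (@le_trans _ _ ((2 * A0) ^+ 10 * del)); last first.
  by rewrite -[leRHS](mulfV (lt0r_neq0 P0)) ler_pM2l.
rewrite ler_pM2r ?del_gt0// exprMn ler_pM ?exprn_ge0 ?(ltW A00)//.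
exact: ler_weXn2l.
Qed.

Lemma del_lt1 : del < 1.
Proof.
have := @A0_del 2 0; rewrite expr0 mulr1 => h.
have : 2 * del <= 1 by apply: h => //; lra.
by move=> ?; have := del_gt0; lra.
Qed.

(* Radii are taken in the scale [K * del^k], with [K] so large that every cube of
   level [k] has diameter at most [rho k] and [Bk k x] lies in [B(x, rho k)]. *)
Definition rho (k : int) : R := K * del ^ k.

Hypothesis K1 : 1 <= K.
Hypothesis KC : 4 * A0 ^+ 2 * C0 D <= K.

Lemma K_gt0 : 0 < K. Proof. exact: lt_le_trans K1. Qed.

Lemma rho_gt0 k : 0 < rho k.
Proof. by rewrite mulr_gt0 ?K_gt0// exprz_gt0 ?del_gt0. Qed.

Lemma rho_ge0 k : 0 <= rho k. Proof. exact/ltW/rho_gt0. Qed.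

Lemma rhoS k : rho k = del * rho (k - 1).
Proof. by rewrite /rho mulrCA -{2}(expr1z del) -expfzDr ?del_neq0// addrC subrK. Qed.

Lemma rho_step (c : R) n k : 0 <= c <= 2 ^+ 10 -> (n <= 10)%N ->
  c * A0 ^+ n * rho k <= rho (k - 1).
Proof.
move=> c1 n10; rewrite rhoS mulrA -[leRHS]mul1r ler_pM2r ?rho_gt0//.
exact: A0_del.
Qed.

Lemma rho_shift k (n : nat) : rho (k - n%:Z) = del ^- n * rho k.
Proof. by rewrite /rho mulrCA exprnN -expfzDr ?del_neq0// addrC. Qed.

Lemma le_rho (k l : int) : k <= l -> rho l <= rho k.
Proof.
move=> kl; rewrite /rho ler_pM2l ?K_gt0//.
have -> : l = k + `|l - k|%N by lia.
rewrite expfzDr ?del_neq0// ler_piMr ?exprz_ge0 ?del_ge0//.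
by rewrite -exprnP exprn_ile1 ?del_ge0// ltW// del_lt1.
Qed.

(** Bounds the ratio of volumes of balls whose radii are [n] levels apart; the extra level in [n.+1]
    pays for moving the centre. *)
Definition Cvol : nat -> R := locked (fun n => Cmu H * (del ^- n.+1) `^ om).

Lemma CvolE n : Cvol n = Cmu H * (del ^- n.+1) `^ om.
Proof. by rewrite /Cvol -lock. Qed.

Lemma Cvol_gt0 n : 0 < Cvol n.
Proof. by rewrite CvolE mulr_gt0 ?Cmu_gt0// powR_gt0// invr_gt0 exprn_gt0// del_gt0. Qed.

Lemma Vr_rho (n : nat) m (x y : X) : d x y <= rho (m - n%:Z) ->
  Vr H (rho (m - n%:Z)) x <= Cvol n * Vr H (rho m) y.
Proof.
move=> dxy; set t := rho (m - n%:Z) in dxy *.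
have t0 : 0 < t by exact: rho_gt0.
have A1 := A0_ge1 H; have A00 := A0_gt0 H.
have tm : rho m <= t by apply: le_rho; lia.
apply: le_trans (Vr_cmp t0 (rho_gt0 m) dxy _) _.
  by rewrite ler_pdivlMr ?rho_gt0// mul1r (le_trans tm)// -[leLHS]mul1r ler_pM// ?(ltW t0)// lerDl ltW.
rewrite ler_wpM2r ?Vr_ge0// CvolE ler_wpM2l ?(ltW (Cmu_gt0 H))//.
apply: ge0_ler_powR; rewrite ?omega_ge0// ?nnegrE.
- by rewrite divr_ge0 ?rho_ge0// mulr_ge0 ?(ltW A00)// addr_ge0// ltW.
- by rewrite invr_ge0 exprn_ge0// del_ge0.
rewrite ler_pdivrMr ?rho_gt0// -rho_shift.
rewrite (_ : (m - n.+1%:Z) = (m - n%:Z) - 1); last by lia.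
apply: le_trans (@rho_step 2 1 _ _ _) => //; last by lra.
by rewrite -/t expr1; nra.
Qed.


Lemma idx_ex k x : {a | idx_at D k a & cube D k a x}.
Proof.
apply: cid2; have := cube_cover D k => /seteqP[_ /(_ x)/(_ I)] [a ka ax].
by exists a.
Qed.

Definition cidx k x : idx D := s2val (idx_ex k x).

Lemma cidx_at k x : idx_at D k (cidx k x).
Proof. exact: s2valP. Qed.

Lemma cidx_cube k x : cube D k (cidx k x) x.
Proof. by rewrite /cidx; case: (idx_ex k x). Qed.

Lemma cidx_eq k x a : idx_at D k a -> cube D k a x -> cidx k x = a.
Proof.
move=> ka ax; have := @cube_disjoint _ _ _ _ D k (cidx k x) a (cidx_at k x) ka.
by apply; exists x; split => //; exact: cidx_cube.
Qed.

Definition cen k x : X := center D k (cidx k x).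

Lemma C0_gt0 : 0 < C0 D.
Proof. by have /andP[c0 /(lt_le_trans c0)] := c0_C0 D. Qed.

Lemma cube_cen k a x : idx_at D k a -> cube D k a x ->
  d (center D k a) x < (2 * A0)^-1 * rho k.
Proof.
move=> ka ax; have [_ /(_ _ ax)/= h] := cube_balls ka.
apply: (lt_le_trans h); rewrite /rho mulrA; apply: ler_wpM2r; first exact/ltW/delz_gt0.
have A00 := A0_gt0 H; rewrite ler_pdivlMl ?mulr_gt0//; apply: le_trans KC.
by rewrite le_eqVlt; apply/orP; left; apply/eqP; ring.
Qed.

Lemma d_cen k x : d (cen k x) x < (2 * A0)^-1 * rho k.
Proof. by apply: cube_cen; [exact: cidx_at|exact: cidx_cube]. Qed.

Lemma d_cen_le k x : d (cen k x) x <= rho k.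
Proof.
apply: le_trans (ltW (d_cen k x)) _; rewrite ler_piMl ?rho_ge0//.
have A1 := A0_ge1 H; rewrite invf_le1; lra.
Qed.

Lemma cube_diam k a x y : idx_at D k a -> cube D k a x -> cube D k a y ->
  d x y <= rho k.
Proof.
move=> ka ax ay; apply: le_trans (qdist_triangle H x (center D k a) y) _.
have h1 := cube_cen ka ax; have h2 := cube_cen ka ay; have A00 := A0_gt0 H.
rewrite (qdist_sym H x) -ler_pdivlMl//; apply: le_trans (lerD (ltW h1) (ltW h2)) _.
by rewrite le_eqVlt; apply/orP; left; apply/eqP; field; rewrite gt_eqF.
Qed.

(** A cube of level [k] contains the ball of radius [kap * del ^ k] about its centre. *)
Definition kap : R := (3 * A0 ^+ 2)^-1 * c0 D.

Lemma kap_gt0 : 0 < kap.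
Proof.
rewrite mulr_gt0 ?invr_gt0//; last by have /andP[] := c0_C0 D.
by rewrite mulr_gt0// exprn_gt0// A0_gt0.
Qed.

Lemma kap_le_K : kap <= K.
Proof.
have A1 := A0_ge1 H; have /andP[c00 c0C] := c0_C0 D.
apply: le_trans KC; rewrite /kap ler_pdivrMl ?mulr_gt0 ?exprn_gt0 ?A0_gt0//.
apply: (@le_trans _ _ (C0 D)) => //; have A2 : 1 <= A0 ^+ 2 by exact: exprn_ege1.
rewrite !mulrA ler_peMl ?(ltW C0_gt0)//; nra.
Qed.

Lemma cube_mu k a : idx_at D k a ->
  mu (cube D k a) = (fine (mu (cube D k a)))%:E.
Proof.
move=> ka; rewrite fineK// ge0_fin_numE//.
have [_ s] := cube_balls ka; have A00 := A0_gt0 H.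
apply: le_lt_trans (qball_lty H (center D k a) (_ : 0 < 2 * A0 * C0 D * del ^ k)).
  apply: le_measure => //; rewrite inE; first exact: cube_measurable.
  by apply: qball_measurable; rewrite !mulr_gt0 ?C0_gt0 ?delz_gt0.
by rewrite !mulr_gt0 ?C0_gt0 ?delz_gt0.
Qed.

Definition Ccell : R := Cmu H * (A0 * (K + K) / kap) `^ om.

Lemma Ccell_gt0 : 0 < Ccell.
Proof.
have A00 := A0_gt0 H; have k0 := K_gt0; have kk := kap_gt0.
by rewrite mulr_gt0 ?Cmu_gt0// powR_gt0// !mulr_gt0 ?invr_gt0 ?addr_gt0.
Qed.

Lemma Vr_cube k a x : idx_at D k a -> cube D k a x ->
  Vr H (rho k) x <= Ccell * fine (mu (cube D k a)).
Proof.
move=> ka ax; have A00 := A0_gt0 H; have A1 := A0_ge1 H; have kk := kap_gt0.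
have d0 := delz_gt0 k; have K0 := K_gt0; have kK := kap_le_K.
have kd0 : 0 < kap * del ^ k by rewrite mulr_gt0.
have dc : d x (center D k a) <= rho k.
  rewrite (qdist_sym H); apply: le_trans (ltW (cube_cen ka ax)) _.
  by rewrite ler_piMl ?rho_ge0// invf_le1; lra.
have -> : Ccell = Cmu H * (A0 * (rho k + rho k) / (kap * del ^ k)) `^ om.
  congr (_ * _ `^ _); rewrite /rho; field.
  by rewrite !gt_eqF.
apply: le_trans (Vr_cmp (rho_gt0 k) kd0 dc _) _.
  rewrite ler_pdivlMr// mul1r /rho -mulrDl mulrA ler_pM2r//; nra.
rewrite ler_wpM2l//; first by rewrite mulr_ge0 ?powR_ge0// ltW// Cmu_gt0.
rewrite -lee_fin -mu_qball// -cube_mu//; have [s _] := cube_balls ka.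
apply: le_measure => //; rewrite inE; [exact: qball_measurable|exact: cube_measurable].
Qed.

Lemma cube_mu_gt0 k a : idx_at D k a -> 0 < fine (mu (cube D k a)).
Proof.
move=> ka; have [s _] := cube_balls ka; have kd0 : 0 < kap * del ^ k by rewrite mulr_gt0 ?kap_gt0 ?delz_gt0.
have ax : cube D k a (center D k a) by apply: s; rewrite /qball/= (qdist_eq0 H _ _).2.
have := Vr_cube ka ax; rewrite -(pmulr_rgt0 _ Ccell_gt0); apply: lt_le_trans.
exact/Vr_gt0/rho_gt0.
Qed.


(** By doubling, the cubes centred in a fixed ball have measure bounded below by a fixed fraction of
    a larger ball that contains them all. Being disjoint, they are finitely many; the balls of
    integer radius exhaust the space. *)
Lemma idx_at_countable k : countable (idx_at D k).
Proof.
have [->|/set0P[a1 ka1]] := eqVneq (idx_at D k) set0; first exact: countable0.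
pose x1 := center D k a1.
pose S (n : nat) := [set a | idx_at D k a /\ d (center D k a) x1 <= n%:R].
rewrite (_ : idx_at D k = \bigcup_n S n); last first.
  apply/seteqP; split => [a ka|a [n _ [//]]].
  exists (Num.truncn (d (center D k a) x1)).+1 => //; split=> //.
  exact/ltW/truncnS_gt.
apply: bigcup_countable => // n _; apply: finite_set_countable.
apply: contrapT => /infinite_set_fsetP hinf.
have A00 := A0_gt0 H; have r0 := rho_gt0 k.
pose t := rho k + n%:R; have t0 : 0 < t by rewrite ltr_pwDl.
have tt0 : 0 < A0 * (t + t) by rewrite mulr_gt0// addr_gt0.
pose M := Cmu H * (A0 * (t + t) / rho k) `^ om.
have M0 : 0 < M by rewrite mulr_gt0 ?Cmu_gt0// powR_gt0// divr_gt0.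
have A1 := A0_ge1 H.
have low a : S n a -> Vr H t x1 <= M * Ccell * fine (mu (cube D k a)).
  move=> [ka dn]; have [s _] := cube_balls ka.
  have ax : cube D k a (center D k a).
    by apply: s; rewrite /qball/= (qdist_eq0 H _ _).2// mulr_gt0 ?kap_gt0 ?delz_gt0.
  rewrite -mulrA; apply: le_trans (ler_wpM2l (ltW M0) (Vr_cube ka ax)).
  apply: (Vr_cmp t0 r0 (t := t)).
    by rewrite (qdist_sym H) (le_trans dn)// lerDr ltW.
  have rt : rho k <= t by rewrite lerDl.
  rewrite ler_pdivlMr// mul1r; nra.
(* More than the number of disjoint cubes of measure [Vr H t x1 / (M * Ccell)] for which the large
   ball has room. *)
pose N := (Num.truncn (Vr H (A0 * (t + t)) x1 * (M * Ccell) / Vr H t x1)).+1.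
have [F FS FN] := hinf N.
have V0 : 0 < Vr H t x1 by exact: Vr_gt0.
have MC0 : 0 < M * Ccell by rewrite mulr_gt0// Ccell_gt0.
have sub : \bigcup_(a in [set` F]) cube D k a `<=` qball H x1 (A0 * (t + t)).
  move=> y [a /FS[ka dn] ay]; rewrite /qball/=.
  apply: le_lt_trans (qdist_triangle H _ (center D k a) _) _.
  rewrite ltr_pM2l// ler_ltD//.
    by rewrite (qdist_sym H) (le_trans dn)// lerDr ltW.
  apply: lt_le_trans (cube_cen ka ay) _; apply: (@le_trans _ _ (rho k)); last by rewrite lerDl.
  by rewrite ler_piMl ?rho_ge0// invf_le1; lra.
have mF a : [set` F] a -> measurable (cube D k a) by move=> /FS[ka _]; exact: cube_measurable.
have : (mu (\bigcup_(a in [set` F]) cube D k a) <= (Vr H (A0 * (t + t)) x1)%:E)%E.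
  rewrite -mu_qball//; apply: le_measure => //; rewrite inE; last exact: qball_measurable.
  by apply: fin_bigcup_measurable => //; exact: finite_fset.
rewrite measure_fin_bigcup//; last first.
  by move=> a b /FS[ka _] /FS[kb _]; exact: (@cube_disjoint _ _ _ _ D k).
rewrite fsbig_finite//= set_fsetK.
have : ((#|` F|%:R * (Vr H t x1 / (M * Ccell)))%:E <= \sum_(i <- F) mu (cube D k i))%E.
  rewrite [leRHS](eq_big_seq (fun a => (fine (mu (cube D k a)))%:E)); last first.
    by move=> a /FS[ka _]; exact: cube_mu.
  rewrite sumEFin lee_fin mulr_natl.
  have -> : (Vr H t x1 / (M * Ccell)) *+ #|` F| = \sum_(i <- F) (Vr H t x1 / (M * Ccell)).
    by rewrite big_const_seq iter_addr_0 count_predT.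
  rewrite big_seq [leRHS]big_seq; apply: ler_sum => a aF; rewrite ler_pdivrMr// mulrC; apply: low.
  exact: FS.
move=> /le_trans h1 /h1; rewrite lee_fin mulrA ler_pdivrMr// -ler_pdivlMr//.
apply/negP; rewrite -ltNge; apply: lt_le_trans (truncnS_gt _) _.
by rewrite ler_nat.
Qed.

(** The preimage of any set is a countable union of cubes. This is the source of nearly all
    measurability below. *)
Lemma measurable_cidx k d' (T : measurableType d') (Phi : idx D -> T) :
  measurable_fun setT (fun x => Phi (cidx k x)).
Proof.
move=> _ Y mY; rewrite setTI.
rewrite (_ : _ @^-1` Y = \bigcup_(a in idx_at D k `&` [set a | Y (Phi a)]) cube D k a).
  apply: countable_bigcup_measurable.
    by apply: sub_countable (idx_at_countable k); apply: subset_card_le; exact: subIsetl.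
  by move=> a [ka _]; exact: cube_measurable.
apply/seteqP; split => [x /= Yx|x [a [ka /= Ya] ax]] /=.
  by exists (cidx k x); [split => //; exact: cidx_at|exact: cidx_cube].
by rewrite (cidx_eq ka ax).
Qed.

Lemma esum_cell k x (g : idx D -> \bar R) : (forall a, 0 <= g a)%E ->
  (\esum_(a in idx_at D k) (if x \in cube D k a then g a else 0) = g (cidx k x))%E.
Proof.
move=> g0; rewrite (esumID [set cidx k x]); last by move=> a _; case: ifP.
rewrite (_ : _ `&` [set cidx k x] = [set cidx k x]); last first.
  by apply/seteqP; split => [a []//|a ->]; split => //; exact: cidx_at.
rewrite esum_set1; last by case: ifP.
rewrite mem_set; last exact: cidx_cube.
rewrite esum1 ?adde0// => a [ka /= acx]; case: ifPn => // /[!inE] ax.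
by exfalso; apply: acx; rewrite (cidx_eq ka ax).
Qed.

Lemma integral_cells k (g : X -> \bar R) : measurable_fun setT g ->
  (forall x, 0 <= g x)%E ->
  (\int[mu]_x g x = \esum_(a in idx_at D k) \int[mu]_(x in cube D k a) g x)%E.
Proof.
move=> mg g0.
transitivity (\int[mu]_x \esum_(a in idx_at D k) (g \_ (cube D k a)) x)%E.
  by apply: eq_integral => x _; rewrite -(@esum_cell k x (fun=> g x)).
rewrite integral_esum//.
- by apply: eq_esum => a ka; rewrite [RHS]integral_mkcond.
- exact: idx_at_countable.
- by move=> a x; rewrite /patch; case: ifP.
- move=> a ka; apply/(measurable_restrictT _ _).1; first exact: cube_measurable.
  exact: measurable_funTS.
Qed.


Local Open Scope ereal_scope.

(** One level of scale pays for one quasi-triangle inequality. The integer shifts of levels in the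
    sequel count such uses. *)
Lemma rho_lev (i j k : int) x y z : (k < i)%R -> (k < j)%R ->
  (d x y <= rho i)%R -> (d y z <= rho j)%R -> (d x z < rho k)%R.
Proof.
move=> ki kj xy yz; have A1 := A0_ge1 H; have A00 := A0_gt0 H.
have r0 := rho_gt0 (k + 1).
have hi : (rho i <= rho (k + 1))%R by apply: le_rho; lia.
have hj : (rho j <= rho (k + 1))%R by apply: le_rho; lia.
have := @rho_step 3 1 (k + 1)%R _ isT; rewrite addrK expr1 => h.
apply: (@lt_le_trans _ _ (3 * A0 * rho (k + 1))%R); last by apply: h; lra.
apply: le_lt_trans (qdist_triangle H x y z) _.
rewrite (mulrC 3%R) -mulrA ltr_pM2l//; lra.
Qed.

(** * Averaging operators and their vector-valued inequality *)

(* The balls are centred at cube centres, so that averages over them take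
   countably many values and are measurable whatever the quasi-metric is. *)
Definition Bs m x : set X := qball H (cen m x) (rho (m - 1)).
Definition Vs m x : R := Vr H (rho (m - 1)) (cen m x).
Definition avr_def m (h : X -> \bar R) (x : X) : \bar R :=
  ((Vs m x)^-1)%:E * \int[mu]_(y in Bs m x) h y.
Definition avr := locked avr_def.

Lemma avrE m h x : avr m h x = ((Vs m x)^-1)%:E * \int[mu]_(y in Bs m x) h y.
Proof. by rewrite /avr -lock. Qed.

Lemma Vs_gt0 m x : (0 < Vs m x)%R. Proof. exact/Vr_gt0/rho_gt0. Qed.

Lemma mu_Bs m x : mu (Bs m x) = (Vs m x)%:E.
Proof. exact/mu_qball/rho_gt0. Qed.

Lemma measurable_Bs m x : measurable (Bs m x).
Proof. exact/qball_measurable/rho_gt0. Qed.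

Lemma Bs_d m x y : Bs m x y -> (d x y < rho (m - 2))%R.
Proof.
move=> xy; apply: (@rho_lev m (m - 1)) (ltW xy); try lia.
by rewrite (qdist_sym H) d_cen_le.
Qed.

Lemma d_Bs m k x y : (m <= k)%R -> (d x y <= rho k)%R -> Bs m x y.
Proof. by move=> mk xy; apply: (@rho_lev m k) (d_cen_le _ _) xy; lia. Qed.

Lemma avr_ge0 m h x : (forall y, 0 <= h y) -> 0 <= avr m h x.
Proof.
by move=> h0; rewrite avrE mule_ge0 ?integral_ge0// lee_fin invr_ge0 ltW// Vs_gt0.
Qed.

Lemma measurable_avr m h : measurable_fun setT (avr m h).
Proof.
pose Phi (a : idx D) := ((Vr H (rho (m - 1)) (center D m a))^-1)%:E *
  \int[mu]_(y in qball H (center D m a) (rho (m - 1))) h y.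
rewrite (_ : avr m h = Phi \o cidx m); first exact: (@measurable_cidx m _ _ Phi).
by apply/funext => x; rewrite avrE.
Qed.

Lemma le_avr m h g x : (forall y, 0 <= h y) -> (forall y, h y <= g y) ->
  avr m h x <= avr m g x.
Proof.
move=> h0 hg; rewrite !avrE; apply: lee_wpmul2l; first by rewrite lee_fin invr_ge0 ltW// Vs_gt0.
by apply: ge0_le_integral_nomeas => y _.
Qed.

Lemma avr_cst m (c : R) x : avr m (fun=> c%:E) x = c%:E.
Proof.
rewrite avrE integral_cst ?mu_Bs; last exact: measurable_Bs.
by rewrite -!EFinM mulrCA mulVf ?mulr1// gt_eqF// Vs_gt0.
Qed.

Lemma avrZ m (c : R) h x : (0 <= c)%R -> (forall y, 0 <= h y) ->
  measurable_fun setT h -> avr m (fun y => c%:E * h y) x = c%:E * avr m h x.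
Proof.
move=> c0 h0 mh; rewrite !avrE ge0_integralZl ?lee_fin//.
- by rewrite muleCA.
- exact: measurable_Bs.
- exact: measurable_funTS.
Qed.

Lemma avrD m h g x : (forall y, 0 <= h y) -> (forall y, 0 <= g y) ->
  measurable_fun setT h -> measurable_fun setT g ->
  avr m (fun y => h y + g y) x = avr m h x + avr m g x.
Proof.
move=> h0 g0 mh mg; rewrite !avrE ge0_integralD//.
- by rewrite ge0_muleDr// integral_ge0.
- exact: measurable_Bs.
- exact: measurable_funTS.
- exact: measurable_funTS.
Qed.

Lemma avr_esum (U : choiceType) (I : set U) m (h : U -> X -> \bar R) x : countable I ->
  (forall u y, 0 <= h u y) -> (forall u, I u -> measurable_fun setT (h u)) ->
  avr m (fun y => \esum_(u in I) h u y) x = \esum_(u in I) avr m (h u) x.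
Proof.
move=> cI h0 mh; rewrite avrE integral_esum//.
- rewrite -esumZl ?lee_fin ?invr_ge0 ?(ltW (Vs_gt0 _ _))//; last by move=> u; rewrite integral_ge0.
  by apply: eq_esum => u _; rewrite avrE.
- exact: measurable_Bs.
- by move=> u Iu; apply: measurable_funTS; exact: mh.
Qed.

Lemma avr_jensen m h P x : (1 <= P)%R -> (forall y, 0 <= h y) ->
  measurable_fun setT h -> (avr m h x) `^ P <= avr m (fun y => h y `^ P) x.
Proof.
move=> P1 h0 mh; rewrite !avrE; apply: jensen_poweR => //.
- exact: measurable_Bs.
- exact: mu_Bs.
- exact: Vs_gt0.
- exact: measurable_funTS.
Qed.

Lemma avr_dom (n : int) (c : R) B (V : R) h x : measurable B -> (forall y, 0 <= h y) ->
  measurable_fun setT h -> B `<=` Bs n x -> (0 < V)%R -> (Vs n x <= c * V)%R ->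
  V^-1%:E * \int[mu]_(y in B) h y <= c%:E * avr n h x.
Proof.
move=> mB h0 mh sB V0 Vc; have Vn := Vs_gt0 n x.
rewrite avrE muleA -EFinM; apply: lee_pmul.
- by rewrite lee_fin invr_ge0 ltW.
- by rewrite integral_ge0.
- by rewrite lee_fin ler_pdivlMr// mulrC ler_pdivrMr.
- apply: ge0_subset_integral => //; first exact: measurable_Bs.
  exact: measurable_funTS.
Qed.

Definition CA : R := locked (Cvol 3).
Lemma CAE : CA = Cvol 3. Proof. by rewrite /CA -lock. Qed.
Lemma CA_gt0 : (0 < CA)%R. Proof. rewrite CAE; exact: Cvol_gt0. Qed.
Lemma CA_ge0 : (0 <= CA)%R. Proof. exact/ltW/CA_gt0. Qed.

(** [Bs m y] lies in [Bs (m - 3) x] and the volumes are comparable. In this sense an average at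
    level [m] is nearly constant at distances of that scale. *)
Lemma avr_shift m h x y : (forall y, 0 <= h y) -> measurable_fun setT h ->
  (d x y <= rho (m - 2))%R -> avr m h y <= CA%:E * avr (m - 3) h x.
Proof.
move=> h0 mh xy; rewrite [avr m h y]avrE; apply: avr_dom => //.
- exact: measurable_Bs.
- move=> z /Bs_d/ltW yz; apply: (@d_Bs _ (m - 3)%R); first lia.
  by apply/ltW/(rho_lev _ _ xy yz); lia.
- exact: Vs_gt0.
- rewrite /Vs CAE (_ : m - 3 - 1 = (m - 1) - 3%:Z)%R; last by lia.
  apply: Vr_rho; apply/ltW.
  have xc : (d (cen (m - 3) x) x <= rho (m - 3))%R by exact: d_cen_le.
  have yc : (d y (cen m y) <= rho m)%R by rewrite (qdist_sym H) d_cen_le.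
  apply: (rho_lev _ _ xc (ltW (rho_lev (k := m - 3) _ _ xy yc))); lia.
Qed.

Lemma avr_shift0 m h x : (forall y, 0 <= h y) -> measurable_fun setT h ->
  avr m h x <= CA%:E * avr (m - 3) h x.
Proof.
by move=> h0 mh; apply: avr_shift => //; rewrite (qdist_eq0 H _ _).2// rho_ge0.
Qed.

Lemma avr_shift6 m h x y : (forall y, 0 <= h y) -> measurable_fun setT h ->
  (d x y <= rho (m - 5))%R -> avr m h y <= (CA ^+ 2)%:E * avr (m - 6) h x.
Proof.
move=> h0 mh xy; apply: (le_trans (avr_shift0 m y h0 mh)).
rewrite (_ : (CA ^+ 2)%:E = CA%:E * CA%:E) -?EFinM ?expr2// EFinM -muleA; apply: lee_wpmul2l; first by rewrite lee_fin CA_ge0.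
rewrite (_ : m - 6 = m - 3 - 3)%R; last by lia.
by apply: avr_shift => //; rewrite (_ : m - 3 - 2 = m - 5)%R//; lia.
Qed.

(** The kernel of the averaging operator is symmetric up to a constant and three levels. Since
    [avr m h] is constant on the cubes of level [m], the double integral is a sum over cubes, and
    only a countable sum is exchanged with an integral. *)
Lemma avr_adj m h phi : (forall y, 0 <= h y) -> (forall y, 0 <= phi y) ->
  measurable_fun setT h -> measurable_fun setT phi ->
  \int[mu]_x (phi x * avr m h x) <= CA%:E * \int[mu]_x (h x * avr (m - 3) phi x).
Proof.
move=> h0 p0 mh mp.
pose B a := qball H (center D m a) (rho (m - 1)).
pose V a := Vr H (rho (m - 1)) (center D m a).
have V0 a : (0 < V a)%R by exact/Vr_gt0/rho_gt0.
have V0' a : 0 <= (V a)^-1%:E by rewrite lee_fin invr_ge0 ltW.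
pose J a := \int[mu]_(y in cube D m a) phi y.
have J0 a : 0 <= J a by exact: integral_ge0.
pose I a := \int[mu]_(y in B a) h y.
have I0 a : 0 <= I a by exact: integral_ge0.
have mB a : measurable (B a) by exact/qball_measurable/rho_gt0.
rewrite (integral_cells m); last 2 first.
- by apply: emeasurable_funM => //; exact: measurable_avr.
- by move=> x; rewrite mule_ge0// avr_ge0.
rewrite (eq_esum (b := fun a => ((V a)^-1%:E * J a) * I a)); last first.
  move=> a ma; transitivity (\int[mu]_(x in cube D m a) (phi x * ((V a)^-1%:E * I a))).
    by apply: eq_integral => x /[!inE] ax; rewrite avrE /Vs /Bs /cen (cidx_eq ma ax).
  rewrite ge0_integralZr//.
  - by rewrite -/(J a) muleCA muleA.
  - exact: cube_measurable.
  - exact: measurable_funTS.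
  - by rewrite mule_ge0.
(* The inner integral over the ball is written over the whole space, so that the sum over the cubes
   can pass under it. *)
pose g a y := ((V a)^-1%:E * J a) * (h \_ (B a)) y.
have g0 a y : 0 <= g a y by rewrite /g mule_ge0 ?mule_ge0// /patch; case: ifP.
have mg a : measurable_fun setT (g a).
  apply: measurable_funeM; apply/(measurable_restrictT _ _).1; first exact: mB.
  exact: measurable_funTS.
rewrite (eq_esum (b := fun a => \int[mu]_y g a y)); last first.
  move=> a ma; rewrite ge0_integralZl//; last 3 first.
  - apply/(measurable_restrictT _ _).1; first exact: mB.
    exact: measurable_funTS.
  - by move=> x _; rewrite /patch; case: ifP.
  - by rewrite mule_ge0.
  by rewrite -integral_mkcond.
rewrite -integral_esum//; last exact: idx_at_countable.
rewrite -ge0_integralZl ?lee_fin ?CA_ge0//; last 2 first.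
- by apply: emeasurable_funM => //; exact: measurable_avr.
- by move=> x _; rewrite mule_ge0// avr_ge0.
apply: ge0_le_integral_nomeas => [y _|y _]; first exact: esum_ge0.
apply: (@le_trans _ _ (\esum_(a in idx_at D m) (h y * ((CA / Vs (m - 3) y)%:E *
    \int[mu]_(x in Bs (m - 3) y) (phi \_ (cube D m a)) x)))).
  apply: le_esum => a ma; rewrite /g /patch; case: ifPn => [|_]; last first.
    rewrite mule0 mule_ge0// mule_ge0 ?integral_ge0//.
      by rewrite lee_fin divr_ge0 ?CA_ge0// ltW// Vs_gt0.
    by move=> x _; case: ifP.
  rewrite inE => ya; rewrite muleC; apply: lee_wpmul2l => //.
  have ya1 : (d y (center D m a) <= rho (m - 1))%R by rewrite (qdist_sym H) ltW.
  apply: lee_pmul => //.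
    rewrite lee_fin ler_pdivlMr ?Vs_gt0// mulrC ler_pdivrMr//.
    rewrite /Vs CAE (_ : m - 3 - 1 = (m - 1) - 3%:Z)%R; last by lia.
    apply: Vr_rho; apply/ltW.
    by apply: (rho_lev _ _ (d_cen_le _ _) ya1); lia.
  rewrite [leRHS](_ : _ = \int[mu]_(x in Bs (m - 3) y) (phi \_ (cube D m a)) x)//.
  rewrite -integral_mkcondr.
  rewrite (_ : _ `&` _ = cube D m a)//; apply/seteqP; split=> [x []//|x ax]; split => //.
  apply: (@d_Bs _ (m - 2)%R); first lia.
  apply/ltW; apply: (rho_lev _ _ ya1 (_ : _ <= rho m)%R); try lia.
  apply: le_trans (ltW (cube_cen ma ax)) _; rewrite ler_piMl ?rho_ge0// invf_le1//.
    by have := A0_ge1 H; lra.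
  by have := A0_gt0 H; lra.
have c0 a x : 0 <= (phi \_ (cube D m a)) x by rewrite /patch; case: ifP.
have C0' : 0 <= (CA / Vs (m - 3) y)%:E.
  by rewrite lee_fin divr_ge0 ?CA_ge0// ltW// Vs_gt0.
rewrite esumZl//; last by move=> a; rewrite mule_ge0// integral_ge0.
rewrite esumZl//; last by move=> a; rewrite integral_ge0.
rewrite -integral_esum//; last 3 first.
- exact: idx_at_countable.
- exact: measurable_Bs.
- move=> a ma; apply: measurable_funTS; apply/(measurable_restrictT _ _).1.
    exact: cube_measurable.
  exact: measurable_funTS.
rewrite (eq_integral phi); last first.
  by move=> x _; rewrite (@esum_cell m x (fun=> phi x)).
by rewrite [leRHS]muleCA; apply: lee_wpmul2l => //; rewrite avrE muleA -EFinM.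
Qed.

Lemma integral_avr m h : (forall y, 0 <= h y) -> measurable_fun setT h ->
  \int[mu]_x avr m h x <= CA%:E * \int[mu]_x h x.
Proof.
move=> h0 mh; have := @avr_adj m h (fun=> 1%:E) h0 (fun=> lee01) mh (measurable_cst _).
under eq_integral do rewrite mul1e.
by under [X in _ <= _ * X -> _]eq_integral do rewrite avr_cst mule1.
Qed.



(** Separates the volume loss of [n] levels, which the decay of the kernels has to beat, from a
    fixed constant. *)
Lemma Vr_rho_exp (i n : nat) : Cvol (i + n) = ((del ^- n) `^ om * Cvol i)%R.
Proof.
rewrite !CvolE mulrCA; congr (_ * _)%R; rewrite -powRM ?invr_ge0 ?exprn_ge0 ?del_ge0//.
by rewrite -invfM -exprD addnS addnC.
Qed.

(* For functions that are constant on the cubes of a finer level, Jensen's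
   inequality for concave powers can be reversed. *)
Lemma avr_reverse (r : R) : (0 < r <= 1)%R -> exists2 C : R, (0 <= C)%R &
  forall m (i : nat) (Phi : idx D -> R), (forall a, 0 <= Phi a)%R -> forall x,
  (avr m (fun y => (Phi (cidx (m + i%:Z) y))%:E) x) `^ r <=
  (C * ((del ^- i) `^ om) `^ (1 - r))%:E *
     avr (m - 3) (fun y => (Phi (cidx (m + i%:Z) y) `^ r)%:E) x.
Proof.
move=> /andP[r0 r1]; have r01 : (0 < r <= 1)%R by rewrite r0.
pose E := (Ccell * Cvol 4)%R.
have E0 : (0 < E)%R by rewrite mulr_gt0 ?Ccell_gt0 ?Cvol_gt0.
exists (CA `^ r * E `^ (1 - r))%R; first by rewrite mulr_ge0 ?powR_ge0.
move=> m i Phi P0 x; set n := (m + i%:Z)%R; set G := ((del ^- i) `^ om)%R.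
have G0 : (0 < G)%R by rewrite powR_gt0// invr_gt0 exprn_gt0// del_gt0.
set V := Vs m x; set V' := Vs (m - 3) x.
have V0 : (0 < V)%R by exact: Vs_gt0.
have V'0 : (0 < V')%R by exact: Vs_gt0.
have VV : (V' <= CA * V)%R.
  rewrite /V /V' /Vs CAE (_ : m - 3 - 1 = (m - 1) - 3%:Z)%R; last by lia.
  by apply: Vr_rho; apply/ltW; apply: (rho_lev _ _ (d_cen_le _ _) (_ : _ <= rho m)%R);
    rewrite ?(qdist_sym H x) ?d_cen_le//; lia.
have mPhi g : measurable_fun setT (fun y : X => (g (cidx n y))%:E : \bar R).
  by exact: (@measurable_cidx n _ _ (fun a => (g a)%:E)).
have mu0 a : idx_at D n a -> (0 < fine (mu (cube D n a)))%R by exact: cube_mu_gt0.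
(* The cubes of the finer level that meet the ball [Bs m x]; all of them lie in [Bs (m - 3) x]. *)
pose S a := cube D n a `&` Bs m x !=set0.
pose c a := if pselect (S a) then (Phi a * fine (mu (cube D n a)))%R else 0%R.
have c0 a : 0 <= (c a)%:E.
  by rewrite /c; case: pselect => //= _; rewrite lee_fin mulr_ge0// fine_ge0.
have mpatch (B : set X) (g : idx D -> R) : measurable B -> measurable_fun setT ((fun y : X => (g (cidx n y))%:E : \bar R) \_ B).
  by move=> mB; apply/(measurable_restrictT _ _).1 => //; exact: measurable_funTS.
have h1 : \int[mu]_(y in Bs m x) (Phi (cidx n y))%:E <= \esum_(a in idx_at D n) (c a)%:E.
  rewrite integral_mkcond (integral_cells n); last 2 first.
  - exact/mpatch/measurable_Bs.
  - by move=> y; rewrite /patch; case: ifP; rewrite ?lee_fin.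
  apply: le_esum => a na; rewrite /c; case: pselect => /= [Sa|nS]; last first.
    rewrite integral0_eq// => y ay; rewrite /patch; case: ifPn => // /[!inE] yB.
    by exfalso; apply: nS; exists y.
  rewrite EFinM -cube_mu// -integral_cst; last exact: cube_measurable.
  apply: ge0_le_integral_nomeas => y ay; rewrite /patch /cst; case: ifP; rewrite ?lee_fin//.
  by rewrite (cidx_eq na ay).
have h2 : \esum_(a in idx_at D n) (if pselect (S a) then (Phi a `^ r * fine (mu (cube D n a)))%R else 0%R)%:E
    <= \int[mu]_(y in Bs (m - 3) x) (Phi (cidx n y) `^ r)%:E.
  rewrite integral_mkcond (integral_cells n); last 2 first.
  - exact/(mpatch _ (fun a => Phi a `^ r)%R)/measurable_Bs.
  - by move=> y; rewrite /patch; case: ifP; rewrite ?lee_fin ?powR_ge0.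
  apply: le_esum => a na; case: pselect => /= [[z [az zB]]|_]; last first.
    by apply: integral_ge0 => y _; rewrite /patch; case: ifP; rewrite ?lee_fin ?powR_ge0.
  rewrite EFinM -cube_mu// -integral_cst; last exact: cube_measurable.
  rewrite le_eqVlt; apply/orP; left; apply/eqP; apply: eq_integral => y /[!inE] ay.
  rewrite /patch mem_set /=; first by rewrite (cidx_eq na ay).
  apply: (@d_Bs _ (m - 3)%R) => //; apply/ltW.
  have zy : (d z y <= rho (m - 2))%R.
    by apply: le_trans (cube_diam na az ay) _; apply: le_rho; rewrite /n; clear; lia.
  by apply: (rho_lev _ _ (ltW (Bs_d zB)) zy); clear; lia.
have S0 : 0 <= \esum_(a in idx_at D n) (c a)%:E by exact: esum_ge0.
apply: (@le_trans _ _ ((V^-1%:E * \esum_(a in idx_at D n) (c a)%:E) `^ r)).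
  apply: le_poweR; [exact: ltW|by apply: avr_ge0 => y; rewrite lee_fin|].
  by rewrite avrE; apply: lee_wpmul2l => //; rewrite lee_fin invr_ge0 ltW.
rewrite poweRM ?lee_fin ?invr_ge0 ?(ltW V0)//.
apply: (@le_trans _ _ (V^-1%:E `^ r * \esum_(a in idx_at D n) (c a)%:E `^ r)).
  by apply: lee_wpmul2l; [exact: poweR_ge0|exact: poweR_esum_le].
rewrite avrE muleA -EFinM.
apply: (@le_trans _ _ ((CA `^ r * E `^ (1 - r) * G `^ (1 - r) / V')%:E *
   \esum_(a in idx_at D n) (if pselect (S a) then (Phi a `^ r * fine (mu (cube D n a)))%R else 0%R)%:E)); last first.
  apply: lee_wpmul2l => //; rewrite lee_fin !mulr_ge0 ?powR_ge0 ?invr_ge0// ltW//.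
rewrite -!esumZl ?poweR_ge0//; last 3 first.
- by rewrite lee_fin !mulr_ge0 ?powR_ge0 ?invr_ge0// ltW.
- by move=> a; case: pselect => //= _; rewrite lee_fin mulr_ge0 ?powR_ge0 ?fine_ge0.
- by move=> a; rewrite poweR_ge0.
apply: le_esum => a na; rewrite /c; case: pselect => /= [[z [az zB]]|_]; last first.
  by rewrite powR0 ?gt_eqF// !mule0.
rewrite lee_fin; have := mu0 _ na; set M := fine _ => M0.
rewrite powRM ?(ltW M0)// mulrCA [leRHS]mulrCA; apply: ler_wpM2l; first exact: powR_ge0.
(* The loss is here: a cube [i] levels finer fills at least the fraction [1 / (E * G)] of the ball,
   so [M ^ r] is at most [M * (E * G / V') ^ (1 - r)]. *)
have V'M : (V' <= E * G * M)%R.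
  rewrite mulrAC /E mulrAC -mulrA.
  apply: (@le_trans _ _ (Cvol 4 * G * Vr H (rho n) z)%R); last first.
    rewrite (_ : (Ccell * Cvol 4 * (G * M) = Cvol 4 * G * (Ccell * M))%R); last by ring.
    by apply: ler_wpM2l; [rewrite mulr_ge0 ?(ltW G0) ?(ltW (Cvol_gt0 4))|exact: Vr_cube na az].
  rewrite (mulrC (Cvol 4)) -Vr_rho_exp /V' /Vs (_ : m - 3 - 1 = n - (4 + i)%N%:Z)%R; last by rewrite /n; clear; lia.
  apply: Vr_rho; rewrite (_ : n - (4 + i)%N%:Z = m - 4)%R; last by rewrite /n; clear; lia.
  have xz : (d x z <= rho (m - 3))%R by apply: le_trans (ltW (Bs_d zB)) _; apply: le_rho; clear; lia.
  by apply/ltW; apply: (rho_lev _ _ (d_cen_le _ _) xz); clear; lia.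
clearbody E.
have e1 : (V^-1 `^ r <= CA `^ r * V'^-1 `^ r)%R.
  rewrite -powRM ?invr_ge0 ?CA_ge0 ?(ltW V'0)//; apply: ge0_ler_powR.
  - exact: ltW.
  - by rewrite nnegrE invr_ge0 ltW.
  - by rewrite nnegrE divr_ge0 ?CA_ge0// ltW.
  - by rewrite ler_pdivlMr// mulrC ler_pdivrMr.
have e2 : (M `^ r <= E `^ (1 - r) * G `^ (1 - r) * V'^-1 `^ (1 - r) * M)%R.
  have -> : (M `^ r = M * M^-1 `^ (1 - r))%R.
    rewrite -(powR_inv1 (ltW M0)) -powRrM mulN1r opprB.
    by rewrite -{2}(powRr1 (ltW M0)) -powRD ?(gt_eqF M0) ?implybT// addrCA subrr addr0.
  rewrite mulrC; apply: ler_wpM2r; first exact: ltW.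
  rewrite -!powRM ?invr_ge0 ?(ltW E0) ?(ltW G0) ?(ltW V'0) ?mulr_ge0 ?(ltW E0) ?(ltW G0)//.
  apply: ge0_ler_powR; rewrite ?subr_ge0// ?nnegrE ?invr_ge0 ?(ltW M0)//.
    by rewrite divr_ge0 ?mulr_ge0 ?ltW.
  by rewrite ler_pdivlMr// mulrC ler_pdivrMr.
apply: (@le_trans _ _ (CA `^ r * V'^-1 `^ r * (E `^ (1 - r) * G `^ (1 - r) * V'^-1 `^ (1 - r) * M))%R).
  by apply: ler_pM => //; exact: powR_ge0.
rewrite (_ : (_ * _)%R = (CA `^ r * E `^ (1 - r) * G `^ (1 - r) * (V'^-1 `^ r * V'^-1 `^ (1 - r)) * M)%R); last by ring.
rewrite -powRD; last by rewrite invr_eq0 (gt_eqF V'0) implybT.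
by rewrite addrCA subrr addr0 powRr1 ?invr_ge0 ?(ltW V'0).
Qed.

(** The inner average lives at the coarser scale and is nearly constant on the balls of the outer
    one. *)
Lemma avr_avr_fine m k h x : (m <= k)%R -> (forall y, 0 <= h y) ->
  measurable_fun setT h -> avr k (avr m h) x <= CA%:E * avr (m - 3) h x.
Proof.
move=> mk h0 mh; rewrite [avr k _ _]avrE.
apply: (@le_trans _ _ ((Vs k x)^-1%:E * \int[mu]_(y in Bs k x) (CA%:E * avr (m - 3) h x))).
  apply: lee_wpmul2l; first by rewrite lee_fin invr_ge0 ltW// Vs_gt0.
  apply: ge0_le_integral_nomeas => y; first by move=> _; exact: avr_ge0.
  move=> /Bs_d/ltW xy; apply: avr_shift => //; apply: le_trans xy _; apply: le_rho; lia.
rewrite integral_cst ?mu_Bs; last exact: measurable_Bs.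
by rewrite muleCA -EFinM mulVf ?mule1// gt_eqF// Vs_gt0.
Qed.

(** The inner average lives at the finer scale: moved to the indicator of the outer ball by
    [avr_adj], it only enlarges the support of that indicator. *)
Lemma avr_avr_coarse m k h x : (k < m)%R -> (forall y, 0 <= h y) ->
  measurable_fun setT h ->
  avr k (avr m h) x <= (CA * Cvol 5)%:E * avr (k - 5) h x.
Proof.
move=> km h0 mh; have V0 := Vs_gt0 k x.
pose I y : \bar R := (\1_(Bs k x) y)%:E.
have I0 y : 0 <= I y by rewrite lee_fin.
have mI : measurable_fun setT I.
  by apply/measurable_EFinP; apply: measurable_indic; exact: measurable_Bs.
have mB := measurable_Bs (k - 5) x.
have V4 := Vs_gt0 (k - 5) x.
rewrite [avr k _ _]avrE integral_mkcond.
rewrite (eq_integral (fun y => I y * avr m h y)); last first.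
  by move=> y _; rewrite /patch /I indicE; case: ifP; rewrite ?mul1e ?mul0e.
apply: (@le_trans _ _ ((Vs k x)^-1%:E * (CA%:E * \int[mu]_(y in Bs (k - 5) x) h y))).
  apply: lee_wpmul2l; first by rewrite lee_fin invr_ge0 ltW.
  apply: le_trans (avr_adj _ h0 I0 mh mI) _.
  apply: lee_wpmul2l; first by rewrite lee_fin CA_ge0.
  rewrite [leRHS]integral_mkcond; apply: ge0_le_integral_nomeas => y _.
    by rewrite mule_ge0// avr_ge0.
  rewrite /patch; case: ifPn => [_|/negP yB].
    rewrite -[leRHS]mule1; apply: lee_wpmul2l => //.
    apply: (@le_trans _ _ (avr (m - 3) (fun=> 1%:E) y)); last by rewrite avr_cst.
    by apply: le_avr => // z; rewrite lee_fin indicE; case: (_ \in _).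
  rewrite avrE integral0_eq ?mule0// => z yz; rewrite /I indicE; case: (boolP (z \in _)) => // /[!inE] xz.
  exfalso; apply: yB; rewrite inE; apply: (@d_Bs _ (k - 5)%R) => //.
  have zy : (d z y <= rho (k - 4))%R.
    rewrite (qdist_sym H); apply: le_trans (ltW (Bs_d yz)) _; apply: le_rho; lia.
  by apply/ltW; apply: (rho_lev _ _ (ltW (Bs_d xz)) zy); lia.
rewrite muleCA [leRHS](_ : _ = CA%:E * ((Cvol 5)%:E * avr (k - 5) h x)); last first.
  by rewrite muleA -EFinM.
apply: lee_wpmul2l; first by rewrite lee_fin CA_ge0.
apply: avr_dom => //; rewrite /Vs (_ : k - 5 - 1 = (k - 1) - 5%:Z)%R; last by lia.
apply: Vr_rho; apply/ltW.
by apply: (rho_lev _ _ (d_cen_le _ _) (_ : _ <= rho k)%R);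
  rewrite ?(qdist_sym H x) ?d_cen_le//; lia.
Qed.


Lemma integral_sum_ge0 n (f : nat -> X -> \bar R) :
  (forall i x, 0 <= f i x) -> (forall i, measurable_fun setT (f i)) ->
  \int[mu]_x (\sum_(i < n) f i x) = \sum_(i < n) \int[mu]_x f i x.
Proof.
move=> f0 mf; under eq_integral do rewrite -(big_mkord xpredT (fun i => f i _)).
by rewrite ge0_integral_sum// big_mkord.
Qed.

Lemma measurable_sum_ge0 n (f : nat -> X -> \bar R) :
  (forall i, measurable_fun setT (f i)) ->
  measurable_fun setT (fun x => \sum_(i < n) f i x).
Proof. by move=> mf; apply: emeasurable_sum => i; exact: mf. Qed.

Lemma measurable_poweR_comp (f : X -> \bar R) (r : R) : measurable_fun setT f ->
  measurable_fun setT (fun x => f x `^ r).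
Proof. by move=> mf; apply: (measurableT_comp (measurable_poweR r)). Qed.

(** * The dual Doob inequality *)

Section dual_doob.
Variables (P : R) (n : nat) (h : nat -> X -> \bar R).
Hypotheses (P1 : (1 <= P)%R) (h0 : forall i x, 0 <= h i x)
  (mh : forall i, measurable_fun setT (h i)).
Let P0 : (0 < P)%R. Proof. exact: lt_le_trans P1. Qed.
Let Hint := \int[mu]_x (\sum_(i < n) h i x) `^ P.
Let W (m : int) x := \sum_(i < n) avr (m + i%:Z) (h i) x.
Let a0 m i x : 0 <= avr m (h i) x. Proof. exact: avr_ge0. Qed.
Let ma m i : measurable_fun setT (avr m (h i)). Proof. exact: measurable_avr. Qed.
Let W0 m x : 0 <= W m x. Proof. by apply: sume_ge0 => i _. Qed.
Let mW m : measurable_fun setT (W m).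
Proof. by apply: (@measurable_sum_ge0 _ (fun i => avr (m + i%:Z) (h i))). Qed.

(** Only the finiteness matters, together with the uniformity in [m]: the supremum over [m] in
    [dual_doob_aux] becomes finite. *)
Lemma dual_doob_crude (m : int) :
  \int[mu]_x (W m x) `^ P <= ((2 `^ P) ^+ n * CA * n%:R)%:E * Hint.
Proof.
have q0 : (0 <= (2 `^ P) ^+ n :> R)%R by rewrite exprn_ge0// powR_ge0.
apply: (@le_trans _ _ (\int[mu]_x (((2 `^ P) ^+ n)%:E * \sum_(i < n) avr (m + i%:Z) (h i) x `^ P))).
  apply: ge0_le_integral_nomeas => x _; first exact: poweR_ge0.
  exact: (@poweR_sum_max _ P (fun i => avr (m + i%:Z) (h i) x)).
have mp i : measurable_fun setT (fun x => avr (m + i%:Z) (h i) x `^ P).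
  exact: measurable_poweR_comp.
rewrite ge0_integralZl//; last 2 first.
- exact: (@measurable_sum_ge0 _ (fun i x => avr (m + i%:Z) (h i) x `^ P)).
- by move=> x _; apply: sume_ge0 => i _; exact: poweR_ge0.
rewrite (integral_sum_ge0 _ (f := fun i x => avr (m + i%:Z) (h i) x `^ P))//; last first.
  by move=> i x; exact: poweR_ge0.
rewrite -mulrA EFinM -muleA; apply: lee_wpmul2l; first by rewrite lee_fin.
rewrite EFinM muleC muleA [leRHS]muleC mule_natl.
rewrite (_ : (_ *+ n) = \sum_(i < n) (Hint * CA%:E)); last by rewrite sumr_const card_ord.
apply: lee_sum => i _.
apply: (@le_trans _ _ (\int[mu]_x avr (m + i%:Z) (fun y => h i y `^ P) x)).
  apply: ge0_le_integral_nomeas => x _; first exact: poweR_ge0.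
  exact: avr_jensen.
apply: le_trans (integral_avr _ _ _) _ => [y||]; [exact: poweR_ge0|exact: measurable_poweR_comp|].
rewrite muleC; apply: lee_wpmul2r; first by rewrite lee_fin CA_ge0.
apply: ge0_le_integral_nomeas => x _; first exact: poweR_ge0.
apply: le_poweR => //; first exact: ltW.
by rewrite (bigD1 i)//= leeDl// sume_ge0.
Qed.

Let C1 : R := (P * CA * (CA ^+ 2) `^ (P - 1))%R.
Let C10 : (0 < C1)%R.
Proof. by have c := CA_gt0; apply: mulr_gt0; [exact: mulr_gt0|exact/powR_gt0/exprn_gt0]. Qed.

(** Once an average has moved to the power of a partial sum, that sum must be compared at points up
    to [rho (m + i - 5)] apart. This takes two shifts of three levels, whence [m - 6] on the
    right. *)
Lemma dual_doob_step (m : int) (e : R) : (0 < e)%R ->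
  \int[mu]_x (W m x) `^ P <=
  (C1 * e `^ (1 - P))%:E * Hint + (C1 * e)%:E * \int[mu]_x (W (m - 6)%R x) `^ P.
Proof.
move=> e0; have e1 : (0 <= e `^ (1 - P))%R by exact: powR_ge0.
pose B i x := \sum_(j < i.+1) avr (m + j%:Z) (h j) x.
have B0 i x : 0 <= B i x by apply: sume_ge0.
have mB i : measurable_fun setT (B i).
  exact: (@measurable_sum_ge0 _ (fun j => avr (m + j%:Z) (h j))).
have mBp i : measurable_fun setT (fun x => B i x `^ (P - 1)) by exact: measurable_poweR_comp.
have mWp k : measurable_fun setT (fun x => W k x `^ P) by exact: measurable_poweR_comp.
have mWp1 k : measurable_fun setT (fun x => W k x `^ (P - 1)) by exact: measurable_poweR_comp.
have ms : measurable_fun setT (fun x => \sum_(i < n) h i x) by exact: measurable_sum_ge0.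
apply: (@le_trans _ _ (\int[mu]_x (P%:E * \sum_(i < n) avr (m + i%:Z) (h i) x * B i x `^ (P - 1)))).
  apply: ge0_le_integral_nomeas => x _; first exact: poweR_ge0.
  exact: (@poweR_telescope _ P (fun i => avr (m + i%:Z) (h i) x)).
have f0 i x : 0 <= avr (m + i%:Z) (h i) x * B i x `^ (P - 1) by rewrite mule_ge0 ?poweR_ge0.
have mf i : measurable_fun setT (fun x => avr (m + i%:Z) (h i) x * B i x `^ (P - 1)).
  exact: emeasurable_funM.
rewrite ge0_integralZl ?lee_fin ?(ltW P0)//; last 2 first.
- exact: (@measurable_sum_ge0 _ (fun i x => avr (m + i%:Z) (h i) x * B i x `^ (P - 1))).
- by move=> x _; apply: sume_ge0.
rewrite (integral_sum_ge0 _ (f := fun i x => avr (m + i%:Z) (h i) x * B i x `^ (P - 1)))//.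
have key i : (i < n)%N -> \int[mu]_x (avr (m + i%:Z) (h i) x * B i x `^ (P - 1)) <=
    (CA * (CA ^+ 2) `^ (P - 1))%:E * \int[mu]_x (h i x * W (m - 6)%R x `^ (P - 1)).
  move=> ni; under eq_integral do rewrite muleC.
  apply: le_trans (avr_adj _ _ _ _ _) _ => //; first by move=> y; exact: poweR_ge0.
  rewrite EFinM -muleA; apply: lee_wpmul2l; first by rewrite lee_fin CA_ge0.
  rewrite -ge0_integralZl ?lee_fin ?powR_ge0//; last 2 first.
  - exact: emeasurable_funM.
  - by move=> x _; rewrite mule_ge0 ?poweR_ge0.
  apply: ge0_le_integral_nomeas => x _.
    by rewrite mule_ge0// avr_ge0// => y; exact: poweR_ge0.
  rewrite muleCA; apply: lee_wpmul2l => //.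
  (* The terms [j <= i] of [B i] are averages at scales no finer than that of the ball in which [y]
     varies; the terms [j > i] of [W] are dropped. *)
  have BW y : Bs (m + i%:Z - 3) x y -> B i y <= (CA ^+ 2)%:E * W (m - 6)%R x.
    move=> /Bs_d/ltW xy; rewrite /W ge0_sume_distrr; last by [].
    rewrite [leRHS](_ : _ = \sum_(0 <= j < n) (CA ^+ 2)%:E * avr (m - 6 + j%:Z) (h j) x); last first.
      by rewrite big_mkord.
    rewrite (@big_cat_nat _ _ _ i.+1)//= /B -(big_mkord xpredT (fun j => avr (m + j%:Z) (h j) y)).
    rewrite -[leLHS]adde0; apply: leeD; last first.
      by apply: sume_ge0 => j _; rewrite mule_ge0// lee_fin exprn_ge0// CA_ge0.
    rewrite big_nat_cond [leRHS]big_nat_cond; apply: lee_sum => j /andP[/andP[_ ji] _].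
    rewrite (_ : m - 6 + j%:Z = m + j%:Z - 6)%R; last by clear; lia.
    apply: avr_shift6 => //; apply: le_trans xy _; apply: le_rho.
    by clear -ji; lia.
  rewrite avrE.
  apply: (@le_trans _ _ ((Vs (m + i%:Z - 3) x)^-1%:E * \int[mu]_(y in Bs (m + i%:Z - 3) x)
     ((CA ^+ 2)%:E * W (m - 6)%R x) `^ (P - 1))).
    apply: lee_wpmul2l; first by rewrite lee_fin invr_ge0 ltW// Vs_gt0.
    apply: ge0_le_integral_nomeas => y yB; first exact: poweR_ge0.
    by apply: le_poweR; rewrite ?subr_ge0//; exact: BW.
  rewrite integral_cst ?mu_Bs; last exact: measurable_Bs.
  rewrite muleCA -EFinM mulVf ?mule1; last by rewrite gt_eqF// Vs_gt0.
  by rewrite poweRM ?lee_fin ?exprn_ge0 ?CA_ge0.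
apply: (@le_trans _ _ (P%:E * \sum_(i < n) ((CA * (CA ^+ 2) `^ (P - 1))%:E *
    \int[mu]_x (h i x * W (m - 6)%R x `^ (P - 1))))).
  apply: lee_wpmul2l; first by rewrite lee_fin ltW.
  by apply: lee_sum => i _; exact: key.
have g0 i x : 0 <= h i x * W (m - 6)%R x `^ (P - 1) by rewrite mule_ge0 ?poweR_ge0.
rewrite -ge0_sume_distrr; last by move=> i _; exact: integral_ge0.
rewrite -(integral_sum_ge0 n (f := fun i x => h i x * W (m - 6)%R x `^ (P - 1)))//; last first.
  by move=> i; exact: emeasurable_funM.
rewrite muleA -EFinM mulrA -/C1.
apply: (@le_trans _ _ (C1%:E * \int[mu]_x ((e `^ (1 - P))%:E * (\sum_(i < n) h i x) `^ P
    + e%:E * W (m - 6)%R x `^ P))).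
  apply: lee_wpmul2l; first by rewrite lee_fin ltW.
  apply: ge0_le_integral_nomeas => x _; first exact: sume_ge0.
  rewrite -ge0_sume_distrl; last by [].
  by apply: mule_poweR_eps => //; exact: sume_ge0.
have msp : measurable_fun setT (fun x => (\sum_(i < n) h i x) `^ P) by exact: measurable_poweR_comp.
rewrite ge0_integralD//; last 4 first.
- by move=> x _; rewrite mule_ge0 ?poweR_ge0// lee_fin.
- exact: measurable_funeM.
- by move=> x _; rewrite mule_ge0 ?poweR_ge0// lee_fin ltW.
- exact: measurable_funeM.
rewrite !ge0_integralZl ?lee_fin ?(ltW e0)//; last 2 first.
- by move=> x _; exact: poweR_ge0.
- by move=> x _; exact: poweR_ge0.
rewrite ge0_muleDr ?mule_ge0 ?lee_fin ?(ltW e0) ?integral_ge0//; last 2 first.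
- by move=> x _; exact: poweR_ge0.
- by move=> x _; exact: poweR_ge0.
by rewrite !muleA -!EFinM.
Qed.

(** The step bounds level [m] by level [m - 6], so no single level can be absorbed; the supremum
    over all levels can. The choice [e = (2 * C1)^-1] leaves it with the factor 1/2. *)
Lemma dual_doob_aux (m : int) :
  \int[mu]_x (W m x) `^ P <= (2 * C1 * (2 * C1)^-1 `^ (1 - P))%:E * Hint.
Proof.
pose S := ereal_sup (range (fun k => \int[mu]_x (W k x) `^ P)).
have Hint0 : 0 <= Hint by apply: integral_ge0 => x _; exact: poweR_ge0.
have e0 : (0 < (2 * C1)^-1)%R by rewrite invr_gt0; apply: mulr_gt0.
have le_S k : \int[mu]_x (W k x) `^ P <= S by apply: ereal_sup_ubound; exists k.
apply: le_trans (le_S m) _.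
have S0 : 0 <= S.
  by apply: le_trans (le_S m); apply: integral_ge0 => x _; exact: poweR_ge0.
have [Hoo|Hfin] := eqVneq Hint +oo.
  by rewrite Hoo gt0_muley ?leey// lte_fin; apply: mulr_gt0; [exact: mulr_gt0|exact: powR_gt0].
have Hf : Hint \is a fin_num by rewrite ge0_fin_numE// ltey.
have Sf : S \is a fin_num.
  rewrite ge0_fin_numE//; apply: (@le_lt_trans _ _ (((2 `^ P) ^+ n * CA * n%:R)%:E * Hint)).
    by apply: ge_ereal_sup => _ [k _ <-]; exact: dual_doob_crude.
  by rewrite -(fineK Hf) -EFinM ltry.
have : S <= (C1 * (2 * C1)^-1 `^ (1 - P))%:E * Hint + 2^-1%:E * S.
  apply: ge_ereal_sup => _ [k _ <-].
  apply: le_trans (dual_doob_step k e0) _; apply: leeD => //.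
  have -> : (C1 * (2 * C1)^-1 = 2^-1)%R by field; rewrite gt_eqF.
  by apply: lee_wpmul2l; rewrite ?lee_fin ?invr_ge0.
rewrite -(fineK Hf) -(fineK Sf) -!EFinM -EFinD !lee_fin -!mulrA.
move: (_ * fine Hint)%R => u; set v := (C1 * u)%R; lra.
Qed.

End dual_doob.

(* The dual Doob inequality: with [B_i] the partial sums, the coarser terms of
   [B_i] are nearly constant at the scale of its last term, so that the adjoint
   of the averaging operator can be moved through [B_i `^ (P - 1)]. *)
Lemma dual_doob (P : R) : (1 <= P)%R -> exists2 C : R, (0 < C)%R &
  forall n (h : nat -> X -> \bar R) (m : int), (forall i x, 0 <= h i x) ->
  (forall i, measurable_fun setT (h i)) ->
  \int[mu]_x (\sum_(i < n) avr (m + i%:Z) (h i) x) `^ P <=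
  C%:E * \int[mu]_x (\sum_(i < n) h i x) `^ P.
Proof.
move=> P1; have P0 : (0 < P)%R by exact: lt_le_trans P1.
eexists; last by move=> n h m h0 mh; exact: dual_doob_aux.
have c0 : (0 < P * CA * (CA ^+ 2) `^ (P - 1))%R.
  by have c := CA_gt0; apply: mulr_gt0; [exact: mulr_gt0|exact/powR_gt0/exprn_gt0].
apply: mulr_gt0; first exact: mulr_gt0.
by apply: powR_gt0; rewrite invr_gt0; exact: mulr_gt0.
Qed.


(** By Jensen's inequality the [q]-th power of an average is at most the average of the [q]-th
    power; what remains is the dual Doob inequality with exponent [P / q], at least 1 in this
    case. *)
Lemma avr_vector_le (q P : R) : (1 <= q)%R -> (q <= P)%R -> exists2 C : R, (0 < C)%R &
  forall (h : nat -> X -> \bar R) (m : int), (forall i x, 0 <= h i x) ->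
  (forall i, measurable_fun setT (h i)) ->
  \int[mu]_x (lq q%:E [set: nat] (fun i => avr (m + i%:Z) (h i) x)) `^ P <=
  C%:E * \int[mu]_x (lq q%:E [set: nat] (fun i => h i x)) `^ P.
Proof.
move=> q1 qP; have q0 : (0 < q)%R by exact: lt_le_trans q1.
have P0 : (0 < P)%R by exact: lt_le_trans qP.
have Pq : (0 < q^-1 * P)%R by rewrite mulr_gt0// invr_gt0.
have [|C C0 HC] := @dual_doob (q^-1 * P); first by rewrite ler_pdivlMl// mulr1.
exists C => // h m h0 mh.
pose g i x := h i x `^ q.
have g0 i x : 0 <= g i x by exact: poweR_ge0.
have mg i : measurable_fun setT (g i) by exact: measurable_poweR_comp.
apply: (@le_trans _ _ (\int[mu]_x (\esum_(i in [set: nat]) avr (m + i%:Z) (g i) x) `^ (q^-1 * P))).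
  apply: ge0_le_integral_nomeas => x _; first exact: poweR_ge0.
  rewrite /lq -poweRrM; apply: le_poweR; first exact: ltW.
    by apply: esum_ge0 => i _; exact: poweR_ge0.
  by apply: le_esum => i _; exact: avr_jensen.
have a0 i x : 0 <= avr (m + i%:Z) (g i) x by exact: avr_ge0.
apply: (@integral_sup_le _ _ _ _
  (fun n x => (\sum_(i < n) avr (m + i%:Z) (g i) x) `^ (q^-1 * P))).
- move=> n; apply: measurable_poweR_comp.
  by apply: (@measurable_sum_ge0 _ (fun i => avr (m + i%:Z) (g i))) => i; exact: measurable_avr.
- by move=> n x; exact: poweR_ge0.
- move=> x k n kn; apply: le_poweR; [exact: ltW|exact: sume_ge0|].
  rewrite -!(big_mkord xpredT (fun i => avr (m + i%:Z) (g i) x)).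
  by rewrite [leRHS](@big_cat_nat _ _ _ k)//= leeDl// sume_ge0.
- by move=> x; exact: poweR_ge0.
- move=> x B aB; apply: poweR_esum_nat_le => //.
  by apply: le_trans (aB 0%N); exact: poweR_ge0.
- move=> n; apply: le_trans (HC n g m g0 mg) _.
  apply: lee_wpmul2l; first by rewrite lee_fin ltW.
  apply: ge0_le_integral_nomeas => x _; first exact: poweR_ge0.
  rewrite /lq -poweRrM; apply: le_poweR; [exact: ltW|exact: sume_ge0|].
  exact: (@sum_ord_le_esum _ (fun i => g i x)).
Qed.

(* For [P <= q] one argues by duality: [phi] is the normalizing function of the
   left-hand side, and the averaging operators move to [phi] by [avr_adj]. *)
Lemma vector_dual (P q' : R) : (1 < P)%R -> (1 <= q')%R -> (q' <= P / (P - 1))%R ->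
  exists2 C : R, (0 < C)%R &
  forall n (h phi : nat -> X -> \bar R) (N G : X -> \bar R) (m : int),
  (forall i x, 0 <= h i x) -> (forall i, measurable_fun setT (h i)) ->
  (forall i x, 0 <= phi i x) -> (forall i, measurable_fun setT (phi i)) ->
  (forall x, 0 <= G x) -> measurable_fun setT G ->
  (forall x, N x `^ P <= \sum_(i < n) avr (m + i%:Z) (h i) x * phi i x) ->
  (forall x, (\sum_(i < n) phi i x `^ q') `^ q'^-1 <= N x `^ (P - 1)) ->
  (forall x (psi : nat -> \bar R), (forall i, 0 <= psi i) -> \sum_(i < n) h i x * psi i <=
      2%:E * (G x * (\sum_(i < n) psi i `^ q') `^ q'^-1)) ->
  \int[mu]_x N x `^ P < +oo ->
  \int[mu]_x N x `^ P <= C%:E * \int[mu]_x G x `^ P.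
Proof.
move=> P1 q1 qP; have q0 : (0 < q')%R by exact: lt_le_trans q1.
have P0 : (0 < P)%R by exact: lt_trans P1.
have P10 : (0 < P - 1)%R by rewrite subr_gt0.
(* The ratio of the dual exponent of [P] to [q']: the dual Doob inequality is applied with this
   exponent to the averages of [phi i ^ q']. *)
pose t := (q'^-1 * (P / (P - 1)))%R.
have t1 : (1 <= t)%R by rewrite ler_pdivlMl// mulr1.
have t0 : (0 < t)%R by exact: lt_le_trans t1.
have [C C0 HC] := dual_doob t1.
have CA0 := CA_gt0.
(* Chosen so that [CA * 2 * e * C] is 1/2, and the left-hand side can be absorbed. *)
pose e := ((4 * CA * C)^-1)%R.
have e0 : (0 < e)%R by rewrite invr_gt0 mulr_gt0// mulr_gt0.
exists (4 * CA * e `^ (1 - P))%R; first by rewrite mulr_gt0 ?powR_gt0// mulr_gt0.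
move=> n h phi N G m h0 mh p0 mp G0 mG Ha Hb Hc Nfin.
pose psi i := avr (m + i%:Z - 3) (phi i).
have psi0 i x : 0 <= psi i x by exact: avr_ge0.
have mpsi i : measurable_fun setT (psi i) by exact: measurable_avr.
have a0 i x : 0 <= avr (m + i%:Z) (h i) x by exact: avr_ge0.
pose S x := \sum_(i < n) psi i x `^ q'.
have S0 x : 0 <= S x by apply: sume_ge0 => i _; exact: poweR_ge0.
have mS : measurable_fun setT S.
  by apply: (@measurable_sum_ge0 _ (fun i x => psi i x `^ q')) => i; exact: measurable_poweR_comp.
have NI0 : 0 <= \int[mu]_x N x `^ P by apply: integral_ge0 => x _; exact: poweR_ge0.
have St : \int[mu]_x S x `^ t <= C%:E * \int[mu]_x N x `^ P.
  pose g i x := phi i x `^ q'.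
  have g0 i x : 0 <= g i x by exact: poweR_ge0.
  have mg i : measurable_fun setT (g i) by exact: measurable_poweR_comp.
  apply: (@le_trans _ _ (\int[mu]_x (\sum_(i < n) avr (m - 3 + i%:Z) (g i) x) `^ t)).
    apply: ge0_le_integral_nomeas => x _; first exact: poweR_ge0.
    apply: le_poweR => //; first exact: ltW.
    apply: lee_sum => i _; rewrite (_ : m - 3 + i%:Z = m + i%:Z - 3)%R; last by clear; lia.
    exact: avr_jensen.
  apply: le_trans (HC n g (m - 3)%R g0 mg) _.
  apply: lee_wpmul2l; first by rewrite lee_fin ltW.
  apply: ge0_le_integral_nomeas => x _; first exact: poweR_ge0.
  rewrite /t poweRrM; apply: (@le_trans _ _ ((N x `^ (P - 1)) `^ (P / (P - 1)))).
    apply: le_poweR; [by rewrite divr_ge0// ltW|exact: poweR_ge0|exact: Hb].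
  by rewrite -poweRrM mulrCA mulfV ?mulr1// gt_eqF.
have step : \int[mu]_x N x `^ P <= (CA * 2)%:E *
    ((e `^ (1 - P))%:E * \int[mu]_x G x `^ P + e%:E * \int[mu]_x S x `^ t).
  apply: (@le_trans _ _ (\int[mu]_x \sum_(i < n) avr (m + i%:Z) (h i) x * phi i x)).
    by apply: ge0_le_integral_nomeas => x _; [exact: poweR_ge0|exact: Ha].
  rewrite (integral_sum_ge0 _ (f := fun i x => avr (m + i%:Z) (h i) x * phi i x)); last 2 first.
  - by move=> i x; rewrite mule_ge0.
  - by move=> i; apply: emeasurable_funM => //; exact: measurable_avr.
  apply: (@le_trans _ _ (\sum_(i < n) CA%:E * \int[mu]_x (h i x * psi i x))).
    apply: lee_sum => i _; under eq_integral do rewrite muleC.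
    exact: avr_adj.
  rewrite -ge0_sume_distrr; last first.
    by move=> i _; apply: integral_ge0 => x _; rewrite mule_ge0.
  rewrite EFinM -muleA; apply: lee_wpmul2l; first by rewrite lee_fin ltW.
  rewrite -(integral_sum_ge0 _ (f := fun i x => h i x * psi i x)); last 2 first.
  - by move=> i x; rewrite mule_ge0.
  - by move=> i; exact: emeasurable_funM.
  apply: (@le_trans _ _ (\int[mu]_x (2%:E * ((e `^ (1 - P))%:E * G x `^ P + e%:E * S x `^ t)))).
    apply: ge0_le_integral_nomeas => x _.
      by apply: sume_ge0 => i _; rewrite mule_ge0.
    apply: le_trans (Hc x (psi^~ x) _) _ => //.
    apply: lee_wpmul2l => //; rewrite -/(S x).
    have -> : S x `^ q'^-1 = (S x `^ (q'^-1 / (P - 1))) `^ (P - 1).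
      by rewrite -poweRrM divfK// gt_eqF.
    have -> : S x `^ t = (S x `^ (q'^-1 / (P - 1))) `^ P.
      by rewrite -poweRrM /t; congr (_ `^ _); rewrite mulrA mulrAC.
    by apply: mule_poweR_eps => //; [exact: ltW|exact: poweR_ge0].
  have mG1 : measurable_fun setT (fun x => (e `^ (1 - P))%:E * G x `^ P).
    by apply: measurable_funeM; exact: measurable_poweR_comp.
  have mS1 : measurable_fun setT (fun x => e%:E * S x `^ t).
    by apply: measurable_funeM; exact: measurable_poweR_comp.
  rewrite ge0_integralZl//; last 2 first.
  - exact: emeasurable_funD.
  - by move=> x _; rewrite adde_ge0 ?mule_ge0 ?poweR_ge0 ?lee_fin ?powR_ge0 ?(ltW e0).
  rewrite ge0_integralD//; last 2 first.
  - by move=> x _; rewrite mule_ge0 ?poweR_ge0 ?lee_fin ?powR_ge0.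
  - by move=> x _; rewrite mule_ge0 ?poweR_ge0 ?lee_fin ?(ltW e0).
  rewrite !ge0_integralZl//; try by move=> x _; exact: poweR_ge0.
  - exact: measurable_poweR_comp.
  - by rewrite lee_fin ltW.
  - exact: measurable_poweR_comp.
  - by rewrite lee_fin powR_ge0.
set IN := \int[mu]_x N x `^ P in NI0 Nfin St step *; set IG := \int[mu]_x G x `^ P in step *.
have IG0 : 0 <= IG by apply: integral_ge0 => x _; exact: poweR_ge0.
have [IGoo|IGfin] := eqVneq IG +oo.
  rewrite IGoo gt0_muley ?leey// lte_fin mulr_gt0 ?powR_gt0// mulr_gt0//.
have Gf : IG \is a fin_num by rewrite ge0_fin_numE// ltey.
have Nf : IN \is a fin_num by rewrite ge0_fin_numE.
have : IN <= (CA * 2)%:E * ((e `^ (1 - P))%:E * IG + e%:E * (C%:E * IN)).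
  apply: (le_trans step); apply: lee_wpmul2l; first by rewrite lee_fin mulr_ge0// ltW.
  by apply: leeD => //; apply: lee_wpmul2l => //; rewrite lee_fin ltW.
rewrite -(fineK Gf) -(fineK Nf) -!EFinM !lee_fin => h1.
have : (CA * 2 * (e * (C * fine IN)) = 2^-1 * fine IN)%R.
  by rewrite /e; field; rewrite !gt_eqF.
move: h1; set u := (e * (C * _))%R; set v := (e `^ _)%R.
rewrite mulrDr => h1 h2; rewrite h2 in h1.
by move: h1; rewrite !mulrA; lra.
Qed.


Lemma mule_poweR_pred (x : \bar R) (q : R) : (1 < q)%R -> 0 <= x ->
  x * x `^ (q - 1) = x `^ q.
Proof.
move=> q1; have q10 : (q - 1 != 0)%R by rewrite gt_eqF// subr_gt0.
have q0 : (q != 0)%R by rewrite gt_eqF// (lt_trans _ q1).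
move: x => [x| |]// x0; last by rewrite !poweRyr// mulyy.
rewrite lee_fin in x0; have [->|xn0] := eqVneq x 0%R; first by rewrite !poweR0r// mul0e.
rewrite !poweR_EFin -EFinM -{1}(powRr1 x0) -powRD ?(negbTE xn0) ?implybT//.
by rewrite addrCA subrr addr0.
Qed.

Lemma measurable_infty (N : X -> \bar R) : measurable_fun setT N ->
  measurable_fun setT (fun x => +oo * (\1_(N @^-1` [set +oo%E]) x)%:E : \bar R).
Proof.
move=> mN; have mZ : measurable (N @^-1` [set +oo%E]).
  by rewrite -[_ @^-1` _]setTI; apply: mN => //; exact: emeasurable_set1.
apply: emeasurable_funM; first exact: measurable_cst.
by apply/measurable_EFinP; exact: measurable_indic.
Qed.

(** Supplies the finiteness hypothesis of [vector_dual], for truncated norms. *)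
Lemma avr_finite_sum_lty (P : R) n (h : nat -> X -> \bar R) (G : X -> \bar R) (m : int) :
  (1 <= P)%R -> (forall i x, 0 <= h i x) -> (forall i, measurable_fun setT (h i)) ->
  (forall i x, h i x <= G x) -> \int[mu]_x G x `^ P < +oo ->
  \int[mu]_x (\sum_(i < n) avr (m + i%:Z) (h i) x) `^ P < +oo.
Proof.
move=> P1 h0 mh hG Gfin; have P0 : (0 < P)%R by exact: lt_le_trans P1.
apply: le_lt_trans (@dual_doob_crude P n h P1 h0 mh m) _.
have G0 x : 0 <= G x by apply: le_trans (h0 0%N x) _; exact: hG.
suff : \int[mu]_x (\sum_(i < n) h i x) `^ P < +oo.
  move=> hf; have f : \int[mu]_x (\sum_(i < n) h i x) `^ P \is a fin_num.
    by rewrite ge0_fin_numE// integral_ge0// => x _; exact: poweR_ge0.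
  by rewrite -(fineK f) -EFinM ltry.
apply: (@le_lt_trans _ _ (\int[mu]_x ((((2 `^ P) ^+ n)%:E * \sum_(i < n) h i x `^ P)))).
  by apply: ge0_le_integral_nomeas => x _; [exact: poweR_ge0|exact: (@poweR_sum_max _ _ (h^~ x))].
rewrite ge0_integralZl//; last 2 first.
- by apply: (@measurable_sum_ge0 _ (fun i x => h i x `^ P)) => i; exact: measurable_poweR_comp.
- by move=> x _; apply: sume_ge0 => i _; exact: poweR_ge0.
rewrite (integral_sum_ge0 _ (f := fun i x => h i x `^ P)); last 2 first.
- by move=> i x; exact: poweR_ge0.
- by move=> i; exact: measurable_poweR_comp.
have Gf : \int[mu]_x G x `^ P \is a fin_num.
  by rewrite ge0_fin_numE// integral_ge0// => x _; exact: poweR_ge0.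
apply: (@le_lt_trans _ _ (((2 `^ P) ^+ n)%:E * \sum_(i < n) \int[mu]_x G x `^ P)).
  apply: lee_wpmul2l; first by rewrite lee_fin exprn_ge0// powR_ge0.
  apply: lee_sum => i _; apply: ge0_le_integral_nomeas => x _; first exact: poweR_ge0.
  by apply: le_poweR; [exact: ltW| |exact: hG].
by rewrite -(fineK Gf) sumEFin -EFinM ltry.
Qed.

Lemma avr_vector_ge (q P : R) : (1 < P)%R -> (P <= q)%R -> exists2 C : R, (0 < C)%R &
  forall (h : nat -> X -> \bar R) (m : int), (forall i x, 0 <= h i x) ->
  (forall i, measurable_fun setT (h i)) ->
  \int[mu]_x (lq q%:E [set: nat] (fun i => avr (m + i%:Z) (h i) x)) `^ P <=
  C%:E * \int[mu]_x (lq q%:E [set: nat] (fun i => h i x)) `^ P.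
Proof.
move=> P1 Pq; have P0 : (0 < P)%R by exact: lt_trans P1.
have q1 : (1 < q)%R by exact: lt_le_trans Pq.
have q0 : (0 < q)%R by exact: lt_trans q1.
have P10 : (0 < P - 1)%R by rewrite subr_gt0.
have q10 : (0 < q - 1)%R by rewrite subr_gt0.
have qP0 : (0 < q^-1 * P)%R by rewrite mulr_gt0 ?invr_gt0.
pose q' := (q / (q - 1))%R.
have q'0 : (0 < q')%R by rewrite divr_gt0.
have [||C C0 HC] := @vector_dual P q' P1.
- by rewrite ler_pdivlMr// mul1r gerBl.
- rewrite ler_pdivlMr// mulrAC ler_pdivrMr//; nra.
exists C => // h m h0 mh.
pose G x := lq q%:E [set: nat] (fun i => h i x).
have G0 x : 0 <= G x by exact: poweR_ge0.
have mG : measurable_fun setT G.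
  apply: measurable_poweR_comp; apply: measurable_esum => //; first exact: countableP.
  - by move=> i x; exact: poweR_ge0.
  - by move=> i _; exact: measurable_poweR_comp.
have hG i x : h i x <= G x by exact: (@lq_ge_term _ _ _ _ (fun i => h i x)).
have [Goo|Gfin] := eqVneq (\int[mu]_x G x `^ P) +oo.
  by rewrite [leRHS](_ : _ = +oo) ?leey// Goo gt0_muley// lte_fin.
have Glt : \int[mu]_x G x `^ P < +oo by rewrite ltey.
pose U i x := avr (m + i%:Z) (h i) x.
have U0 i x : 0 <= U i x by exact: avr_ge0.
have mU i : measurable_fun setT (U i) by exact: measurable_avr.
pose V n x := \sum_(i < n) U i x `^ q.
have V0 n x : 0 <= V n x by apply: sume_ge0 => i _; exact: poweR_ge0.
have mV n : measurable_fun setT (V n).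
  by apply: (@measurable_sum_ge0 _ (fun i x => U i x `^ q)) => i; exact: measurable_poweR_comp.
apply: (@integral_sup_le _ _ _ _ (fun n x => V n x `^ (q^-1 * P))).
- by move=> n; exact: measurable_poweR_comp.
- by move=> n x; exact: poweR_ge0.
- move=> x k n kn; apply: le_poweR => //; first exact: ltW.
  rewrite /V -!(big_mkord xpredT (fun i => U i x `^ q)).
  rewrite [leRHS](@big_cat_nat _ _ _ k)//= leeDl// sume_ge0// => i _; exact: poweR_ge0.
- by move=> x; exact: poweR_ge0.
- move=> x B aB; rewrite /lq -poweRrM; apply: (poweR_esum_nat_le (a := fun i => U i x `^ q)) => //.
  + by move=> i; exact: poweR_ge0.
  + by apply: le_trans (aB 0%N); exact: poweR_ge0.
move=> n; pose N x := V n x `^ q^-1.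
have N0 x : 0 <= N x by exact: poweR_ge0.
have mN : measurable_fun setT N by exact: measurable_poweR_comp.
have -> : \int[mu]_x V n x `^ (q^-1 * P) = \int[mu]_x N x `^ P.
  by apply: eq_integral => x _; rewrite /N -poweRrM.
(* The extremal function of the duality between the exponents [q] and [q'], scaled to pair with [U]
   to [N ^ P]. Where [N] is infinite [fine] returns 0, and the second summand restores the value
   [+oo]. *)
pose phi i x := U i x `^ (q - 1) * ((fine (N x)) `^ (P - q))%:E + +oo * (\1_(N @^-1` [set +oo%E]) x)%:E.
have p0 i x : 0 <= phi i x.
  rewrite adde_ge0 ?mule_ge0 ?poweR_ge0 ?lee_fin ?powR_ge0//.
have UN (i : 'I_n) x : U i x <= N x.
  rewrite /N -poweR_leP// /V (bigD1 i)//= leeDl// sume_ge0// => j _; exact: poweR_ge0.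
have finN x : N x != +oo -> exists n0 : R, [/\ N x = n0%:E, (0 <= n0)%R,
    V n x = (n0 `^ q)%:E & forall i, phi i x = U i x `^ (q - 1) * (n0 `^ (P - q))%:E].
  move=> Nfin; exists (fine (N x)).
  have Nf : N x \is a fin_num by rewrite ge0_fin_numE// ltey.
  split; first by rewrite fineK.
  - by rewrite fine_ge0.
  - by rewrite -poweR_EFin fineK// /N poweRVK// gt_eqF.
  - by move=> i; rewrite /phi indicE memNset ?mule0 ?adde0//=; exact/eqP.
apply: (HC n h phi N G m) => //.
- move=> i; apply: emeasurable_funD; last exact: measurable_infty.
  apply: emeasurable_funM; first exact: measurable_poweR_comp.
  apply/measurable_EFinP.
  apply: (measurableT_comp (measurable_powR (P - q))).
  by apply: (measurableT_comp (@fine_measurable R _ _)).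
- move=> x; have [Noo|Nfin] := eqVneq (N x) +oo.
    have [i Ui] : exists i : 'I_n, U i x != 0.
      apply/existsP; rewrite -[X in is_true X]negbK negb_exists; apply/negP => /forallP h2.
      have : N x = 0.
        rewrite /N /V big1 ?poweR0r ?invr_eq0 ?gt_eqF// => i _.
        by have := h2 i; rewrite negbK => /eqP ->; rewrite poweR0r// gt_eqF.
      by rewrite Noo.
    rewrite (bigD1 i)//= (_ : U i x * phi i x = +oo) -/(U i x).
      rewrite addye ?leey// gt_eqF// (lt_le_trans (ltNyr 0))// sume_ge0// => j _.
      by apply: mule_ge0; [exact: U0|exact: p0].
    rewrite /phi indicE mem_set//= mule1 addey; last first.
      by rewrite gt_eqF// (lt_le_trans (ltNyr 0))// mule_ge0 ?poweR_ge0// lee_fin powR_ge0.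
    by rewrite gt0_muley// lt_neqAle eq_sym Ui U0.
  have [n0 [nE n00 Vn phiE]] := finN x Nfin.
  under eq_bigr do rewrite -/(U _ x) phiE muleA mule_poweR_pred//.
  rewrite -ge0_sume_distrl; last by move=> i _; exact: poweR_ge0.
  rewrite -/(V n x) Vn nE poweR_EFin -EFinM lee_fin.
  have [->|nz] := eqVneq n0 0%R; first by rewrite [leLHS]powR0 ?gt_eqF// mulr_ge0 ?powR_ge0.
  by rewrite -powRD ?(negbTE nz) ?implybT// addrCA subrr addr0.
- move=> x; have [Noo|Nfin] := eqVneq (N x) +oo.
    by rewrite Noo [leRHS]poweRyr ?leey// gt_eqF.
  have [n0 [nE n00 Vn phiE]] := finN x Nfin.
  under eq_bigr do rewrite phiE poweRM ?poweR_ge0 ?lee_fin ?powR_ge0// -poweRrM [((q - 1) * q')%R]mulrC divfK ?gt_eqF// poweR_EFin.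
  rewrite -ge0_sume_distrl; last by move=> i _; exact: poweR_ge0.
  rewrite -/(V n x) Vn nE -EFinM !poweR_EFin lee_fin.
  rewrite powRM ?powR_ge0// -!powRrM mulfV ?gt_eqF// mulr1.
  have [->|nz] := eqVneq n0 0%R; first by rewrite [X in (X * _)%R]powR0 ?mul0r ?powR_ge0// gt_eqF// mulr_gt0// invr_gt0.
  rewrite -powRD ?(negbTE nz) ?implybT// le_eqVlt; apply/orP; left; apply/eqP.
  by congr (_ `^ _)%R; rewrite /q'; field; rewrite !gt_eqF.
- move=> x psi psi0; apply: le_trans (sum_hoelder n q1 (h0^~ x) psi0) _.
  apply: lee_wpmul2l => //; rewrite /q' invf_div; apply: lee_wpmul2r; first exact: poweR_ge0.
  apply: le_poweR; first by rewrite invr_ge0 ltW.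
    by apply: sume_ge0 => i _; exact: poweR_ge0.
  by apply: (@sum_ord_le_esum _ (fun i => h i x `^ q)) => i; exact: poweR_ge0.
- apply: (@le_lt_trans _ _ (\int[mu]_x (\sum_(i < n) U i x) `^ P)); last first.
    exact: (avr_finite_sum_lty _ _ (ltW P1) h0 mh hG).
  apply: ge0_le_integral_nomeas => x _; first exact: poweR_ge0.
  apply: le_poweR => //; first exact: ltW.
  rewrite /N /V; apply: le_trans (poweR_sum_le _ _ _) _.
  + by rewrite invr_gt0 q0 invf_le1// ltW.
  + by move=> i; exact: poweR_ge0.
  + by apply: lee_sum => i _; rewrite poweRK// gt_eqF.
Qed.


(** The dual exponent of [+oo] is 1: [phi] is concentrated on a single index at which the maximum is
    attained. *)
Lemma avr_vector_sup (P : R) : (1 < P)%R -> exists2 C : R, (0 < C)%R &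
  forall (h : nat -> X -> \bar R) (m : int), (forall i x, 0 <= h i x) ->
  (forall i, measurable_fun setT (h i)) ->
  \int[mu]_x (lq +oo [set: nat] (fun i => avr (m + i%:Z) (h i) x)) `^ P <=
  C%:E * \int[mu]_x (lq +oo [set: nat] (fun i => h i x)) `^ P.
Proof.
move=> P1; have P0 : (0 < P)%R by exact: lt_trans P1.
have P10 : (0 < P - 1)%R by rewrite subr_gt0.
have [||C C0 HC] := @vector_dual P 1 P1 => //.
  by rewrite ler_pdivlMr// mul1r gerBl.
exists C => // h m h0 mh.
pose G x := lq +oo [set: nat] (fun i => h i x).
have hG i x : h i x <= G x by exact: (@lq_ge_term _ _ _ _ (fun i => h i x)).
have G0 x : 0 <= G x by apply: le_trans (hG 0%N x).
have mG : measurable_fun setT G.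
  rewrite (_ : G = fun x => ereal_sup (range (h^~ x))); last by [].
  rewrite (_ : (fun x => _) = (fun x => ereal_sup [set h^~ x k | k in [set k | (0 <= k)%N]])).
    exact: (measurable_fun_esups mh 0%N).
  by apply/funext => x; congr (ereal_sup _); apply/seteqP; split=> y [k _ <-]; exists k.
have [Goo|Gfin] := eqVneq (\int[mu]_x G x `^ P) +oo.
  by rewrite [leRHS](_ : _ = +oo) ?leey// Goo gt0_muley// lte_fin.
have Glt : \int[mu]_x G x `^ P < +oo by rewrite ltey.
pose U i x := avr (m + i%:Z) (h i) x.
have U0 i x : 0 <= U i x by exact: avr_ge0.
have mU i : measurable_fun setT (U i) by exact: measurable_avr.
pose N n x := \big[maxe/0]_(i < n) U i x.
have N0 n x : 0 <= N n x by exact: bigmax_ge_id.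
have UN n i x : (i < n)%N -> U i x <= N n x.
  by move=> ni; exact: (@le_bigmax _ _ _ 0 (fun i : 'I_n => U i x) (Ordinal ni)).
have mN n : measurable_fun setT (N n).
  rewrite /N; elim: n U mU {U0 N N0 UN} => [|n IH] U mU.
    by under eq_fun do rewrite big_ord0; exact: measurable_cst.
  under eq_fun do rewrite big_ord_recl/=.
  by apply: measurable_maxe => //; exact: (IH (fun i => U i.+1)).
apply: (@integral_sup_le _ _ _ _ (fun n x => N n x `^ P)).
- by move=> n; exact: measurable_poweR_comp.
- by move=> n x; exact: poweR_ge0.
- move=> x k n kn; apply: le_poweR => //; first exact: ltW.
  by apply: (@maxe_sum_le _ _ (U^~ x)) => // i ik; apply: UN; exact: leq_trans kn.
- by move=> x; exact: poweR_ge0.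
- move=> x B aB; have B0 : 0 <= B by apply: le_trans (aB 0%N); exact: poweR_ge0.
  rewrite poweR_leP//; last by apply: lq_ge0 => // i; exact: (U0 i x).
  apply: ge_ereal_sup => _ [i _ <-].
  by apply: le_trans (UN i.+1 i x _) _ => //; rewrite -poweR_leP.
move=> n.
(* The set where [i] is the first index with the maximal value. Taking the first one makes these
   sets disjoint. *)
pose E i := \bigcap_(j in `I_n) [set x | U j x <= U i x] `&` \bigcap_(j in `I_i) [set x | U j x < U i x].
have mE i : measurable (E i).
  apply: measurableI; apply: bigcap_measurableType => j _.
    rewrite -[X in measurable X]setTI; exact: emeasurable_fun_le.
  rewrite -[X in measurable X]setTI; exact: emeasurable_fun_lt.
have E_uniq i j x : (i < n)%N -> (j < n)%N -> E i x -> E j x -> i = j.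
  move=> ni nj [Ei1 Ei2] [Ej1 Ej2]; case: (ltngtP i j) => // ij.
    by have := Ej2 i ij; rewrite /= ltNge (Ei1 j nj).
  by have := Ei2 j ij; rewrite /= ltNge (Ej1 i ni).
have E_ex x : (0 < n)%N -> exists2 i, (i < n)%N & E i x /\ N n x = U i x.
  move=> n0.
  have : exists i, (i < n)%N && (N n x <= U i x).
    have [i _ Ni] : exists2 i : 'I_n, true & N n x = U i x.
      have := @eq_bigmax _ _ _ 0 (Ordinal n0) (fun=> true) (fun i : 'I_n => U i x) isT.
      by move=> []// i _ Ni; exists i.
    by exists i; rewrite ltn_ord Ni lexx.
  move=> ex; case: (ex_minnP ex) => i /andP[ni Ni] imin.
  have NU : N n x = U i x by apply/eqP; rewrite eq_le Ni UN.
  exists i => //; split => //; split => j /= jn.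
    by rewrite -NU UN.
  rewrite ltNge; apply/negP => Uij.
  have : (i <= j)%N by apply: imin; rewrite (ltn_trans jn ni)/= NU.
  by rewrite leqNgt jn.
pose phi i x := (\1_(E i) x)%:E * N n x `^ (P - 1).
have phi0 i x : 0 <= phi i x by rewrite mule_ge0 ?poweR_ge0// lee_fin.
have phi1 (b : nat -> \bar R) i x : (i < n)%N -> E i x -> (forall j, 0 <= b j) ->
    \sum_(j < n) b j * phi j x = b i * N n x `^ (P - 1).
  move=> ni Ei b0; rewrite (bigD1 (Ordinal ni))//= big1 ?adde0.
    by rewrite /phi indicE mem_set//= mul1e.
  move=> j ji; rewrite /phi indicE memNset ?mul0e ?mule0// => Ej.
  by move/eqP: ji; apply; apply: val_inj => /=; exact: (E_uniq _ _ x (ltn_ord j) ni Ej Ei).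
apply: (HC n h phi (N n) G m) => //.
- move=> i; apply: emeasurable_funM; last exact: measurable_poweR_comp.
  by apply/measurable_EFinP; exact: measurable_indic.
- move=> x; case: (posnP n) => [n0|n0].
    by rewrite n0 /N !big_ord0 poweR0r// gt_eqF.
  have [i ni [Ei Ni]] := E_ex x n0.
  by rewrite (phi1 (U^~ x) i)// -Ni mule_poweR_pred.
- move=> x; rewrite invr1 poweRe1; last by apply: sume_ge0 => i _; exact: poweR_ge0.
  case: (posnP n) => [n0|n0]; first by rewrite n0 big_ord0 poweR_ge0.
  have [i ni [Ei Ni]] := E_ex x n0.
  under eq_bigr do rewrite poweRe1// -[phi _ _]mul1e.
  by rewrite (phi1 (fun=> 1) i)// mul1e.
- move=> x psi psi0; rewrite invr1 poweRe1; last by apply: sume_ge0 => i _; exact: poweR_ge0.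
  apply: (@le_trans _ _ (G x * \sum_(i < n) psi i `^ 1)).
    rewrite ge0_sume_distrr; last by move=> i _; exact: poweR_ge0.
    by apply: lee_sum => i _; rewrite poweRe1//; apply: lee_wpmul2r.
  rewrite lee_pemull ?lee1n//; rewrite mule_ge0// sume_ge0// => i _; exact: poweR_ge0.
- apply: (@le_lt_trans _ _ (\int[mu]_x (\sum_(i < n) U i x) `^ P)); last first.
    exact: (avr_finite_sum_lty _ _ (ltW P1) h0 mh hG).
  apply: ge0_le_integral_nomeas => x _; first exact: poweR_ge0.
  apply: le_poweR => //; first exact: ltW.
  apply: (@maxe_sum_le _ _ (U^~ x)) => [i ni|]; last exact: sume_ge0.
  by rewrite (bigD1 (Ordinal ni))//= leeDl// sume_ge0.
Qed.

Lemma avr_vector (P : R) (q : \bar R) : (1 < P)%R -> 1 < q -> exists2 C : R, (0 < C)%R &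
  forall (h : nat -> X -> \bar R) (m : int), (forall i x, 0 <= h i x) ->
  (forall i, measurable_fun setT (h i)) ->
  \int[mu]_x (lq q [set: nat] (fun i => avr (m + i%:Z) (h i) x)) `^ P <=
  C%:E * \int[mu]_x (lq q [set: nat] (fun i => h i x)) `^ P.
Proof.
move=> P1; case: q => [q||]// q1; last exact: avr_vector_sup.
rewrite lte_fin in q1; have [qP|Pq] := leP q P; first by apply: avr_vector_le => //; exact: ltW.
by apply: avr_vector_ge => //; exact: ltW.
Qed.


(* The decay [(del^j / (del^j + d x y))^gam] of the kernels, cut into annuli. *)
Definition smo (th : R) (j : int) (h : X -> \bar R) (x : X) : \bar R :=
  \esum_(l in [set: nat]) ((th ^+ l)%:E * avr (j - l%:Z) h x).

Section smo.
Variable th : R.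
Hypothesis th01 : (0 < th < 1)%R.
Let th0 : (0 <= th)%R. Proof. by have /andP[/ltW] := th01. Qed.
Let thn (l : nat) : 0 <= (th ^+ l)%:E. Proof. by rewrite lee_fin exprn_ge0. Qed.

Lemma smo_ge0 j h x : (forall y, 0 <= h y) -> 0 <= smo th j h x.
Proof. by move=> h0; apply: esum_ge0 => l _; rewrite mule_ge0// avr_ge0. Qed.

Lemma measurable_smo j h : (forall y, 0 <= h y) -> measurable_fun setT (smo th j h).
Proof.
move=> h0; apply: measurable_esum; first exact: countableP.
- by move=> l x; rewrite mule_ge0// avr_ge0.
- by move=> l _; apply: measurable_funeM; exact: measurable_avr.
Qed.

Lemma smo_esum (U : choiceType) (I : set U) j (h : U -> X -> \bar R) x : countable I ->
  (forall u y, 0 <= h u y) -> (forall u, I u -> measurable_fun setT (h u)) ->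
  smo th j (fun y => \esum_(u in I) h u y) x = \esum_(u in I) smo th j (h u) x.
Proof.
move=> cI h0 mh; rewrite /smo [RHS]exchange_esum; last first.
  by move=> u l; rewrite mule_ge0// avr_ge0.
apply: eq_esum => l _; rewrite avr_esum// esumZl// => u.
exact: avr_ge0.
Qed.

Lemma integral_smo j h : (forall y, 0 <= h y) -> measurable_fun setT h ->
  \int[mu]_x smo th j h x <= (CA / (1 - th))%:E * \int[mu]_x h x.
Proof.
move=> h0 mh; rewrite /smo integral_esum//.
- apply: (@le_trans _ _ (\esum_(l in [set: nat]) ((th ^+ l)%:E * (CA%:E * \int[mu]_x h x)))).
    apply: le_esum => l _; rewrite ge0_integralZl//.
    + by apply: lee_wpmul2l => //; exact: integral_avr.
    + exact: measurable_avr.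
    + by move=> x _; exact: avr_ge0.
  apply: le_trans (esum_geoZ th01 _) _.
    by rewrite mule_ge0 ?lee_fin ?CA_ge0// integral_ge0.
  by rewrite muleA -EFinM mulrC.
- exact: countableP.
- by move=> l x; rewrite mule_ge0// avr_ge0.
- by move=> l _; apply: measurable_funeM; exact: measurable_avr.
Qed.

(* The loss in [avr_reverse] is compensated by the decay of the weights. *)
Lemma smo_pow_le (r : R) (i0 : nat) : (0 < r <= 1)%R ->
  exists2 C : R, (0 <= C)%R &
  forall (j : int) (Phi : idx D -> R), (forall a, 0 <= Phi a)%R -> forall x,
  (smo th j (fun y => (Phi (cidx (j + i0%:Z) y))%:E) x) `^ r <=
  C%:E * smo (th `^ r * (del^-1 `^ om) `^ (1 - r)) (j - 3)
         (fun y => (Phi (cidx (j + i0%:Z) y) `^ r)%:E) x.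
Proof.
move=> r01; have /andP[r0 r1] := r01.
have [C C0 HC] := avr_reverse r01.
pose e := ((del^-1 `^ om) `^ (1 - r))%R.
have e0 : (0 <= e)%R by exact: powR_ge0.
exists (C * e ^+ i0)%R; first by rewrite mulr_ge0// exprn_ge0.
move=> j Phi P0 x; rewrite /smo.
have a0 l : 0 <= (th ^+ l)%:E * avr (j - l%:Z) (fun y => (Phi (cidx (j + i0%:Z) y))%:E) x.
  by rewrite mule_ge0// avr_ge0// => y; rewrite lee_fin.
apply: (le_trans (poweR_esum_le _ r01 a0)).
have b0 y : 0 <= (Phi (cidx (j + i0%:Z) y) `^ r)%:E by rewrite lee_fin powR_ge0.
rewrite -esumZl ?lee_fin ?mulr_ge0 ?exprn_ge0//; last first.
  by move=> l; rewrite mule_ge0 ?avr_ge0// lee_fin exprn_ge0// mulr_ge0// powR_ge0.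
apply: le_esum => l _; rewrite poweRM//; last by rewrite avr_ge0// => y; rewrite lee_fin.
rewrite poweR_EFin powR_exprn//.
have -> : (j + i0%:Z = (j - l%:Z) + (l + i0)%N%:Z)%R by clear; lia.
apply: (@le_trans _ _ ((th `^ r ^+ l)%:E * ((C * ((del ^- (l + i0)) `^ om) `^ (1 - r))%:E *
     avr (j - l%:Z - 3) (fun y => (Phi (cidx ((j - l%:Z) + (l + i0)%N%:Z)%R y) `^ r)%:E) x))).
  by apply: lee_wpmul2l; [rewrite lee_fin exprn_ge0// powR_ge0|exact: HC].
rewrite (_ : j - 3 - l%:Z = j - l%:Z - 3)%R; last by clear; lia.
rewrite !muleA -!EFinM; apply: lee_wpmul2r; first by apply: avr_ge0 => y; rewrite lee_fin powR_ge0.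
rewrite lee_fin le_eqVlt; apply/orP; left; apply/eqP.
rewrite -exprVn powR_exprn ?invr_ge0 ?del_ge0// powR_exprn ?powR_ge0// -/e.
by rewrite exprD exprMn; ring.
Qed.

End smo.

Section single_scale.
Variables (gam p : R) (i0 : nat).
Hypotheses (gam0 : (0 < gam)%R) (p0 : (0 < p)%R)
  (gamp : (p < 1)%R -> (om * (1 - p) < gam * p)%R).

Let th := (del `^ gam)%R.
Lemma th01 : (0 < th < 1)%R.
Proof. by apply: powR_lt1 => //; rewrite del_gt0 del_lt1. Qed.

(** The product is [del ^ (gam * r - om * (1 - r))]: the decay per level, raised to the power [r],
    against the volume loss of the reversed Jensen inequality. *)
Lemma th_reverse01 (r : R) : (0 < r)%R -> (om * (1 - r) < gam * r)%R ->
  (0 < th `^ r * (del^-1 `^ om) `^ (1 - r) < 1)%R.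
Proof.
move=> r0 gr; have d0 := del_gt0.
have dV : (del^-1 = del `^ (-1))%R by rewrite powRN powRr1// ltW.
have -> : (th `^ r * (del^-1 `^ om) `^ (1 - r) = del `^ (gam * r - om * (1 - r)))%R.
  rewrite dV /th -!powRrM -powRD; last by rewrite del_neq0 implybT.
  by congr (_ `^ _)%R; ring.
by apply: powR_lt1; rewrite ?subr_gt0// d0 del_lt1.
Qed.

(** For [p < 1] the reversed Jensen inequality is used, which is why the function has to be constant
    on cubes [i0] levels finer. For [p >= 1] the usual one is applied to each average. *)
Lemma single_scale : exists2 C : R, (0 <= C)%R &
  forall (j : int) (Phi : idx D -> R), (forall a, 0 <= Phi a)%R ->
  \int[mu]_x (smo th j (fun y => (Phi (cidx (j + i0%:Z) y))%:E) x) `^ p <=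
  C%:E * \int[mu]_x ((Phi (cidx (j + i0%:Z) x)) `^ p)%:E.
Proof.
have mPhi n (g : idx D -> R) : measurable_fun setT (fun y : X => (g (cidx n y))%:E : \bar R).
  by exact: (@measurable_cidx n _ _ (fun a => (g a)%:E)).
have [p1|p1] := ltP p 1%R.
  have p01 : (0 < p <= 1)%R by rewrite p0 ltW.
  have [C C0 HC] := smo_pow_le th01 i0 p01.
  have th' := th_reverse01 p0 (gamp p1).
  set t := (_ * _)%R in HC th'.
  have t1 : (0 <= (1 - t)^-1)%R by have /andP[_ h] := th'; rewrite invr_ge0 subr_ge0 ltW.
  exists (C * (CA / (1 - t)))%R; first by rewrite mulr_ge0// mulr_ge0// CA_ge0.
  move=> j Phi P0.
  have b0 y : 0 <= (Phi (cidx (j + i0%:Z) y) `^ p)%:E by rewrite lee_fin powR_ge0.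
  apply: (@le_trans _ _ (\int[mu]_x (C%:E * smo t (j - 3) (fun y => (Phi (cidx (j + i0%:Z) y) `^ p)%:E) x))).
    by apply: ge0_le_integral_nomeas => x _; [exact: poweR_ge0|exact: HC].
  rewrite ge0_integralZl//; last 2 first.
  - exact: measurable_smo.
  - by move=> x _; exact: smo_ge0.
  rewrite EFinM -muleA; apply: lee_wpmul2l; first by rewrite lee_fin.
  by apply: integral_smo => //; exact: (mPhi _ (fun a => Phi a `^ p)%R).
(* Half of the decay is spent in [poweR_geo_esum]; the other half stays as the weight of the
   averages. *)
pose u := Num.sqrt th; have /andP[t0 t1] := th01.
have u0 : (0 < u)%R by rewrite sqrtr_gt0.
have uu : (u * u = th)%R by rewrite -expr2 sqr_sqrtr ?ltW.
have u01 : (0 < u < 1)%R.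
  by rewrite u0/= -(@ltr_pXn2r _ 2) ?nnegrE ?(ltW u0)// expr1n sqr_sqrtr ?ltW.
have v01 := powR_lt1 u01 p0; have /andP[v0 v1] := v01.
exists ((1 - u)^-1 `^ p * (CA / (1 - u `^ p)))%R.
  by rewrite mulr_ge0 ?powR_ge0 ?divr_ge0 ?CA_ge0// subr_ge0 ltW.
move=> j Phi P0.
have b0 y : 0 <= (Phi (cidx (j + i0%:Z) y) `^ p)%:E by rewrite lee_fin powR_ge0.
have c0 y : 0 <= (Phi (cidx (j + i0%:Z) y))%:E by rewrite lee_fin.
have mb := mPhi (j + i0%:Z)%R (fun a => Phi a `^ p)%R.
apply: (@le_trans _ _ (\int[mu]_x (((1 - u)^-1 `^ p)%:E * smo (u `^ p) j (fun y => (Phi (cidx (j + i0%:Z) y) `^ p)%:E) x))).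
  apply: ge0_le_integral_nomeas => x _; first exact: poweR_ge0.
  rewrite /smo; under eq_esum do rewrite -uu exprMn.
  apply: le_trans (poweR_geo_esum u01 p0 _) _; first by move=> l; exact: avr_ge0.
  apply: lee_wpmul2l; first by rewrite lee_fin powR_ge0.
  apply: le_esum => l _; apply: lee_wpmul2l; first by rewrite lee_fin exprn_ge0// powR_ge0.
  exact: (@avr_jensen _ (fun y => (Phi (cidx (j + i0%:Z) y))%:E)).
rewrite ge0_integralZl//; last 3 first.
- exact: measurable_smo.
- by move=> x _; exact: smo_ge0.
- by rewrite lee_fin powR_ge0.
rewrite EFinM -muleA; apply: lee_wpmul2l; first by rewrite lee_fin powR_ge0.
exact: integral_smo.
Qed.

End single_scale.

(** A single term of [smo] suffices. Take the least [l] with [d x y < rho (j - l)]: the cube of [y]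
    then lies in the ball of that term, while the kernel at [(x, y)] has decayed by [u ^ l] up to a
    constant. *)
Lemma le_Rgamma_smo (gam : R) : (0 < gam)%R -> exists2 C : R, (0 <= C)%R &
  forall (j : nat) (t : idx D) (c : R) x y, (0 <= c)%R ->
  idx_at D (j%:Z + (j0 D)%:Z) t -> cube D (j%:Z + (j0 D)%:Z) t y ->
  (Rgamma D gam j x y * (c * fine (mu (cube D (j%:Z + (j0 D)%:Z) t))))%:E <=
  C%:E * smo (del `^ gam) (j%:Z - 1)
     (fun z => (c * \1_(cube D (j%:Z + (j0 D)%:Z) t) z)%:E) x.
Proof.
move=> gam0; have th := th01 gam0; have /andP[th0 th1] := th; set u := (del `^ gam)%R in th th0 th1 *.
(* [E1] serves [l = 0], where [Vr H (del ^+ j) x] controls the volume. [E2] serves [l > 0], where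
   [V H x y] does; the least [l] only gives [d x y >= rho (j - l + 1)], so one factor [u] is
   lost. *)
pose E1 := (Cvol 2 * (Cmu H * K `^ om))%R; pose E2 := (Cvol 3 / u)%R.
have E10 : (0 <= E1)%R by rewrite mulr_ge0 ?(ltW (Cvol_gt0 _))// mulr_ge0 ?powR_ge0// ltW// Cmu_gt0.
have E20 : (0 <= E2)%R by rewrite divr_ge0 ?(ltW (Cvol_gt0 _))// ltW.
exists (E1 + E2)%R; first exact: addr_ge0.
move=> j t c x y c0 It yt; set Q := cube D _ t in yt *.
have dj := delz_gt0 j.
(* The radii [rho (j - l)] tend to infinity, since [del ^- n] is at least [n * (del^-1 - 1)]. *)
have ex : exists l : nat, (d x y < rho (j%:Z - l%:Z))%R.
  have [l hl] : exists l : nat, (d x y < (del ^- l))%R.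
    exists (Num.truncn (d x y / (del^-1 - 1))).+1.
    have e0 : (0 < del^-1 - 1)%R by rewrite subr_gt0 invf_gt1 ?del_lt1// del_gt0.
    have := truncnS_gt (d x y / (del^-1 - 1))%R; set n := _.+1.
    rewrite ltr_pdivrMr// => /lt_le_trans; apply; rewrite -exprVn.
    elim: (n) => [|i IH]; first by rewrite mul0r expr0.
    have i1 : (1 <= del^-1 ^+ i)%R by rewrite exprn_ege1// ltW// -subr_gt0.
    rewrite exprS -natr1 mulrDl mul1r; nra.
  exists (j + l)%N; apply: lt_le_trans hl _.
  rewrite (_ : j%:Z - (j + l)%N%:Z = 0 - l%:Z)%R; last by clear; lia.
  by rewrite rho_shift /rho expr0z mulr1 ler_peMr// invr_ge0 exprn_ge0// del_ge0.
case: (ex_minnP ex) => l xyl lmin {ex}.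
have QB : Q `<=` Bs (j%:Z - 1 - l%:Z) x.
  move=> z zt; apply: (@d_Bs _ (j%:Z - l%:Z - 1)%R); first by clear; lia.
  apply: ltW; apply: (rho_lev (i := (j%:Z - l%:Z)%R) (j := (j%:Z + (j0 D)%:Z)%R) (y := y)).
  - by clear; lia.
  - by clear; lia.
  - exact: ltW.
  - exact: (cube_diam It).
have mQ : measurable Q by exact: cube_measurable.
have V0 := Vs_gt0 (j%:Z - 1 - l%:Z) x.
have key : (Rgamma D gam j x y <= (E1 + E2) * (u ^+ l / Vs (j%:Z - 1 - l%:Z) x))%R.
  have dc : (d (cen (j%:Z - 1 - l%:Z) x) x <= rho (j%:Z - l%:Z - 2))%R.
    by apply: le_trans (d_cen_le _ _) _; apply: le_rho; clear; lia.
  have dxy := qdist_ge0 H x y.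
  have Vd : (0 < Vr H (del ^+ j) x)%R by apply: Vr_gt0.
  have Vxy : (0 <= V H x y)%R by exact: fine_ge0.
  rewrite /Rgamma /Vs (_ : j%:Z - 1 - l%:Z - 1 = j%:Z - l%:Z - 2)%R; last by clear; lia.
  set W := Vr H _ (cen _ _).
  have W0 : (0 < W)%R by exact/Vr_gt0/rho_gt0.
  have [l0|l0] := posnP l.
    rewrite l0 expr0 mul1r.
    have WE : (W <= E1 * (Vr H (del ^+ j) x + V H x y))%R.
      rewrite /W l0 subr0 /E1; move: dc; rewrite l0 !subr0 => dc.
      apply: le_trans (Vr_rho (n := 2) dc) _; rewrite -mulrA ler_wpM2l ?(ltW (Cvol_gt0 _))//.
      have Vg : (Vr H (rho j) x <= Cmu H * K `^ om * Vr H (del ^+ j) x)%R.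
        exact: (Vr_growth H x dj K1).
      by apply: le_trans Vg _; rewrite ler_wpM2l ?mulr_ge0 ?powR_ge0 ?(ltW (Cmu_gt0 H))// lerDl.
    have : (((del ^+ j) / (del ^+ j + d x y)) `^ gam <= 1)%R.
      apply: powR_le1; last exact: ltW.
      by rewrite divr_ge0 ?addr_ge0 ?(ltW dj)//= ler_pdivrMr ?mul1r ?lerDl// ltr_wpDr.
    move=> h1; apply: (@le_trans _ _ ((Vr H (del ^+ j) x + V H x y)^-1 * 1)%R).
      by rewrite ler_wpM2l// invr_ge0 addr_ge0// ltW.
    rewrite mulr1 ler_pdivlMr// mulrC ler_pdivrMr ?ltr_wpDr//.
    by apply: le_trans WE _; rewrite ler_wpM2r ?addr_ge0 ?(ltW Vd)// lerDl.
  have rd : (rho (j%:Z - l%:Z + 1) <= d x y)%R.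
    rewrite leNgt; apply/negP => h; have : (l <= l.-1)%N.
      apply: lmin; rewrite (_ : (j%:Z - l.-1%:Z = j%:Z - l%:Z + 1)%R)//; move: l0; clear; lia.
    by move: l0; clear; lia.
  have WE : (W <= Cvol 3 * (Vr H (del ^+ j) x + V H x y))%R.
    rewrite (_ : j%:Z - l%:Z - 2 = (j%:Z - l%:Z + 1) - 3%:Z)%R in dc; last by clear; lia.
    rewrite /W (_ : j%:Z - l%:Z - 2 = (j%:Z - l%:Z + 1) - 3%:Z)%R; last by clear; lia.
    apply: le_trans (Vr_rho (n := 3) dc) _; rewrite ler_wpM2l ?(ltW (Cvol_gt0 _))//.
    apply: (@le_trans _ _ (V H x y)); last by rewrite lerDr ltW.
    apply: le_Vr; first exact: lt_le_trans (rho_gt0 _) rd.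
    by move=> z /= /lt_le_trans; apply.
  have h1 : (((del ^+ j) / (del ^+ j + d x y)) `^ gam <= u ^+ l / u)%R.
    rewrite -{1}(prednK l0) exprSr mulfK ?gt_eqF// /u -powR_exprn ?del_ge0//.
    rewrite ge0_ler_powR ?nnegrE ?divr_ge0 ?addr_ge0 ?(ltW dj) ?(ltW gam0)//; first by rewrite exprn_ge0// del_ge0.
    rewrite ler_pdivrMr ?ltr_wpDr//; apply: (@le_trans _ _ (del ^+ l.-1 * rho (j%:Z - l%:Z + 1)))%R.
      rewrite (_ : j%:Z - l%:Z + 1 = j%:Z - l.-1%:Z)%R; last by move: l0; clear; lia.
      rewrite rho_shift mulrA mulfV ?mul1r ?expf_neq0 ?del_neq0//.
      by rewrite /rho -[leLHS]mul1r ler_wpM2r// ltW.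
    by rewrite ler_wpM2l ?exprn_ge0 ?del_ge0// (le_trans rd)// lerDr ltW.
  have ul0 : (0 <= u ^+ l)%R by rewrite exprn_ge0// ltW.
  apply: (@le_trans _ _ ((Vr H (del ^+ j) x + V H x y)^-1 * (u ^+ l / u))%R).
    by rewrite ler_wpM2l// invr_ge0 addr_ge0// ltW.
  rewrite mulrC ler_pdivrMr ?ltr_wpDr//.
  apply: (@le_trans _ _ (E2 * (u ^+ l / W) * (Vr H (del ^+ j) x + V H x y))%R).
    rewrite /E2 (_ : (Cvol 3 / u * (u ^+ l / W) * (Vr H (del ^+ j) x + V H x y) = (u ^+ l / u) * ((Cvol 3 * (Vr H (del ^+ j) x + V H x y)) / W))%R); last by ring.
    by rewrite ler_peMr ?divr_ge0 ?(ltW th0)// ler_pdivlMr// mul1r.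
  rewrite ler_wpM2r ?addr_ge0 ?(ltW Vd)// ler_wpM2r ?divr_ge0 ?(ltW W0)// lerDr//.
set m := fine (mu Q).
have m0 : (0 <= m)%R by exact: fine_ge0.
have h0 z : 0 <= (c * \1_Q z)%:E by rewrite lee_fin mulr_ge0// indicE.
have Hs : (u ^+ l)%:E * avr (j%:Z - 1 - l%:Z) (fun z => (c * \1_Q z)%:E) x <=
    smo u (j%:Z - 1) (fun z => (c * \1_Q z)%:E) x.
  by apply: (@esum_ge_term _ _ [set: nat] (fun l : nat => (u ^+ l)%:E * avr (j%:Z - 1 - l%:Z) _ x)).
apply: le_trans (lee_wpmul2l _ Hs); last by rewrite lee_fin addr_ge0.
rewrite avrE; under eq_integral do rewrite EFinM.
rewrite ge0_integralZl_EFin//; last 2 first.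
- exact: measurable_Bs.
- exact/measurable_EFinP/measurable_indic.
rewrite integral_indic//; last exact: measurable_Bs.
rewrite setIidl// cube_mu// -/m -!EFinM lee_fin.
apply: (@le_trans _ _ ((E1 + E2) * (u ^+ l / Vs (j%:Z - 1 - l%:Z) x) * (c * m))%R).
  by rewrite ler_wpM2r// mulr_ge0.
by rewrite !mulrA.
Qed.

(** * Sums of atoms *)

(* The level of the cubes [Q^{j,m}_alpha]. *)
Definition lev (j : nat) : int := (j%:Z + (j0 D)%:Z)%R.

Section atoms.
Variables (gam beta s C1 : R) (a : nat -> idx D -> R) (phi : nat -> idx D -> X -> R).

Local Notation th := (del `^ gam)%R.
Let ind j t z := (a j t * \1_(cube D (lev j) t) z)%:E.
Definition coefun j z := (a j (cidx (lev j) z))%:E.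
Definition envel j x := smo th (j%:Z - 1) (coefun j) x.
Definition modulus (k : int) (j : nat) : R :=
  (if (j%:Z <= k)%R then (del `^ beta) ^+ `|k - j%:Z|%N else 1)%R.
Definition atom_idx := [set: nat] `*`` (fun j => idx_at D (lev j)).
(** The value has no meaning where the atoms are not absolutely summable; the bounds below are
    infinite there, or the sum is zero because [C1] is. *)
Definition synth x := usum atom_idx (fun p => phi p.1 p.2 x).

Hypotheses (gam0 : (0 < gam)%R) (beta0 : (0 < beta)%R) (C10 : (0 <= C1)%R)
  (a0 : forall j t, (0 <= a j t)%R).
Hypothesis atom_size : forall j t x, idx_at D (lev j) t -> `|phi j t x|%:E <=
  C1%:E * smo th (j%:Z - 1) (fun z => (a j t * \1_(cube D (lev j) t) z)%:E) x.
Hypothesis atom_reg : forall j t x x' (k : int), idx_at D (lev j) t ->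
  (d x x' <= rho k)%R -> `|phi j t x - phi j t x'|%:E <= (C1 * modulus k j)%:E *
   (smo th (j%:Z - 1) (fun z => (a j t * \1_(cube D (lev j) t) z)%:E) x +
    smo th (j%:Z - 1) (fun z => (a j t * \1_(cube D (lev j) t) z)%:E) x').

Let t01 : (0 < th < 1)%R. Proof. exact: th01. Qed.
Let ind0 j t z : 0 <= ind j t z. Proof. by rewrite lee_fin mulr_ge0// indicE. Qed.
Let sind0 j t x : 0 <= smo th (j%:Z - 1) (ind j t) x. Proof. exact: smo_ge0. Qed.

Lemma coefun_ge0 j z : 0 <= coefun j z. Proof. by rewrite lee_fin. Qed.
Lemma envel_ge0 j x : 0 <= envel j x. Proof. by apply: smo_ge0 => // y; exact: coefun_ge0. Qed.
Lemma measurable_coefun j : measurable_fun setT (coefun j).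
Proof. exact: (@measurable_cidx _ _ _ (fun t => (a j t)%:E)). Qed.
Lemma measurable_envel j : measurable_fun setT (envel j).
Proof. exact: (measurable_smo t01 _ (coefun_ge0 j)). Qed.

Lemma esum_envel j x : \esum_(t in idx_at D (lev j)) smo th (j%:Z - 1) (ind j t) x = envel j x.
Proof.
rewrite -smo_esum//; first last.
- move=> t It; apply/measurable_EFinP/measurable_funM => //.
  exact/measurable_indic/cube_measurable.
- exact: idx_at_countable.
rewrite /envel; congr (smo _ _ _ x); apply/funext => y; rewrite /coefun.
rewrite -(@esum_cell (lev j) y (fun t => (a j t)%:E)); last by move=> t; rewrite lee_fin.
apply: eq_esum => t _; rewrite /ind indicE; case: (y \in _); rewrite ?mulr1 ?mulr0//.
Qed.

Lemma esum_atom_idx (f : nat -> idx D -> \bar R) : (forall j t, 0 <= f j t) ->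
  \esum_(p in atom_idx) f p.1 p.2 = \esum_(j in [set: nat]) \esum_(t in idx_at D (lev j)) f j t.
Proof. by move=> f0; rewrite esum_esum. Qed.

Lemma esum_atoms_le x : \esum_(p in atom_idx) `|phi p.1 p.2 x|%:E <=
  C1%:E * \esum_(j in [set: nat]) envel j x.
Proof.
rewrite (esum_atom_idx (f := fun j t => `|phi j t x|%:E))//.
rewrite -esumZl//; last by move=> j; exact: envel_ge0.
apply: le_esum => j _; rewrite -esum_envel -esumZl//.
by apply: le_esum => t It; exact: atom_size.
Qed.

Lemma synth_abs x : `|synth x|%:E <= C1%:E * \esum_(j in [set: nat]) envel j x.
Proof. by apply: le_trans (esum_atoms_le x); exact: usum_abs_le. Qed.

Lemma modulus_gt0 k j : (0 < modulus k j)%R.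
Proof. by rewrite /modulus; case: ifP => // _; rewrite exprn_gt0// powR_gt0// del_gt0. Qed.

(** As [j] is nonnegative, [k - j] cannot exceed [|k|]. Hence a finite weighted sum of envelopes at
    one scale [k] makes the unweighted sum finite. *)
Lemma modulus_lbound k : exists2 c : R, (0 < c)%R & forall j, (c <= modulus k j)%R.
Proof.
have b0 : (0 < del `^ beta)%R by rewrite powR_gt0// del_gt0.
have b1 : (del `^ beta <= 1)%R by rewrite powR_le1 ?del_ge0 ?(ltW del_lt1) ?(ltW beta0).
exists ((del `^ beta) ^+ `|k|%N)%R; first by rewrite exprn_gt0.
move=> j; rewrite /modulus; case: ifP => jk; last by rewrite exprn_ile1// ltW.
by rewrite ler_wiXn2l ?(ltW b0)//; move: jk; clear; lia.
Qed.

Lemma synth_diff k x x' : (d x x' <= rho k)%R ->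
  `|synth x - synth x'|%:E <=
  C1%:E * \esum_(j in [set: nat]) ((modulus k j)%:E * (envel j x + envel j x')).
Proof.
move=> xx'; set S := esum _ _.
have U0 := envel_ge0.
have mS0 j : 0 <= (modulus k j)%:E * (envel j x + envel j x').
  by rewrite mule_ge0 ?adde_ge0// lee_fin ltW// modulus_gt0.
have S0 : 0 <= S by apply: esum_ge0.
(* An infinite right-hand side settles everything except [C1 = 0], where [+oo * 0] is 0 but [synth]
   vanishes. *)
have [Soo|Sfin] := eqVneq S +oo.
  have [C1z|C1n] := eqVneq C1 0%R; last by rewrite Soo gt0_muley ?leey// lte_fin lt_def C1n.
  have z y : synth y = 0%R.
    apply/eqP; rewrite -normr_le0 -lee_fin.
    by apply: le_trans (synth_abs y) _; rewrite C1z mul0e.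
  by rewrite !z subrr normr0 C1z mul0e.
(* [usum_dist_le] requires absolute summability at both points; it follows from the finiteness of
   [S]. *)
have [c c0 Hc] := modulus_lbound k.
have fin y : y = x \/ y = x' -> \esum_(p in atom_idx) `|phi p.1 p.2 y|%:E < +oo.
  move=> yx; apply: le_lt_trans (esum_atoms_le y) _.
  have UE : \esum_(j in [set: nat]) envel j y <= c^-1%:E * S.
    rewrite /S -esumZl ?lee_fin ?invr_ge0 ?(ltW c0)//; apply: le_esum => j _.
    apply: (@le_trans _ _ (c^-1%:E * (c%:E * envel j y))).
      by rewrite muleA -EFinM mulVf ?gt_eqF// mul1e.
    apply: lee_wpmul2l; first by rewrite lee_fin invr_ge0 ltW.
    apply: lee_pmul => //; first by rewrite lee_fin ltW.
      by rewrite lee_fin.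
    by case: yx => ->; rewrite ?leeDl ?leeDr.
  apply: (@le_lt_trans _ _ (C1%:E * (c^-1%:E * S))); first by rewrite lee_wpmul2l ?lee_fin.
  rewrite lte_mul_pinfty ?lee_fin// lte_mul_pinfty ?lee_fin ?invr_ge0 ?(ltW c0)//.
  by rewrite ltey.
apply: le_trans (usum_dist_le (fin x (or_introl erefl)) (fin x' (or_intror erefl))) _.
rewrite (esum_atom_idx (f := fun j t => `|phi j t x - phi j t x'|%:E))//.
rewrite /S -esumZl//; apply: le_esum => j _.
rewrite -!esum_envel -esumD//.
have m0 : (0 <= modulus k j)%R by exact/ltW/modulus_gt0.
rewrite -!esumZl ?lee_fin//; last 2 first.
- by move=> t; rewrite mule_ge0// adde_ge0.
- by move=> t; rewrite adde_ge0.
apply: le_esum => t It; rewrite muleA -EFinM; exact: atom_reg.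
Qed.

(* The piecewise constant functions [phi \o cen k] converge to [phi]. *)
Lemma measurable_atom j t : idx_at D (lev j) t -> measurable_fun setT (phi j t).
Proof.
move=> It; apply/measurable_EFinP.
have B x : smo th (j%:Z - 1) (ind j t) x <= ((1 - th)^-1 * a j t)%:E.
  rewrite EFinM; apply: le_trans (esum_geoZ t01 (c := (a j t)%:E) _); last by rewrite lee_fin.
  apply: le_esum => l _; apply: lee_wpmul2l.
    by rewrite lee_fin exprn_ge0// powR_ge0.
  rewrite -(avr_cst (j%:Z - 1 - l%:Z) (a j t) x); apply: le_avr => // y.
  by rewrite lee_fin indicE -[leRHS]mulr1 ler_wpM2l// lern1 leq_b1.
pose b := (del `^ beta)%R.
have b01 : (0 < b < 1)%R by apply: powR_lt1; rewrite ?del_gt0 ?del_lt1.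
have /andP[b0 b1] := b01.
pose M := (C1 * ((1 - th)^-1 * a j t + (1 - th)^-1 * a j t))%R.
have h x (n : nat) : (`|phi j t x - phi j t (cen (j + n)%N%:Z x)| <= M * b ^+ n)%R.
  rewrite -lee_fin; apply: le_trans (atom_reg (k := (j + n)%N%:Z) It _) _.
    by rewrite (qdist_sym H); exact: d_cen_le.
  apply: (@le_trans _ _ ((C1 * modulus (j + n)%N%:Z j)%:E * ((1 - th)^-1 * a j t + (1 - th)^-1 * a j t)%:E)).
    apply: lee_wpmul2l; first by rewrite lee_fin mulr_ge0// ltW// modulus_gt0.
    by rewrite EFinD leeD.
  rewrite -EFinM lee_fin /modulus ifT; last by clear; lia.
  rewrite (_ : `|(j + n)%N%:Z - j%:Z|%N = n)%R; last by clear; lia.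
  by rewrite /M -/b mulrAC.
apply: (@emeasurable_fun_cvg _ _ _ _ (fun (n : nat) x => (phi j t (cen (j + n)%N%:Z x))%:E)).
  move=> n; exact: (@measurable_cidx _ _ _ (fun i => (phi j t (center D (j + n)%N%:Z i))%:E)).
move=> x _; apply: cvg_EFin; first by apply: nearW.
apply/cvgrPdist_le => e e0.
have cv : (fun n => (M * b ^+ n)%R) @ \oo --> (0%R : R).
  by apply: cvg_geometric; rewrite ger0_norm// ltW.
have /cvgrPdist_le/(_ _ e0) := cv; apply: filterS => n; rewrite sub0r normrN => Hn.
by apply: le_trans (h x n) _; apply: le_trans Hn; exact: ler_norm.
Qed.

Lemma atom_idx_countable : countable atom_idx.
Proof.
rewrite (_ : atom_idx = \bigcup_(j in [set: nat]) ((fun t => (j, t)) @` idx_at D (lev j))).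
  apply: bigcup_countable; first exact: countableP.
  by move=> j _; apply: card_le_trans (card_image_le _ _) (idx_at_countable _).
apply/seteqP; split => [[j t] [_ /= It]|[j t] [i _ [t' It' [<- <-]]]]; last by split.
by exists j => //; exists t.
Qed.

Lemma measurable_synth : measurable_fun setT synth.
Proof.
have h (e : R) : measurable_fun setT (fun x => fine (\esum_(p in atom_idx) (Num.max (e * phi p.1 p.2 x) 0)%:E)).
  apply: measurableT_comp => //; apply: measurable_esum.
  - exact: atom_idx_countable.
  - by move=> p x; rewrite lee_fin le_max lexx orbT.
  - move=> [j t] [_ /= It]; apply/measurable_EFinP/measurable_maxr => //.
    exact/measurable_funM/measurable_atom.
rewrite /synth /usum; apply: measurable_funB.
  by have := h 1%R; under eq_fun do under eq_esum do rewrite mul1r.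
by have := h (-1)%R; under eq_fun do under eq_esum do rewrite mulN1r.
Qed.

(** The gain per level is [del ^ (beta - s)] on one side of the diagonal and [del ^ s] on the other.
    The third is there because three factors are needed: one for the sum over [j] at fixed [k], two
    for [lq_geo]. *)
Definition decay (u : R) : R := ((del `^ (Num.min (beta - s) s / 3)) `^ u)%R.

Hypothesis s_bound : (0 < s < beta)%R.

Lemma decay01 (u : R) : (0 < u)%R -> (0 < decay u < 1)%R.
Proof.
move=> u0; apply: powR_lt1 => //; apply: powR_lt1; first by rewrite del_gt0 del_lt1.
by rewrite divr_gt0// lt_min subr_gt0 andbC.
Qed.

(** For [j <= k] smoothness yields [del ^ (beta (k - j))] and the change of weight costs
    [del ^ (- s (k - j))]; for [j > k] the change of weight alone gains [del ^ (s (j - k))]. *)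
Lemma wt_modulus k j : (wt D s k * modulus k j <=
  (del `^ (Num.min (beta - s) s / 3)) ^+ (3 * `|k - j%:Z|%N) * wt D s j%:Z)%R.
Proof.
have d0 := del_gt0; have dn : del != 0%R by exact: del_neq0.
have dle x y : (x <= y -> del `^ y <= del `^ x)%R.
  by move=> xy; rewrite ger_powR// d0 ltW// del_lt1.
rewrite -powR_mulrn ?powR_ge0// -powRrM natrM mulrA divfK// /wt.
set m := Num.min _ _; set n := `|_|%N.
have m1 : (m <= beta - s)%R by rewrite ge_min lexx.
have m2 : (m <= s)%R by rewrite ge_min lexx orbT.
rewrite -powRD ?dn ?implybT// /modulus; case: ifPn => jk.
  rewrite -powR_mulrn ?powR_ge0// -powRrM -powRD ?dn ?implybT//; apply: dle.
  have -> : (k%:~R = j%:Z%:~R + n%:R :> R)%R.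
    by rewrite -[n%:R]/(n%:Z%:~R) -intrD; congr (_%:~R)%R; move: jk; rewrite /n; clear; lia.
  have n0 : (0 <= n%:R :> R)%R by [].
  by nra.
rewrite mulr1; apply: dle.
have -> : (j%:Z%:~R = k%:~R + n%:R :> R)%R.
  by rewrite -[n%:R]/(n%:Z%:~R) -intrD; congr (_%:~R)%R; move: jk; rewrite /n; clear; lia.
have n0 : (0 <= n%:R :> R)%R by [].
by nra.
Qed.

Lemma wt_ge0 k : (0 <= wt D s k)%R. Proof. exact: powR_ge0. Qed.

Lemma synth_diff_pow (u : R) : (0 < u)%R -> exists2 C : R, (0 <= C)%R &
  forall k x x', (d x x' <= rho k)%R ->
  ((wt D s k * `|synth x - synth x'|)%:E) `^ u <=
  C%:E * \esum_(j in [set: nat])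
    ((decay u ^+ `|k - j%:Z|%N * decay u ^+ `|k - j%:Z|%N)%:E *
     ((wt D s j)%:E * (envel j x + envel j x')) `^ u).
Proof.
move=> u0; set v := (del `^ (Num.min (beta - s) s / 3))%R.
have /andP[v0 v1] : (0 < v < 1)%R.
  apply: powR_lt1; first by rewrite del_gt0 del_lt1.
  by rewrite divr_gt0// lt_min subr_gt0 andbC.
have v01 : (0 < v < 1)%R by rewrite v0.
exists ((2 / (1 - v)) `^ u * C1 `^ u)%R; first by rewrite mulr_ge0 ?powR_ge0.
move=> k x x' xx'; have U0 := envel_ge0.
pose c (j : nat) := (v ^+ (2 * `|k - j%:Z|%N))%:E * ((wt D s j)%:E * (envel j x + envel j x')).
have b0 (j : nat) : 0 <= (wt D s j)%:E * (envel j x + envel j x').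
  by rewrite mule_ge0 ?adde_ge0// lee_fin wt_ge0.
have c0 (j : nat) : 0 <= c j by rewrite mule_ge0// lee_fin exprn_ge0// ltW.
have vn (j : nat) : (0 <= v ^+ `|k - j%:Z|%N)%R by rewrite exprn_ge0// ltW.
have step : (wt D s k * `|synth x - synth x'|)%:E <=
    C1%:E * \esum_(j in [set: nat]) ((v ^+ `|k - j%:Z|%N)%:E * c j).
  rewrite EFinM; apply: le_trans (lee_wpmul2l _ (synth_diff xx')) _.
    by rewrite lee_fin wt_ge0.
  rewrite muleCA; apply: lee_wpmul2l; first by rewrite lee_fin.
  rewrite -esumZl ?lee_fin ?wt_ge0//; last first.
    by move=> j; rewrite mule_ge0 ?adde_ge0// lee_fin ltW// modulus_gt0.
  apply: le_esum => j _; rewrite /c !muleA -!EFinM; apply: lee_wpmul2r.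
    by rewrite adde_ge0.
  rewrite lee_fin; apply: le_trans (wt_modulus k j) _.
  by rewrite -/v -exprD -{2}(mul1n `|_|%N) -mulnDl.
apply: le_trans (le_poweR (ltW u0) _ step) _.
  by rewrite lee_fin mulr_ge0// wt_ge0.
rewrite poweRM ?lee_fin//; last by apply: esum_ge0 => j _; rewrite mule_ge0// lee_fin.
rewrite poweR_EFin mulrC EFinM -muleA; apply: lee_wpmul2l; first by rewrite lee_fin powR_ge0.
have W : \esum_(j in [set: nat]) (v ^+ `|k - j%:Z|%N)%:E <= (2 / (1 - v))%:E.
  apply: le_trans (esum_geo_int v01 k).
  under eq_esum do rewrite distnC.
  by apply: (@esum_inj_le _ _ _ Posz (fun i => (v ^+ `|i - k|%N)%:E)) => i i' [].
apply: le_trans (poweR_wesum u0 vn c0 W) _.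
apply: lee_wpmul2l; first by rewrite lee_fin powR_ge0.
apply: le_esum => j _; rewrite /c poweRM ?lee_fin ?exprn_ge0 ?(ltW v0)//.
by rewrite poweR_EFin powR_exprn ?(ltW v0)// -/(decay u) mul2n -addnn exprD.
Qed.

Let i0 := (j0 D).+1.

Lemma coefunE j x : coefun j x = (a j (cidx ((j%:Z - 1) + i0%:Z)%R x))%:E.
Proof. by rewrite (_ : j%:Z - 1 + i0%:Z = lev j)%R// /lev /i0; clear; lia. Qed.

Lemma envelE j x : envel j x =
  smo th (j%:Z - 1) (fun y => (a j (cidx ((j%:Z - 1) + i0%:Z)%R y))%:E) x.
Proof. by rewrite /envel; congr (smo _ _ _ x); apply/funext => y; exact: coefunE. Qed.

Lemma envel_pow_int (p : R) : (0 < p)%R -> ((p < 1)%R -> (om * (1 - p) < gam * p)%R) ->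
  exists2 C : R, (0 <= C)%R &
  forall j, \int[mu]_x (envel j x) `^ p <= C%:E * \int[mu]_x (coefun j x) `^ p.
Proof.
move=> p0 gp; have [C C00 HC] := single_scale i0 gam0 p0 gp.
exists C => // j; have := HC (j%:Z - 1)%R (a j) (a0 j).
rewrite (_ : (fun x => _ `^ p) = (fun x => (envel j x) `^ p)); last first.
  by apply/funext => x; rewrite envelE.
rewrite (_ : (fun x => (a j _ `^ p)%:E) = (fun x => (coefun j x) `^ p))//.
by apply/funext => x; rewrite coefunE poweR_EFin.
Qed.

Lemma measurable_wenvel (j : nat) (p : R) :
  measurable_fun setT (fun x => ((wt D s j)%:E * envel j x) `^ p).
Proof. by apply: measurable_poweR_comp; apply: measurable_funeM; exact: measurable_envel. Qed.

Lemma mulr_ge0_sq (x : R) : (0 <= x * x)%R. Proof. by rewrite -expr2 sqr_ge0. Qed.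

Lemma osc_le (Ct p : R) : (0 < Ct)%R -> (Ct <= K)%R -> (0 < p)%R -> exists2 C : R, (0 <= C)%R &
  forall k x, (wt D s k `^ p)%:E * osc D Ct p k synth x <=
  C%:E * \esum_(j in [set: nat])
    ((decay p ^+ `|k - j%:Z|%N * decay p ^+ `|k - j%:Z|%N)%:E *
     (((wt D s j)%:E * envel j x) `^ p +
      avr k (fun y => ((wt D s j)%:E * envel j y) `^ p) x)).
Proof.
move=> Ct0 CtK p0; have [C C00 HC] := synth_diff_pow p0.
have U0 := envel_ge0; have dk0 := decay01 p0; have d0 := del_gt0.
(* Compares the volume of [Bs k x], centred at a cube centre, with that of [Bk D Ct k x], centred at
   [x]. *)
pose cB := (Cmu H * (A0 * (1 + del^-1) * K / Ct) `^ om)%R.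
have cB0 : (0 <= cB)%R by rewrite mulr_ge0 ?powR_ge0// ltW// Cmu_gt0.
exists (cB * (C * 2 `^ p))%R; first by apply: mulr_ge0 => //; rewrite mulr_ge0 ?powR_ge0.
move=> k x; have A1 := A0_ge1 H.
have Cd : (0 < Ct * del ^ k)%R by rewrite mulr_gt0// delz_gt0.
have mB : measurable (Bk D Ct k x) by exact: qball_measurable.
have BBs : Bk D Ct k x `<=` Bs k x.
  move=> y /= xy; apply: d_Bs (lexx _) _; apply: (le_trans (ltW xy)).
  by rewrite ler_wpM2r// ltW// delz_gt0.
have VB : (0 < fine (mu (Bk D Ct k x)))%R by exact: (Vr_gt0 H x Cd).
have VV : (Vs k x <= cB * fine (mu (Bk D Ct k x)))%R.
  have e : (A0 * (rho k + rho (k - 1)) / (Ct * del ^ k) = A0 * (1 + del^-1) * K / Ct)%R.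
    rewrite (rho_shift k 1) expr1 /rho; field.
    by rewrite !gt_eqF// delz_gt0.
  rewrite /cB -e; apply: (Vr_cmp (rho_gt0 (k - 1)) Cd (d_cen_le k x)).
  rewrite e ler_pdivlMr// mul1r (le_trans CtK)// ler_peMl ?(ltW K_gt0)//.
  by rewrite mulr_ege1// lerDl invr_ge0 ltW.
pose kk (j : nat) := (decay p ^+ `|k - j%:Z|%N * decay p ^+ `|k - j%:Z|%N)%R.
have kk0 j : (0 <= kk j)%R by exact: mulr_ge0_sq.
pose G (j : nat) y := ((wt D s j)%:E * envel j y) `^ p.
have G0 j y : 0 <= G j y by exact: poweR_ge0.
have mG j : measurable_fun setT (G j) by exact: measurable_wenvel.
pose g y := \esum_(j in [set: nat]) ((kk j)%:E * (G j x + G j y)).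
have g0 y : 0 <= g y by apply: esum_ge0 => j _; rewrite mule_ge0 ?adde_ge0 ?lee_fin.
have mg : measurable_fun setT g.
  apply: measurable_esum; first exact: countableP.
    by move=> j y; rewrite mule_ge0 ?adde_ge0 ?lee_fin.
  by move=> j _; apply/measurable_funeM/emeasurable_funD => //; exact: measurable_cst.
have pw : forall y, Bk D Ct k x y ->
    (wt D s k `^ p)%:E * (`|synth x - synth y| `^ p)%:E <= (C * 2 `^ p)%:E * g y.
  move=> y /= xy; rewrite -EFinM -powRM ?wt_ge0// -poweR_EFin.
  apply: le_trans (HC k x y _) _.
    by apply: (le_trans (ltW xy)); rewrite ler_wpM2r// ltW// delz_gt0.
  rewrite EFinM -muleA; apply: lee_wpmul2l; first by rewrite lee_fin.
  rewrite /g -esumZl ?lee_fin ?powR_ge0//; last by move=> j; rewrite mule_ge0 ?adde_ge0 ?lee_fin.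
  apply: le_esum => j _; rewrite muleCA; apply: lee_wpmul2l; first by rewrite lee_fin kk0.
  have w0 z : 0 <= (wt D s j)%:E * envel j z by rewrite mule_ge0// lee_fin wt_ge0.
  rewrite ge0_muleDr//; exact: poweRD_max.
rewrite /osc /avge muleCA -ge0_integralZl//; last 2 first.
- apply/measurable_EFinP/(@measurableT_comp _ _ _ _ _ _ (@powR R ^~ p)) => //.
  apply: (measurableT_comp (@normr_measurable _ setT)) => //.
  apply: measurable_funB => //; apply: measurable_funTS; exact: measurable_synth.
- by rewrite lee_fin powR_ge0.
apply: (@le_trans _ _ ((fine (mu (Bk D Ct k x)))^-1%:E * \int[mu]_(y in Bk D Ct k x) ((C * 2 `^ p)%:E * g y))).
  apply: lee_wpmul2l; first by rewrite lee_fin invr_ge0 ltW.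
  apply: ge0_le_integral_nomeas => y By; last exact: pw.
  by rewrite mule_ge0// lee_fin powR_ge0.
have Cg0 : (0 <= C * 2 `^ p)%R by rewrite mulr_ge0// powR_ge0.
apply: le_trans (avr_dom mB _ _ BBs VB VV) _.
- by move=> y; rewrite mule_ge0// lee_fin.
- exact: measurable_funeM.
rewrite avrZ// muleA -EFinM; apply: lee_wpmul2l; first by rewrite lee_fin mulr_ge0.
rewrite /g avr_esum//; last 3 first.
- exact: countableP.
- by move=> j y; rewrite mule_ge0 ?adde_ge0 ?lee_fin.
- by move=> j _; apply/measurable_funeM/emeasurable_funD => //; exact: measurable_cst.
apply: le_esum => j _; rewrite avrZ//; last 2 first.
- by move=> y; rewrite adde_ge0.
- by apply/emeasurable_funD => //; exact: measurable_cst.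
apply: lee_wpmul2l; first by rewrite lee_fin kk0.
rewrite avrD//.
(* [G j x] is constant in the variable of the average. A real constant is its own average, and for
   an infinite one the bound is trivial. *)
apply: leeD => //; move: (G0 j x); rewrite -/(G j x); case: (G j x) => [r||]//.
- by rewrite avr_cst.
- by move=> _; rewrite leey.
Qed.

Lemma wt_gt0 k : (0 < wt D s k)%R. Proof. by rewrite powR_gt0// del_gt0. Qed.

Lemma osc_ge0 Ct u k f x : 0 <= osc D Ct u k f x.
Proof.
apply: mule_ge0; first by rewrite lee_fin invr_ge0 fine_ge0.
by apply: integral_ge0 => y _; rewrite lee_fin powR_ge0.
Qed.

Lemma integralTZ (c : R) (f : X -> \bar R) : (0 <= c)%R ->
  measurable_fun setT f -> (forall x, 0 <= f x) ->
  \int[mu]_x (c%:E * f x) = c%:E * \int[mu]_x f x.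
Proof. by move=> c0 mf f0; rewrite ge0_integralZl. Qed.

(** Meant for an oscillation [f], whose measurability is not at hand: the constant is moved to the
    measurable majorant [S], where the integral is linear. *)
Lemma integral_scale_le (c : R) (f S : X -> \bar R) : (0 < c)%R ->
  (forall x, 0 <= f x) -> measurable_fun setT S -> (forall x, c%:E * f x <= S x) ->
  c%:E * \int[mu]_x f x <= \int[mu]_x S x.
Proof.
move=> c0 f0 mS fS; have S0 x : 0 <= S x 
  by apply: le_trans (fS x); apply: mule_ge0 => //; rewrite lee_fin; exact: ltW.
have cV : (0 <= c^-1)%R by rewrite invr_ge0 ltW.
apply: (@le_trans _ _ (c%:E * \int[mu]_x (c^-1%:E * S x))).
  apply: lee_wpmul2l; first by rewrite lee_fin ltW.
  apply: ge0_le_integral_nomeas => x _ //.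
  apply: (@le_trans _ _ (c^-1%:E * (c%:E * f x))); last by rewrite lee_wpmul2l ?lee_fin.
  by rewrite muleA -EFinM mulVf ?gt_eqF// mul1e.
by rewrite ge0_integralZl// muleA -EFinM mulfV ?gt_eqF// mul1e.
Qed.

Lemma wenvel_pow (j : nat) (p : R) x : (0 < p)%R ->
  ((wt D s j)%:E * envel j x) `^ p = (wt D s j `^ p)%:E * envel j x `^ p.
Proof. by move=> p0; rewrite poweRM ?lee_fin ?wt_ge0 ?envel_ge0// poweR_EFin. Qed.

Lemma integral_osc_le (Ct p : R) : (0 < Ct)%R -> (Ct <= K)%R -> (0 < p)%R ->
  ((p < 1)%R -> (om * (1 - p) < gam * p)%R) -> exists2 C : R, (0 <= C)%R &
  forall k, (wt D s k `^ p)%:E * \int[mu]_x osc D Ct p k synth x <=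
  C%:E * \esum_(j in [set: nat])
    ((decay p ^+ `|k - j%:Z|%N * decay p ^+ `|k - j%:Z|%N)%:E *
     ((wt D s j `^ p)%:E * \int[mu]_x coefun j x `^ p)).
Proof.
move=> Ct0 CtK p0 gp; have [C C00 HC] := osc_le Ct0 CtK p0.
have [C' C'0 HC'] := envel_pow_int p0 gp.
exists (C * ((1 + CA) * C'))%R; first by rewrite !mulr_ge0// addr_ge0// CA_ge0.
move=> k; have /andP[dk0 dk1] := decay01 p0.
have wp0 : (0 < wt D s k `^ p)%R by rewrite powR_gt0// wt_gt0.
pose kk (j : nat) := (decay p ^+ `|k - j%:Z|%N * decay p ^+ `|k - j%:Z|%N)%R.
have kk0 j : (0 <= kk j)%R by exact: mulr_ge0_sq.
pose G (j : nat) y := ((wt D s j)%:E * envel j y) `^ p.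
have G0 j y : 0 <= G j y by exact: poweR_ge0.
have mG j : measurable_fun setT (G j) by exact: measurable_wenvel.
have GG0 j y : 0 <= G j y + avr k (G j) y by rewrite adde_ge0// avr_ge0.
have mGG j : measurable_fun setT (fun x => G j x + avr k (G j) x).
  by apply: emeasurable_funD => //; exact: measurable_avr.
pose S x := \esum_(j in [set: nat]) ((kk j)%:E * (G j x + avr k (G j) x)).
have mS : measurable_fun setT S.
  apply: measurable_esum; first exact: countableP.
    by move=> j y; rewrite mule_ge0 ?lee_fin.
  by move=> j _; exact: measurable_funeM.
have S0 x : 0 <= S x by apply: esum_ge0 => j _; rewrite mule_ge0 ?lee_fin.
have step : (wt D s k `^ p)%:E * \int[mu]_x osc D Ct p k synth x <= C%:E * \int[mu]_x S x.
  have -> : C%:E * \int[mu]_x S x = \int[mu]_x (C%:E * S x).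
    by rewrite ge0_integralZl// lee_fin.
  apply: integral_scale_le => //; [by move=> x; exact: osc_ge0|exact: measurable_funeM|exact: HC].
apply: (le_trans step); rewrite EFinM -muleA; apply: lee_wpmul2l; first by rewrite lee_fin.
rewrite /S integral_esum//; last 3 first.
- exact: countableP.
- by move=> j y; rewrite mule_ge0 ?lee_fin.
- by move=> j _; exact: measurable_funeM.
have I0 (j : nat) : 0 <= (wt D s j `^ p)%:E * \int[mu]_x coefun j x `^ p.
  by rewrite mule_ge0 ?lee_fin ?powR_ge0// integral_ge0// => x _; exact: poweR_ge0.
rewrite -esumZl ?lee_fin ?mulr_ge0 ?addr_ge0 ?CA_ge0//; last first.
  by move=> j; apply: mule_ge0 => //; rewrite lee_fin; exact: mulr_ge0_sq.
apply: le_esum => j _; rewrite ge0_integralZl ?lee_fin//.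
rewrite muleCA; apply: lee_wpmul2l; first by rewrite lee_fin kk0.
rewrite ge0_integralD//; last 2 first.
- by move=> x _; exact: avr_ge0.
- exact: measurable_avr.
apply: (@le_trans _ _ ((1 + CA)%:E * \int[mu]_x G j x)).
  rewrite EFinD ge0_muleDl ?lee_fin ?CA_ge0// mul1e leeD//; exact: integral_avr.
rewrite EFinM -muleA; apply: lee_wpmul2l; first by rewrite lee_fin addr_ge0// CA_ge0.
rewrite /G (_ : (fun y => _ `^ p) = (fun y => (wt D s j `^ p)%:E * envel j y `^ p)); last first.
  by apply/funext => y; rewrite wenvel_pow.
rewrite integralTZ; first last.
- by move=> y; exact: poweR_ge0.
- apply: measurable_poweR_comp; exact: measurable_envel.
- exact: powR_ge0.
rewrite [X in _ <= X]muleCA; apply: lee_wpmul2l; last exact: HC'.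
by rewrite lee_fin; exact: powR_ge0.
Qed.

(** * Oscillations integrated at each scale *)

Lemma lip_sum_lty (Ct p : R) q : (0 < Ct)%R -> (Ct <= K)%R -> (0 < p)%R ->
  ((p < 1)%R -> (om * (1 - p) < gam * p)%R) -> 0 < q ->
  lq q [set: nat] (fun j : nat => (wt D s j)%:E * (\int[mu]_x coefun j x `^ p) `^ p^-1) < +oo ->
  lq q [set: int] (fun k => (wt D s k)%:E * lip_osc D Ct p%:E k synth) < +oo.
Proof.
move=> Ct0 CtK p0 gp q0 fin; have [C C00 HC] := integral_osc_le Ct0 CtK p0 gp.
pose b (j : nat) := (wt D s j)%:E * (\int[mu]_x coefun j x `^ p) `^ p^-1.
have I0 (j : nat) : 0 <= \int[mu]_x coefun j x `^ p.
  by apply: integral_ge0 => x _; exact: poweR_ge0.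
have b0 j : 0 <= b j by rewrite mule_ge0 ?poweR_ge0// lee_fin wt_ge0.
have bp j : b j `^ p = (wt D s j `^ p)%:E * \int[mu]_x coefun j x `^ p.
  by rewrite poweRM ?poweR_ge0 ?lee_fin ?wt_ge0// poweR_EFin poweRVK ?gt_eqF.
have pV : (0 < p^-1)%R by rewrite invr_gt0.
(* The convolution bound holds between [p]-th powers, so [lq_geo] is applied with the exponent
   [q / p], which may be below 1. *)
pose Q := q * p^-1%:E.
have Q0 : 0 < Q by rewrite mule_gt0.
have QE : Q * p%:E = q by rewrite /Q -muleA -EFinM mulVf ?gt_eqF// mule1.
have [C' C'0 HC'] := lq_geo (decay01 p0) Q0.
pose E (k : int) := \esum_(j in [set: nat])
    ((decay p ^+ `|k - j%:Z|%N * decay p ^+ `|k - j%:Z|%N)%:E * b j `^ p).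
have E0 k : 0 <= E k.
  apply: esum_ge0 => j _; apply: mule_ge0; last exact: poweR_ge0.
  by rewrite lee_fin; exact: mulr_ge0_sq.
have step k : (wt D s k)%:E * lip_osc D Ct p%:E k synth <= (C%:E * E k) `^ p^-1.
  have O0 : 0 <= \int[mu]_x osc D Ct p k synth x by apply: integral_ge0 => x _; exact: osc_ge0.
  rewrite -poweR_leP ?mule_ge0 ?poweR_ge0 ?lee_fin ?wt_ge0//.
  rewrite poweRM ?poweR_ge0 ?lee_fin ?wt_ge0// poweR_EFin /lip_osc poweRVK ?gt_eqF//.
  apply: le_trans (HC k) _; apply: lee_wpmul2l; first by rewrite lee_fin.
  by apply: le_esum => j _; rewrite bp.
apply: (@le_lt_trans _ _ ((C%:E * (C'%:E * (lq q [set: nat] b) `^ p)) `^ p^-1)); last first.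
  have lf : (lq q [set: nat] b) `^ p < +oo.
    by apply: poweR_lty.
  apply: poweR_lty; rewrite lte_mul_pinfty ?lee_fin// lte_mul_pinfty ?lee_fin//.
apply: (@le_trans _ _ (lq q [set: int] (fun k => (C%:E * E k) `^ p^-1))).
  apply: le_lq => // k _.
  by rewrite mule_ge0 ?lee_fin ?wt_ge0// poweR_ge0.
apply: le_trans (lq_poweR q0 pV _ _) _ => //.
- by exists 0%R.
- by move=> k; rewrite mule_ge0.
apply: le_poweR; [exact: ltW| |].
  by apply: lq_ge0 => //; [exists 0%R|move=> k; rewrite mule_ge0].
apply: le_trans (lqZl _ Q0 C00 E0) _; apply: lee_wpmul2l; first by rewrite lee_fin.
apply: le_trans (HC' _ _) _; first by move=> j; exact: poweR_ge0.
apply: lee_wpmul2l; first by rewrite lee_fin.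
by rewrite -QE; apply: lq_poweR.
Qed.

Lemma avr_ub m h e x : (forall y, 0 <= h y) -> (forall y, h y <= e) -> avr m h x <= e.
Proof.
move=> h0 he; apply: (le_trans (le_avr m x h0 he)).
have e0 : 0 <= e by exact: le_trans (h0 x) (he x).
case: e e0 {he} => [r||]// _; first by rewrite avr_cst.
by rewrite leey.
Qed.

Lemma envel_ub j e x : (forall t, idx_at D (lev j) t -> (a j t)%:E <= e) ->
  envel j x <= ((1 - th)^-1)%:E * e.
Proof.
move=> ae; have he y : coefun j y <= e by apply: ae; exact: cidx_at.
have e0 : 0 <= e by exact: le_trans (coefun_ge0 j x) (he x).
apply: le_trans (esum_geoZ t01 e0); apply: le_esum => l _.
apply: lee_wpmul2l; first by rewrite lee_fin; apply: exprn_ge0; exact: powR_ge0.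
by apply: avr_ub => // y; exact: coefun_ge0.
Qed.

Lemma lip_sup_lty (Ct : R) q (A : nat -> \bar R) : (0 < Ct)%R -> (Ct <= K)%R -> X -> 0 < q ->
  (forall j, 0 <= A j) -> (forall j t, idx_at D (lev j) t -> (a j t)%:E <= A j) ->
  lq q [set: nat] (fun j : nat => (wt D s j)%:E * A j) < +oo ->
  lq q [set: int] (fun k => (wt D s k)%:E * lip_osc D Ct +oo k synth) < +oo.
Proof.
move=> Ct0 CtK x0 q0 A0' aA fin; have [C C00 HC] := synth_diff_pow (@ltr01 R).
have [C' C'0 HC'] := lq_geo (decay01 (@ltr01 R)) q0.
pose b (j : nat) := (wt D s j)%:E * A j.
have b0 j : 0 <= b j by apply: mule_ge0 => //; rewrite lee_fin wt_ge0.
have tV : (0 <= (1 - th)^-1)%R by have /andP[_ h] := t01; rewrite invr_ge0 subr_ge0 ltW.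
pose M := (C * (2 * (1 - th)^-1))%R.
have M0 : (0 <= M)%R by apply: mulr_ge0 => //; exact: mulr_ge0.
pose E (k : int) := \esum_(j in [set: nat])
    ((decay 1 ^+ `|k - j%:Z|%N * decay 1 ^+ `|k - j%:Z|%N)%:E * b j).
have E0 k : 0 <= E k.
  by apply: esum_ge0 => j _; apply: mule_ge0 => //; rewrite lee_fin; exact: mulr_ge0_sq.
have pw k x y : (d x y <= rho k)%R -> `|synth x - synth y|%:E <= (wt D s k)^-1%:E * (M%:E * E k).
  move=> xy; have w0 := wt_gt0 k.
  apply: (@le_trans _ _ ((wt D s k)^-1%:E * (wt D s k * `|synth x - synth y|)%:E)).
    by rewrite -EFinM mulrA mulVf ?gt_eqF// mul1r.
  apply: lee_wpmul2l; first by rewrite lee_fin invr_ge0 ltW.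
  have := HC k x y xy; rewrite poweRe1; last by rewrite lee_fin; apply: mulr_ge0 => //; exact: ltW.
  move=> /le_trans; apply; rewrite /M EFinM -muleA; apply: lee_wpmul2l; first by rewrite lee_fin.
  rewrite -esumZl ?lee_fin//; last 2 first.
  - exact: mulr_ge0.
  - by move=> j; apply: mule_ge0 => //; rewrite lee_fin; exact: mulr_ge0_sq.
  apply: le_esum => j _.
  have U0 := envel_ge0 j; have w00 : 0 <= (wt D s j)%:E by rewrite lee_fin wt_ge0.
  rewrite poweRe1; last by apply: mule_ge0 => //; apply: adde_ge0.
  rewrite [X in _ <= X]muleCA; apply: lee_wpmul2l.
    by rewrite lee_fin; exact: mulr_ge0_sq.
  rewrite /b [X in _ <= X]muleCA; apply: lee_wpmul2l => //.
  rewrite mulr_natl mulr2n EFinD ge0_muleDl ?lee_fin//.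
  by apply: leeD; apply: envel_ub; exact: aA.
have step k : (wt D s k)%:E * lip_osc D Ct +oo k synth <= M%:E * E k.
  have w0 := wt_gt0 k.
  apply: (@le_trans _ _ ((wt D s k)%:E * ((wt D s k)^-1%:E * (M%:E * E k)))); last first.
    by rewrite muleA -EFinM mulfV ?gt_eqF// mul1e.
  apply: lee_wpmul2l; first by rewrite lee_fin ltW.
  have r0 : 0 <= (wt D s k)^-1%:E * (M%:E * E k).
    by apply: mule_ge0; [rewrite lee_fin invr_ge0 ltW|apply: mule_ge0; rewrite ?lee_fin].
  apply/ess_supP; apply: nearW => x; apply/ess_supP; apply: nearW => y.
  rewrite patchE; case: ifPn => // /set_mem /= xy; apply: pw.
  by apply: (le_trans (ltW xy)); rewrite ler_wpM2r// ltW// delz_gt0.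
(* The essential supremum of a nonnegative function is nonnegative only if the measure is non-zero;
   the ball about the given point [x0] ensures this. *)
have muT : 0 < mu [set: X].
  apply: lt_le_trans (le_measure mu _ _ (@subsetT _ (qball H x0 1))); rewrite ?inE//.
    by have /andP[] := qball_mu_bounds H x0 (@ltr01 R).
  exact: qball_measurable.
apply: (@le_lt_trans _ _ (M%:E * (C'%:E * lq q [set: nat] b))); last first.
  by rewrite lte_mul_pinfty ?lee_fin// lte_mul_pinfty ?lee_fin.
apply: (@le_trans _ _ (lq q [set: int] (fun k => M%:E * E k))).
  apply: le_lq => // k _; apply: mule_ge0; first by rewrite lee_fin wt_ge0.
  by apply: ess_sup_gee => //; apply: nearW => x; apply: ess_sup_gee => //; apply: nearW => y;
    rewrite patchE; case: ifP.
apply: le_trans (lqZl _ q0 M0 E0) _; apply: lee_wpmul2l => //.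
exact: HC'.
Qed.

Lemma measurable_lq q (f : nat -> X -> \bar R) : 0 < q -> (forall i x, 0 <= f i x) ->
  (forall i, measurable_fun setT (f i)) ->
  measurable_fun setT (fun x => lq q [set: nat] (fun i => f i x)).
Proof.
case: q => [q||]// q0 f0 mf.
  apply: measurable_poweR_comp; apply: measurable_esum; first exact: countableP.
    by move=> i x; exact: poweR_ge0.
  by move=> i _; exact: measurable_poweR_comp.
rewrite (_ : (fun x => _) = (fun x => esups (f ^~ x) 0%N)); first exact: measurable_fun_esups.
apply/funext => x; rewrite /lq /esups/= /sdrop; congr (ereal_sup (_ @` _)).
by apply/seteqP; split.
Qed.

(** * Oscillations in mixed norms *)

Section lipt_atoms.
Variables (Ct p u : R) (q : \bar R).
Hypotheses (Ct0 : (0 < Ct)%R) (CtK : (Ct <= K)%R) (u01 : (0 < u <= 1)%R)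
  (up : (u < p)%R) (uq : u%:E < q) (gu : (om * (1 - u) < gam * u)%R).

Let u0 : (0 < u)%R. Proof. by have /andP[] := u01. Qed.
Let th' := (th `^ u * (del^-1 `^ om) `^ (1 - u))%R.
Let th'01 : (0 < th' < 1)%R. Proof. exact: th_reverse01. Qed.
Let h j x := ((wt D s j%:Z)%:E * coefun j x) `^ u.
Let h0 j x : 0 <= h j x. Proof. exact: poweR_ge0. Qed.
Let mh j : measurable_fun setT (h j).
Proof. by apply: measurable_poweR_comp; apply: measurable_funeM; exact: measurable_coefun. Qed.
(** The first average comes from [smo]; the second, three levels coarser, dominates a further
    average of the first at a finer scale. *)
Let e l j x := avr (j%:Z - 4 - l%:Z) (h j) x + avr (j%:Z - 7 - l%:Z) (h j) x.
Let e0 l j x : 0 <= e l j x. Proof. by rewrite adde_ge0// avr_ge0. Qed.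
Let me_ l j : measurable_fun setT (e l j).
Proof. by apply: emeasurable_funD; exact: measurable_avr. Qed.
Let J j x := \esum_(l in [set: nat]) ((th' ^+ l)%:E * e l j x).
Let tl l : 0 <= (th' ^+ l)%:E.
Proof. by rewrite lee_fin; apply: exprn_ge0; apply: ltW; case/andP: th'01. Qed.
Let J0 j x : 0 <= J j x. Proof. by apply: esum_ge0 => l _; exact: mule_ge0. Qed.

Lemma wenvel_le : exists2 C : R, (0 <= C)%R & forall j x,
  ((wt D s j%:Z)%:E * envel j x) `^ u <= C%:E * smo th' (j%:Z - 4) (h j) x.
Proof.
have [C C00 HC] := smo_pow_le t01 i0 u01.
exists C => // j x; rewrite wenvel_pow// envelE.
have w0 : (0 <= wt D s j%:Z `^ u)%R by exact: powR_ge0.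
apply: le_trans (lee_wpmul2l _ (HC (j%:Z - 1)%R (a j) (a0 j) x)) _; first by rewrite lee_fin.
rewrite muleCA; apply: lee_wpmul2l; first by rewrite lee_fin.
rewrite -/th' (_ : j%:Z - 1 - 3 = j%:Z - 4)%R; last by clear; lia.
set g := (fun y => _); have g0 y : 0 <= g y by rewrite lee_fin powR_ge0.
have hE : h j = fun y => (wt D s j%:Z `^ u)%:E * g y.
  apply/funext => y; rewrite /h poweRM ?lee_fin ?wt_ge0 ?coefun_ge0//.
  by rewrite poweR_EFin coefunE poweR_EFin.
have mg : measurable_fun setT g.
  exact: (@measurable_cidx _ _ _ (fun t => (a j t `^ u)%:E)).
rewrite /smo -esumZl ?lee_fin//; last by move=> l; apply: mule_ge0 => //; exact: avr_ge0.
apply: le_esum => l _; rewrite muleCA; apply: lee_wpmul2l => //.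
by rewrite hE avrZ.
Qed.

(** Averaging [smo] at level [k], the terms at coarser scales are nearly unchanged and go into [J].
    Those at finer scales are absorbed by an average at level [k - 5], independent of [l], so that
    their weights can be summed. *)
Lemma avr_smo_le : exists2 C : R, (0 <= C)%R & forall (k : int) j x,
  smo th' (j%:Z - 4) (h j) x + avr k (smo th' (j%:Z - 4) (h j)) x <=
  C%:E * (J j x + avr (k - 5) (h j) x).
Proof.
pose c := (CA + CA * Cvol 5)%R.
have c0 : (0 <= c)%R by rewrite addr_ge0 ?mulr_ge0 ?CA_ge0// ltW// Cvol_gt0.
have /andP[t0 t1] := th'01.
have tV : (0 <= (1 - th')^-1)%R by rewrite invr_ge0 subr_ge0 ltW.
exists (1 + c * (1 + (1 - th')^-1))%R.
  by apply: addr_ge0 => //; apply: mulr_ge0 => //; exact: addr_ge0.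
move=> k j x; have A0k : 0 <= avr (k - 5) (h j) x by exact: avr_ge0.
have S0 := smo_ge0 th'01 (j%:Z - 4)%R _ (h0 j).
have SJ : smo th' (j%:Z - 4) (h j) x <= J j x.
  by apply: le_esum => l _; apply: lee_wpmul2l => //; rewrite /e leeDl// avr_ge0.
have AJ : avr k (smo th' (j%:Z - 4) (h j)) x <=
    c%:E * (J j x + ((1 - th')^-1)%:E * avr (k - 5) (h j) x).
  rewrite /smo avr_esum; first last.
  - by move=> l _; apply: measurable_funeM; exact: measurable_avr.
  - by move=> l y; apply: mule_ge0 => //; exact: avr_ge0.
  - exact: countableP.
  apply: (@le_trans _ _ (\esum_(l in [set: nat]) (c%:E * ((th' ^+ l)%:E * (e l j x + avr (k - 5) (h j) x))))).
    apply: le_esum => l _; rewrite avrZ; first last.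
    - exact: measurable_avr.
    - by move=> y; exact: avr_ge0.
    - by rewrite -lee_fin.
    rewrite [X in _ <= X]muleCA; apply: lee_wpmul2l => //.
    have A7 : 0 <= avr (j%:Z - 7 - l%:Z) (h j) x by exact: avr_ge0.
    have [mk|km] := leP (j%:Z - 4 - l%:Z)%R k.
      apply: le_trans (avr_avr_fine x mk (h0 j) (mh j)) _.
      rewrite (_ : j%:Z - 4 - l%:Z - 3 = j%:Z - 7 - l%:Z)%R; last by clear; lia.
      apply: lee_pmul => //; first by rewrite lee_fin CA_ge0.
        by rewrite lee_fin lerDl mulr_ge0 ?CA_ge0// ltW// Cvol_gt0.
      by rewrite /e -addeA addeC -addeA leeDl// adde_ge0// avr_ge0.
    apply: le_trans (avr_avr_coarse x km (h0 j) (mh j)) _.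
    apply: lee_pmul => //; first by rewrite lee_fin mulr_ge0 ?CA_ge0// ltW// Cvol_gt0.
      by rewrite lee_fin lerDr CA_ge0.
    by rewrite leeDr// e0.
  rewrite esumZl ?lee_fin//; last by move=> l; apply: mule_ge0 => //; exact: adde_ge0.
  apply: lee_wpmul2l; first by rewrite lee_fin.
  apply: (@le_trans _ _ (\esum_(l in [set: nat]) ((th' ^+ l)%:E * e l j x + (th' ^+ l)%:E * avr (k - 5) (h j) x))).
    by apply: le_esum => l _; rewrite ge0_muleDr.
  rewrite esumD; try by move=> l _; apply: mule_ge0.
  by rewrite leeD2l//; exact: esum_geoZ.
apply: le_trans (leeD SJ AJ) _.
have Jx := J0 j x; have q1 : 0 <= ((1 - th')^-1)%:E * avr (k - 5) (h j) x.
  by apply: mule_ge0; rewrite ?lee_fin.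
have o0 : (0 <= 1 + (1 - th')^-1)%R by exact: addr_ge0.
have co0 : (0 <= c * (1 + (1 - th')^-1))%R by exact: mulr_ge0.
rewrite (EFinD 1 (c * _)) ge0_muleDl ?lee_fin//.
rewrite mul1e leeD//; first by rewrite leeDl.
rewrite EFinM -muleA; apply: lee_wpmul2l; first by rewrite lee_fin.
rewrite EFinD ge0_muleDl ?lee_fin// mul1e; apply: leeD; first by rewrite leeDl.
by apply: lee_wpmul2l; rewrite ?lee_fin// leeDr.
Qed.

Let kk (k : int) (j : nat) := (decay u ^+ `|k - j%:Z|%N * decay u ^+ `|k - j%:Z|%N)%R.
Let kk0 k j : 0 <= (kk k j)%:E. Proof. by rewrite lee_fin; exact: mulr_ge0_sq. Qed.
Let M k y := \esum_(j in [set: nat]) ((kk k j)%:E * h j y).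
Let M0 k y : 0 <= M k y. Proof. by apply: esum_ge0 => j _; exact: mule_ge0. Qed.
Let mM k : measurable_fun setT (M k).
Proof.
apply: measurable_esum; first exact: countableP.
  by move=> j x; exact: mule_ge0.
by move=> j _; exact: measurable_funeM.
Qed.
Let N k x := \esum_(j in [set: nat]) ((kk k j)%:E * J j x).
Let N0 k x : 0 <= N k x. Proof. by apply: esum_ge0 => j _; exact: mule_ge0. Qed.

(** Two kinds of averages are left: in [N] the scale follows [j] up to the offset [l], in the other
    term it follows [k]. In each, a fixed function is averaged at one scale, which is the form that
    [avr_vector] treats. *)
Lemma osc_pointwise : exists2 C : R, (0 <= C)%R & forall (k : int) x,
  (wt D s k `^ u)%:E * osc D Ct u k synth x <= C%:E * (N k x + avr (k - 5) (M k) x).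
Proof.
have [C C00 HC] := osc_le Ct0 CtK u0.
have [C' C'0 HC'] := wenvel_le; have [C'' C''0 HC''] := avr_smo_le.
exists (C * (C' * C''))%R; first by do 2 apply: mulr_ge0 => //.
move=> k x; apply: (le_trans (HC k x)).
rewrite EFinM -muleA; apply: lee_wpmul2l; first by rewrite lee_fin.
have A5 j : 0 <= avr (k - 5) (h j) x by exact: avr_ge0.
rewrite avr_esum; first last.
- by move=> j _; exact: measurable_funeM.
- by move=> j y; exact: mule_ge0.
- exact: countableP.
rewrite /N -esumD; last 2 first.
- by move=> j _; exact: mule_ge0.
- by move=> j _; apply: avr_ge0 => y; exact: mule_ge0.
rewrite -esumZl; first last.
- by move=> j; apply: adde_ge0; [exact: mule_ge0|apply: avr_ge0 => y; exact: mule_ge0].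
- by rewrite lee_fin mulr_ge0.
apply: le_esum => j _; rewrite -/(kk k j) avrZ//; last by rewrite -lee_fin; exact: kk0.
rewrite -ge0_muleDr// [X in _ <= X]muleCA; apply: lee_wpmul2l => //.
have S0 y : 0 <= smo th' (j%:Z - 4) (h j) y by exact: smo_ge0.
have mS : measurable_fun setT (smo th' (j%:Z - 4) (h j)) by exact: (measurable_smo th'01 _ (h0 j)).
rewrite EFinM -muleA; apply: (le_trans _ (lee_wpmul2l _ (HC'' k j x))); last by rewrite lee_fin.
rewrite ge0_muleDr//; last exact: avr_ge0.
apply: leeD => //; rewrite -avrZ//; apply: le_avr => // y; exact: poweR_ge0.
Qed.

Let P := (p / u)%R.
Let Q := q * u^-1%:E.
Let P1 : (1 < P)%R. Proof. by rewrite ltr_pdivlMr// mul1r. Qed.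
Let P0 : (0 < P)%R. Proof. exact: lt_trans P1. Qed.
Let q0 : 0 < q. Proof. by apply: lt_trans uq; rewrite lte_fin. Qed.
Let Q1 : 1 < Q.
Proof.
rewrite /Q; move: uq; case: (q) => [r||]//; last by rewrite gt0_mulye ?ltey// lte_fin invr_gt0.
by rewrite -EFinM !lte_fin ltr_pdivlMr// mul1r.
Qed.
Let Q0 : 0 < Q. Proof. exact: lt_trans Q1. Qed.
Let HQ x := lq Q [set: nat] (fun j => h j x).
Let HQ0 x : 0 <= HQ x. Proof. exact: lq_ge0. Qed.
Let mHQ : measurable_fun setT HQ. Proof. exact: measurable_lq. Qed.
Let HI := \int[mu]_x HQ x `^ P.
Let HI0 : 0 <= HI. Proof. by apply: integral_ge0 => x _; exact: poweR_ge0. Qed.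
Let mHQP : measurable_fun setT (fun x => HQ x `^ P).
Proof. exact: measurable_poweR_comp. Qed.

Lemma lq_decay : exists2 C : R, (0 <= C)%R & forall f : nat -> \bar R,
  (forall j, 0 <= f j) ->
  lq Q [set: nat] (fun k : nat => \esum_(j in [set: nat]) ((kk k%:Z j)%:E * f j)) <=
  C%:E * lq Q [set: nat] f.
Proof.
have [C C00 HC] := lq_geo (decay01 u0) Q0; exists C => // f f0.
apply: le_trans (HC f f0).
by apply: (@lq_inj_le _ _ _ Posz) => // i i' [].
Qed.

Lemma lipt_coarse : exists2 C : R, (0 <= C)%R &
  \int[mu]_x (lq Q [set: nat] (fun k : nat => avr (k%:Z - 5) (M k%:Z) x)) `^ P <= C%:E * HI.
Proof.
have [C C00 HC] := avr_vector P1 Q1; have [C' C'0 HC'] := lq_decay.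
exists (C * C' `^ P)%R; first by apply: mulr_ge0; [exact: ltW|exact: powR_ge0].
rewrite (_ : (fun x => _) = (fun x => lq Q [set: nat] (fun k : nat => avr (-5 + k%:Z) (M k%:Z) x) `^ P)); last first.
  by apply/funext => x; congr (lq _ _ _ `^ _); apply/funext => k; congr avr; rewrite addrC.
apply: le_trans (HC (fun k : nat => M k%:Z) (-5)%R (fun k => M0 k%:Z) (fun k => mM k%:Z)) _.
rewrite EFinM -muleA; apply: lee_wpmul2l; first by rewrite lee_fin ltW.
rewrite -integralTZ//; last 2 first.
- exact: powR_ge0.
- by move=> x; exact: poweR_ge0.
apply: ge0_le_integral_nomeas => x _; first exact: poweR_ge0.
rewrite -poweRZl//; apply: le_poweR; [exact: ltW|by apply: lq_ge0|exact: HC'].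
Qed.

Let E l x := lq Q [set: nat] (fun j => e l j x).

(** The constant does not depend on [l] because [avr_vector] is uniform in the offset of the
    levels. *)
Lemma lipt_shift : exists2 C : R, (0 <= C)%R & forall l,
  \int[mu]_x E l x `^ P <= C%:E * HI.
Proof.
have [C C00 HC] := avr_vector P1 Q1; have [C' C'0 HC'] := le_lqD Q0.
have Cge : (0 <= C)%R by exact: ltW.
exists (C' `^ P * (2 `^ P * (C + C)))%R.
  by apply: mulr_ge0; [exact: powR_ge0|apply: mulr_ge0; [exact: powR_ge0|exact: addr_ge0]].
move=> l; pose F (m : int) x := lq Q [set: nat] (fun j : nat => avr (m + j%:Z) (h j) x).
have F0 m x : 0 <= F m x by apply: lq_ge0 => // j; exact: avr_ge0.
have mF m : measurable_fun setT (fun x => F m x `^ P).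
  apply: measurable_poweR_comp; apply: measurable_lq => // j; last exact: measurable_avr.
  by move=> x; exact: avr_ge0.
have FI m : \int[mu]_x F m x `^ P <= C%:E * HI by exact: HC.
have EF x : E l x `^ P <= (C' `^ P * 2 `^ P)%:E * (F (- 4 - l%:Z)%R x `^ P + F (- 7 - l%:Z)%R x `^ P).
  apply: (@le_trans _ _ ((C'%:E * (F (- 4 - l%:Z)%R x + F (- 7 - l%:Z)%R x)) `^ P)).
    apply: le_poweR; [exact: ltW|by apply: lq_ge0|].
    have := HC' (fun j : nat => avr (- 4 - l%:Z + j%:Z) (h j) x) (fun j : nat => avr (- 7 - l%:Z + j%:Z) (h j) x).
    rewrite /E /e.
    rewrite (_ : (fun j : nat => avr (j%:Z - 4 - l%:Z) (h j) x + avr (j%:Z - 7 - l%:Z) (h j) x) =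
       (fun i : nat => avr (-4 - l%:Z + i%:Z) (h i) x + avr (-7 - l%:Z + i%:Z) (h i) x)); last first.
      by apply/funext => j; congr (avr _ _ _ + avr _ _ _); clear; lia.
    by apply => j; exact: avr_ge0.
  rewrite poweRZl//; last exact: adde_ge0.
  rewrite EFinM -muleA; apply: lee_wpmul2l; first by rewrite lee_fin; exact: powR_ge0.
  exact: poweRD_max.
apply: (@le_trans _ _ (\int[mu]_x ((C' `^ P * 2 `^ P)%:E * (F (- 4 - l%:Z)%R x `^ P + F (- 7 - l%:Z)%R x `^ P)))).
  by apply: ge0_le_integral_nomeas => x _; [exact: poweR_ge0|exact: EF].
rewrite integralTZ; first last.
- by move=> x; apply: adde_ge0; exact: poweR_ge0.
- exact: emeasurable_funD.
- by apply: mulr_ge0; exact: powR_ge0.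
rewrite [X in _ <= X%:E * _]mulrA [X in _ <= X * _]EFinM -[X in _ <= X]muleA.
apply: lee_wpmul2l; first by rewrite lee_fin; apply: mulr_ge0; exact: powR_ge0.
rewrite ge0_integralD//; last 2 first.
- by move=> x _; exact: poweR_ge0.
- by move=> x _; exact: poweR_ge0.
by rewrite EFinD ge0_muleDl ?lee_fin//; apply: leeD.
Qed.

Lemma lipt_fine : exists2 C : R, (0 <= C)%R &
  \int[mu]_x (lq Q [set: nat] (fun k : nat => N k%:Z x)) `^ P <= C%:E * HI.
Proof.
have [C C00 HC] := lipt_shift; have [C' C'0 HC'] := lq_decay.
(* Three factors are spent in turn: in [lq_wesum] to take the sum over [l] out of the norm, in
   [lq_geo_weight] to reach a sum of [P]-th powers, and on the convergence of the resulting sum of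
   integrals. *)
pose v := (th' `^ 3^-1)%R.
have v01 : (0 < v < 1)%R by apply: powR_lt1 => //; rewrite invr_gt0.
have v3 : (v ^+ 3 = th')%R.
  by rewrite -powR_mulrn ?powR_ge0// /v -powRrM mulVf// powRr1// ltW//; case/andP: th'01.
have [C'' C''0 HC''] := lq_geo_weight v01 Q0 P0.
have w01 := powR_lt1 v01 P0; have /andP[w0 w1] := w01.
have /andP[v0 v1] := v01.
have vl l : (0 <= v ^+ l)%R by exact/exprn_ge0/ltW.
have Vv : (0 <= (1 - v)^-1)%R by rewrite invr_ge0 subr_ge0 ltW.
have wV : (0 <= (1 - v `^ P)^-1)%R by rewrite invr_ge0 subr_ge0 ltW.
pose B := (C' * (1 - v)^-1)%R.
have B0 : (0 <= B)%R by exact: mulr_ge0.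
have E0 l x : 0 <= E l x by exact: lq_ge0.
exists (B `^ P * (C'' * ((1 - v `^ P)^-1 * C)))%R.
  by apply: mulr_ge0; [exact: powR_ge0|do 2 apply: mulr_ge0 => //].
pose T x := \esum_(l in [set: nat]) (((v `^ P) ^+ l)%:E * E l x `^ P).
have t0 l x : 0 <= ((v `^ P) ^+ l)%:E * E l x `^ P.
  by apply: mule_ge0; [rewrite lee_fin; exact/exprn_ge0/ltW|exact: poweR_ge0].
have mt l : measurable_fun setT (fun x => ((v `^ P) ^+ l)%:E * E l x `^ P).
  by apply: measurable_funeM; apply: measurable_poweR_comp; exact: measurable_lq.
have pw x : (lq Q [set: nat] (fun k : nat => N k%:Z x)) `^ P <= (B `^ P * C'')%:E * T x.
  apply: (@le_trans _ _ ((B%:E * lq Q [set: nat] (fun l => (v ^+ l)%:E * ((v ^+ l)%:E * E l x))) `^ P)).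
    apply: le_poweR; [exact: ltW|by apply: lq_ge0|].
    apply: le_trans (HC' _ (fun j => J0 j x)) _; rewrite /B EFinM -muleA.
    apply: lee_wpmul2l; first by rewrite lee_fin.
    rewrite /J; under [X in lq Q _ X]eq_fun do under eq_esum do rewrite -v3 -exprM mulnC -[3%N]/(1 + 2)%N mulnDr muln1 exprD EFinM -muleA.
    apply: le_trans (lq_wesum Q0 _ _ vl _ (esum_geo v01)) _ => //.
    - by move=> l j; apply: mule_ge0 => //; rewrite lee_fin; exact/exprn_ge0/ltW.
    apply: lee_wpmul2l; first by rewrite lee_fin.
    apply: le_lq => // l _.
      by apply: lq_ge0 => // j; apply: mule_ge0 => //; rewrite lee_fin; exact/exprn_ge0/ltW.
    rewrite muln2 -addnn exprD muleA -EFinM; apply: lqZl => //.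
    by apply: mulr_ge0.
  have L0 : 0 <= lq Q [set: nat] (fun l => (v ^+ l)%:E * ((v ^+ l)%:E * E l x)).
    by apply: lq_ge0 => // l; apply: mule_ge0; rewrite ?lee_fin//; apply: mule_ge0; rewrite ?lee_fin.
  rewrite poweRZl// EFinM -muleA; apply: lee_wpmul2l; first by rewrite lee_fin; exact: powR_ge0.
  apply: le_trans (HC'' (fun l => (v ^+ l)%:E * E l x) _) _.
    by move=> l; apply: mule_ge0; rewrite ?lee_fin.
  apply: lee_wpmul2l; first by rewrite lee_fin.
  by apply: le_esum => l _; rewrite poweRZl// powR_exprn// ltW.
apply: (@le_trans _ _ (\int[mu]_x ((B `^ P * C'')%:E * T x))).
  by apply: ge0_le_integral_nomeas => x _; [exact: poweR_ge0|exact: pw].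
have BC0 : (0 <= B `^ P * C'')%R by apply: mulr_ge0 => //; exact: powR_ge0.
rewrite integralTZ//; first last.
- by move=> x; exact: esum_ge0.
- by apply: measurable_esum => //; exact: countableP.
rewrite [X in _ <= X%:E * _]mulrA [X in _ <= X * _]EFinM -[X in _ <= X]muleA.
apply: lee_wpmul2l; first by rewrite lee_fin.
rewrite /T integral_esum//; last exact: countableP.
apply: (@le_trans _ _ (\esum_(l in [set: nat]) (((v `^ P) ^+ l)%:E * (C%:E * HI)))).
  apply: le_esum => l _; have vP : (0 <= (v `^ P) ^+ l)%R by exact/exprn_ge0/ltW.
  rewrite integralTZ//; last 2 first.
  - by apply: measurable_poweR_comp; exact: measurable_lq.
  - by move=> x; exact: poweR_ge0.
  by apply: lee_wpmul2l; rewrite ?lee_fin.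
rewrite EFinM -muleA; apply: esum_geoZ => //.
by apply: mule_ge0; rewrite ?lee_fin.
Qed.

Lemma lipt_sum_lty :
  \int[mu]_x (lq q [set: nat] (fun j : nat => (wt D s j%:Z)%:E * coefun j x)) `^ p < +oo ->
  \int[mu]_x (lq q [set: nat] (fun k : nat =>
     (wt D s k%:Z)%:E * osc D Ct u k%:Z synth x `^ u^-1)) `^ p < +oo.
Proof.
move=> fin; have uV : (0 < u^-1)%R by rewrite invr_gt0.
have QE : Q * u%:E = q by rewrite /Q -muleA -EFinM mulVf ?gt_eqF// mule1.
have PE : (u * P = p)%R by rewrite /P mulrCA mulfV ?mulr1// gt_eqF.
have HIfin : HI < +oo.
  apply: le_lt_trans fin; apply: ge0_le_integral_nomeas => x _; first exact: poweR_ge0.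
  have w0 j : 0 <= (wt D s j%:Z)%:E * coefun j x.
    by apply: mule_ge0; [rewrite lee_fin; exact: wt_ge0|exact: coefun_ge0].
  rewrite -PE poweRrM; apply: le_poweR; [exact: ltW|exact: HQ0|].
  by rewrite -[X in _ <= (lq X _ _) `^ _]QE; apply: lq_poweR.
have [C C00 HC] := osc_pointwise; have [c1 c10 Hc1] := lipt_fine.
have [c2 c20 Hc2] := lipt_coarse; have [c3 c30 Hc3] := le_lqD Q0.
pose LN x := lq Q [set: nat] (fun k : nat => N k%:Z x).
pose LM x := lq Q [set: nat] (fun k : nat => avr (k%:Z - 5) (M k%:Z) x).
have A0' (k : int) x : 0 <= avr (k - 5) (M k) x by exact: avr_ge0.
have LN0 x : 0 <= LN x by exact: lq_ge0.
have LM0 x : 0 <= LM x by apply: lq_ge0.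
have Cc : (0 <= C * c3)%R by exact: mulr_ge0.
pose G := ((C * c3) `^ P * 2 `^ P)%R.
have G0 : (0 <= G)%R by apply: mulr_ge0; exact: powR_ge0.
have mN k : measurable_fun setT (N k).
  apply: measurable_esum; first exact: countableP.
    by move=> j x; exact: mule_ge0.
  move=> j _; apply: measurable_funeM; apply: measurable_esum; first exact: countableP.
    by move=> l x; exact: mule_ge0.
  by move=> l _; exact: measurable_funeM.
have mLN : measurable_fun setT (fun x => LN x `^ P).
  by apply: measurable_poweR_comp; apply: measurable_lq.
have mLM : measurable_fun setT (fun x => LM x `^ P).
  apply: measurable_poweR_comp; apply: measurable_lq => // k; exact: measurable_avr.
have pw x : (lq q [set: nat] (fun k : nat =>
     (wt D s k%:Z)%:E * osc D Ct u k%:Z synth x `^ u^-1)) `^ p <=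
     G%:E * (LN x `^ P + LM x `^ P).
  have O0 k : 0 <= osc D Ct u k synth x by exact: osc_ge0.
  pose Y (k : nat) := (wt D s k%:Z `^ u)%:E * osc D Ct u k%:Z synth x.
  have Y0 k : 0 <= Y k by apply: mule_ge0 => //; rewrite lee_fin; exact: powR_ge0.
  have -> : (fun k : nat => (wt D s k%:Z)%:E * osc D Ct u k%:Z synth x `^ u^-1) = (fun k => Y k `^ u^-1).
    apply/funext => k; have wu : ((wt D s k%:Z `^ u) `^ u^-1 = wt D s k%:Z)%R.
      by rewrite -powRrM mulfV ?gt_eqF// powRr1// wt_ge0.
    rewrite -{1}wu; apply/esym; apply: poweRZl => //; exact: powR_ge0.
  apply: (@le_trans _ _ (lq Q [set: nat] Y `^ P)).
    rewrite (_ : P = u^-1 * p)%R; last by rewrite mulrC.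
    rewrite poweRrM; apply: le_poweR; first by apply: ltW; apply: lt_trans up.
      by apply: lq_ge0 => // k; exact: poweR_ge0.
    exact: lq_poweR.
  apply: (@le_trans _ _ (((C * c3)%:E * (LN x + LM x)) `^ P)); last first.
    rewrite poweRZl//; last exact: adde_ge0.
    rewrite /G EFinM -muleA; apply: lee_wpmul2l; first by rewrite lee_fin; exact: powR_ge0.
    exact: poweRD_max.
  apply: le_poweR; [exact: ltW|exact: lq_ge0|].
  apply: (@le_trans _ _ (lq Q [set: nat] (fun k : nat => C%:E * (N k%:Z x + avr (k%:Z - 5) (M k%:Z) x)))).
    by apply: le_lq => // k _; exact: HC.
  apply: le_trans (lqZl _ Q0 C00 _) _; first by move=> k; exact: adde_ge0.
  rewrite EFinM -muleA; apply: lee_wpmul2l; first by rewrite lee_fin.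
  by apply: Hc3.
apply: (@le_lt_trans _ _ (\int[mu]_x (G%:E * (LN x `^ P + LM x `^ P)))).
  by apply: ge0_le_integral_nomeas => x _; [exact: poweR_ge0|exact: pw].
rewrite integralTZ//; first last.
- by move=> x; apply: adde_ge0; exact: poweR_ge0.
- exact: emeasurable_funD.
rewrite lte_mul_pinfty ?lee_fin// ge0_integralD//; last 2 first.
- by move=> x _; exact: poweR_ge0.
- by move=> x _; exact: poweR_ge0.
apply: (@le_lt_trans _ _ (c1%:E * HI + c2%:E * HI)); first exact: leeD.
by apply: lte_add_pinfty; rewrite lte_mul_pinfty ?lee_fin.
Qed.

End lipt_atoms.

(** * Pairing the sum of atoms with a test function *)

Section representation.
Variable g : X -> R.
Hypotheses (mg : measurable_fun setT g)
  (Sg : \int[mu]_x ((\esum_(j in [set: nat]) envel j x) * `|g x|%:E) < +oo).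

Let S x := \esum_(j in [set: nat]) envel j x.
Let S0 x : 0 <= S x. Proof. by apply: esum_ge0 => j _; exact: envel_ge0. Qed.
Let mS : measurable_fun setT S.
Proof.
apply: measurable_esum; [exact: countableP|by move=> j x; exact: envel_ge0|].
by move=> j _; exact: measurable_envel.
Qed.
(** The positive part for [e = 1] and the negative part for [e = -1]. Sums and integrals are
    exchanged for each separately, where monotone convergence applies. *)
Let part (e : R) j t x := (Num.max (e * (phi j t x * g x)) 0)%R.
Let part0 e j t x : (0 <= part e j t x)%R. Proof. by rewrite /part le_max lexx orbT. Qed.
Let mpart e j t : idx_at D (lev j) t -> measurable_fun setT (fun x => (part e j t x)%:E).
Proof.
move=> It; apply/measurable_EFinP/measurable_maxr => //.
by apply: measurable_funM => //; apply: measurable_funM => //; exact: measurable_atom.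
Qed.
Let tot (e : R) x := \esum_(p in atom_idx) (part e p.1 p.2 x)%:E.
Let tot0 e x : 0 <= tot e x. Proof. by apply: esum_ge0 => p _; rewrite lee_fin. Qed.
Let mtot e : measurable_fun setT (tot e).
Proof.
apply: measurable_esum; first exact: atom_idx_countable.
  by move=> p x; rewrite lee_fin.
by move=> [j t] [_ /= It]; exact: mpart.
Qed.
Let tot_le (e : R) x : (`|e| <= 1)%R -> tot e x <= C1%:E * (S x * `|g x|%:E).
Proof.
move=> e1; rewrite muleA muleC -esumZl//; last first.
  by move=> j; exact: envel_ge0.
apply: (@le_trans _ _ (`|g x|%:E * \esum_(p in atom_idx) `|phi p.1 p.2 x|%:E)).
  rewrite -esumZl ?lee_fin//; apply: le_esum => p _; rewrite -EFinM lee_fin /part.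
  rewrite ge_max mulr_ge0// andbT (le_trans (ler_norm _))// !normrM mulrCA mulrC.
  by rewrite -mulrA ler_piMl// mulr_ge0.
apply: lee_wpmul2l; first by rewrite lee_fin.
by rewrite esumZl//; [exact: esum_atoms_le|move=> j; exact: envel_ge0].
Qed.
Let Itot e : (`|e| <= 1)%R -> \int[mu]_x tot e x < +oo.
Proof.
move=> e1; apply: (@le_lt_trans _ _ (\int[mu]_x (C1%:E * (S x * `|g x|%:E)))).
  by apply: ge0_le_integral_nomeas => x _ //; exact: tot_le.
rewrite integralTZ//.
- by rewrite lte_mul_pinfty ?lee_fin.
- by apply: emeasurable_funM => //; apply/measurable_EFinP; exact: measurableT_comp.
- by move=> x; apply: mule_ge0 => //; rewrite lee_fin.
Qed.
Let itot e : (`|e| <= 1)%R -> mu.-integrable setT (tot e).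
Proof.
by move=> e1; apply/integrableP; split => //; under eq_integral do rewrite gee0_abs//; exact: Itot.
Qed.
Let synthM x : (synth x * g x = fine (tot 1 x) - fine (tot (-1) x))%R.
Proof.
rewrite mulrC -usumZ /usum /tot /part; congr (fine _ - fine _)%R; apply: eq_esum => p _.
  by rewrite mul1r mulrC.
by rewrite mulN1r mulrC.
Qed.
Let tot_fin e : (`|e| <= 1)%R -> ae_eq mu setT (EFin \o (fine \o tot e)) (tot e).
Proof.
move=> e1; have := integrable_ae measurableT (itot e1).
by apply: filterS => x /= /(_ I) h _; rewrite fineK.
Qed.
Let ifin e : (`|e| <= 1)%R -> mu.-integrable setT (EFin \o (fine \o tot e)).
Proof.
move=> e1; apply/integrableP; split; first by apply/measurable_EFinP; exact: measurableT_comp.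
apply: le_lt_trans (Itot e1); apply: ge0_le_integral_nomeas => x _ //=.
rewrite ger0_norm ?fine_ge0//; move: (tot0 e x); case: (tot e x) => [r||]//.
Qed.
Let n1 : (`|1| <= 1 :> R)%R. Proof. by rewrite normr1. Qed.
Let nN1 : (`|-1| <= 1 :> R)%R. Proof. by rewrite normrN1. Qed.

Lemma synth_integrable : mu.-integrable setT (fun x => (synth x * g x)%:E).
Proof.
rewrite (_ : (fun x => _) = (EFin \o (fine \o tot 1)) \- (EFin \o (fine \o tot (-1)))).
  by apply: integrableB => //; exact: ifin.
by apply/funext => x; rewrite synthM.
Qed.

Let pairingE : pairing H synth g = (fine (\int[mu]_x tot 1 x) - fine (\int[mu]_x tot (-1) x))%R.
Proof.
rewrite /pairing (_ : (fun x => _) = (fine \o tot 1) \- (fine \o tot (-1)))%R; last first.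
  by apply/funext => x; rewrite synthM.
rewrite RintegralB//; try exact: ifin.
by congr (fine _ - fine _)%R; apply: ae_eq_integral => //; try exact: tot_fin;
  apply/measurable_EFinP; exact: measurableT_comp.
Qed.

Let col e j := \esum_(t in idx_at D (lev j)) \int[mu]_x (part e j t x)%:E.
Let int0 e j t : 0 <= \int[mu]_x (part e j t x)%:E.
Proof. by apply: integral_ge0 => x _; rewrite lee_fin. Qed.
Let col0 e j : 0 <= col e j. Proof. exact: esum_ge0. Qed.
Let sum_col e : \int[mu]_x tot e x = \esum_(j in [set: nat]) col e j.
Proof.
rewrite /tot integral_esum.
- by rewrite (esum_atom_idx (f := fun j t => \int[mu]_x (part e j t x)%:E)).
- exact: atom_idx_countable.
- exact: measurableT.
- by move=> p x; rewrite lee_fin.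
- by move=> [j t] [_ /= It]; exact: mpart.
Qed.
Let col_lty e j : (`|e| <= 1)%R -> col e j < +oo.
Proof.
move=> e1; apply: le_lt_trans (Itot e1); rewrite sum_col.
exact: (@esum_ge_term _ _ [set: nat] (col e)).
Qed.
Let int_lty e j t : (`|e| <= 1)%R -> idx_at D (lev j) t -> \int[mu]_x (part e j t x)%:E < +oo.
Proof.
move=> e1 It; apply: le_lt_trans (col_lty j e1).
exact: (@esum_ge_term _ _ _ (fun t => \int[mu]_x (part e j t x)%:E)).
Qed.

Let pair_atom j t : idx_at D (lev j) t -> pairing H (phi j t) g =
  (fine (\int[mu]_x (part 1 j t x)%:E) - fine (\int[mu]_x (part (-1) j t x)%:E))%R.
Proof.
move=> It; rewrite /pairing /Rintegral integralE.
rewrite (_ : (fun x => _)^\+ = (fun x => (part 1 j t x)%:E)); last first.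
  by apply/funext => x; rewrite /part funeposE mul1r -EFin_max.
rewrite (_ : (fun x => _)^\- = (fun x => (part (-1) j t x)%:E)); last first.
  by apply/funext => x; rewrite /part funenegE mulN1r -EFin_max.
by rewrite fineB// ge0_fin_numE// int_lty.
Qed.

Let usum_atom j : usum (idx_at D (lev j)) (fun t => pairing H (phi j t) g) =
  (fine (col 1 j) - fine (col (-1) j))%R.
Proof.
have fe e : (`|e| <= 1)%R -> \esum_(t in idx_at D (lev j)) (fine (\int[mu]_x (part e j t x)%:E))%:E = col e j.
  by move=> e1; apply: eq_esum => t It; rewrite fineK// ge0_fin_numE// int_lty.
rewrite (@usum_split _ _ _ _ (fun t => fine (\int[mu]_x (part 1 j t x)%:E))
  (fun t => fine (\int[mu]_x (part (-1) j t x)%:E))) ?fe//.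
- by move=> t It; exact: pair_atom.
- by move=> t; exact: fine_ge0.
- by move=> t; exact: fine_ge0.
- exact: col_lty.
- exact: col_lty.
Qed.

Let cvg_col e : (`|e| <= 1)%R ->
  (fun n => \sum_(0 <= j < n) fine (col e j))%R @ \oo --> fine (\int[mu]_x tot e x).
Proof.
move=> e1.
have h : (fun n => \sum_(0 <= j < n) col e j) @ \oo --> \int[mu]_x tot e x.
  rewrite sum_col -nneseries_esumT; last by move=> j; exact: col0.
  exact: is_cvg_nneseries.
have f : \int[mu]_x tot e x \is a fin_num by rewrite ge0_fin_numE ?Itot// integral_ge0.
move: h; rewrite -[X in _ --> X](fineK f) => /fine_cvg.
apply: cvg_trans; apply: near_eq_cvg; apply: nearW => n /=.
by rewrite -sum_fine// => j _; rewrite ge0_fin_numE// col_lty.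
Qed.

(** The limit is over levels, with each level summed unconditionally, because this is the order of
    summation in the reproducing formula. *)
Lemma synth_pairing :
  (fun n => \sum_(0 <= j < n) usum (idx_at D (lev j)) (fun t => pairing H (phi j t) g))%R
    @ \oo --> pairing H synth g.
Proof.
rewrite pairingE (_ : (fun n => _) = (fun n => \sum_(0 <= j < n) fine (col 1 j))%R \-
   (fun n => \sum_(0 <= j < n) fine (col (-1) j))%R)%R.
  by apply: cvgB; exact: cvg_col.
by apply/funext => n /=; rewrite -sumrB; apply: eq_bigr => j _; exact: usum_atom.
Qed.

Lemma atom_pairing_scale j t c (T : X -> R) : idx_at D (lev j) t ->
  (forall x, phi j t x = c * T x)%R -> pairing H (phi j t) g = (c * pairing H T g)%R.
Proof.
(* For [c = 0] the atom gives no control over [T], but both sides vanish. Otherwise [T * g] is a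
   multiple of the integrable function [phi j t * g]. *)
move=> It phiT; have [c0|c0] := eqVneq c 0%R.
  rewrite /pairing (_ : (fun x => _) = cst 0%R); last first.
    by apply/funext => x; rewrite phiT c0 !mul0r.
  by rewrite Rintegral_cst// !mul0r c0 mul0r.
have ipart e : (`|e| <= 1)%R -> mu.-integrable setT (fun x => (part e j t x)%:E).
  move=> e1; apply/integrableP; split; first exact: mpart.
  under eq_integral do rewrite gee0_abs ?lee_fin//.
  exact: int_lty.
have ig : mu.-integrable setT (EFin \o (fun x => phi j t x * g x)%R).
  rewrite (_ : _ \o _ = (fun x => (part 1 j t x)%:E) \- (fun x => (part (-1) j t x)%:E)).
    by apply: integrableB => //; exact: ipart.
  apply/funext => x; rewrite /= -EFinB /part mul1r mulN1r; congr EFin.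
  rewrite !maxEle oppr_le0; set z := (_ * _)%R.
  by case: (leP z 0%R) => z0; case: (leP 0%R z) => z1; lra.
have -> : pairing H T g = (c^-1 * pairing H (phi j t) g)%R.
  rewrite /pairing -RintegralZl//; congr Rintegral; apply/funext => x.
  by rewrite phiT !mulrA mulVf// mul1r.
by rewrite mulrA mulfV// mul1r.
Qed.

Lemma atoms_summable j :
  \esum_(t in idx_at D (lev j)) `|pairing H (phi j t) g|%:E < +oo.
Proof.
apply: (@le_lt_trans _ _ (col 1 j + col (-1) j)); last by apply: lte_add_pinfty; exact: col_lty.
rewrite /col -esumD//; apply: le_esum => t It; rewrite (pair_atom It).
have f e : (`|e| <= 1)%R -> \int[mu]_x (part e j t x)%:E \is a fin_num.
  by move=> e1; rewrite ge0_fin_numE// int_lty.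
rewrite -[X in _ <= X + _]fineK ?f// -[X in _ <= _ + X]fineK ?f// -EFinD lee_fin.
by rewrite (le_trans (ler_normB _ _))// !ger0_norm// fine_ge0.
Qed.

End representation.

Lemma wt_nat (j : nat) : ((del `^ s) ^+ j * wt D s j%:Z = 1)%R.
Proof.
rewrite -powR_mulrn ?powR_ge0// -powRrM /wt -powRD; last by rewrite del_neq0 implybT.
by rewrite mulrC [(j%:Z)%:~R]/(j%:R) subrr powRr0.
Qed.

(** The weight [wt D s j] leaves a spare factor [del ^ (s j)], split into two halves [w ^ j]: one
    for [poweR_geo_esum], the other for the sum of the integrals over the levels. *)
Lemma envel_sum_pow_lty (p B : R) : (0 < p)%R -> ((p < 1)%R -> (om * (1 - p) < gam * p)%R) ->
  (forall j : nat, (wt D s j%:Z `^ p)%:E * \int[mu]_x coefun j x `^ p <= B%:E) ->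
  \int[mu]_x (\esum_(j in [set: nat]) envel j x) `^ p < +oo.
Proof.
move=> p0 gp HB; have s0 : (0 < s)%R by case/andP: s_bound.
pose w := (del `^ (s / 2))%R.
have w01 : (0 < w < 1)%R by apply: powR_lt1; rewrite ?del_gt0 ?del_lt1// divr_gt0.
have ww : (w * w = del `^ s)%R.
  rewrite /w -powRD; last by rewrite del_neq0 implybT.
  by congr (_ `^ _)%R; field.
have [C C00 HC] := envel_pow_int p0 gp.
have v01 := powR_lt1 w01 p0; have /andP[v0 v1] := v01.
have B0 : (0 <= B)%R.
  rewrite -lee_fin; apply: le_trans (HB 0%N); apply: mule_ge0; first by rewrite lee_fin; exact: powR_ge0.
  by apply: integral_ge0 => x _; exact: poweR_ge0.
pose W (j : nat) x := (wt D s j%:Z)%:E * envel j x.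
have W0 j x : 0 <= W j x by apply: mule_ge0; [rewrite lee_fin; exact: wt_ge0|exact: envel_ge0].
have mW j : measurable_fun setT (fun x => W j x `^ p) by exact: measurable_wenvel.
have WI j : \int[mu]_x W j x `^ p <= (C * B)%:E.
  rewrite /W (_ : (fun x => _ `^ p) = (fun x => (wt D s j `^ p)%:E * envel j x `^ p)); last first.
    by apply/funext => x; rewrite wenvel_pow.
  have w0 : (0 <= wt D s j `^ p)%R by exact: powR_ge0.
  rewrite integralTZ//; first last.
  - by move=> x; exact: poweR_ge0.
  - by apply: measurable_poweR_comp; exact: measurable_envel.
  apply: le_trans (lee_wpmul2l _ (HC j)) _; first by rewrite lee_fin.
  by rewrite muleCA EFinM; apply: lee_wpmul2l; rewrite ?lee_fin.
pose c := ((1 - w)^-1 `^ p)%R.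
pose T x := \esum_(l in [set: nat]) (((w `^ p) ^+ l)%:E * W l x `^ p).
have t0 l x : 0 <= ((w `^ p) ^+ l)%:E * W l x `^ p.
  by apply: mule_ge0; [rewrite lee_fin; exact/exprn_ge0/ltW|exact: poweR_ge0].
have mt l : measurable_fun setT (fun x => ((w `^ p) ^+ l)%:E * W l x `^ p).
  exact: measurable_funeM.
apply: (@le_lt_trans _ _ (\int[mu]_x (c%:E * T x))).
  apply: ge0_le_integral_nomeas => x _; first exact: poweR_ge0.
  apply: le_trans (poweR_geo_esum w01 p0 (fun l => W0 l x)).
  rewrite le_eqVlt; apply/orP; left; apply/eqP; congr (_ `^ _); apply: eq_esum => j _.
  by rewrite -exprMn ww /W muleA -EFinM wt_nat mul1e.
rewrite integralTZ//; first last.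
- by move=> x; exact: esum_ge0.
- by apply: measurable_esum => //; exact: countableP.
- exact: powR_ge0.
rewrite lte_mul_pinfty ?lee_fin ?powR_ge0// /T integral_esum//; last exact: countableP.
apply: (@le_lt_trans _ _ (\esum_(l in [set: nat]) (((w `^ p) ^+ l)%:E * (C * B)%:E))).
  apply: le_esum => l _; have vP : (0 <= (w `^ p) ^+ l)%R by exact/exprn_ge0/ltW.
  rewrite integralTZ//; last by move=> x; exact: poweR_ge0.
  by apply: lee_wpmul2l; rewrite ?lee_fin.
apply: le_lt_trans (esum_geoZ v01 _) _; first by rewrite lee_fin mulr_ge0.
by rewrite -EFinM ltry.
Qed.

Lemma synth_Lp (p : R) : (0 < p)%R ->
  \int[mu]_x (\esum_(j in [set: nat]) envel j x) `^ p < +oo -> in_Lp H p%:E synth.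
Proof.
move=> p0 fin; split; first exact: measurable_synth.
rewrite unlock /Lnorm; apply: poweR_lty.
have S0 x : 0 <= \esum_(j in [set: nat]) envel j x by apply: esum_ge0 => j _; exact: envel_ge0.
apply: (@le_lt_trans _ _ (\int[mu]_x ((C1 `^ p)%:E * (\esum_(j in [set: nat]) envel j x) `^ p))).
  apply: ge0_le_integral_nomeas => x _; first exact: poweR_ge0.
  rewrite -poweR_EFin -poweRM ?lee_fin//; apply: le_poweR; [exact: ltW|by rewrite abse_ge0|].
  exact: synth_abs.
rewrite integralTZ ?powR_ge0//; first by rewrite lte_mul_pinfty ?lee_fin ?powR_ge0.
  apply: measurable_poweR_comp; apply: measurable_esum; first exact: countableP.
    by move=> j x; exact: envel_ge0.
  by move=> j _; exact: measurable_envel.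
by move=> x; exact: poweR_ge0.
Qed.

Lemma envel_sum_ub (A : nat -> \bar R) (B : R) :
  (forall j t, idx_at D (lev j) t -> (a j t)%:E <= A j) ->
  (forall j : nat, (wt D s j%:Z)%:E * A j <= B%:E) ->
  exists2 M : R, (0 <= M)%R & forall x, \esum_(j in [set: nat]) envel j x <= M%:E.
Proof.
move=> aA HB; have s0 : (0 < s)%R by case/andP: s_bound.
have w01 : (0 < del `^ s < 1)%R by apply: powR_lt1; rewrite ?del_gt0 ?del_lt1.
have /andP[w0 w1] := w01; have /andP[_ t1] := t01.
have tV : (0 <= (1 - th)^-1)%R by rewrite invr_ge0 subr_ge0 ltW.
have wV : (0 <= (1 - del `^ s)^-1)%R by rewrite invr_ge0 subr_ge0 ltW.
exists ((1 - th)^-1 * ((1 - del `^ s)^-1 * `|B|))%R; first by do 2 apply: mulr_ge0 => //.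
move=> x; apply: (@le_trans _ _ (\esum_(j in [set: nat]) (((1 - th)^-1)%:E * (((del `^ s) ^+ j)%:E * `|B|%:E)))).
  apply: le_esum => j _; apply: le_trans (envel_ub x (aA j)) _.
  apply: lee_wpmul2l; first by rewrite lee_fin.
  apply: (@le_trans _ _ (((del `^ s) ^+ j)%:E * ((wt D s j%:Z)%:E * A j))).
    by rewrite muleA -EFinM wt_nat mul1e.
  apply: lee_wpmul2l; first by rewrite lee_fin; exact/exprn_ge0/ltW.
  by apply: (le_trans (HB j)); rewrite lee_fin ler_norm.
have b0 : 0 <= `|B|%:E by rewrite lee_fin.
rewrite esumZl//; last first.
  by move=> j; apply: mule_ge0 => //; rewrite lee_fin; exact/exprn_ge0/ltW.
rewrite EFinM; apply: lee_wpmul2l; first by rewrite lee_fin.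
by rewrite EFinM; exact: esum_geoZ.
Qed.

Lemma synth_Loo (M : R) : (forall x, \esum_(j in [set: nat]) envel j x <= M%:E) ->
  in_Lp H +oo synth.
Proof.
move=> HM; split; first exact: measurable_synth.
rewrite unlock /Lnorm; case: ifPn => // _.
apply: (@le_lt_trans _ _ (C1%:E * M%:E)); last by rewrite -EFinM ltry.
apply/ess_supP; apply: nearW => x; apply: le_trans (synth_abs x) _.
by apply: lee_wpmul2l; rewrite ?lee_fin.
Qed.

(** With [S] the sum of the envelopes, [S <= 1 + S ^ p]; thus [S * |g|] is at most
    [|g| + M * S ^ p], and both terms are integrable. *)
Lemma envel_test_lty (p M : R) (g : X -> R) : (1 <= p)%R -> measurable_fun setT g ->
  (0 <= M)%R -> (forall x, (`|g x| <= M)%R) -> \int[mu]_x `|g x|%:E < +oo ->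
  \int[mu]_x (\esum_(j in [set: nat]) envel j x) `^ p < +oo ->
  \int[mu]_x ((\esum_(j in [set: nat]) envel j x) * `|g x|%:E) < +oo.
Proof.
pose S x := \esum_(j in [set: nat]) envel j x.
rewrite -/(S _) => p1 mg M0 gM gI SI.
have S0 x : 0 <= S x by apply: esum_ge0 => j _; exact: envel_ge0.
have mS : measurable_fun setT S.
  apply: measurable_esum; first exact: countableP.
    by move=> j x; exact: envel_ge0.
  by move=> j _; exact: measurable_envel.
have ag : measurable_fun setT (fun x => `|g x|%:E) by apply/measurable_EFinP; exact: measurableT_comp.
have mSp : measurable_fun setT (fun x => S x `^ p) by exact: measurable_poweR_comp.
have p0 : (0 < p)%R by exact: lt_le_trans p1.
have Sle y : 0 <= y -> y <= 1 + y `^ p.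
  move=> y0; have [y1|y1] := leP y 1; first by apply: (le_trans y1); rewrite leeDl// poweR_ge0.
  apply: (@le_trans _ _ (y `^ p)); last by rewrite leeDr.
  rewrite -{1}(poweRe1 y0); move: y1; case: y y0 => [r||]// _ r1.
    by rewrite !poweR_EFin lee_fin ler_powR// ltW// -lte_fin.
  by rewrite !poweRyr ?gt_eqF.
apply: (@le_lt_trans _ _ (\int[mu]_x (`|g x|%:E + M%:E * S x `^ p))).
  apply: ge0_le_integral_nomeas => x _; first by apply: mule_ge0; rewrite ?lee_fin//; exact: S0.
  have g0 : 0 <= `|g x|%:E by rewrite lee_fin.
  apply: le_trans (lee_wpmul2r g0 (Sle _ (S0 x))) _.
  rewrite ge0_muleDl ?poweR_ge0// mul1e leeD2l// muleC.
  by apply: lee_wpmul2r; [exact: poweR_ge0|rewrite lee_fin].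
rewrite ge0_integralD//; last 2 first.
- by move=> x _; apply: mule_ge0; [rewrite lee_fin|exact: poweR_ge0].
- exact: measurable_funeM.
apply: lte_add_pinfty => //; rewrite integralTZ//; last by move=> x; exact: poweR_ge0.
by rewrite lte_mul_pinfty ?lee_fin.
Qed.

Lemma envel_test_ub (M : R) (g : X -> R) : (0 <= M)%R -> measurable_fun setT g ->
  \int[mu]_x `|g x|%:E < +oo ->
  (forall x, \esum_(j in [set: nat]) envel j x <= M%:E) ->
  \int[mu]_x ((\esum_(j in [set: nat]) envel j x) * `|g x|%:E) < +oo.
Proof.
move=> M0 mg gI HM; apply: (@le_lt_trans _ _ (\int[mu]_x (M%:E * `|g x|%:E))).
  apply: ge0_le_integral_nomeas => x _.
    by apply: mule_ge0; rewrite ?lee_fin//; apply: esum_ge0 => j _; exact: envel_ge0.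
  by apply: lee_wpmul2r; rewrite ?lee_fin.
rewrite integralTZ//; first by rewrite lte_mul_pinfty ?lee_fin.
by apply/measurable_EFinP; exact: measurableT_comp.
Qed.

End atoms.

(** * Integrability of test functions and volume of small cubes *)

Lemma integral_cidx k (Phi : idx D -> \bar R) : (forall t, 0 <= Phi t) ->
  \int[mu]_x Phi (cidx k x) = \esum_(t in idx_at D k) (Phi t * mu (cube D k t)).
Proof.
move=> P0; rewrite (@integral_cells k (fun x => Phi (cidx k x))); first last.
- by move=> x; exact: P0.
- exact: measurable_cidx.
apply: eq_esum => t It.
rewrite (eq_integral (fun=> Phi t)); last first.
  by move=> x /set_mem xt; rewrite (cidx_eq It xt).
rewrite integral_cst//; exact: cube_measurable.
Qed.

(** The majorant is constant on the small cubes. Its integral is the sum of the bounds of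
    [le_Rgamma_smo] over all cubes; the indicators add up to 1, and [smo] of the constant 1 is a
    geometric series. *)
Lemma Rgamma0_dom (gam : R) x0 : (0 < gam)%R -> exists P : X -> \bar R,
  [/\ measurable_fun setT P, forall x, (Rgamma D gam 0 x0 x)%:E <= P x &
      \int[mu]_x P x < +oo].
Proof.
move=> gam0; have [C C00 HC] := le_Rgamma_smo gam0.
have t01 := th01 gam0; set th := (del `^ gam)%R in HC t01.
pose I := idx_at D (0 + (j0 D)%:Z)%R.
pose Qc t := cube D (0 + (j0 D)%:Z)%R t.
pose S t := smo th (0 - 1) (fun z => (1 * \1_(Qc t) z)%:E) x0.
have pw t x : I t -> Qc t x -> (Rgamma D gam 0 x0 x)%:E <= ((fine (mu (Qc t)))^-1 * C)%:E * S t.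
  move=> It tx; have m0 : (0 < fine (mu (Qc t)))%R by exact: cube_mu_gt0.
  apply: (@le_trans _ _ ((fine (mu (Qc t)))^-1%:E * (Rgamma D gam 0 x0 x * (1 * fine (mu (Qc t))))%:E)).
    by rewrite -EFinM lee_fin mul1r mulrCA mulVf ?mulr1// gt_eqF.
  rewrite [X in _ <= X * _]EFinM -[X in _ <= X]muleA; apply: lee_wpmul2l; first by rewrite lee_fin invr_ge0 ltW.
  exact: (HC 0%N).
have S0 t : 0 <= S t by apply: smo_ge0 => // y; rewrite lee_fin mul1r indicE.
have R0 x : 0 <= (Rgamma D gam 0 x0 x)%:E.
  by rewrite lee_fin /Rgamma; apply: mulr_ge0; [rewrite invr_ge0; apply: addr_ge0; exact: fine_ge0|exact: powR_ge0].
pose Phi t := if t \in I then ((fine (mu (Qc t)))^-1 * C)%:E * S t else 0.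
have Phi0 t : 0 <= Phi t.
  rewrite /Phi; case: ifP => // _; apply: mule_ge0 => //.
  by rewrite lee_fin; apply: mulr_ge0 => //; rewrite invr_ge0 fine_ge0.
exists (fun x => Phi (cidx (0 + (j0 D)%:Z)%R x)); split; first exact: measurable_cidx.
  move=> x; rewrite /Phi mem_set; last exact: cidx_at.
  by apply: pw; [exact: cidx_at|exact: cidx_cube].
rewrite integral_cidx// (eq_esum (b := fun t => C%:E * S t)); last first.
  move=> t It; rewrite /Phi mem_set//.
  have m0 : (0 < fine (mu (Qc t)))%R by exact: cube_mu_gt0.
  rewrite (cube_mu It) muleC muleA -EFinM -/(Qc t) mulrA mulfV ?mul1r// gt_eqF//.
rewrite esumZl// lte_mul_pinfty ?lee_fin//.
rewrite -smo_esum; first last.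
- move=> t It; apply/measurable_EFinP/measurable_funM => //.
  exact/measurable_indic/cube_measurable.
- by move=> t y; rewrite lee_fin mul1r indicE.
- exact: idx_at_countable.
- by [].
rewrite (_ : (fun y => _) = (fun=> 1)); last first.
  apply/funext => y; rewrite -[RHS](@esum_cell (0 + (j0 D)%:Z)%R y (fun=> 1%E))//.
  by apply: eq_esum => t _; rewrite mul1r indicE /Qc; case: (y \in _).
rewrite /smo; under eq_esum do rewrite avr_cst.
apply: le_lt_trans (esum_geoZ t01 _) _ => //.
by rewrite mule1 ltry.
Qed.

Lemma test_bounded (x0 : X) (r0 b gam : R) g : (0 < r0)%R -> (0 < gam)%R ->
  test_space H x0 r0 b gam g ->
  [/\ measurable_fun setT g, exists2 M : R, (0 <= M)%R & forall x, (`|g x| <= M)%R &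
      \int[mu]_x `|g x|%:E < +oo].
Proof.
move=> r00 gam0 [mg [C [C00 HC _]]].
have V0 : (0 < Vr H r0 x0)%R by exact: Vr_gt0.
have Vx x : (0 <= V H x0 x)%R by exact: fine_ge0.
have dx x : (0 <= d x0 x)%R by exact: qdist_ge0.
split => //.
  exists (C * (Vr H r0 x0)^-1)%R; first by rewrite mulr_ge0// invr_ge0 ltW.
  move=> x; apply: le_trans (HC x) _; apply: ler_wpM2l => //; rewrite /test_weight.
  rewrite -[leRHS]mulr1; apply: ler_pM.
  - by rewrite invr_ge0; apply: addr_ge0 => //; exact: ltW.
  - exact: powR_ge0.
  - by rewrite lef_pV2 ?posrE ?ltr_wpDr// lerDl.
  - apply: powR_le1; last exact: ltW.
    rewrite divr_ge0 ?addr_ge0 ?(ltW r00)//= ler_pdivrMr ?ltr_wpDr// mul1r lerDl//.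
have V10 : (0 < Vr H 1 x0)%R by exact: Vr_gt0.
(* Passes from the radius [r0] of the test weight to the radius 1, at which the weight is the kernel
   [Rgamma] of level 0. *)
pose A := (Num.max 1 (Vr H 1 x0 / Vr H r0 x0))%R.
have A1 : (1 <= A)%R by rewrite le_max lexx.
have A0' : (0 <= A)%R by exact: le_trans A1.
pose m := (Num.max 1 r0)%R; have m1 : (1 <= m)%R by rewrite le_max lexx.
have mr : (r0 <= m)%R by rewrite le_max lexx orbT.
have key x : (test_weight H x0 r0 gam x <= A * m `^ gam * Rgamma D gam 0 x0 x)%R.
  rewrite /test_weight /Rgamma expr0.
  have W1 : (0 < Vr H 1 x0 + V H x0 x)%R by rewrite ltr_wpDr.
  have Wr : (0 < Vr H r0 x0 + V H x0 x)%R by rewrite ltr_wpDr.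
  have d1 : (0 < 1 + d x0 x)%R by rewrite ltr_wpDr.
  have dr : (0 < r0 + d x0 x)%R by rewrite ltr_wpDr.
  rewrite mulrACA; apply: ler_pM.
  - by rewrite invr_ge0 ltW.
  - exact: powR_ge0.
  - rewrite ler_pdivlMr// mulrC ler_pdivrMr//.
    have h1 : (Vr H 1 x0 <= A * Vr H r0 x0)%R by rewrite -ler_pdivrMr// le_max lexx orbT.
    rewrite mulrDr lerD// ler_peMl//.
  - have m0 : (0 <= m)%R by exact: le_trans m1.
    have i1 : (0 <= 1 / (1 + d x0 x))%R by rewrite divr_ge0// ltW.
    have i2 : (0 <= r0 / (r0 + d x0 x))%R by rewrite divr_ge0// ltW.
    have i3 : (0 <= m * (1 / (1 + d x0 x)))%R by exact: mulr_ge0.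
    rewrite -powRM//; apply: ge0_ler_powR; rewrite ?nnegrE//; first exact: ltW.
    rewrite ler_pdivrMr// div1r mulrAC ler_pdivlMr//.
    have := dx x; nra.
have [P [mP RP PI]] := Rgamma0_dom x0 gam0.
have R0 x : 0 <= (Rgamma D gam 0 x0 x)%:E.
  by rewrite lee_fin /Rgamma; apply: mulr_ge0; [rewrite invr_ge0; apply: addr_ge0; exact: fine_ge0|exact: powR_ge0].
have P0 x : 0 <= P x by exact: le_trans (RP x).
have B0 : (0 <= C * (A * m `^ gam))%R by apply: mulr_ge0 => //; apply: mulr_ge0 => //; exact: powR_ge0.
apply: (@le_lt_trans _ _ (\int[mu]_x ((C * (A * m `^ gam))%:E * P x))).
  apply: ge0_le_integral_nomeas => x _; first by rewrite lee_fin.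
  apply: le_trans (lee_wpmul2l _ (RP x)); last by rewrite lee_fin.
  by rewrite -EFinM lee_fin -mulrA (le_trans (HC x))// ler_wpM2l.
by rewrite integralTZ// lte_mul_pinfty ?lee_fin.
Qed.

Lemma cube_mu_lbound (Q : R) : local_lower_bound H Q -> exists2 c : R, (0 < c)%R &
  forall (j : nat) t, idx_at D (lev j) t -> (c * (del `^ Q) ^+ j <= fine (mu (cube D (lev j) t)))%R.
Proof.
move=> [Q0 [C C00 HC]]; have d0 := del_gt0.
exists (C * (del `^ Q) ^+ (j0 D) / Ccell)%R.
  by apply: divr_gt0; [apply: mulr_gt0 => //; apply: exprn_gt0; exact: powR_gt0|exact: Ccell_gt0].
move=> j t It; have t_ne : exists x, cube D (lev j) t x.
  apply: contrapT => h; have := cube_mu_gt0 It.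
  rewrite (_ : cube D (lev j) t = set0) ?measure0 ?ltxx//.
  by rewrite -subset0 => x tx; apply: h; exists x.
have [x tx] := t_ne.
have := Vr_cube It tx; rewrite -ler_pdivrMl ?Ccell_gt0//.
apply: le_trans; rewrite mulrAC mulrC ler_wpM2l ?invr_ge0 ?(ltW Ccell_gt0)//.
(* The lower bound speaks of radii up to 1, and every level in question is nonnegative. *)
have r01 : (0 < del ^+ (j + j0 D) <= 1)%R.
  by rewrite exprn_gt0// exprn_ile1// ltW// del_lt1.
have := HC x _ r01; rewrite mu_qball; last by case/andP: r01.
rewrite lee_fin -mulrA -exprD addnC powR_exprn ?(ltW d0)// => /le_trans; apply.
apply: le_Vr; first exact: rho_gt0.
move=> z /= /lt_le_trans; apply; rewrite /rho /lev -[leLHS]mul1r.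
by rewrite -PoszD addnC -exprnP ler_wpM2r// ltW// exprn_gt0.
Qed.

(* Passing from the exponent [p < 1] to the exponent 1 costs the smoothness
   [Q (1/p - 1)]. *)
Lemma integral_cidx_pow (Q p : R) : local_lower_bound H Q -> (0 < p < 1)%R ->
  exists2 C : R, (0 <= C)%R & forall (j : nat) (Phi : idx D -> R), (forall t, 0 <= Phi t)%R ->
  (\int[mu]_x (Phi (cidx (lev j) x))%:E) `^ p <=
  (C * ((del `^ Q) ^+ j) `^ (p - 1))%:E * \int[mu]_x (Phi (cidx (lev j) x) `^ p)%:E.
Proof.
move=> llb /andP[p0 p1]; have [c c0 Hc] := cube_mu_lbound llb.
have b0 j : (0 < (del `^ Q) ^+ j)%R by apply: exprn_gt0; rewrite powR_gt0// del_gt0.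
exists (c `^ (p - 1))%R; first exact: powR_ge0.
move=> j Phi P0; rewrite (@integral_cidx _ (fun t => (Phi t)%:E))//.
rewrite (@integral_cidx _ (fun t => (Phi t `^ p)%:E)); last by move=> t; rewrite lee_fin powR_ge0.
have m0 t : 0 <= (Phi t)%:E * mu (cube D (lev j) t) by apply: mule_ge0; rewrite ?lee_fin.
have p01 : (0 < p <= 1)%R by rewrite p0 ltW.
apply: le_trans (poweR_esum_le _ p01 m0) _.
rewrite -esumZl ?lee_fin; last 2 first.
- by apply: mulr_ge0; exact: powR_ge0.
- by move=> t; apply: mule_ge0; rewrite ?lee_fin ?powR_ge0.
apply: le_esum => t It; have mt := cube_mu_gt0 It.
rewrite (cube_mu It) -!EFinM poweR_EFin lee_fin powRM ?(ltW mt)//.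
rewrite mulrCA; apply: ler_wpM2l; first exact: powR_ge0.
rewrite -powRM ?(ltW c0) ?(ltW (b0 j))//.
have mp z : (0 < z -> z `^ p = z `^ (p - 1) * z)%R.
  move=> z0; rewrite -[X in (_ * X)%R](powRr1 (ltW z0)) -powRD ?subrK//.
  by apply/implyP => _; rewrite gt_eqF.
rewrite mp//; apply: ler_wpM2r; first exact: ltW.
have := Hc j t It; set y := (c * _)%R => yz.
have y0 : (0 < y)%R by exact: mulr_gt0.
rewrite -[(p - 1)%R]opprK opprB !powRN lef_pV2 ?posrE ?powR_gt0//.
by apply: ge0_ler_powR; rewrite ?nnegrE ?subr_ge0 ?(ltW p1) ?(ltW y0) ?(ltW mt).
Qed.

(** * Atoms from the Calderon formula *)

Lemma cube_neq0 k t : idx_at D k t -> exists x, cube D k t x.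
Proof.
move=> It; apply: contrapT => h; have := cube_mu_gt0 It.
rewrite (_ : cube D k t = set0) ?measure0 ?ltxx//.
by rewrite -subset0 => x tx; apply: h; exists x.
Qed.

(** Each cube of level [lev k] lies in exactly one cube of level [k], so the double enumeration of
    the reproducing formula meets it once. *)
Lemma esum_sub_idx (k : nat) (E : idx D -> \bar R) : (forall t, 0 <= E t) ->
  \esum_(b in idx_at D k) (\sum_(0 <= m < nsub D k b) E (sub_idx D k b m)) =
  \esum_(t in idx_at D (lev k)) E t.
Proof.
move=> E0; pose sub b := [set t : idx D | cube D (lev k) t `<=` cube D k b].
transitivity (\esum_(b in idx_at D k) \esum_(t in idx_at D (lev k)) if t \in sub b then E t else 0).
  apply: eq_esum => b Ib; rewrite -esum_mkcondr.
  rewrite (@reindex_esum _ _ _ _ _ _ E (sub_idx_bij Ib)) esum_fset//.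
  by rewrite -(fsbig_ord _ _ (fun m => E (sub_idx D k b m))) /= big_mkord.
rewrite exchange_esum; last by move=> b t; case: ifP.
apply: eq_esum => t It; have [x tx] := cube_neq0 It.
rewrite -[RHS](@esum_cell k x (fun=> E t))//; apply: eq_esum => b Ib.
congr (if _ then _ else _); apply/idP/idP; rewrite !inE /sub /=; first by apply.
have kl : (k%:Z <= lev k)%R by rewrite /lev; clear; lia.
move=> bx; have [//|h] := cube_nested kl Ib It.
by have : (cube D (lev k) t `&` cube D k b) x by []; rewrite h.
Qed.

Lemma sub_idx_surj (k : nat) t : idx_at D (lev k) t -> exists b m,
  [/\ idx_at D k b, (m < nsub D k b)%N & sub_idx D k b m = t].
Proof.
move=> It; have [x tx] := cube_neq0 It.
have kl : (k%:Z <= lev k)%R by rewrite /lev; clear; lia.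
have Ib := cidx_at k x; have sub : cube D (lev k) t `<=` cube D k (cidx k x).
  have [//|h] := cube_nested kl Ib It.
  have : (cube D (lev k) t `&` cube D k (cidx k x)) x by split => //; exact: cidx_cube.
  by rewrite h.
have [_ _ sj] := sub_idx_bij Ib; have [m mb bt] := sj t (conj It sub).
by exists (cidx k x), m; split.
Qed.

(** The positive part of a block sum is not the block sum of positive parts; [usum_split] allows the
    latter to be used. *)
Lemma usum_sub_idx (k : nat) (G : idx D -> R) :
  \esum_(t in idx_at D (lev k)) `|G t|%:E < +oo ->
  usum (idx_at D k) (fun b => \sum_(0 <= m < nsub D k b) G (sub_idx D k b m))%R =
  usum (idx_at D (lev k)) G.
Proof.
move=> Goo.
have h (G' : idx D -> R) : (forall t, 0 <= G' t <= `|G t|)%R ->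
    \esum_(b in idx_at D k) (\sum_(0 <= m < nsub D k b) G' (sub_idx D k b m))%:E =
    \esum_(t in idx_at D (lev k)) (G' t)%:E.
  move=> G'0; rewrite -esum_sub_idx; last by move=> t; rewrite lee_fin; case/andP: (G'0 t).
  by apply: eq_esum => b _; rewrite sumEFin.
have p0 t : (0 <= Num.max (G t) 0 <= `|G t|)%R.
  by rewrite le_max lexx orbT/= ge_max normr_ge0 ler_norm.
have n0 t : (0 <= Num.max (- G t) 0 <= `|G t|)%R.
  by rewrite le_max lexx orbT/= ge_max normr_ge0 -normrN ler_norm.
rewrite (@usum_split _ _ _ _ (fun b => \sum_(0 <= m < nsub D k b) Num.max (G (sub_idx D k b m)) 0)%R
  (fun b => \sum_(0 <= m < nsub D k b) Num.max (- G (sub_idx D k b m)) 0)%R).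
- by rewrite (h (fun t => Num.max (G t) 0)%R)// (h (fun t => Num.max (- G t) 0)%R).
- move=> b _; rewrite -sumrB; apply: eq_bigr => m _; rewrite !maxEle oppr_le0.
  by case: (leP (G (sub_idx D k b m)) 0%R) => g0; case: (leP 0%R (G (sub_idx D k b m))) => g1; lra.
- by move=> b; apply: sumr_ge0 => m _; case/andP: (p0 (sub_idx D k b m)).
- by move=> b; apply: sumr_ge0 => m _; case/andP: (n0 (sub_idx D k b m)).
- by rewrite (h (fun t => Num.max (G t) 0)%R)//; exact: esum_dom_lty p0 Goo.
- by rewrite (h (fun t => Num.max (- G t) 0)%R)//; exact: esum_dom_lty n0 Goo.
Qed.

Section operators.
Variables (beta gam C1 C2 : R) (T : nat -> X -> X -> R).
Hypotheses (gam0 : (0 < gam)%R) (beta0 : (0 < beta)%R) (C10 : (0 <= C1)%R) (C20 : (0 <= C2)%R).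
Local Notation th := (del `^ gam)%R.
Hypothesis HC2 : forall (j : nat) (t : idx D) (c : R) x y, (0 <= c)%R ->
  idx_at D (lev j) t -> cube D (lev j) t y ->
  (Rgamma D gam j x y * (c * fine (mu (cube D (lev j) t))))%:E <=
  C2%:E * smo th (j%:Z - 1) (fun z => (c * \1_(cube D (lev j) t) z)%:E) x.
Hypothesis mT : forall j, measurable_fun setT (fun z : X * X => T j z.1 z.2).
Hypothesis T_size : forall j x z, (`|T j x z| <= C1 * Rgamma D gam j x z)%R.
Hypothesis T_reg : forall j x x' z, (d x x' <= (2 * A0)^-1 * (del ^+ j + d x z))%R ->
  (`|T j x z - T j x' z| <= C1 * (d x x' / (del ^+ j + d x z)) `^ beta * Rgamma D gam j x z)%R.

Let s_ (c : R) j t x := smo th (j%:Z - 1) (fun z => (c * \1_(cube D (lev j) t) z)%:E) x.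
Let s0 c j t x : (0 <= c)%R -> 0 <= s_ c j t x.
Proof. by move=> c0; apply: (smo_ge0 (th01 gam0)) => y; rewrite lee_fin; apply: mulr_ge0 => //; rewrite indicE. Qed.

Lemma kernel_size j t c x y : (0 <= c)%R -> idx_at D (lev j) t -> cube D (lev j) t y ->
  (`|T j x y| * (c * fine (mu (cube D (lev j) t))))%:E <= (C1 * C2)%:E * s_ c j t x.
Proof.
move=> c0 It ty; rewrite [X in _ <= X * _]EFinM -[X in _ <= X]muleA.
apply: le_trans (lee_wpmul2l _ (HC2 x c0 It ty)); last by rewrite lee_fin.
rewrite -EFinM lee_fin [leRHS]mulrA; apply: ler_wpM2r; last exact: T_size.
by apply: mulr_ge0 => //; exact: fine_ge0.
Qed.

(** The three summands answer the three cases of [kernel_reg]: [k < j], a displacement small enough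
    for the regularity of the kernel, and a larger one. *)
Let B := (C1 * C2 * (1 + K `^ beta + (2 * A0 * K) `^ beta))%R.
Let B0 : (0 <= B)%R.
Proof.
by apply: mulr_ge0; [exact: mulr_ge0|apply: addr_ge0; [apply: addr_ge0 => //|]; exact: powR_ge0].
Qed.

Lemma kernel_reg j t c x x' y (k : int) : (0 <= c)%R -> idx_at D (lev j) t ->
  cube D (lev j) t y -> (d x x' <= rho k)%R ->
  (`|T j x y - T j x' y| * (c * fine (mu (cube D (lev j) t))))%:E <=
  (B * modulus beta k j)%:E * (s_ c j t x + s_ c j t x').
Proof.
move=> c0 It ty xx'; set m := (c * _)%R.
have m0 : (0 <= m)%R by apply: mulr_ge0 => //; exact: fine_ge0.
have S0 z := s0 j t z c0.
have b0 : (0 < del `^ beta)%R by rewrite powR_gt0// del_gt0.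
have A1 := A0_ge1 H; have A00 := A0_gt0 H; have K0 := K_gt0.
have p1 := powR_ge0 K beta; have p2 := powR_ge0 (2 * A0 * K) beta.
have crude : (`|T j x y - T j x' y| * m)%:E <= (C1 * C2)%:E * (s_ c j t x + s_ c j t x').
  rewrite ge0_muleDr//; apply: le_trans (leeD (kernel_size x c0 It ty) (kernel_size x' c0 It ty)).
  by rewrite -EFinD lee_fin -mulrDl; apply: ler_wpM2r => //; exact: ler_normB.
have CC0 : (0 <= C1 * C2)%R by exact: mulr_ge0.
have SS0 : 0 <= s_ c j t x + s_ c j t x' by exact: adde_ge0.
have [jk|kj] := leP j%:Z k; last first.
  apply: (le_trans crude); apply: lee_wpmul2r => //; rewrite lee_fin.
  rewrite /modulus ifF; last by apply/negbTE; rewrite -ltNge.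
  by rewrite mulr1 /B ler_peMr//; lra.
have dj : (0 < del ^+ j)%R by rewrite exprn_gt0// del_gt0.
set n := `|k - j%:Z|%N; have nE : (k = j%:Z + n%:Z)%R by move: jk; rewrite /n; clear; lia.
have MM : modulus beta k j = ((del ^+ n) `^ beta)%R.
  by rewrite /modulus jk powR_exprn ?del_ge0.
have rk : (rho k = K * del ^+ n * del ^+ j)%R.
  by rewrite /rho nE exprzD_nat -!exprnP mulrAC mulrA.
have dn : (0 < del ^+ n)%R by rewrite exprn_gt0// del_gt0.
have dxy : (0 <= d x y)%R by exact: qdist_ge0.
have dd : (0 <= d x x')%R by exact: qdist_ge0.
have [near|far] := leP (d x x') ((2 * A0)^-1 * (del ^+ j + d x y))%R.
  have := T_reg near => /(ler_wpM2r m0) h.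
  have e1 : (d x x' / (del ^+ j + d x y) <= K * del ^+ n)%R.
    rewrite ler_pdivrMr ?ltr_wpDr//; apply: (le_trans xx'); rewrite rk.
    by rewrite ler_wpM2l ?lerDl// mulr_ge0// ltW.
  have e2 : ((d x x' / (del ^+ j + d x y)) `^ beta <= K `^ beta * (del ^+ n) `^ beta)%R.
    rewrite -powRM ?(ltW K0) ?(ltW dn)//.
    have i0 : (0 <= d x x' / (del ^+ j + d x y))%R by apply: divr_ge0 => //; apply: addr_ge0 => //; exact: ltW.
    apply: ge0_ler_powR; rewrite ?nnegrE//; first exact: ltW.
    by apply: mulr_ge0; exact: ltW.
  have R0 : (0 <= Rgamma D gam j x y)%R.
    by rewrite /Rgamma; apply: mulr_ge0; [rewrite invr_ge0; apply: addr_ge0; exact: fine_ge0|exact: powR_ge0].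
  apply: (@le_trans _ _ ((C1 * (K `^ beta * (del ^+ n) `^ beta))%:E * (C2%:E * s_ c j t x))).
    apply: le_trans (lee_wpmul2l _ (HC2 x c0 It ty)); last first.
      by rewrite lee_fin; apply: mulr_ge0 => //; apply: mulr_ge0 => //; exact: powR_ge0.
    rewrite -EFinM lee_fin -/m; apply: (le_trans h); rewrite [leRHS]mulrA.
    apply: ler_wpM2r => //; apply: ler_wpM2r => //; exact: ler_wpM2l.
  rewrite muleA -EFinM; apply: lee_pmul => //; first last.
  - by rewrite leeDl.
  - rewrite lee_fin MM /B (_ : (C1 * (K `^ beta * (del ^+ n) `^ beta) * C2 = C1 * C2 * K `^ beta * (del ^+ n) `^ beta)%R); last by ring.
    apply: ler_wpM2r; first exact: powR_ge0.
    by apply: ler_wpM2l => //; lra.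
  - by rewrite lee_fin; apply: mulr_ge0 => //; apply: mulr_ge0 => //; apply: mulr_ge0; exact: powR_ge0.
(* The displacement exceeds the range of the regularity estimate; then [2 * A0 * K * del ^+ n] is at
   least 1, and the size bound already has the required form. *)
apply: (le_trans crude); apply: lee_wpmul2r => //; rewrite lee_fin MM /B -mulrA ler_peMr//.
have e3 : (1 <= (2 * A0 * K) * del ^+ n)%R.
  have h1 : ((2 * A0)^-1 * del ^+ j <= K * del ^+ n * del ^+ j)%R.
    rewrite -rk; apply: le_trans xx'; apply: ltW; apply: le_lt_trans far.
    by rewrite ler_wpM2l ?lerDl// invr_ge0 mulr_ge0// ltW.
  move: h1; rewrite ler_pM2r// -div1r ler_pdivrMr ?mulr_gt0//.
  by move=> /le_trans; apply; rewrite le_eqVlt; apply/orP; left; apply/eqP; ring.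
have e4 : (1 <= (2 * A0 * K) `^ beta * (del ^+ n) `^ beta)%R.
  have k0 : (0 <= 2 * A0 * K)%R by apply: mulr_ge0; [apply: mulr_ge0 => //|]; exact: ltW.
  rewrite -powRM ?(ltW dn)//; apply: (@le_trans _ _ (1 `^ beta)%R); first by rewrite powR1.
  by apply: ge0_ler_powR; rewrite ?nnegrE//; [exact: ltW|apply: mulr_ge0 => //; exact: ltW].
have p3 := powR_ge0 (del ^+ n) beta.
apply: (le_trans e4); apply: ler_wpM2r => //; lra.
Qed.


Section atoms_of_kernel.
Variables (pt : nat -> idx D -> X) (co : nat -> idx D -> R).
Hypothesis pt_cube : forall j t, idx_at D (lev j) t -> cube D (lev j) t (pt j t).

(** The function multiplying the coefficient in the reproducing formula: level 0 integrates the
    kernel over the cube, all other levels sample it. *)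
Definition tile j t x : R :=
  if j == 0%N then (\int[mu]_(y in cube D (lev j) t) T j x y)%R
  else (fine (mu (cube D (lev j) t)) * T j x (pt j t))%R.

(** The pointwise hypothesis carries the factor [c * mu] because [kernel_size] and [kernel_reg] do;
    dividing by it and integrating over the cube leaves [b / c]. *)
Lemma Rintegral_cube_le j t (F : X -> R) (c b : R) : idx_at D (lev j) t ->
  measurable_fun setT F -> (0 <= c)%R -> (0 <= b)%R ->
  (forall y, cube D (lev j) t y -> (`|F y| * (c * fine (mu (cube D (lev j) t))) <= b)%R) ->
  (c * `|\int[mu]_(y in cube D (lev j) t) F y| <= b)%R.
Proof.
move=> It mF c0 b0 Fb; have [->|cn] := eqVneq c 0%R; first by rewrite mul0r.
have cp : (0 < c)%R by rewrite lt_def cn.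
have mQ := cube_measurable It; have m0 := cube_mu_gt0 It; have mE := cube_mu It.
set Q := cube D _ t in Fb mQ m0 mE *; set m := fine (mu Q) in Fb m0 mE *.
rewrite mulrC -ler_pdivlMr//.
have Fy y : Q y -> (`|F y| <= b / (c * m))%R.
  by move=> Qy; rewrite ler_pdivlMr ?mulr_gt0//; exact: Fb.
have mF' : measurable_fun Q F by exact: measurable_funTS.
have Qfin : mu Q < +oo by rewrite mE ltry.
rewrite -lee_fin; apply: (@le_trans _ _ (\int[mu]_(y in Q) (b / (c * m))%:E)); last first.
  by rewrite integral_cst// mE -EFinM lee_fin invfM mulrA mulfVK ?gt_eqF.
have i1 : mu.-integrable Q (EFin \o F).
  apply: (@le_integrable _ _ _ mu Q mQ _ (cst (b / (c * m))%:E)).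
  - exact/measurable_EFinP.
  - by move=> y Qy /=; rewrite lee_fin (le_trans (Fy y Qy))// ler_norm.
  - by apply/integrableP; split=> //; rewrite integral_cst//= lte_mul_pinfty// ?lee_fin.
apply: (@le_trans _ _ (\int[mu]_(y in Q) `|F y|%:E)); last first.
  by apply: ge0_le_integral_nomeas => y Qy; rewrite ?lee_fin//; exact: Fy.
have := le_abse_integral mu mQ (proj1 (integrableP _ _ _ i1)).
by rewrite -[X in `|X|]fineK ?integrable_fin_num.
Qed.


Lemma Rgamma_ub j x y : (Rgamma D gam j x y <= (Vr H (del ^+ j) x)^-1)%R.
Proof.
have dj : (0 < del ^+ j)%R by rewrite exprn_gt0// del_gt0.
have V0 : (0 < Vr H (del ^+ j) x)%R by exact: Vr_gt0.
have Vx : (0 <= V H x y)%R by exact: fine_ge0.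
have dxy : (0 <= d x y)%R by exact: qdist_ge0.
rewrite /Rgamma -[leRHS]mulr1; apply: ler_pM.
- by rewrite invr_ge0; apply: addr_ge0 => //; exact: ltW.
- exact: powR_ge0.
- by rewrite lef_pV2 ?posrE ?ltr_wpDr// lerDl.
- apply: powR_le1; last exact: ltW.
  by rewrite divr_ge0 ?addr_ge0 ?(ltW dj)//= ler_pdivrMr ?ltr_wpDr// mul1r lerDl.
Qed.

Lemma measurable_section j x : measurable_fun setT (fun y => T j x y).
Proof. exact: (measurableT_comp (mT j) (measurable_pair1 x)). Qed.

Lemma section_integrable j t x : idx_at D (lev j) t ->
  mu.-integrable (cube D (lev j) t) (EFin \o (fun y => T j x y)).
Proof.
move=> It; have mQ := cube_measurable It.
pose b := (C1 * (Vr H (del ^+ j) x)^-1)%R.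
have b0 : (0 <= b)%R by apply: mulr_ge0 => //; rewrite invr_ge0 Vr_ge0.
apply: (@le_integrable _ _ _ mu _ mQ _ (cst b%:E)).
- apply/measurable_EFinP; apply: measurable_funTS; exact: measurable_section.
- move=> y Qy /=; rewrite lee_fin (le_trans (T_size j x y))//.
  by apply: le_trans (ler_norm _); apply: ler_wpM2l => //; exact: Rgamma_ub.
- apply/integrableP; split=> //; rewrite integral_cst//= lte_mul_pinfty// ?lee_fin//.
  by rewrite (cube_mu It) ltry.
Qed.

Let env_fin (b : \bar R) (r : R) : 0 <= b -> (forall c, b = c%:E -> (0 <= c)%R -> (r <= c)%R) ->
  r%:E <= b.
Proof.
by case: b => [c||]// b0 h; [rewrite lee_fin; apply: h|rewrite leey].
Qed.

Lemma tile_size j t x : idx_at D (lev j) t ->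
  `|co j t * tile j t x|%:E <= (C1 * C2)%:E *
   smo th (j%:Z - 1) (fun z => (`|co j t| * \1_(cube D (lev j) t) z)%:E) x.
Proof.
move=> It; rewrite normrM; have c0 := normr_ge0 (co j t).
have CC0 : (0 <= C1 * C2)%R by exact: mulr_ge0.
have S0 := s0 j t x c0.
have m0 : (0 <= fine (mu (cube D (lev j) t)))%R by exact: fine_ge0.
rewrite /tile; case: ifPn => [/eqP j00|_]; last first.
  rewrite normrM (ger0_norm m0) (_ : (_ * _ = `|T j x (pt j t)| * (`|co j t| * fine (mu (cube D (lev j) t))))%R); last by ring.
  exact: kernel_size (pt_cube It).
apply: env_fin; first by apply: mule_ge0; rewrite ?lee_fin.
move=> c ce cp; apply: Rintegral_cube_le => //; first exact: measurable_section.
by move=> y Qy; rewrite -lee_fin -ce; exact: kernel_size.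
Qed.

Lemma tile_reg j t x x' (k : int) : idx_at D (lev j) t -> (d x x' <= rho k)%R ->
  `|co j t * tile j t x - co j t * tile j t x'|%:E <= (B * modulus beta k j)%:E *
   (smo th (j%:Z - 1) (fun z => (`|co j t| * \1_(cube D (lev j) t) z)%:E) x +
    smo th (j%:Z - 1) (fun z => (`|co j t| * \1_(cube D (lev j) t) z)%:E) x').
Proof.
move=> It xx'; rewrite -mulrBr normrM; have c0 := normr_ge0 (co j t).
have S0 z := s0 j t z c0.
have m0 : (0 <= fine (mu (cube D (lev j) t)))%R by exact: fine_ge0.
rewrite /tile; case: ifPn => [/eqP j00|_]; last first.
  rewrite -mulrBr normrM (ger0_norm m0) (_ : (_ * _ = `|T j x (pt j t) - T j x' (pt j t)| * (`|co j t| * fine (mu (cube D (lev j) t))))%R); last by ring.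
  exact: kernel_reg (pt_cube It) xx'.
rewrite -RintegralB; try exact: section_integrable; last exact: cube_measurable.
apply: env_fin.
  by apply: mule_ge0; [rewrite lee_fin; apply: mulr_ge0 => //; exact/ltW/modulus_gt0|apply: adde_ge0; exact: S0].
move=> c ce cp; apply: Rintegral_cube_le => //.
  by apply: measurable_funB; exact: measurable_section.
by move=> y Qy; rewrite -lee_fin -ce; exact: kernel_reg.
Qed.

End atoms_of_kernel.

End operators.

Section calderon.
Variables (x0 : X) (r0 eta beta gam : R) (Qk : nat -> X -> X -> R) (N : nat).
Hypotheses (gam0 : (0 < gam)%R) (beta0 : (0 < beta)%R)
  (HN : calderon_number D x0 r0 eta beta gam Qk N).
Variables (pt : nat -> idx D -> X) (f : (X -> R) -> R).
Hypothesis pt_cube : forall j t, idx_at D (lev j) t -> cube D (lev j) t (pt j t).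
Hypothesis Hf : distribution H x0 r0 eta beta gam f.

Definition coeff j t : R :=
  if (j <= N)%N then avg H (cube D (lev j) t) (dist_op Qk j f) else dist_op Qk j f (pt j t).
Let a (j : nat) (t : idx D) : R := `|coeff j t|%R.

Lemma calderon_synth : exists (C1 : R) (phi : nat -> idx D -> X -> R),
  [/\ (0 <= C1)%R,
      forall j t x, idx_at D (lev j) t -> `|phi j t x|%:E <= C1%:E *
        smo (del `^ gam) (j%:Z - 1) (fun z => (a j t * \1_(cube D (lev j) t) z)%:E) x,
      forall j t x x' (k : int), idx_at D (lev j) t ->
        (d x x' <= rho k)%R -> `|phi j t x - phi j t x'|%:E <= (C1 * modulus beta k j)%:E *
        (smo (del `^ gam) (j%:Z - 1) (fun z => (a j t * \1_(cube D (lev j) t) z)%:E) x +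
         smo (del `^ gam) (j%:Z - 1) (fun z => (a j t * \1_(cube D (lev j) t) z)%:E) x') &
      forall g, test_space0 H x0 r0 eta beta gam g -> measurable_fun setT g ->
        \int[mu]_x ((\esum_(j in [set: nat]) envel gam a j x) * `|g x|%:E) < +oo ->
        mu.-integrable setT (fun x => (synth phi x * g x)%:E) /\
        f g = pairing H (synth phi) g].
Proof.
have [C2 C20 HC2] := le_Rgamma_smo gam0.
(* The formula indexes its sample points by a cube and the number of a subcube; here they depend on
   the subcube only. *)
have [N0 [Cc Cc0 /(_ (fun k b m => pt k (sub_idx D k b m)))[]]] := HN.
  move=> k b m Ib mb; apply: pt_cube.
  by have [h _ _] := sub_idx_bij Ib; have [] := h _ mb.
move=> Qt [QL Qsize Qreg _ Qcal]; have Cc00 := ltW Cc0.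
have mQ j : measurable_fun setT (fun z : X * X => Qt j z.1 z.2) by have [] := QL j.
pose phi (j : nat) (t : idx D) (x : X) : R := (coeff j t * tile Qt pt j t x)%R.
pose B := (Cc * C2 * (1 + K `^ beta + (2 * A0 * K) `^ beta))%R.
have A1 := A0_ge1 H; have K0 := K_gt0.
have p1 := powR_ge0 K beta; have p2 := powR_ge0 (2 * A0 * K) beta.
have CC0 : (0 <= Cc * C2)%R by exact: mulr_ge0.
have CB : (Cc * C2 <= B)%R by rewrite /B ler_peMr//; lra.
have B0 : (0 <= B)%R by exact: le_trans CB.
have size j t x : idx_at D (lev j) t -> `|phi j t x|%:E <= B%:E *
    smo (del `^ gam) (j%:Z - 1) (fun z => (a j t * \1_(cube D (lev j) t) z)%:E) x.
  move=> It; have h := tile_size gam0 Cc00 C20 HC2 mQ Qsize coeff pt_cube x It.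
  apply: (le_trans h).
  apply: lee_wpmul2r; last by rewrite lee_fin.
  by apply: (smo_ge0 (th01 gam0)) => y; rewrite lee_fin; apply: mulr_ge0 => //; rewrite indicE.
have reg j t x x' (k : int) : idx_at D (lev j) t -> (d x x' <= rho k)%R ->
    `|phi j t x - phi j t x'|%:E <= (B * modulus beta k j)%:E *
    (smo (del `^ gam) (j%:Z - 1) (fun z => (a j t * \1_(cube D (lev j) t) z)%:E) x +
     smo (del `^ gam) (j%:Z - 1) (fun z => (a j t * \1_(cube D (lev j) t) z)%:E) x').
  exact: (tile_reg gam0 beta0 Cc00 C20 HC2 mQ Qsize Qreg coeff pt_cube).
exists B, phi; split => //.
move=> g g0 mg Sg.
have a0 j t : (0 <= a j t)%R by exact: normr_ge0.
split; first exact: (synth_integrable gam0 beta0 B0 a0 size reg mg Sg).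
have sp := synth_pairing gam0 beta0 B0 a0 size reg mg Sg.
have [_ _ _ cal] := Qcal f Hf g g0.
(* [f g] and the pairing with [synth phi] are limits of the same partial sums: beyond [N] the two
   sequences agree term by term. *)
apply: (cvg_unique _ cal); first exact: Rhausdorff.
have scale j t c T : idx_at D (lev j) t -> (forall x, phi j t x = c * T x)%R ->
    pairing H (phi j t) g = (c * pairing H T g)%R.
  exact: (atom_pairing_scale gam0 beta0 B0 a0 size reg mg Sg).
have sm j := atoms_summable gam0 beta0 B0 a0 size reg mg Sg j.
have eq_usum (J : set (idx D)) (u v : idx D -> R) : (forall t, J t -> u t = v t) -> usum J u = usum J v.
  by move=> uv; rewrite /usum; congr (fine _ - fine _)%R; apply: eq_esum => t Jt; rewrite uv.
have term (j : nat) (G : idx D -> R) : (forall t, idx_at D (lev j) t -> G t = pairing H (phi j t) g) ->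
    usum (idx_at D j) (fun b => \sum_(0 <= m < nsub D j b) G (sub_idx D j b m))%R =
    usum (idx_at D (lev j)) (fun t => pairing H (phi j t) g).
  move=> Gphi; rewrite usum_sub_idx; first exact: eq_usum.
  by apply: le_lt_trans (sm j); apply: le_esum => t It; rewrite Gphi.
have e0 : usum (idx_at D 0) (calderon_term0 Qk Qt f g) =
    usum (idx_at D (lev 0)) (fun t => pairing H (phi 0%N t) g).
  rewrite -(term 0%N (fun t => pairing H (fun x => \int[mu]_(y in cube D (lev 0) t) Qt 0%N x y)%R g *
    avg H (cube D (lev 0) t) (dist_op Qk 0 f))%R)//.
  by move=> t It; rewrite (scale 0%N t (coeff 0%N t) _ It (fun x => erefl)) mulrC.
have el (k : nat) : (1 <= k <= N)%N -> usum (idx_at D k)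
     (calderon_term_low Qk Qt (fun k b m => pt k (sub_idx D k b m)) f g k) =
    usum (idx_at D (lev k)) (fun t => pairing H (phi k t) g).
  move=> /andP[k1 kN]; rewrite -(term k (fun t => fine (mu (cube D (lev k) t)) *
    pairing H (fun x => Qt k x (pt k t)) g * avg H (cube D (lev k) t) (dist_op Qk k f))%R)//.
  move=> t It; rewrite (scale k t (coeff k t * fine (mu (cube D (lev k) t)))%R (fun x => Qt k x (pt k t)))//.
    by rewrite /coeff kN; ring.
  by move=> x; rewrite /phi /tile ifN ?mulrA// -lt0n.
have eh (k : nat) : (N < k)%N -> usum (idx_at D k)
     (calderon_term_high Qk Qt (fun k b m => pt k (sub_idx D k b m)) f g k) =
    usum (idx_at D (lev k)) (fun t => pairing H (phi k t) g).
  move=> Nk; rewrite -(term k (fun t => fine (mu (cube D (lev k) t)) *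
    pairing H (fun x => Qt k x (pt k t)) g * dist_op Qk k f (pt k t))%R)//.
  move=> t It; rewrite (scale k t (coeff k t * fine (mu (cube D (lev k) t)))%R (fun x => Qt k x (pt k t)))//.
    by rewrite /coeff leqNgt Nk/=; ring.
  by move=> x; rewrite /phi /tile ifN ?mulrA// -lt0n (leq_ltn_trans _ Nk).
apply: cvg_trans sp; apply: near_eq_cvg; near=> n.
have Nn : (N < n)%N by near: n; exact: nbhs_infty_gt.
rewrite (big_cat_nat (n := N.+1))//= big_ltn// e0.
congr (_ + _ + _)%R.
- by rewrite !big_nat; apply: eq_bigr => k /andP[k1 kN]; rewrite el// k1.
- by rewrite !big_nat; apply: eq_bigr => k /andP[Nk _]; rewrite eh.
Unshelve. all: by end_near. Qed.

End calderon.

(** * Size of the coefficients and inclusions *)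

Lemma finite_head (N : nat) (c : nat -> \bar R) :
  (forall j, (j <= N)%N -> 0 <= c j < +oo) ->
  exists2 M : R, (0 <= M)%R & forall j, (j <= N)%N -> c j <= M%:E.
Proof.
move=> h; have c0 (i : 'I_N.+1) : 0 <= c i by have /andP[] := h i (ltn_ord i).
have cf (i : 'I_N.+1) : c i = (fine (c i))%:E.
  by rewrite fineK// ge0_fin_numE//; have /andP[] := h i (ltn_ord i).
exists (\sum_(i < N.+1) fine (c i))%R; first by apply: sumr_ge0 => i _; exact: fine_ge0.
move=> j jN; rewrite (cf (Ordinal (jN : (j < N.+1)%N))) lee_fin (bigD1 (Ordinal (jN : (j < N.+1)%N)))//= lerDl.
by apply: sumr_ge0 => i _; exact: fine_ge0.
Qed.

Lemma lq_mask (N : nat) q (b : nat -> \bar R) : 0 < q -> (forall j, 0 <= b j) ->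
  lq q [set: nat] (fun k => if (k <= N)%N then 0 else b k) <= lq q [set k | (N < k)%N] b.
Proof.
move=> q0 b0; have ne : [set k | (N < k)%N] !=set0 by exists N.+1 => /=.
have L0 := lq_ge0 q0 ne b0.
case: q q0 L0 => [q||]// q0 L0; last first.
  apply: ge_ereal_sup => _ [k _ <-]; case: leqP => // Nk.
  by apply: ereal_sup_ubound; exists k.
rewrite lte_fin in q0; rewrite /lq; apply: le_poweR; first by rewrite invr_ge0 ltW.
  by apply: esum_ge0 => k _; exact: poweR_ge0.
rewrite [X in _ <= X]esum_mkcond; apply: le_esum => k _.
case: leqP => Nk; first by rewrite poweR0r ?gt_eqF//; case: ifP => // _; exact: poweR_ge0.
by rewrite mem_set.
Qed.

Lemma lq_rapid (th M : R) q (b : nat -> \bar R) : (0 < th < 1)%R -> 0 < q -> (0 <= M)%R ->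
  (forall j, 0 <= b j) -> (forall j, b j <= (th ^+ j * (th ^+ j * M))%:E) ->
  lq q [set: nat] b < +oo.
Proof.
move=> t01 q0 M0 b0 bM; have [C C00 HC] := lq_geo_weight t01 q0 (@ltr01 R).
have /andP[t0 t1] := t01.
have e0 j : 0 <= (th ^+ j * M)%:E by rewrite lee_fin mulr_ge0// exprn_ge0// ltW.
apply: (@le_lt_trans _ _ (lq q [set: nat] (fun l => (th ^+ l)%:E * (th ^+ l * M)%:E))).
  by apply: le_lq => // j _; rewrite -EFinM.
rewrite -[X in X < _](@poweRe1 R); last first.
  by apply: lq_ge0 => // j; apply: mule_ge0 => //; rewrite lee_fin exprn_ge0// ltW.
apply: le_lt_trans (HC _ e0) _; rewrite lte_mul_pinfty ?lee_fin//.
under eq_esum do rewrite poweRe1//.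
under eq_esum do rewrite EFinM.
apply: le_lt_trans (esum_geoZ t01 _) _; first by rewrite lee_fin.
by rewrite -EFinM ltry.
Qed.

(** The finitely many finite terms of the head, extended by 0, are bounded by a constant times
    [del ^ (2 j)], so the criterion for rapidly decreasing sequences applies to them for every
    [q]. *)
Lemma lq_head_tail (N : nat) q (b : nat -> \bar R) : 0 < q -> (forall j, 0 <= b j) ->
  (forall j, (j <= N)%N -> b j < +oo) -> lq q [set k | (N < k)%N] b < +oo ->
  lq q [set: nat] b < +oo.
Proof.
move=> q0 b0 bN tail; have [C C00 HC] := le_lqD q0.
have d01 : (0 < del < 1)%R by rewrite del_gt0 del_lt1.
have dj j : (0 < del ^+ j)%R by rewrite exprn_gt0// del_gt0.
have dV j : (0 <= del ^- j)%R by rewrite invr_ge0 ltW.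
have h j : (j <= N)%N -> 0 <= (del ^- j * del ^- j)%:E * b j < +oo.
  move=> jN; rewrite mule_ge0 ?lee_fin ?mulr_ge0//= lte_mul_pinfty ?lee_fin ?mulr_ge0//.
  exact: bN.
have [M M0 HM] := finite_head h.
pose u j := if (j <= N)%N then b j else 0.
pose v j := if (j <= N)%N then 0 else b j.
have u0 j : 0 <= u j by rewrite /u; case: ifP.
have v0 j : 0 <= v j by rewrite /v; case: ifP.
have bE : b = fun j => u j + v j.
  by apply/funext => j; rewrite /u /v; case: ifP; rewrite ?adde0 ?add0e.
rewrite bE; apply: le_lt_trans (HC u v u0 v0) _; rewrite lte_mul_pinfty ?lee_fin//.
apply: lte_add_pinfty; last exact: le_lt_trans (lq_mask N q0 b0) tail.
apply: (lq_rapid d01 q0 M0 u0) => j; rewrite /u; case: leqP => jN; last first.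
  by rewrite lee_fin; apply: mulr_ge0; [|apply: mulr_ge0 => //]; exact: ltW.
apply: (@le_trans _ _ ((del ^+ j * del ^+ j)%:E * ((del ^- j * del ^- j)%:E * b j))).
  rewrite muleA -EFinM mulrACA mulfV ?gt_eqF// mul1r mul1e//.
rewrite [X in _ <= X%:E]mulrA [X in _ <= X]EFinM; apply: lee_wpmul2l; last exact: HM.
by rewrite lee_fin; apply: mulr_ge0; exact: ltW.
Qed.

Lemma choose_points (x0 : X) (P : nat -> idx D -> X -> Prop) :
  (forall j t, idx_at D (lev j) t -> exists2 x, cube D (lev j) t x & P j t x) ->
  exists pt : nat -> idx D -> X, forall j t, idx_at D (lev j) t ->
    cube D (lev j) t (pt j t) /\ P j t (pt j t).
Proof.
move=> h; have /choice[pt Hpt] : forall p : nat * idx D, exists x, idx_at D (lev p.1) p.2 ->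
    cube D (lev p.1) p.2 x /\ P p.1 p.2 x.
  (* [x0] is a default value for indices that do not belong to the level. *)
  move=> [j t]; have [It|nI] := pselect (idx_at D (lev j) t); last by exists x0.
  by have [x xt Px] := h j t It; exists x.
by exists (fun j t => pt (j, t)) => j t; exact: (Hpt (j, t)).
Qed.

(* The infimum of [`|h|] over a cube need not be attained, and can vanish. *)
Lemma near_inf_point k t (h : X -> R) (e : R) : idx_at D k t -> (0 < e)%R ->
  exists2 x, cube D k t x & forall z, cube D k t z -> (`|h x| <= `|h z| + e)%R.
Proof.
move=> It e0; have [x tx] := cube_neq0 It.
have hi : has_inf [set `|h z|%R | z in cube D k t].
  by split; [exists `|h x|%R, x|exists 0%R => _ [z _ <-]].
have [_ [y ty <-] yi] := inf_adherent e0 hi.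
exists y => // z tz; apply: (le_trans (ltW yi)); rewrite lerD2r.
by apply: ge_inf; [case: hi|exists z].
Qed.

(** Positive tolerances for all cubes of a level whose total [p]-th power is bounded uniformly in
    the level: [2 ^ (- r t)], with [r] an enumeration of the cubes, is divided by the measure of the
    cube. *)
Lemma cell_weights k p : (0 < p)%R -> exists E : idx D -> R,
  [/\ forall t, (0 <= E t)%R, forall t, idx_at D k t -> (0 < E t)%R &
      \int[mu]_x (E (cidx k x) `^ p)%:E <= 2%:E].
Proof.
move=> p0; have /countable_injP[r rinj] := idx_at_countable k.
pose w (n : nat) : R := (2^-1 ^+ n)%R.
have w0 n : (0 < w n)%R by rewrite exprn_gt0.
exists (fun t => (w (r t) / fine (mu (cube D k t))) `^ p^-1)%R; split => [t|t It|].
- exact: powR_ge0.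
- by rewrite powR_gt0// divr_gt0// cube_mu_gt0.
rewrite (@integral_cidx k (fun t => (((w (r t) / fine (mu (cube D k t))) `^ p^-1) `^ p)%:E)); last first.
  by move=> t; rewrite lee_fin powR_ge0.
rewrite (eq_esum (b := fun t => (w (r t))%:E)); last first.
  move=> t It; have m0 := cube_mu_gt0 It.
  rewrite -powRrM mulVf ?gt_eqF// powRr1; last by rewrite divr_ge0// ltW.
  by rewrite (cube_mu It) -EFinM mulfVK// gt_eqF.
have rbij : set_bij (idx_at D k) (r @` idx_at D k) r.
  exact: inj_bij.
rewrite -(@reindex_esum _ _ _ _ _ _ (fun n => (w n)%:E) rbij).
apply: (le_trans (subset_esum _ (@subsetT _ _))).
have h : (0 < (2^-1 : R) < 1)%R by rewrite invr_gt0 ltr0n invf_lt1 ?ltr1n.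
by apply: le_trans (esum_geo h) _; rewrite lee_fin le_eqVlt; apply/orP; left; apply/eqP; field.
Qed.

(** The integrals of the positive and of the negative part are each bounded by that of [|h|], by
    monotonicity alone; an infinite value makes the right-hand side infinite. *)
Lemma abs_avg_le E (h : X -> R) : (`|avg H E h|)%:E <= avge H E (fun x => `|h x|%R).
Proof.
rewrite /avg /avge normrM EFinM ger0_norm ?invr_ge0 ?fine_ge0//.
apply: lee_wpmul2l; first by rewrite lee_fin invr_ge0 fine_ge0.
rewrite /Rintegral integralE.
have A : \int[mu]_(x in E) (fun y => (h y)%:E)^\+ x <= \int[mu]_(x in E) `|h x|%:E.
  apply: ge0_le_integral_nomeas => x _ //.
  by rewrite funeposE /= -EFin_max lee_fin ge_max normr_ge0 ler_norm.
have B : \int[mu]_(x in E) (fun y => (h y)%:E)^\- x <= \int[mu]_(x in E) `|h x|%:E.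
  apply: ge0_le_integral_nomeas => x _ //.
  by rewrite funenegE /= -EFin_max lee_fin ge_max normr_ge0 -normrN ler_norm.
have I0 : 0 <= \int[mu]_(x in E) `|h x|%:E by apply: integral_ge0 => x _; rewrite lee_fin.
have A0' : 0 <= \int[mu]_(x in E) (fun y => (h y)%:E)^\+ x by apply: integral_ge0.
have B0' : 0 <= \int[mu]_(x in E) (fun y => (h y)%:E)^\- x by apply: integral_ge0.
move: A B A0' B0' I0.
case: (\int[mu]_(x in E) (fun y => (h y)%:E)^\+ x) => [u||]//; case: (\int[mu]_(x in E) (fun y => (h y)%:E)^\- x) => [v||]//;
 case: (\int[mu]_(x in E) `|h x|%:E) => [w||]//; rewrite ?leey ?lee_fin//=.
by move=> uw vw u0 v0 w0; rewrite ler_norml; apply/andP; split; lra.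
Qed.

(** * Mixed norms of the coefficients *)

Section coefficients.
Variables (s p : R) (N : nat) (h : nat -> X -> R) (a E : nat -> idx D -> R).
Hypotheses (p0 : (0 < p)%R) (a0 : forall j t, (0 <= a j t)%R) (E0 : forall j t, (0 <= E j t)%R).
(** The factor [del ^ (s j)] cancels the weight [wt D s j]; the remaining [del ^ j] makes the errors
    summable over the levels. *)
Let eps j t := ((del `^ (s + 1)) ^+ j * E j t)%R.
Hypotheses (low : forall j, (j <= N)%N -> \int[mu]_x coefun a j x `^ p < +oo)
  (EI : forall j, \int[mu]_x (E j (cidx (lev j) x) `^ p)%:E <= 2%:E)
  (tail : forall j t x, (N < j)%N -> idx_at D (lev j) t -> cube D (lev j) t x ->
     (a j t <= `|h j x| + (del `^ (s + 1)) ^+ j * E j t)%R).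

(** The bound [a <= |h| + eps] cannot be split under an integral, as [h] may fail to be measurable.
    It is replaced by [a <= r + v] with both terms functions of the cube index: [r] collects the low
    levels and the errors, and [v] is at most [|h|] on high levels. *)
Let r (j : nat) (t : idx D) : R := if (j <= N)%N then a j t else eps j t.
Let v (j : nat) (t : idx D) : R := (if (j <= N)%N then 0 else Num.max (a j t - eps j t) 0)%R.
Let eps0 j t : (0 <= eps j t)%R.
Proof. by apply: mulr_ge0 => //; apply: exprn_ge0; exact: powR_ge0. Qed.
Let r0 j t : (0 <= r j t)%R. Proof. by rewrite /r; case: ifP. Qed.
Let v0 j t : (0 <= v j t)%R. Proof. by rewrite /v; case: ifP => // _; rewrite le_max lexx orbT. Qed.
Let w0 (j : nat) : 0 <= (wt D s j%:Z)%:E. Proof. by rewrite lee_fin; exact: powR_ge0. Qed.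

Let split_coef j x : coefun a j x <= coefun r j x + coefun v j x.
Proof.
rewrite -EFinD lee_fin /r /v; case: leqP => _; first by rewrite addr0.
by rewrite addrC -lerBlDr le_max lexx.
Qed.

Let v_le j x : (N < j)%N -> coefun v j x <= `|h j x|%:E.
Proof.
move=> Nj; rewrite lee_fin /v leqNgt Nj/= ge_max normr_ge0 andbT lerBlDr.
by apply: tail => //; [exact: cidx_at|exact: cidx_cube].
Qed.

Let mc (b : nat -> idx D -> R) j : measurable_fun setT (fun x => coefun b j x `^ p).
Proof. by apply: measurable_poweR_comp; exact: (@measurable_cidx _ _ _ (fun t => (b j t)%:E)). Qed.

Let rapid : exists2 M : R, (0 <= M)%R & forall j : nat,
  (wt D s j%:Z `^ p)%:E * \int[mu]_x coefun r j x `^ p <= ((del ^+ j) `^ p * M)%:E.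
Proof.
have d0 := del_gt0; have dj (j : nat) : (0 < (del ^+ j) `^ p)%R by rewrite powR_gt0// exprn_gt0.
have I0 b (j : nat) : 0 <= \int[mu]_x coefun b j x `^ p.
  by apply: integral_ge0 => x _; exact: poweR_ge0.
have wp (j : nat) : (0 <= wt D s j%:Z `^ p)%R by exact: powR_ge0.
have hd j : (j <= N)%N -> 0 <= (((del ^+ j) `^ p)^-1 * wt D s j%:Z `^ p)%:E * \int[mu]_x coefun a j x `^ p < +oo.
  move=> jN; have c0 : (0 <= ((del ^+ j) `^ p)^-1 * wt D s j%:Z `^ p)%R.
    by apply: mulr_ge0 => //; rewrite invr_ge0 ltW.
  apply/andP; split; first by apply: mule_ge0; rewrite ?lee_fin.
  by rewrite lte_mul_pinfty ?lee_fin//; exact: low.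
have [M M0 HM] := finite_head hd.
exists (M + 2)%R; first by rewrite addr_ge0.
move=> j; have [jN|Nj] := leqP j N.
  have -> : coefun r j = coefun a j by apply/funext => x; rewrite /coefun /r jN.
  apply: (@le_trans _ _ (((del ^+ j) `^ p)%:E * M%:E)); last first.
    by rewrite -EFinM lee_fin ler_wpM2l ?lerDl// ltW.
  apply: le_trans (lee_wpmul2l _ (HM j jN)); last by rewrite lee_fin ltW.
  by rewrite muleA -EFinM mulrA mulfV ?gt_eqF// mul1r.
have -> : (fun x => coefun r j x `^ p) = (fun x => ((((del `^ (s + 1)) ^+ j) `^ p)%:E * (E j (cidx (lev j) x) `^ p)%:E)).
  apply/funext => x; rewrite /coefun /r leqNgt Nj/= -EFinM -powRM//.
  by apply: exprn_ge0; exact: powR_ge0.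
rewrite integralTZ; first last.
- by move=> x; rewrite lee_fin powR_ge0.
- exact: (@measurable_cidx _ _ _ (fun t => (E j t `^ p)%:E)).
- exact: powR_ge0.
rewrite muleA -EFinM -powRM; last 2 first.
- exact: powR_ge0.
- by apply: exprn_ge0; exact: powR_ge0.
have -> : (wt D s j%:Z * (del `^ (s + 1)) ^+ j = del ^+ j)%R.
  rewrite /wt -[X in (_ * X)%R]powR_mulrn ?powR_ge0// -powRrM -powRD ?del_neq0 ?implybT//.
  by rewrite -pmulrn -[RHS]powR_mulrn ?(ltW d0)//; congr (_ `^ _)%R; ring.
rewrite [X in _ <= X]EFinM; apply: lee_wpmul2l; first by rewrite lee_fin ltW.
by apply: le_trans (EI j) _; rewrite lee_fin lerDr.
Qed.

(** The decay [del ^ j] of the remainder is used in two halves: one carries the [q]-norm, the other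
    the sum over the levels. *)
Let th := Num.sqrt del.
Let thh : (th * th = del)%R. Proof. by rewrite -expr2 sqr_sqrtr// ltW// del_gt0. Qed.
Let th01 : (0 < th < 1)%R.
Proof.
rewrite sqrtr_gt0 del_gt0/= -(@ltr_pXn2r _ 2) ?nnegrE ?sqrtr_ge0// expr1n sqr_sqrtr.
  exact: del_lt1.
exact/ltW/del_gt0.
Qed.

Lemma besov_coefficients q : 0 < q ->
  lq q [set k | (N < k)%N] (fun k : nat => (wt D s k%:Z)%:E * (\int[mu]_x `|h k x|%:E `^ p) `^ p^-1) < +oo ->
  lq q [set: nat] (fun j : nat => (wt D s j%:Z)%:E * (\int[mu]_x coefun a j x `^ p) `^ p^-1) < +oo.
Proof.
move=> q0 fin; have [M M0 HM] := rapid; have [C C00 HC] := le_lqD q0.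
have pV : (0 < p^-1)%R by rewrite invr_gt0.
have I0 b (j : nat) : 0 <= \int[mu]_x coefun b j x `^ p.
  by apply: integral_ge0 => x _; exact: poweR_ge0.
pose Ib b (j : nat) := (wt D s j%:Z)%:E * (\int[mu]_x coefun b j x `^ p) `^ p^-1.
have Ib0 b j : 0 <= Ib b j by apply: mule_ge0 => //; exact: poweR_ge0.
pose c := ((2 `^ p) `^ p^-1 * 2 `^ p^-1)%R.
have c0 : (0 <= c)%R by apply: mulr_ge0; exact: powR_ge0.
have step j : Ib a j <= c%:E * (Ib r j + Ib v j).
  rewrite /Ib -ge0_muleDr ?poweR_ge0// muleCA; apply: lee_wpmul2l => //.
  apply: (@le_trans _ _ (((2 `^ p)%:E * (\int[mu]_x coefun r j x `^ p + \int[mu]_x coefun v j x `^ p)) `^ p^-1)).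
    apply: le_poweR; [exact: ltW|exact: I0|].
    rewrite -ge0_integralD//; last 2 first.
    - by move=> x _; exact: poweR_ge0.
    - by move=> x _; exact: poweR_ge0.
    rewrite -integralTZ; first last.
    - by move=> x; apply: adde_ge0; exact: poweR_ge0.
    - exact: emeasurable_funD.
    - exact: powR_ge0.
    apply: ge0_le_integral_nomeas => x _; first exact: poweR_ge0.
    have cf0 b : (forall j t, 0 <= b j t)%R -> 0 <= coefun b j x by move=> b0; rewrite lee_fin.
    apply: le_trans (poweRD_max p0 (cf0 r r0) (cf0 v v0)).
    by apply: le_poweR; [exact: ltW|exact: cf0|exact: split_coef].
  rewrite poweRZl ?powR_ge0//; last exact: adde_ge0.
  rewrite [X in _ <= X * _]EFinM -[X in _ <= X]muleA.
  apply: lee_wpmul2l; first by rewrite lee_fin powR_ge0.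
  by apply: poweRD_max.
apply: (@le_lt_trans _ _ (c%:E * (C%:E * (lq q [set: nat] (Ib r) + lq q [set: nat] (Ib v))))).
  apply: (@le_trans _ _ (lq q [set: nat] (fun j => c%:E * (Ib r j + Ib v j)))).
    by apply: le_lq => // j _; [exact: (Ib0 a)|exact: step].
  apply: le_trans (lqZl _ q0 c0 _) _; first by move=> j; exact: adde_ge0.
  by apply: lee_wpmul2l; rewrite ?lee_fin//; exact: HC.
rewrite lte_mul_pinfty ?lee_fin// lte_mul_pinfty ?lee_fin//.
apply: lte_add_pinfty.
  apply: (@lq_rapid th (M `^ p^-1) _ _ th01 q0 _ (Ib0 r)); first exact: powR_ge0.
  move=> j; rewrite /Ib mulrA -exprMn thh.
  have e : Ib r j = ((wt D s j%:Z `^ p)%:E * \int[mu]_x coefun r j x `^ p) `^ p^-1.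
    rewrite poweRM ?lee_fin ?powR_ge0// poweR_EFin -powRrM mulfV ?gt_eqF// powRr1//.
    by rewrite -lee_fin.
  rewrite -/(Ib r j) e; apply: (le_trans (le_poweR (ltW pV) _ (HM j))).
    by apply: mule_ge0; rewrite ?lee_fin ?powR_ge0.
  rewrite poweR_EFin powRM ?powR_ge0// -powRrM mulfV ?gt_eqF// powRr1//.
  by apply: exprn_ge0; exact/ltW/del_gt0.
apply: le_lt_trans fin.
have b0 (k : nat) : 0 <= (wt D s k%:Z)%:E * (\int[mu]_x `|h k x|%:E `^ p) `^ p^-1.
  by apply: mule_ge0 => //; exact: poweR_ge0.
apply: le_trans (lq_mask N q0 b0); apply: le_lq => // j _.
case: leqP => Nj.
  rewrite /Ib (_ : (fun x => coefun v j x `^ p) = cst 0).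
    by rewrite integral_cst// mul0e poweR0r ?gt_eqF// mule0.
  by apply/funext => x; rewrite /coefun /v Nj poweR0r// gt_eqF.
apply: lee_wpmul2l => //; apply: le_poweR; [exact: ltW|exact: I0|].
apply: ge0_le_integral_nomeas => x _; first exact: poweR_ge0.
by apply: le_poweR; [exact: ltW|rewrite lee_fin|exact: v_le].
Qed.

Lemma triebel_coefficients q : 0 < q ->
  \int[mu]_x (lq q [set k | (N < k)%N] (fun k : nat => (wt D s k%:Z * `|h k x|)%:E)) `^ p < +oo ->
  \int[mu]_x (lq q [set: nat] (fun j : nat => (wt D s j%:Z)%:E * coefun a j x)) `^ p < +oo.
Proof.
move=> q0 fin; have [M M0 HM] := rapid; have [C C00 HC] := le_lqD q0.
have [C' C'0 HC'] := lq_geo_weight th01 q0 p0.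
have /andP[t0 t1] := th01.
have cf0 b j x : (forall j t, 0 <= b j t)%R -> 0 <= coefun b j x by move=> b0; rewrite lee_fin.
pose L b x := lq q [set: nat] (fun j : nat => (wt D s j%:Z)%:E * coefun b j x).
have L0 b x : (forall j t, 0 <= b j t)%R -> 0 <= L b x.
  by move=> b0; apply: lq_ge0 => // j; apply: mule_ge0 => //; exact: cf0.
have mL b : (forall j t, 0 <= b j t)%R -> measurable_fun setT (fun x => L b x `^ p).
  move=> b0; apply: measurable_poweR_comp; apply: measurable_lq => // j.
    by move=> x; apply: mule_ge0 => //; exact: cf0.
  by apply: measurable_funeM; exact: (@measurable_cidx _ _ _ (fun t => (b j t)%:E)).
have step x : L a x `^ p <= (C `^ p * 2 `^ p)%:E * (L r x `^ p + L v x `^ p).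
  apply: (@le_trans _ _ ((C%:E * (L r x + L v x)) `^ p)).
    apply: le_poweR; [exact: ltW|exact: L0|].
    apply: le_trans (HC _ _ _ _).
    - apply: le_lq => // j _; first by apply: mule_ge0 => //; exact: cf0.
      by rewrite -ge0_muleDr ?cf0//; apply: lee_wpmul2l.
    - by move=> j; apply: mule_ge0 => //; exact: cf0.
    - by move=> j; apply: mule_ge0 => //; exact: cf0.
  rewrite poweRM ?lee_fin ?adde_ge0 ?L0// poweR_EFin EFinM -muleA.
  apply: lee_wpmul2l; first by rewrite lee_fin powR_ge0.
  by apply: poweRD_max => //; exact: L0.
have c0 : (0 <= C `^ p * 2 `^ p)%R by apply: mulr_ge0; exact: powR_ge0.
apply: (@le_lt_trans _ _ (\int[mu]_x ((C `^ p * 2 `^ p)%:E * (L r x `^ p + L v x `^ p)))).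
  by apply: ge0_le_integral_nomeas => x _; [exact: poweR_ge0|exact: step].
rewrite integralTZ//; first last.
- by move=> x; apply: adde_ge0; exact: poweR_ge0.
- by apply: emeasurable_funD; exact: mL.
rewrite lte_mul_pinfty ?lee_fin// ge0_integralD//; first last.
- exact: mL.
- by move=> x _; exact: poweR_ge0.
- exact: mL.
- by move=> x _; exact: poweR_ge0.
apply: lte_add_pinfty; last first.
  apply: le_lt_trans fin; apply: ge0_le_integral_nomeas => x _; first exact: poweR_ge0.
  apply: le_poweR; [exact: ltW|exact: L0|].
  have b0 (k : nat) : 0 <= (wt D s k%:Z * `|h k x|)%:E.
    by rewrite lee_fin; apply: mulr_ge0 => //; exact: powR_ge0.
  apply: le_trans (lq_mask N q0 b0); apply: le_lq => // j _.
    by apply: mule_ge0 => //; exact: cf0.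
  case: leqP => Nj; first by rewrite /coefun /v Nj mule0.
  by rewrite EFinM; apply: lee_wpmul2l => //; exact: v_le.
have wp (j : nat) : (0 <= wt D s j%:Z `^ p)%R by exact: powR_ge0.
(* Takes the weight [th ^ j] required by [lq_geo_weight] out of the remainder, which decays like its
   square. *)
pose z (j : nat) : R := (th ^- j)%R.
have z0 j : (0 <= z j)%R by rewrite invr_ge0 exprn_ge0// ltW.
pose e (j : nat) x := (z j)%:E * ((wt D s j%:Z)%:E * coefun r j x).
have e0 j x : 0 <= e j x.
  by apply: mule_ge0; [rewrite lee_fin|apply: mule_ge0 => //; exact: cf0].
have eE j x : e j x `^ p = (z j `^ p * wt D s j%:Z `^ p)%:E * coefun r j x `^ p.
  rewrite /e; move: (coefun r j x) (cf0 r j x r0) => y y0.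
  have wj : (0 <= wt D s j%:Z)%R by exact: powR_ge0.
  have zw : (0 <= z j * wt D s j%:Z)%R by exact: mulr_ge0.
  by rewrite muleA -EFinM poweRM ?lee_fin// poweR_EFin powRM.
have me j : measurable_fun setT (fun x => e j x `^ p).
  under eq_fun do rewrite eE; exact: measurable_funeM.
apply: (@le_lt_trans _ _ (\int[mu]_x (C'%:E * \esum_(j in [set: nat]) e j x `^ p))).
  apply: ge0_le_integral_nomeas => x _; first exact: poweR_ge0.
  apply: le_trans (HC' (fun j => e j x) (fun j => e0 j x)).
  rewrite le_eqVlt; apply/orP; left; apply/eqP; congr (lq _ _ _ `^ _); apply/funext => j.
  rewrite /e; move: (coefun r j x) => y.
  by rewrite [RHS]muleA -[in RHS]EFinM /z mulfV ?mul1e// expf_neq0// gt_eqF.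
rewrite integralTZ//; first last.
- by move=> x; apply: esum_ge0 => j _; exact: poweR_ge0.
- apply: measurable_esum; [exact: countableP| |by move=> j _; exact: me].
  by move=> j x; exact: poweR_ge0.
rewrite lte_mul_pinfty ?lee_fin// integral_esum//; first last.
- by move=> j x; exact: poweR_ge0.
- exact: countableP.
have u01 := powR_lt1 th01 p0; have /andP[u0 u1] := u01.
apply: (@le_lt_trans _ _ (\esum_(j in [set: nat]) (((th `^ p) ^+ j)%:E * M%:E))); last first.
  apply: le_lt_trans (esum_geoZ u01 _) _; first by rewrite lee_fin.
  by rewrite -EFinM ltry.
apply: le_esum => j _; under eq_integral do rewrite eE.
rewrite integralTZ//; first last.
- by move=> x; exact: poweR_ge0.
- by apply: mulr_ge0; exact: powR_ge0.
rewrite EFinM -muleA; apply: (le_trans (lee_wpmul2l _ (HM j))); first by rewrite lee_fin powR_ge0.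
rewrite -!EFinM lee_fin mulrA; apply: ler_wpM2r => //.
rewrite -powRM ?exprn_ge0 ?(ltW del_gt0)// -powR_exprn ?(ltW t0)//.
rewrite (_ : z j * del ^+ j = th ^+ j)%R// /z -thh exprMn mulrA mulVf ?mul1r//.
by rewrite expf_neq0// gt_eqF.
Qed.

End coefficients.

(** * Representation of distributions by functions and the inclusions *)

Section inclusions.
Variables (x0 : X) (r0 eta beta gam s Q Ct : R) (Qk : nat -> X -> X -> R) (N : nat).
Hypotheses (r00 : (0 < r0)%R) (gam0 : (0 < gam)%R) (s_bound : (0 < s < beta)%R)
  (s_gam : (s < gam)%R) (Ct0 : (0 < Ct)%R) (CtK : (Ct <= K)%R)
  (HN : calderon_number D x0 r0 eta beta gam Qk N).
Let s_gt0 : (0 < s)%R. Proof. by case/andP: s_bound. Qed.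
Let beta0 : (0 < beta)%R. Proof. by case/andP: s_bound => h1 h2; exact: lt_trans h1 h2. Qed.

Section distribution.
Variables (pt : nat -> idx D -> X) (f : (X -> R) -> R).
Hypothesis pt_cube : forall j t, idx_at D (lev j) t -> cube D (lev j) t (pt j t).
Hypothesis Hf : distribution H x0 r0 eta beta gam f.
Let a (j : nat) (t : idx D) : R := `|coeff Qk N pt f j t|%R.
Let a0 j t : (0 <= a j t)%R. Proof. exact: normr_ge0. Qed.

Definition atomic (C1 : R) (phi : nat -> idx D -> X -> R) : Prop :=
  [/\ (0 <= C1)%R,
      forall j t x, idx_at D (lev j) t -> `|phi j t x|%:E <= C1%:E *
        smo (del `^ gam) (j%:Z - 1) (fun z => (a j t * \1_(cube D (lev j) t) z)%:E) x &
      forall j t x x' (k : int), idx_at D (lev j) t ->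
        (d x x' <= rho k)%R -> `|phi j t x - phi j t x'|%:E <= (C1 * modulus beta k j)%:E *
        (smo (del `^ gam) (j%:Z - 1) (fun z => (a j t * \1_(cube D (lev j) t) z)%:E) x +
         smo (del `^ gam) (j%:Z - 1) (fun z => (a j t * \1_(cube D (lev j) t) z)%:E) x')].

(** A Sobolev embedding on the level of coefficients: from the exponent [p] and smoothness [s] to
    the exponent 1 and [s' = s - Q (1/p - 1)]. The hypothesis on [p] says that [s'] is positive, so
    the sum over the levels still converges. *)
Let sum_lty1 (p B : R) : (0 < p < 1)%R -> local_lower_bound H Q -> (Q * (1 - p) < s * p)%R ->
  (forall j : nat, (wt D s j%:Z `^ p)%:E * \int[mu]_x coefun a j x `^ p <= B%:E) ->
  \int[mu]_x (\esum_(j in [set: nat]) envel gam a j x) `^ 1 < +oo.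
Proof.
move=> p01 llb Qp HB; have /andP[p0 p1] := p01.
have [C C00 HC] := integral_cidx_pow llb p01.
have B0 : (0 <= B)%R.
  rewrite -lee_fin; apply: le_trans (HB 0%N); apply: mule_ge0; first by rewrite lee_fin; exact: powR_ge0.
  by apply: integral_ge0 => x _; exact: poweR_ge0.
pose s' := (s - Q * (p^-1 - 1))%R.
have [Q0 _] := llb.
have s'p : (s' * p = s * p - Q * (1 - p))%R by rewrite /s'; field; rewrite gt_eqF.
have s'b : (0 < s' < beta)%R.
  apply/andP; split; first by rewrite -(pmulr_lgt0 _ p0) s'p subr_gt0.
  case/andP: s_bound => _; apply: le_lt_trans; rewrite /s' gerBl.
  by apply: mulr_ge0; [exact: ltW|rewrite subr_ge0 invf_ge1// ltW].
apply: (envel_sum_pow_lty (B := ((C * B) `^ p^-1)%R) gam0 a0 s'b ltr01) => [|j].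
  by rewrite ltxx.
have d0 := del_gt0.
have I0 : 0 <= \int[mu]_x coefun a j x by apply: integral_ge0 => x _; rewrite lee_fin.
have w0 : (0 <= wt D s' j%:Z)%R by exact: powR_ge0.
rewrite powRr1//; under eq_integral do rewrite poweRe1 ?lee_fin//.
rewrite -[X in _ <= X]poweR_EFin -poweR_leP//; last 2 first.
- by apply: mule_ge0; rewrite ?lee_fin.
- by rewrite lee_fin mulr_ge0.
rewrite poweRZl//; apply: (le_trans (lee_wpmul2l _ (HC j (a j) (a0 j)))).
  by rewrite lee_fin powR_ge0.
rewrite muleA -EFinM.
have -> : (wt D s' j%:Z `^ p * (C * ((del `^ Q) ^+ j) `^ (p - 1)) = C * wt D s j%:Z `^ p)%R.
  rewrite mulrCA; congr (_ * _)%R; rewrite /wt -[X in (X `^ (p - 1))%R]powR_mulrn ?powR_ge0//.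
  rewrite -!powRrM -powRD ?del_neq0 ?implybT// -pmulrn; congr (_ `^ _)%R.
  rewrite !mulNr -[(j%:R * s' * p)%R]mulrA s'p; ring.
rewrite [X in X * _]EFinM -muleA [X in _ <= X]EFinM; apply: lee_wpmul2l; first by rewrite lee_fin.
exact: HB.
Qed.

Lemma represents_pow (p B : R) : (0 < p)%R -> ((p < 1)%R -> (om * (1 - p) < gam * p)%R) ->
  ((p < 1)%R -> local_lower_bound H Q /\ (Q * (1 - p) < s * p)%R) ->
  (forall j : nat, (wt D s j%:Z `^ p)%:E * \int[mu]_x coefun a j x `^ p <= B%:E) ->
  exists (C1 : R) (phi : nat -> idx D -> X -> R),
  [/\ atomic C1 phi, in_Lp H p%:E (synth phi) &
      represents H x0 r0 eta beta gam (synth phi) f].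
Proof.
move=> p0 gp sp HB.
have [C1 [phi [C10 size reg rep]]] := calderon_synth gam0 beta0 HN pt_cube Hf.
have SI := envel_sum_pow_lty gam0 a0 s_bound p0 gp HB.
exists C1, phi; split; first by split.
  exact: (synth_Lp gam0 beta0 C10 a0 size reg p0 SI).
move=> g g0; have [mg [M M0 gM] gI] := test_bounded r00 gam0 (proj1 g0).
apply: rep => //; have [p1|p1] := leP 1%R p.
  exact: (envel_test_lty gam0 a0 p1 mg M0 gM gI SI).
have [llb Qp] := sp p1.
apply: (envel_test_lty gam0 a0 (lexx _) mg M0 gM gI).
by apply: (sum_lty1 (B := B) _ llb Qp HB); rewrite p0.
Qed.

Lemma represents_sup (A : nat -> \bar R) (B : R) :
  (forall j t, idx_at D (lev j) t -> (a j t)%:E <= A j) ->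
  (forall j : nat, (wt D s j%:Z)%:E * A j <= B%:E) ->
  exists (C1 : R) (phi : nat -> idx D -> X -> R),
  [/\ atomic C1 phi, in_Lp H +oo (synth phi) &
      represents H x0 r0 eta beta gam (synth phi) f].
Proof.
move=> aA HB.
have [C1 [phi [C10 size reg rep]]] := calderon_synth gam0 beta0 HN pt_cube Hf.
have [M M0 SM] := envel_sum_ub gam0 a0 s_bound aA HB.
exists C1, phi; split; first by split.
  exact: (synth_Loo gam0 beta0 C10 a0 size reg SM).
move=> g g0; have [mg _ gI] := test_bounded r00 gam0 (proj1 g0).
by apply: rep => //; exact: (envel_test_ub gam0 a0 M0 mg gI SM).
Qed.

Lemma low_coefficients (p : R) : (0 < p)%R -> BF_low D Qk N p%:E f < +oo ->
  forall j, (j <= N)%N -> \int[mu]_x coefun a j x `^ p < +oo.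
Proof.
move=> p0 fin j jN.
pose v (k : nat) (b : idx D) (m : nat) := avge H (subcube k b m) (fun x => `|dist_op Qk k f x|%R).
have v0 k b m : 0 <= v k b m.
  by apply: mule_ge0; [rewrite lee_fin invr_ge0 fine_ge0|apply: integral_ge0 => x _; rewrite lee_fin].
pose S (k : nat) := \esum_(b in idx_at D k%:Z) \sum_(0 <= m < nsub D k b) mu (subcube k b m) * v k b m `^ p.
have t0 (k : nat) (b : idx D) (m : nat) : 0 <= mu (subcube k b m) * v k b m `^ p by apply: mule_ge0 => //; exact: poweR_ge0.
have S0 k : 0 <= S k by apply: esum_ge0 => b _; apply: sume_ge0 => m _.
have Sfin : \sum_(0 <= k < N.+1) S k < +oo.
  move: fin; rewrite /BF_low -/v.
  have T0 : 0 <= \sum_(0 <= k < N.+1) S k by apply: sume_ge0 => k _.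
  have [-> |/negP/negP h _] := eqVneq (\sum_(0 <= k < N.+1) S k) +oo; last by rewrite ltey.
  by rewrite -/(S _) poweRyr ?gt_eqF ?invr_gt0.
have Sj : S j < +oo.
  apply: le_lt_trans Sfin; rewrite (big_cat_nat (n := j))//=; last exact: ltnW.
  rewrite [X in _ + X]big_ltn//; apply: (@le_trans _ _ (S j + \sum_(j.+1 <= i < N.+1) S i)).
    by rewrite leeDl// sume_ge0.
  by rewrite leeDr// sume_ge0.
apply: le_lt_trans Sj; under eq_integral do rewrite poweR_EFin.
rewrite (@integral_cidx _ (fun t => (a j t `^ p)%:E)); last by move=> t; rewrite lee_fin powR_ge0.
rewrite -esum_sub_idx; last by move=> t; apply: mule_ge0; rewrite ?lee_fin ?powR_ge0.
apply: le_esum => b _; apply: lee_sum => m _; rewrite muleC; apply: lee_wpmul2l => //.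
rewrite -poweR_EFin; apply: le_poweR; [exact: ltW|by rewrite lee_fin|].
by rewrite /a /coeff jN; exact: abs_avg_le.
Qed.

End distribution.

(** The sample points depend on [f], as the reproducing formula permits with constants independent
    of the points. *)
Lemma good_points (p : R) f : (0 < p)%R -> exists (pt : nat -> idx D -> X) (E : nat -> idx D -> R),
  [/\ forall j t, idx_at D (lev j) t -> cube D (lev j) t (pt j t),
      forall j t, (0 <= E j t)%R,
      forall j, \int[mu]_x (E j (cidx (lev j) x) `^ p)%:E <= 2%:E &
      forall j t x, (N < j)%N -> idx_at D (lev j) t -> cube D (lev j) t x ->
       (`|coeff Qk N pt f j t| <= `|dist_op Qk j f x| + (del `^ (s + 1)) ^+ j * E j t)%R].
Proof.
move=> p0; have /choice[E HE] : forall j : nat, exists E : idx D -> R,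
  [/\ forall t, (0 <= E t)%R, forall t, idx_at D (lev j) t -> (0 < E t)%R &
      \int[mu]_x (E (cidx (lev j) x) `^ p)%:E <= 2%:E] by move=> j; exact: cell_weights.
have [pt Hpt] := @choose_points x0 (fun j t x => forall z, cube D (lev j) t z ->
    (`|dist_op Qk j f x| <= `|dist_op Qk j f z| + (del `^ (s + 1)) ^+ j * E j t)%R) (fun j t It =>
    near_inf_point (dist_op Qk j f) It (mulr_gt0 (exprn_gt0 j (powR_gt0 (s + 1) del_gt0))
      (let: And3 _ h _ := HE j in h t It))).
exists pt, E; split.
- by move=> j t It; have [] := Hpt j t It.
- by move=> j; have [] := HE j.
- by move=> j; have [] := HE j.
move=> j t x Nj It tx; rewrite /coeff leqNgt Nj/=.
by have [_] := Hpt j t It; apply.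
Qed.

Lemma besov_incl (p : R) q : (0 < p)%R -> 0 < q -> ((p < 1)%R -> (om * (1 - p) < gam * p)%R) ->
  ((p < 1)%R -> local_lower_bound H Q /\ (Q * (1 - p) < s * p)%R) ->
  distr_incl H x0 r0 eta beta gam (besov D x0 r0 eta beta gam Qk N s p%:E q) (lip D Ct s p%:E q).
Proof.
move=> p0 q0 gp sp f [Hf fin].
have [pt [E [pt_cube E0 EI tail]]] := good_points f p0.
pose a (j : nat) (t : idx D) : R := `|coeff Qk N pt f j t|%R.
have a0 j t : (0 <= a j t)%R by exact: normr_ge0.
pose tl := lq q [set k | (N < k)%N] (fun k : nat => (wt D s k%:Z)%:E * 'N[mu]_p%:E[EFin \o dist_op Qk k f]).
have tl0 : 0 <= tl.
  apply: lq_ge0 => //; first by exists N.+1 => /=.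
  by move=> k; apply: mule_ge0; [rewrite lee_fin; exact: powR_ge0|exact: Lnorm_ge0].
have lw0 : 0 <= BF_low D Qk N p%:E f by exact: poweR_ge0.
have lowfin : BF_low D Qk N p%:E f < +oo by apply: le_lt_trans fin; rewrite leeDl.
have tlfin : tl < +oo by apply: le_lt_trans fin; rewrite leeDr.
have bc : lq q [set: nat] (fun j : nat => (wt D s j%:Z)%:E * (\int[mu]_x coefun a j x `^ p) `^ p^-1) < +oo.
  have lc : forall j, (j <= N)%N -> \int[mu]_x coefun a j x `^ p < +oo.
    exact: (low_coefficients pt p0 lowfin).
  apply: (besov_coefficients p0 a0 E0 lc EI tail q0).
  apply: le_lt_trans tlfin; rewrite /tl unlock; apply: le_lq => // k _.
  by apply: mule_ge0; [rewrite lee_fin; exact: powR_ge0|exact: poweR_ge0].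
set L := lq q _ _ in bc.
have I0 (j : nat) : 0 <= \int[mu]_x coefun a j x `^ p by apply: integral_ge0 => x _; exact: poweR_ge0.
have b0 (j : nat) : 0 <= (wt D s j%:Z)%:E * (\int[mu]_x coefun a j x `^ p) `^ p^-1.
  by apply: mule_ge0; [rewrite lee_fin; exact: powR_ge0|exact: poweR_ge0].
have L0 : 0 <= L by exact: lq_ge0.
have HB (j : nat) : (wt D s j%:Z `^ p)%:E * \int[mu]_x coefun a j x `^ p <= ((fine L) `^ p)%:E.
  rewrite -[X in _ <= X]poweR_EFin fineK ?ge0_fin_numE//.
  have := @lq_ge_term _ _ [set: nat] q (fun j : nat => (wt D s j%:Z)%:E * (\int[mu]_x coefun a j x `^ p) `^ p^-1) j q0 b0 I.
  move=> /(le_poweR (ltW p0) (b0 j)); rewrite poweRZl ?poweR_ge0 ?powR_ge0//.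
  by rewrite poweRVK ?gt_eqF.
have [C1 [phi [[C10 size reg] Lp rep]]] := represents_pow pt_cube Hf p0 gp sp HB.
exists (synth phi) => //; split => //.
apply: lte_add_pinfty; first by case: Lp.
exact: (lip_sum_lty gam0 beta0 C10 a0 size reg s_bound Ct0 CtK p0 gp q0 bc).
Qed.

Lemma osc_mono (u r : R) (k : int) (F : X -> R) x : (0 < u)%R -> (u <= r)%R ->
  measurable_fun setT F -> osc D Ct u k F x `^ u^-1 <= osc D Ct r k F x `^ r^-1.
Proof.
move=> u0 ur mF; have r0' : (0 < r)%R by exact: lt_le_trans ur.
have Cd : (0 < Ct * del ^ k)%R by rewrite mulr_gt0// delz_gt0.
have mB : measurable (Bk D Ct k x) by exact: qball_measurable.
have VB : (0 < fine (mu (Bk D Ct k x)))%R by exact: (Vr_gt0 H x Cd).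
have muB : mu (Bk D Ct k x) = (fine (mu (Bk D Ct k x)))%:E by rewrite mu_qball.
rewrite (_ : u^-1 = (r / u) * r^-1)%R; last by field; rewrite !gt_eqF.
rewrite poweRrM; apply: le_poweR; [by rewrite invr_ge0 ltW|exact: poweR_ge0|].
rewrite /osc /avge; apply: le_trans (jensen_poweR mB muB VB _ _ _) _.
- by rewrite ler_pdivlMr// mul1r.
- apply/measurable_EFinP/(@measurableT_comp _ _ _ _ _ _ (@powR R ^~ u)) => //.
  apply: (measurableT_comp (@normr_measurable _ setT)) => //.
  by apply: measurable_funB => //; exact: measurable_funTS.
- by move=> y; rewrite lee_fin powR_ge0.
rewrite le_eqVlt; apply/orP; left; apply/eqP; congr (_ * _); apply: eq_integral => y _.
by rewrite poweR_EFin -powRrM mulrCA mulfV ?mulr1// gt_eqF.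
Qed.

(** The estimate by atoms works for the exponent [r], subject to [om * (1 - r) < gam * r]. The given
    [u] may be too small for that condition, and is reached from [r] by Jensen's inequality on the
    balls. *)
Lemma triebel_incl (p u r : R) q : (0 < u)%R -> (u <= r)%R -> (r <= 1)%R -> (r < p)%R -> r%:E < q ->
  (om * (1 - r) < gam * r)%R -> ((p < 1)%R -> (om * (1 - p) < gam * p)%R) ->
  ((p < 1)%R -> local_lower_bound H Q /\ (Q * (1 - p) < s * p)%R) ->
  distr_incl H x0 r0 eta beta gam (triebel D x0 r0 eta beta gam Qk N s p%:E q) (lipt D Ct s p%:E q u).
Proof.
move=> u0 ur r1 rp rq gr gp sp f [Hf fin].
have r0' : (0 < r)%R by exact: lt_le_trans ur.
have p0 : (0 < p)%R by exact: lt_trans rp.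
have q0 : 0 < q by apply: lt_trans rq; rewrite lte_fin.
have [pt [E [pt_cube E0 EI tail]]] := good_points f p0.
pose a (j : nat) (t : idx D) : R := `|coeff Qk N pt f j t|%R.
have a0 j t : (0 <= a j t)%R by exact: normr_ge0.
pose h x := lq q [set k | (N < k)%N] (fun k : nat => (wt D s k%:Z * `|dist_op Qk k f x|)%:E).
have h0 x : 0 <= h x.
  apply: lq_ge0 => //; first by exists N.+1 => /=.
  by move=> k; rewrite lee_fin; apply: mulr_ge0 => //; exact: powR_ge0.
have lw0 : 0 <= BF_low D Qk N p%:E f by exact: poweR_ge0.
have tl0 : 0 <= 'N[mu]_p%:E[h] by exact: Lnorm_ge0.
have lowfin : BF_low D Qk N p%:E f < +oo by apply: le_lt_trans fin; rewrite leeDl.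
have tlfin : \int[mu]_x h x `^ p < +oo.
  have : 'N[mu]_p%:E[h] < +oo by apply: le_lt_trans fin; rewrite leeDr.
  rewrite unlock; under eq_integral do rewrite gee0_abs//.
  have [->|/eqP/eqP I1 _] := eqVneq (\int[mu]_x h x `^ p) +oo; last by rewrite ltey.
  by rewrite poweRyr ?gt_eqF ?invr_gt0.
have tc : \int[mu]_x (lq q [set: nat] (fun j : nat => (wt D s j%:Z)%:E * coefun a j x)) `^ p < +oo.
  have lc : forall j, (j <= N)%N -> \int[mu]_x coefun a j x `^ p < +oo.
    exact: (low_coefficients pt p0 lowfin).
  exact: (triebel_coefficients p0 a0 E0 lc EI tail q0 tlfin).
set L := \int[mu]_x _ in tc.
have c0 (j : nat) x : 0 <= (wt D s j%:Z)%:E * coefun a j x.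
  by apply: mule_ge0; [rewrite lee_fin; exact: powR_ge0|rewrite lee_fin].
have L0 : 0 <= L by apply: integral_ge0 => x _; exact: poweR_ge0.
have HB (j : nat) : (wt D s j%:Z `^ p)%:E * \int[mu]_x coefun a j x `^ p <= (fine L)%:E.
  rewrite fineK ?ge0_fin_numE// -integralTZ; first last.
  - by move=> x; exact: poweR_ge0.
  - by apply: measurable_poweR_comp; exact: (@measurable_cidx _ _ _ (fun t => (a j t)%:E)).
  - exact: powR_ge0.
  apply: ge0_le_integral_nomeas => x _.
    by apply: mule_ge0; [rewrite lee_fin; exact: powR_ge0|exact: poweR_ge0].
  rewrite -poweRZl ?powR_ge0 ?lee_fin//; apply: le_poweR; [exact: ltW|exact: c0|].
  exact: (@lq_ge_term _ _ [set: nat] q (fun j : nat => (wt D s j%:Z)%:E * coefun a j x) j q0 (fun j => c0 j x) I).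
have [C1 [phi [[C10 size reg] Lp rep]]] := represents_pow pt_cube Hf p0 gp sp HB.
exists (synth phi) => //; split => //.
apply: lte_add_pinfty; first by case: Lp.
have r01 : (0 < r <= 1)%R by rewrite r0'.
have := lipt_sum_lty gam0 beta0 C10 a0 size reg s_bound Ct0 CtK r01 rp rq gr tc.
rewrite unlock => fin'; apply: poweR_lty; apply: le_lt_trans fin'.
have o0 w (k : nat) x : 0 <= (wt D s k%:Z)%:E * osc D Ct w k%:Z (synth phi) x `^ w^-1.
  by apply: mule_ge0; [rewrite lee_fin; exact: powR_ge0|exact: poweR_ge0].
apply: ge0_le_integral_nomeas => x _; first exact: poweR_ge0.
rewrite gee0_abs; last by apply: lq_ge0 => //; move=> k; exact: o0.
apply: le_poweR; [exact: ltW|by apply: lq_ge0 => //; move=> k; exact: o0|].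
apply: le_lq => // k _.
apply: lee_wpmul2l; first by rewrite lee_fin; exact: powR_ge0.
by apply: osc_mono => //; case: Lp.
Qed.

(** A cube has positive measure, so it is not contained in the exceptional null set. Sampling at
    such a point bounds the coefficient by the essential supremum without an error term. *)
Lemma ess_sup_point k t (h : X -> R) : idx_at D k t ->
  exists2 x, cube D k t x & `|h x|%:E <= 'N[mu]_+oo[EFin \o h].
Proof.
move=> It; apply: contrapT => no; have m0 := cube_mu_gt0 It.
have mQ := cube_measurable It.
have Q0 : 0 < mu (cube D k t) by rewrite (cube_mu It) lte_fin.
have muT : 0 < mu [set: X].
  by apply: lt_le_trans Q0 _; apply: le_measure => //; rewrite inE.
have := ess_sup_ge mu (abse \o (EFin \o h)).
have NE : 'N[mu]_+oo[EFin \o h] = ess_sup mu (abse \o (EFin \o h)) by rewrite unlock /Lnorm muT.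
rewrite -NE => -[A [mA muA hA]].
have QA : cube D k t `<=` A.
  by move=> x tx; apply: hA => /= hx; apply: no; exists x.
have : mu (cube D k t) <= mu A by apply: le_measure => //; rewrite inE.
by rewrite muA leNgt Q0.
Qed.

Lemma besov_sup_incl q : 0 < q ->
  distr_incl H x0 r0 eta beta gam (besov D x0 r0 eta beta gam Qk N s +oo q) (lip D Ct s +oo q).
Proof.
move=> q0 f [Hf fin].
pose nf (k : nat) := 'N[mu]_+oo[EFin \o dist_op Qk k f].
have [pt Hpt] := @choose_points x0 (fun j t x => `|dist_op Qk j f x|%:E <= nf j) (fun j t It =>
  ess_sup_point (dist_op Qk j f) It).
have pt_cube j t : idx_at D (lev j) t -> cube D (lev j) t (pt j t).
  by move=> It; have [] := Hpt j t It.
pose a (j : nat) (t : idx D) : R := `|coeff Qk N pt f j t|%R.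
have a0 j t : (0 <= a j t)%R by exact: normr_ge0.
have nf0 k : 0 <= nf k by exact: Lnorm_ge0.
pose low := BF_low D Qk N +oo f.
(* A supremum over a possibly empty set could be [-oo]; the maximum with 0 makes [A] nonnegative
   from the start. *)
pose A (j : nat) := if (j <= N)%N then maxe 0 low else nf j.
have A0' j : 0 <= A j by rewrite /A; case: ifP => // _; rewrite le_max lexx.
have w0 (j : nat) : 0 <= (wt D s j%:Z)%:E by rewrite lee_fin; exact: powR_ge0.
have wA0 (j : nat) : 0 <= (wt D s j%:Z)%:E * A j by exact: mule_ge0.
pose tl := lq q [set k | (N < k)%N] (fun k : nat => (wt D s k%:Z)%:E * nf k).
have tl0 : 0 <= tl.
  apply: lq_ge0 => //; first by exists N.+1 => /=.
  by move=> k; exact: mule_ge0.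
have a_low (j : nat) t : (j <= N)%N -> idx_at D (lev j) t -> (a j t)%:E <= low.
  move=> jN It; have [b [m [Ib mb bt]]] := sub_idx_surj It.
  apply: (@le_trans _ _ (avge H (subcube j b m) (fun x => `|dist_op Qk j f x|%R))).
    by rewrite /a /coeff jN /subcube bt; exact: abs_avg_le.
  by apply: ereal_sup_ubound; exists j, b, m; split.
have low0 : 0 <= low.
  by apply: le_trans (a_low 0%N _ _ (cidx_at (lev 0) x0)) => //; rewrite lee_fin.
have lowfin : low < +oo by apply: le_lt_trans fin; rewrite leeDl.
have tlfin : tl < +oo by apply: le_lt_trans fin; rewrite leeDr.
have aA j t : idx_at D (lev j) t -> (a j t)%:E <= A j.
  move=> It; rewrite /A; have [jN|Nj] := leqP j N.
    by apply: (le_trans (a_low j t jN It)); rewrite le_max lexx orbT.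
  by rewrite /a /coeff leqNgt Nj/=; have [] := Hpt j t It.
have fin1 : lq q [set: nat] (fun j : nat => (wt D s j%:Z)%:E * A j) < +oo.
  apply: (lq_head_tail q0 wA0 (N := N)) => [j jN|].
    by rewrite /A jN max_r// lte_mul_pinfty.
  apply: le_lt_trans tlfin; apply: le_lq => // k /= Nk.
  by rewrite /A leqNgt Nk.
set L := lq q _ _ in fin1; have L0 : 0 <= L by exact: lq_ge0.
have HB (j : nat) : (wt D s j%:Z)%:E * A j <= (fine L)%:E.
  rewrite fineK ?ge0_fin_numE//.
  exact: (@lq_ge_term _ _ [set: nat] q (fun j : nat => (wt D s j%:Z)%:E * A j) j q0 wA0 I).
have [C1 [phi [[C10 size reg] Lp rep]]] := represents_sup pt_cube Hf aA HB.
exists (synth phi) => //; split => //.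
apply: lte_add_pinfty; first by case: Lp.
exact: (lip_sup_lty gam0 beta0 C10 a0 size reg s_bound Ct0 CtK x0 q0 A0' aA fin1).
Qed.

End inclusions.

End scales.

Local Close Scope ereal_scope.
Local Close Scope classical_set_scope.

Theorem proposition5p4 (R : realType) (disp : measure_display)
    (X : measurableType disp) (H : homog_space R X) (D : dyadic_system H)
    (eta beta gamma s Q Ct : R) (x0 : X) (r0 : R)
    (Qk : nat -> X -> X -> R) (N : nat)
    (Heta : 0 < eta < 1) (Hbeta : 0 < beta < eta) (Hgamma : 0 < gamma < eta)
    (Hs : 0 < s < Num.min beta gamma) (HQ : omega H <= Q)
    (HCt : 0 < Ct) (Hr0 : 0 < r0)
    (HQk : exp_iati D eta Qk)
    (HN : calderon_number D x0 r0 eta beta gamma Qk N) :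
  let B := besov D x0 r0 eta beta gamma Qk N s in
  let F := triebel D x0 r0 eta beta gamma Qk N s in
  let incl := distr_incl H x0 r0 eta beta gamma in
  [/\ forall p q : \bar R, (1 <= p)%E -> (0 < q)%E ->
        incl (B p q) (lip D Ct s p q),
      local_lower_bound H Q -> forall (p : R) (q : \bar R),
        Q / (Q + s) < p < 1 -> - eta < s - Q / p -> (0 < q)%E ->
        incl (B p%:E q) (lip D Ct s p%:E q),
      forall (p : R) (q : \bar R), 1 < p -> (1 < q)%E ->
        incl (F p%:E q) (lipt D Ct s p%:E q 1) &
      local_lower_bound H Q -> forall (p : R) (q : \bar R) (u : R),
        Q / (Q + s) < p <= 1 -> - eta < s - Q / p ->
        ((Q / (Q + Num.min beta gamma))%:E < q)%E ->
        0 < u -> (u%:E < mine p%:E q)%E ->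
        incl (F p%:E q) (lipt D Ct s p%:E q u)].
Proof.
move=> B F incl.
have /andP[b0 _] := Hbeta; have /andP[g0 _] := Hgamma.
have /andP[s0] := Hs; rewrite lt_min => /andP[sb sg].
have s_bound : 0 < s < beta by rewrite s0.
have A1 := A0_ge1 H; have C00 := C0_gt0 D.
(* Large enough for the three requirements on the unit of scale: at least 1, cubes of controlled
   diameter, and [Bk] inside the balls of the same level. *)
pose K := 1 + 4 * A0 H ^+ 2 * C0 D + Ct.
have P0 : 0 <= 4 * A0 H ^+ 2 * C0 D.
  by apply: mulr_ge0; [apply: mulr_ge0 => //; exact: sqr_ge0|exact: ltW].
have K1 : 1 <= K by rewrite /K; lra.
have KC : 4 * A0 H ^+ 2 * C0 D <= K by rewrite /K; lra.
have CtK : Ct <= K by rewrite /K; lra.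
have om0 := omega_ge0 H.
have gt1 (p : R) (P : Prop) : 1 <= p -> p < 1 -> P by move=> h1 /(le_lt_trans h1); rewrite ltxx.
have small (p : R) : 0 < Q -> Q / (Q + s) < p -> Q * (1 - p) < s * p.
  by move=> Q0; rewrite ltr_pdivrMr ?addr_gt0// => h; lra.
have p_gt0 (p : R) : 0 < Q -> Q / (Q + s) < p -> 0 < p.
  by move=> Q0; apply: lt_trans; apply: divr_gt0 => //; exact: addr_gt0.
have om_small (p : R) : 0 < p -> p <= 1 -> Q * (1 - p) < s * p -> omega H * (1 - p) < gamma * p.
  move=> p0 p1 h; apply: (@le_lt_trans _ _ (Q * (1 - p))).
    by apply: ler_wpM2r => //; rewrite subr_ge0.
  by apply: (lt_trans h); rewrite ltr_pM2r.
split.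
- move=> [p||] q p1 q0; [|exact: (besov_sup_incl K1 KC Hr0 g0 s_bound HCt CtK HN q0)|by []].
  rewrite lee_fin in p1.
  apply: (besov_incl (Q := Q) K1 KC Hr0 g0 s_bound HCt CtK HN _ q0).
  + exact: lt_le_trans p1.
  + exact: gt1.
  + exact: gt1.
- move=> llb p q /andP[Qp p1] _ q0; have [Q0 _] := llb.
  have sp := small p Q0 Qp; have p0 := p_gt0 p Q0 Qp.
  apply: (besov_incl (Q := Q) K1 KC Hr0 g0 s_bound HCt CtK HN p0 q0) => // _.
  by apply: om_small => //; exact: ltW.
- move=> p q p1 q1.
  (* Here [u = r = 1], where the reversed Jensen inequality loses nothing. *)
  apply: (triebel_incl (Q := Q) K1 KC Hr0 g0 s_bound HCt CtK HN ltr01 (lexx _) (lexx _) p1 q1).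
  + by rewrite subrr mulr0 mulr1.
  + by apply: gt1; exact: ltW.
  + by apply: gt1; exact: ltW.
- move=> llb p q u /andP[Qp p1] _ Qq u0; rewrite lt_min => /andP[up uq].
  rewrite lte_fin in up.
  have [Q0 _] := llb; have sp := small p Q0 Qp; have p0 := p_gt0 p Q0 Qp.
  have og : 0 < omega H + gamma by rewrite ltr_wpDl.
  (* The condition [om * (1 - r) < gamma * r] holds exactly for [r] above [om / (om + gamma)]. Any
     [r] strictly between [l] and both [p] and [q] is admissible; such an [r] exists because this
     threshold lies below both lower bounds assumed for [p] and [q]. *)
  pose l := Num.max u (omega H / (omega H + gamma)).
  have oQ c : 0 < c -> c <= gamma -> omega H / (omega H + gamma) <= Q / (Q + c).
    move=> c0 cg; rewrite ler_pdivrMr// mulrAC ler_pdivlMr ?addr_gt0//.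
    nra.
  have lp : l < p.
    rewrite gt_max up/=; apply: le_lt_trans Qp.
    by apply: oQ => //; exact: ltW.
  have lq_ : (l%:E < q)%E.
    rewrite EFin_max gt_max uq/=; apply: le_lt_trans Qq; rewrite lee_fin.
    by apply: oQ; [rewrite lt_min b0|rewrite ge_min lexx orbT].
  have [r [lr rp rq]] : exists r, [/\ l < r, r < p & (r%:E < q)%E].
    case: q lq_ {Qq uq} => [q||]// lq_.
      rewrite lte_fin in lq_.
      exists ((l + Num.min p q) / 2); rewrite lte_fin.
      have h1 : Num.min p q <= p by rewrite ge_min lexx.
      have h2 : Num.min p q <= q by rewrite ge_min lexx orbT.
      have h3 : l < Num.min p q by rewrite lt_min lp.
      by split; lra.
    by exists ((l + p) / 2); rewrite ltry; split=> //; lra.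
  have ul : u <= l by rewrite le_max lexx.
  have ol : omega H / (omega H + gamma) <= l by rewrite le_max lexx orbT.
  apply: (triebel_incl (Q := Q) K1 KC Hr0 g0 s_bound HCt CtK HN u0 _ _ rp rq).
  + exact/ltW/(le_lt_trans ul).
  + exact/ltW/(lt_le_trans rp).
  + have := le_lt_trans ol lr; rewrite ltr_pdivrMr// => h; lra.
  + by move=> p1'; apply: om_small.
  + by move=> p1'.
Qed.
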